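(* Let $(\Sigma,g)$ be a compact Riemannian surface and $(N,h)$ a compact Riemannian manifold. There exist $R_0>0$, depending on the geometry of $\Sigma$, and a universal constant $C$ as follows. Let $u:\Sigma\times[0,T)\to N$ be a solution of harmonic map flow, and suppose that for some $q\ge1$, $\sigma>0$ and $0\le\tau<T$, $$\sup_{\tau\le t<T}\|S(u(t))\|_{L^q}\le\sigma .$$ Let $p\in\Sigma$ and $\varepsilon>0$. Suppose that $0<R\le\rho<R_0$ and $\tau\le t_1\le t_2<T$ are such that $$\sup_{t_1\le t\le t_2}E(u(t),B_\rho(p))\le E(u(t_2),B_R(p))+\frac\varepsilon2 .$$ Then for all $t_1\le t\le t_2$, $$\lambda_{\varepsilon,\rho,p}(u(t))\le\max\left\{4R,\ \left(\frac{C\sigma(t_2-t)}{\varepsilon}\right)^{q/2}\right\}.$$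
   Context: $E(u,\Omega)=\int_\Omega\frac12|du|^2\,dV_g$. Harmonic map flow is $\partial_tu=\mathcal T(u)=\operatorname{tr}_g\nabla du$; a solution on $[0,T)$, $0<T\le\infty$, has $L^2_1$ initial data and is smooth for $0<t<T$. The stress-energy tensor of $u$ is $S(u)=\langle du\otimes du\rangle-\frac12|du|^2g$, i.e. $S_{ij}=\langle\partial_iu,\partial_ju\rangle-\frac12|du|^2g_{ij}$. $B_r(p)$ is the geodesic ball and $U^R_r(p)=B_R(p)\setminus\overline{B_r(p)}$. Outer energy scale: for $0<\rho<R_0$, $\varepsilon>0$ and an $L^2_1$ map $u:B_\rho(p)\to N$, $\lambda_{\varepsilon,\rho,p}(u)$ is the minimal number (infimum of numbers) $\lambda\in[0,\rho]$ such that $\sup_{\lambda<r<\rho}E(u,U^r_{r/2}(p))<\varepsilon$ (the condition is vacuous for $\lambda=\rho$). *)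

(* Defs.v *)
From HB Require Import structures.
From mathcomp Require Import all_boot all_order all_algebra.
From mathcomp Require Import all_classical all_reals all_analysis.

Set Implicit Arguments.
Unset Strict Implicit.
Unset Printing Implicit Defensive.

Import Order.TTheory GRing.Theory Num.Theory.
Import numFieldNormedType.Exports.

Local Open Scope classical_set_scope.
Local Open Scope ring_scope.

(* Vectors are rows, so the differential of f acts as [v |-> v *m jacobian f z]
   and [(jacobian f z) i a] is the i-th partial derivative of [f_a]. *)

Section Smooth.
Context {R : realType} {V W : normedModType R}.

Fixpoint iter_derive (f : V -> W) (s : seq V) : V -> W :=
  if s is v :: s' then fun z => 'D_v (iter_derive f s') z else f.

(* C^infinity on an open set [A]: every iterated directional derivative exists
   and is differentiable (hence continuous) at every point of [A]. *)
Definition smooth_on (A : set V) (f : V -> W) : Prop :=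
  forall (s : seq V) (z : V), A z -> differentiable (iter_derive f s) z.

End Smooth.

Definition basis_vec {R : realType} {n} (i : 'I_n) : 'rV[R]_n := delta_mx 0 i.

(* A Riemannian manifold of dimension n, without boundary. The atlas is indexed
   by points: [chart x] is a chart around [x], with domain [dom x] and inverse
   [ichart x], both total functions that are meaningful only on [dom x] and on
   its image. [metric x z] is the matrix (g_ij) at the point of coordinates [z]
   in the chart [chart x]. *)
Record riemannian_manifold (R : realType) (n : nat) := RiemannianManifold {
  carrier :> ptopologicalType ;
  dom : carrier -> set carrier ;
  chart : carrier -> carrier -> 'rV[R]_n ;
  ichart : carrier -> 'rV[R]_n -> carrier ;
  metric : carrier -> 'rV[R]_n -> 'M[R]_n ;
  manifold_hausdorff : hausdorff_space carrier ;
  manifold_second_countable : @second_countable carrier ;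
  dom_open : forall x, open (dom x) ;
  dom_self : forall x, dom x x ;
  img_open : forall x, open (chart x @` dom x) ;
  chartK : forall x y, dom x y -> ichart x (chart x y) = y ;
  chart_continuous : forall x y, dom x y -> {for y, continuous (chart x)} ;
  ichart_continuous : forall x z, (chart x @` dom x) z ->
    {for z, continuous (ichart x)} ;
  transition_smooth : forall x y,
    smooth_on (chart x @` (dom x `&` dom y)) (chart y \o ichart x) ;
  metric_smooth : forall x i j,
    smooth_on (chart x @` dom x) (fun z => metric x z i j : R^o) ;
  metric_sym : forall x z, (chart x @` dom x) z ->
    (metric x z)^T = metric x z ;
  metric_pos : forall x z, (chart x @` dom x) z -> forall v : 'rV[R]_n,
    v != 0 -> 0 < (v *m metric x z *m v^T) 0 0 ;
  metric_transition : forall x y z, (chart x @` (dom x `&` dom y)) z ->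
    metric x z = jacobian (chart y \o ichart x) z
                 *m metric y ((chart y \o ichart x) z)
                 *m (jacobian (chart y \o ichart x) z)^T
}.

Section Riemannian.
Context {R : realType} {n : nat} (M : riemannian_manifold R n).
Implicit Types (x y p : M).

Definition img x : set 'rV[R]_n := chart x @` dom x.

(* The tangent space at [x] is identified with R^n through the chart [chart x];
   [metric_at x] is the scalar product on it. *)
Definition metric_at x : 'M[R]_n := metric x (chart x x).

(* The differential at [y] of the change of coordinates from [chart x] to
   [chart y]. *)
Definition transition_jac x y : 'M[R]_n :=
  jacobian (chart y \o ichart x) (chart x y).

Definition smooth_fun (f : M -> R) : Prop :=
  forall x, smooth_on (img x) (f \o ichart x : 'rV[R]_n -> R^o).

(* The differential of [f] at [x], as a column of partial derivatives. *)
Definition dfun (f : M -> R) x : 'cV[R]_n :=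
  \col_a 'D_(basis_vec a) (f \o ichart x : 'rV[R]_n -> R^o) (chart x x).

(* C^1 curves parametrised by the whole line. A piecewise C^1 path on [0, 1] can
   be reparametrised to stop at its break points and endpoints, and then
   extended by constants, so these curves realise the length of every
   piecewise C^1 path. *)
Definition C1_curve (c : R -> M) : Prop :=
  continuous c /\
  forall x t, dom x (c t) ->
    derivable (chart x \o c) t 1 /\ {for t, continuous (derive1 (chart x \o c))}.

Definition speed (c : R -> M) (t : R) : R :=
  let v := derive1 (chart (c t) \o c) t in
  Num.sqrt ((v *m metric_at (c t) *m v^T) 0 0).

Definition curve_length (c : R -> M) : \bar R :=
  (\int[lebesgue_measure]_(t in `[0%R, 1%R]) (speed c t)%:E)%E.

(* Points in different components are at distance +oo. *)
Definition dist p x : \bar R :=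
  ereal_inf [set curve_length c | c in
    [set c | [/\ C1_curve c, c 0 = p & c 1 = x]]].

Definition geodesic_ball p (r : R) : set M := [set x | (dist p x < r%:E)%E].

Definition annulus p (r s : R) : set M :=
  geodesic_ball p s `\` closure (geodesic_ball p r).

Definition borel := g_sigma_algebraType (@open M).

End Riemannian.

Section Coordinates.
Context {R : realType} {m n : nat}.

Definition christoffel {k} (g : 'rV[R]_k -> 'M[R]_k) (z : 'rV[R]_k)
    (a i j : 'I_k) : R :=
  2^-1 * \sum_l invmx (g z) a l *
    ('D_(basis_vec i) (fun w => g w l j : R^o) z
     + 'D_(basis_vec j) (fun w => g w l i : R^o) z
     - 'D_(basis_vec l) (fun w => g w i j : R^o) z).

(* The components of nabla dv, for a map [v] between coordinate domains with
   metrics [g] and [h], nabla being the connection induced on T*M (x) v*TN by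
   the Levi-Civita connections. *)
Definition second_form (g : 'rV[R]_m -> 'M[R]_m) (h : 'rV[R]_n -> 'M[R]_n)
    (v : 'rV[R]_m -> 'rV[R]_n) (z : 'rV[R]_m) (i j : 'I_m) : 'rV[R]_n :=
  let d k a := ('D_(basis_vec k) v z) 0 a in
  \row_a (('D_(basis_vec i) (fun w => 'D_(basis_vec j) v w) z) 0 a
          - \sum_k christoffel g z k i j * d k a
          + \sum_b \sum_c christoffel h (v z) a b c * d i b * d j c).

Definition tension (g : 'rV[R]_m -> 'M[R]_m) (h : 'rV[R]_n -> 'M[R]_n)
    (v : 'rV[R]_m -> 'rV[R]_n) (z : 'rV[R]_m) : 'rV[R]_n :=
  \sum_i \sum_j invmx (g z) i j *: second_form g h v z i j.

End Coordinates.

Definition row2 {R : realType} (z : R * R) : 'rV[R]_2 :=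
  \row_i (if i == ord0 then z.1 else z.2).

Definition leb2 {R : realType} :=
  ((@lebesgue_measure R) \x (@lebesgue_measure R))%E.

(* The Riemannian measure dV = sqrt (det g) dx^1 dx^2 of a surface; these
   identities determine it, since countably many charts cover. *)
Definition is_volume {R : realType} (S : riemannian_manifold R 2)
    (vol : {measure set (borel S) -> \bar R}) : Prop :=
  forall (x : S) (A : set (borel S)), measurable A -> A `<=` dom x ->
    vol A = (\int[leb2]_(z in [set z | img x (row2 z) /\ A (ichart x (row2 z))])
               (Num.sqrt (\det (metric x (row2 z))))%:E)%E.

Section Maps.
Context {R : realType} {n : nat}.
Variables (S : riemannian_manifold R 2) (N : riemannian_manifold R n).
Implicit Types (u : S -> N) (D : S -> 'M[R]_(2, n)).

(* In [D : S -> 'M_(2, n)], [D x] stands for a linear map from T_x S to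
   T_(u x) N, in the bases given by [chart x] and [chart (u x)]. *)

Definition test_fun (x : S) (phi : 'rV[R]_2 -> R) : Prop :=
  smooth_on setT (phi : 'rV[R]_2 -> R^o) /\
  exists K : set 'rV[R]_2,
    [/\ compact K, K `<=` img x & forall z, ~ K z -> phi z = 0].

(* [D] is the weak differential of [u]: for every smooth f : N -> R, the weak
   differential of the bounded function f o u is df o D. As N is compact, this
   is the weak derivative of u for any embedding of N in a Euclidean space. *)
Definition weak_differential u D : Prop :=
  forall (f : N -> R) (x : S) (phi : 'rV[R]_2 -> R) (j : 'I_2),
    smooth_fun f -> test_fun x phi ->
    let df y := (transition_jac x y *m (D y *m dfun f (u y))) j 0 in
    leb2.-integrable setT
      (fun z => (df (ichart x (row2 z)) * phi (row2 z))%:E) /\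
    \int[leb2]_z (f (u (ichart x (row2 z)))
                  * 'D_(basis_vec j) (phi : 'rV[R]_2 -> R^o) (row2 z))
    = - \int[leb2]_z (df (ichart x (row2 z)) * phi (row2 z)).

(* du, unique up to a null set when it exists, and almost everywhere the
   classical differential if u is smooth. *)
Definition diff_map u : S -> 'M[R]_(2, n) :=
  xget (fun=> 0) [set D | weak_differential u D].

(* <du (x) du> *)
Definition pullback u (x : S) : 'M[R]_2 :=
  diff_map u x *m metric_at (u x) *m (diff_map u x)^T.

(* |du|^2 *)
Definition diff_sqnorm u (x : S) : R :=
  \tr (invmx (metric_at x) *m pullback u x).

Definition stress_energy u (x : S) : 'M[R]_2 :=
  pullback u x - (2^-1 * diff_sqnorm u x) *: metric_at x.

Definition tensor_norm (x : S) (A : 'M[R]_2) : R :=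
  Num.sqrt (\tr (invmx (metric_at x) *m A *m invmx (metric_at x) *m A^T)).

Definition covector_sqnorm (x : S) (w : 'cV[R]_2) : R :=
  (w^T *m invmx (metric_at x) *m w) 0 0.

Variable vol : {measure set (borel S) -> \bar R}.

Definition energy u (Omega : set S) : \bar R :=
  (\int[vol]_(x in Omega) (2^-1 * diff_sqnorm u x)%:E)%E.

Definition stress_norm (q : R) u : \bar R :=
  ('N[vol]_q%:E [EFin \o (fun x => tensor_norm x (stress_energy u x))])%E.

Definition outer_scale (eps rho : R) (p : S) u : R :=
  inf [set l | 0 <= l <= rho /\
    (ereal_sup [set energy u (annulus p (r / 2)%R r) | r in `]l, rho[]
       < eps%:E)%E].

Definition L21_map u : Prop :=
  [/\ forall A : set N, open A -> measurable (u @^-1` A : set (borel S)),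
      exists D, weak_differential u D
    & (energy u setT < +oo)%E].

(* The squared L^2_1 distance between f o u and f o v. *)
Definition L21_sqdist (f : N -> R) u v : \bar R :=
  (\int[vol]_x ((f (u x) - f (v x)) ^+ 2
     + covector_sqnorm x (diff_map u x *m dfun f (u x)
                          - diff_map v x *m dfun f (v x)))%:E)%E.

(* A solution of d_t u = tr_g nabla du on [0, T[, T possibly +oo. The initial
   data are attained in L^2_1, expressed through the functions f o u. *)
Definition harmonic_map_flow (T : \bar R) (u : R -> S -> N) : Prop :=
  [/\ L21_map (u 0),
      forall f : N -> R, smooth_fun f ->
        L21_sqdist f (u t) (u 0) @[t --> 0^'+] --> 0%E,
      forall (t : R) (x : S), 0 < t -> (t%:E < T)%E ->
        {for (t, x), continuous (fun s : R * S => u s.1 s.2)},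
      forall (x : S) (y : N),
        smooth_on [set s : R^o * 'rV[R]_2 | [/\ 0 < s.1, (s.1%:E < T)%E,
                      img x s.2 & dom y (u s.1 (ichart x s.2))]]
          (fun s : R^o * 'rV[R]_2 => chart y (u s.1 (ichart x s.2)))
    & forall (x : S) (y : N) (t : R) (z : 'rV[R]_2),
        0 < t -> (t%:E < T)%E -> img x z -> dom y (u t (ichart x z)) ->
        derive1 (fun s => chart y (u s (ichart x z))) t
        = tension (metric x) (metric y) (chart y \o u t \o ichart x) z].

End Maps.

(* Main.v *)
Require Import Defs.
From HB Require Import structures.
From mathcomp Require Import all_boot all_order all_algebra.
From mathcomp Require Import all_classical all_reals all_analysis.
From mathcomp Require Import measurable_realfun ring lra.

Set Implicit Arguments.
Unset Strict Implicit.
Unset Printing Implicit Defensive.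

Import Order.TTheory GRing.Theory Num.Theory.
Import numFieldNormedType.Exports.

Local Open Scope classical_set_scope.
Local Open Scope ring_scope.

(** Fix a scale l with 4 r <= l < rho and a cutoff phi around p that is 1 on the ball of
    radius l / 4 and is supported in the ball of radius l / 2. For l < s < rho the annulus
    between s / 2 and s is disjoint from the support of phi, so its energy at time t, plus
    the integral of phi against the energy density at time t, is at most the energy of the
    ball of radius rho. By hypothesis this is at most eps / 2 plus the energy of the ball
    of radius r at time t2, and the latter is at most the integral of phi against the
    energy density at time t2. The annulus thus has energy at most 3 eps / 4 as soon as the
    localized energy grows by at most eps / 4 between t and t2 ([annulus_small]).

    The growth is controlled by the stress-energy tensor S. In the time derivative of the
    localized energy, the flow equation produces a kinetic term with a favourable sign and
    the velocity paired with du (grad phi). As the divergence of S is the velocity paired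
    with du, a second integration by parts leaves the integral of <S, Hess phi>
    ([energy_identity]). Since |Hess phi| is of order l^-2 on a set of area of order l^2,
    Young's inequality at a suitable level ([stress_mass]) bounds the rate of growth by a
    multiple of sigma l^(-2/q) ([local_growth]), and the total growth is at most eps / 4 if
    l is at least (C sigma (t2 - t) / eps)^(q/2).

    The constant is universal because phi is a fixed profile of the quadratic form
    l^-2 g(z - z(p)), where g is the metric at the centre of a coordinate box: on a
    small box the metric is within a fixed factor of g, and the derivatives of the metric
    are multiplied by a further factor l ([bump_bracket_bound]). The geometry of the surface
    only enters in the size of the boxes, which compactness makes uniform
    ([scale_estimate_uniform]). Metric balls are compared with ellipses of g by
    [dist_upper] and [dist_lower].

    The target enters the computation only through the inner products of the partial
    derivatives of u, for which the flow is an equation in the plane ([flow_identity]). For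
    t > 0 the weak differential is almost everywhere the classical one
    ([diff_map_classical]). At t = 0, where u is only in L^2_1, the bound on the annulus
    follows from later times by Fatou's lemma ([initial_energy]). Energies of balls and
    annuli are treated as lower integrals, which are monotone and superadditive
    ([integral_superadditive]). *)

(** * Calculus of smooth functions *)

Section DiffN.
Context {R : realType} {V W : normedModType R}.
Implicit Types (A : set V) (f g : V -> W).

Fixpoint diff_n (n : nat) A f : Prop :=
  (forall z, A z -> differentiable f z) /\
  if n is m.+1 then forall v, diff_n m A ('D_v f) else True.

Lemma diff_n_diff n A f z : diff_n n A f -> A z -> differentiable f z.
Proof. by case: n => [|n] [h _]; exact: h. Qed.

Lemma iter_derive_rcons f s v : iter_derive f (rcons s v) = iter_derive ('D_v f) s.
Proof. by elim: s => //= w s ->. Qed.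

Lemma smooth_onP A f : smooth_on A f <-> forall n, diff_n n A f.
Proof.
split=> [h n|h].
  elim: n f h => [|n IH] f h; split=> //; first by move=> z Az; exact: (h [::] z).
    by move=> z Az; exact: (h [::] z).
  by move=> v; apply: IH => s z Az; rewrite -iter_derive_rcons; exact: h.
move=> s; elim/last_ind: s f h => [|s v IH] f h z Az.
  exact: (diff_n_diff (h 0%N)).
rewrite iter_derive_rcons; apply: IH => // n.
by have [_] := h n.+1; apply.
Qed.

Lemma smooth_on_diff A f z : smooth_on A f -> A z -> differentiable f z.
Proof. by move=> h; exact: (h [::]). Qed.

Lemma smooth_on_derive A f v : smooth_on A f -> smooth_on A ('D_v f).
Proof. by move=> h s z Az; rewrite -iter_derive_rcons; exact: h. Qed.

Lemma smooth_on_continuous A f z : smooth_on A f -> A z -> {for z, continuous f}.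
Proof. by move=> h Az; apply: differentiable_continuous; exact: smooth_on_diff Az. Qed.

Lemma smooth_on_sub A B f : A `<=` B -> smooth_on B f -> smooth_on A f.
Proof. by move=> AB h s z /AB; exact: h. Qed.

Lemma near0_differentiable f z : (\near z, f z = 0) -> differentiable f z.
Proof.
move=> f0.
have fz0 : f z = 0 := nbhs_singleton f0.
have f0' : \forall h \near (0 : V), f (h + z) = 0.
  by move: f0; rewrite (near_shift 0); apply: filterS => y /=; rewrite subr0.
have e : f \o shift z = cst (f z) + \0 +o_ 0 id.
  apply/eqaddoP => _/posnumP[d]; near=> h.
  rewrite -[X in `|X|]/(f (h + z) - (f z + 0)) fz0 addr0 subr0.
  have -> : f (h + z) = 0 by near: h; exact: f0'.
  by rewrite normr0 mulr_ge0.
have d0 : 'd f z = \0 :> (V -> W).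
  by apply: diff_unique => //; exact: cst_continuous.
by apply/diff_locallyP; rewrite d0; split => //; exact: cst_continuous.
Unshelve. all: by end_near. Qed.

Lemma near_eq_differentiable f g z :
  (\near z, f z = g z) -> differentiable f z -> differentiable g z.
Proof.
move=> fg fz; have -> : g = f + (g - f) by rewrite addrC subrK.
apply: differentiableD => //; apply: near0_differentiable.
by near=> y; rewrite !fctE -(_ : f y = g y) ?subrr //; near: y.
Unshelve. all: by end_near. Qed.

Lemma eq_diff_n n A f g : open A -> (forall z, A z -> f z = g z) ->
  diff_n n A f -> diff_n n A g.
Proof.
move=> oA; elim: n f g => [|n IH] f g fg [df Df].
  split=> // z Az; apply: near_eq_differentiable (df _ Az).
  by apply: filterS (open_nbhs_nbhs (conj oA Az)) => y /fg.
split=> [z Az|v]; first by apply: near_eq_differentiable (df _ Az);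
  apply: filterS (open_nbhs_nbhs (conj oA Az)) => y /fg.
apply: IH (Df v) => z Az; apply: near_eq_derive.
by apply: filterS (open_nbhs_nbhs (conj oA Az)) => y /fg.
Qed.

Lemma eq_smooth_on A f g : open A -> (forall z, A z -> f z = g z) ->
  smooth_on A f -> smooth_on A g.
Proof. by move=> oA fg /smooth_onP h; apply/smooth_onP => n; exact: eq_diff_n (h n). Qed.

Lemma diff_n_le n A f : diff_n n.+1 A f -> diff_n n A f.
Proof.
elim: n f => [|n IH] f [h h']; first by split.
by split=> // v; apply: IH; exact: h'.
Qed.

Lemma diff_n_cst n A (c : W) : diff_n n A (cst c).
Proof.
elim: n c => [|n IH] c; (split; first by move=> z _; exact: differentiable_cst) => // v.
by rewrite (_ : 'D_v (cst c) = cst 0)//; apply/funext => z; rewrite derive_cst.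
Qed.

Lemma diff_nD n A f g : open A -> diff_n n A f -> diff_n n A g -> diff_n n A (f + g).
Proof.
move=> oA; elim: n f g => [|n IH] f g [df Df] [dg Dg].
  by split; [move=> z Az; exact: differentiableD (df _ Az) (dg _ Az)|].
split=> [z Az|v]; first exact: differentiableD (df _ Az) (dg _ Az).
apply: (eq_diff_n oA _ (IH _ _ (Df v) (Dg v))) => z Az.
by rewrite deriveD; [|apply: diff_derivable; exact: df|apply: diff_derivable; exact: dg].
Qed.

End DiffN.

Section SmoothScalar.
Context {R : realType} {V : normedModType R}.
Implicit Types (A : set V) (f g : V -> R^o).

Lemma diff_nM n A f g : open A -> diff_n n A f -> diff_n n A g ->
  diff_n n A (f * g : V -> R^o).
Proof.
move=> oA; elim: n f g => [|n IH] f g hf hg; move: (hf) (hg) => [df Df] [dg Dg].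
  by split=> // z Az; apply: differentiableM; [exact: df|exact: dg].
split=> [z Az|v]; first by apply: differentiableM; [exact: df|exact: dg].
have h := diff_nD oA (IH _ _ (diff_n_le hf) (Dg v)) (IH _ _ (diff_n_le hg) (Df v)).
apply: (eq_diff_n oA _ h) => z Az.
by rewrite deriveM //; apply: diff_derivable; [exact: df|exact: dg].
Qed.

Lemma diff_n_sum n A m (F : 'I_m -> V -> R^o) : open A ->
  (forall i, diff_n n A (F i)) -> diff_n n A (\sum_i F i).
Proof.
move=> oA h; elim/big_ind : _ => //; [exact: diff_n_cst|].
by move=> x y hx hy; apply: diff_nD.
Qed.

Lemma derive_rV_comp m (G : V -> 'rV[R]_m) (f : 'rV[R]_m -> R^o) z v :
  differentiable G z -> differentiable f (G z) ->
  'D_v (f \o G) z = \sum_a 'D_(basis_vec a) f (G z) * 'D_v (fun y => G y 0 a : R^o) z.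
Proof.
move=> dG df; rewrite deriveE; last exact: differentiable_comp.
rewrite diff_comp //= -(deriveE v dG) derive_mx; last exact: diff_derivable.
rewrite {1}[\matrix_(i, j) _]row_sum_delta linear_sum; apply: eq_bigr => a _.
by rewrite linearZ /= mxE [in RHS]deriveE // [RHS]mulrC.
Qed.

Lemma diff_n_comp n m A (B : set 'rV[R]_m) (G : V -> 'rV[R]_m) (f : 'rV[R]_m -> R^o) :
  open A -> (forall z, A z -> B (G z)) ->
  (forall a, diff_n n A (fun z => G z 0 a : R^o)) -> (forall z, A z -> differentiable G z) ->
  diff_n n B f -> diff_n n A (f \o G).
Proof.
move=> oA AB; elim: n f => [|n IH] f hG dG hf; move: (hf) => [df Df].
  by split=> // z Az; apply: differentiable_comp; [exact: dG|exact: df (AB _ Az)].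
split=> [z Az|v]; first by apply: differentiable_comp; [exact: dG|exact: df (AB _ Az)].
pose F a : V -> R^o := (('D_(basis_vec a) f) \o G) * ('D_v (fun y => G y 0 a : R^o)).
have h : diff_n n A (\sum_a F a).
  apply: diff_n_sum => // a; apply: diff_nM => //.
    by apply: IH (Df _) => // b; exact: diff_n_le.
  by have [_] := hG a; apply.
apply: (eq_diff_n oA _ h) => z Az.
rewrite derive_rV_comp ?fct_sumE //; [exact: dG|exact: df (AB _ Az)].
Qed.

Lemma smooth_onD A f g : open A -> smooth_on A f -> smooth_on A g -> smooth_on A (f + g).
Proof. by move=> oA /smooth_onP h /smooth_onP k; apply/smooth_onP => n; exact: diff_nD. Qed.

Lemma smooth_onM A f g : open A -> smooth_on A f -> smooth_on A g ->
  smooth_on A (f * g : V -> R^o).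
Proof. by move=> oA /smooth_onP h /smooth_onP k; apply/smooth_onP => n; exact: diff_nM. Qed.

Lemma smooth_on_cst A (c : R^o) : smooth_on A (cst c : V -> R^o).
Proof. by apply/smooth_onP => n; exact: diff_n_cst. Qed.

Lemma coord_differentiable m (G : V -> 'rV[R]_m) z a : differentiable G z ->
  differentiable (fun y => G y 0 a : R^o) z.
Proof.
move=> dG; apply: (@differentiable_comp _ _ _ _ G (fun M : 'rV[R]_m => M 0 a : R^o)) => //.
exact: differentiable_coord.
Qed.

Lemma derive_coord m (G : V -> 'rV[R]_m) z v a : derivable G z v ->
  'D_v (fun y => G y 0 a : R^o) z = ('D_v G z) 0 a.
Proof. by move=> dG; rewrite [in RHS]derive_mx // mxE. Qed.

Lemma smooth_on_coord m A (G : V -> 'rV[R]_m) a : open A -> smooth_on A G ->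
  smooth_on A (fun y => G y 0 a : R^o).
Proof.
move=> oA /smooth_onP h; apply/smooth_onP => n; elim: n G {h}(h n) => [|n IH] G [dG DG].
  by split=> // z Az; apply: coord_differentiable; exact: dG.
split=> [z Az|v]; first by apply: coord_differentiable; exact: dG.
apply: (eq_diff_n oA _ (IH _ (DG v))) => z Az.
by rewrite derive_coord //; apply: diff_derivable; exact: dG.
Qed.

Lemma smooth_on_comp m A (B : set 'rV[R]_m) (G : V -> 'rV[R]_m) (f : 'rV[R]_m -> R^o) :
  open A -> (forall z, A z -> B (G z)) -> smooth_on A G -> smooth_on B f ->
  smooth_on A (f \o G).
Proof.
move=> oA AB hG /smooth_onP hf; apply/smooth_onP => n.
apply: (diff_n_comp oA AB) => // [a|z Az].
  by have /smooth_onP := smooth_on_coord a oA hG; exact.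
exact: smooth_on_diff hG Az.
Qed.

Lemma smooth_on_comp1 A (B : set R) (G : V -> R^o) (f : R^o -> R^o) :
  open A -> (forall z, A z -> B (G z)) -> smooth_on A G -> smooth_on (B : set R^o) f ->
  smooth_on A (f \o G).
Proof.
move=> oA AB /smooth_onP hG /smooth_onP hf; apply/smooth_onP => n.
elim: n f {hf}(hf n) => [|n IH] f hf; move: (hf) (hG 0%N) => [df Df] [dG _].
  by split=> // z Az; apply: differentiable_comp; [exact: dG|exact: df (AB _ Az)].
split=> [z Az|v]; first by apply: differentiable_comp; [exact: dG|exact: df (AB _ Az)].
have h := diff_nM oA (IH _ (Df 1)) ((hG n.+1).2 v).
apply: (eq_diff_n oA _ h) => z Az.
rewrite !fctE; rewrite [RHS]deriveE; last by apply: differentiable_comp; [exact: dG|exact: df (AB _ Az)].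
rewrite diff_comp //=; [|exact: dG|exact: df (AB _ Az)].
rewrite -(deriveE v); last exact: dG.
rewrite -[X in 'd f _ X]mulr1 -[_ * 1]/(_ *: (1 : R^o)) linearZ /= -deriveE; last exact: df (AB _ Az).
by rewrite mulrC.
Qed.

End SmoothScalar.

Section Lines.
Context {R : realType} {V W : normedModType R}.
Implicit Types (f : V -> W) (z v : V) (s : R).

Lemma derive_line f z v s : 'D_1 (fun r : R => f (r *: v + z)) s = 'D_v f (s *: v + z).
Proof.
rewrite /derive; suff -> : (fun h : R => h^-1 *: (((fun r => f (r *: v + z)) \o shift s) (h *: 1) -
  f (s *: v + z))) = (fun h => h^-1 *: ((f \o shift (s *: v + z)) (h *: v) - f (s *: v + z))) by [].
by apply/funext => h /=; rewrite [h *: 1]mulr1 scalerDl addrA.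
Qed.

Lemma derivable_line f z v s :
  derivable (fun r : R => f (r *: v + z)) s 1 <-> derivable f (s *: v + z) v.
Proof.
rewrite /derivable; suff -> : (fun h : R => h^-1 *: (((fun r => f (r *: v + z)) \o shift s) (h *: 1) -
  f (s *: v + z))) = (fun h => h^-1 *: ((f \o shift (s *: v + z)) (h *: v) - f (s *: v + z))) by [].
by apply/funext => h /=; rewrite [h *: 1]mulr1 scalerDl addrA.
Qed.

Lemma is_derive_line f z v s : derivable f (s *: v + z) v ->
  is_derive s 1 (fun r : R => f (r *: v + z)) ('D_v f (s *: v + z)).
Proof. by move=> h; rewrite -derive_line; apply: DeriveDef => //; apply/derivable_line. Qed.

End Lines.

Lemma ler_of_common_close (R : realType) (a b c e : R) :
  `|b - c| < e / 2 -> `|a - c| < e / 2 -> `|a - b| <= e.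
Proof.
move=> p q; rewrite (_ : a - b = (a - c) - (b - c)); last by ring.
by rewrite (le_trans (ler_normB _ _)) // (splitr e) lerD // ltW.
Qed.

Lemma second_difference_sym (R : realType) (p q r s a b h : R) : h != 0 ->
  p - q - (r - s) = a * h -> p - r - (q - s) = b * h -> a = b.
Proof. by move=> h0 e e'; apply: (mulIf h0); rewrite -e -e'; ring. Qed.

Section Clairaut.
Context {R : realType} {V : normedModType R}.
Implicit Types (A : set V) (f : V -> R^o).

Lemma second_difference f z v w (h : R) : 0 < h ->
  (forall s t : R, 0 <= s <= h -> 0 <= t <= h ->
    differentiable f (s *: v + (t *: w + z)) /\
    differentiable ('D_v f) (s *: v + (t *: w + z))) ->
  exists s t : R, [/\ 0 <= s <= h, 0 <= t <= h &
    f (h *: v + (h *: w + z)) - f (h *: v + z) - (f (h *: w + z) - f z)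
    = 'D_w ('D_v f) (s *: v + (t *: w + z)) * h ^+ 2].
Proof.
move=> h0 H.
have h00 : 0 <= h <= h by rewrite lexx ltW.
have h01 : 0 <= (0 : R) <= h by rewrite lexx ltW.
pose g (s : R) : R := f (s *: v + (h *: w + z)) - f (s *: v + z).
have dg s : 0 <= s <= h -> is_derive s 1 g ('D_v f (s *: v + (h *: w + z)) - 'D_v f (s *: v + z)).
  move=> hs; apply: is_deriveB; apply: is_derive_line; apply: diff_derivable.
    exact: (H s h hs h00).1.
  by have := (H s 0 hs h01).1; rewrite scale0r add0r.
have [s hs e1] : exists2 c, c \in `]0, h[ & g h - g 0 = ('D_v f (c *: v + (h *: w + z)) - 'D_v f (c *: v + z)) * (h - 0).
  apply: (@MVT _ g) => [|s|]; first exact: h0.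
    by rewrite in_itv /= => /andP[/ltW a /ltW b]; apply: dg; rewrite a b.
  apply: derivable_within_continuous => s; rewrite in_itv /= => hs.
  by have [] := dg s hs.
have hs' : 0 <= s <= h by move: hs; rewrite in_itv /= => /andP[/ltW -> /ltW ->].
pose k (t : R) : R := 'D_v f (t *: w + (s *: v + z)).
have dk t : 0 <= t <= h -> is_derive t 1 k ('D_w ('D_v f) (t *: w + (s *: v + z))).
  move=> ht; apply: is_derive_line; apply: diff_derivable.
  by have := (H s t hs' ht).2; rewrite addrCA.
have [t ht e2] : exists2 c, c \in `]0, h[ & k h - k 0 = 'D_w ('D_v f) (c *: w + (s *: v + z)) * (h - 0).
  apply: (@MVT _ k) => [|t|]; first exact: h0.
    by rewrite in_itv /= => /andP[/ltW a /ltW b]; apply: dk; rewrite a b.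
  apply: derivable_within_continuous => t; rewrite in_itv /= => ht.
  by have [] := dk t ht.
have ht' : 0 <= t <= h by move: ht; rewrite in_itv /= => /andP[/ltW -> /ltW ->].
exists s, t; split => //.
move: e1 e2; rewrite /g /k !scale0r !add0r !subr0 => e1 e2.
by rewrite e1 [s *: v + (h *: w + z)]addrCA e2 [t *: w + _]addrCA expr2 mulrA.
Qed.

(** Both sides are limits of the same symmetric second difference. *)
Lemma derive_comm A f z v w : open A -> A z -> smooth_on A f ->
  'D_v ('D_w f) z = 'D_w ('D_v f) z.
Proof.
move=> oA Az sf; apply/eqP; rewrite -subr_eq0 -normr_le0; apply/ler_addgt0Pl => e e0.
rewrite addr0.
have c1 : {for z, continuous ('D_v ('D_w f))}.
  by apply: smooth_on_continuous Az; do 2! apply: smooth_on_derive.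
have c2 : {for z, continuous ('D_w ('D_v f))}.
  by apply: smooth_on_continuous Az; do 2! apply: smooth_on_derive.
have e2 : 0 < e / 2 by rewrite divr_gt0.
have N : \forall y \near z, [/\ A y, `|'D_v ('D_w f) z - 'D_v ('D_w f) y| < e / 2 &
     `|'D_w ('D_v f) z - 'D_w ('D_v f) y| < e / 2].
  have n0 := open_nbhs_nbhs (conj oA Az : open_nbhs z A).
  have n1 := (@cvgrPdist_lt _ _ _ _ _ _ _).1 c1 _ e2.
  have n2 := (@cvgrPdist_lt _ _ _ _ _ _ _).1 c2 _ e2.
  apply: filterS3 n0 (n1 _) (n2 _) => y p1 p2 p3; exact: And3 p1 p2 p3.
have [d /= d0 dN] := (@nbhs_ballP _ _ _ _).1 N.
pose h := d / 2 / (`|v| + `|w| + 1).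
have vw : 0 < `|v| + `|w| + 1 by rewrite ltr_wpDl // addr_ge0.
have h0 : 0 < h by rewrite !divr_gt0.
have B s t : 0 <= s <= h -> 0 <= t <= h -> ball z d (s *: v + (t *: w + z)).
  move=> /andP[s0 sh] /andP[t0 th]; rewrite -ball_normE /ball_ /= distrC addrA addrK.
  rewrite (le_lt_trans (ler_normD _ _)) // !normrZ !ger0_norm //.
  apply: (@le_lt_trans _ _ (h * (`|v| + `|w| + 1))).
    by rewrite !mulrDr -[leLHS]addr0 !lerD ?ler_wpM2r // mulr1 ltW.
  by rewrite divfK ?gt_eqF // ltr_pdivrMr // ltr_pMr // ltr1n.
have [s [t [hs ht e1]]] : exists s t : R, [/\ 0 <= s <= h, 0 <= t <= h &
    f (h *: v + (h *: w + z)) - f (h *: v + z) - (f (h *: w + z) - f z)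
    = 'D_w ('D_v f) (s *: v + (t *: w + z)) * h ^+ 2].
  apply: (second_difference h0) => s t hs ht; have [Ay _ _] := dN _ (B s t hs ht).
  by split; [exact: smooth_on_diff Ay|apply: smooth_on_diff Ay; exact: smooth_on_derive].
have [t' [s' [ht' hs' e1']]] : exists s t : R, [/\ 0 <= s <= h, 0 <= t <= h &
    f (h *: w + (h *: v + z)) - f (h *: w + z) - (f (h *: v + z) - f z)
    = 'D_v ('D_w f) (s *: w + (t *: v + z)) * h ^+ 2].
  apply: (second_difference h0) => t' s' ht' hs'; have := B s' t' hs' ht'.
  rewrite addrCA => /dN[Ay _ _].
  by split; [exact: smooth_on_diff Ay|apply: smooth_on_diff Ay; exact: smooth_on_derive].
have [_ _ p1] := dN _ (B s t hs ht).
have := B s' t' hs' ht'; rewrite addrCA => /dN[_ p2 _].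
have hh : h ^+ 2 != 0 by rewrite expf_neq0 // gt_eqF.
have E : 'D_w ('D_v f) (s *: v + (t *: w + z)) = 'D_v ('D_w f) (t' *: w + (s' *: v + z)).
  apply: (second_difference_sym hh e1).
  by rewrite [h *: v + (h *: w + z)]addrCA; exact: e1'.
by move: p1; rewrite E => p1; exact: ler_of_common_close p1 p2.
Qed.

End Clairaut.

Section Flat.
Context {R : realType}.
Implicit Types (p : {poly R}) (x y : R).

(** The functions p(1/x) exp(-1/x) form a family that is closed under differentiation
    ([is_derive_flat_fun]), so differentiability at 0 gives smoothness. *)
Definition flat_fun p x : R := if 0 < x then p.[x^-1] * expR (- x^-1) else 0.

Lemma monomial_expR_bound (n : nat) y : 0 <= y -> y ^+ n * expR (- y) <= n`!%:R.
Proof.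
move=> y0; rewrite expRN ler_pdivrMr ?expR_gt0 //.
case: n => [|n]; first by rewrite expr0 fact0 mul1r -[leLHS]addr0 (le_trans _ (expR_ge1Dx y)) // lerD2l.
have := expR_ge1Dxn n y0; set E := expR y => h.
have f0 : 0 < n.+1`!%:R :> R by rewrite ltr0n fact_gt0.
rewrite mulrC -ler_pdivrMr //; apply: le_trans h.
by rewrite lerDr.
Qed.

Lemma poly_expR_bound p : exists2 C, 0 <= C & forall y, 0 <= y -> `|p.[y]| * expR (- y) <= C.
Proof.
exists (\sum_(i < size p) `|p`_i| * i`!%:R).
  by apply: sumr_ge0 => i _; rewrite mulr_ge0.
move=> y y0; rewrite horner_coef.
apply: (@le_trans _ _ ((\sum_(i < size p) `|p`_i| * y ^+ i) * expR (- y))).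
  rewrite ler_wpM2r ?expR_ge0 // (le_trans (ler_norm_sum _ _ _)) // ler_sum // => i _.
  by rewrite normrM (ger0_norm (exprn_ge0 _ y0)).
rewrite mulr_suml ler_sum // => i _; rewrite -mulrA ler_wpM2l //.
exact: monomial_expR_bound.
Qed.

Lemma flat_fun_sqr_bound p : exists2 C, 0 <= C & forall x, `|flat_fun p x| <= C * x ^+ 2.
Proof.
have [C C0 hC] := poly_expR_bound (p * 'X^2).
exists C => // x; rewrite /flat_fun; case: ifP => [x0|_]; last first.
  by rewrite normr0 mulr_ge0 // sqr_ge0.
have y0 : 0 <= x^-1 by rewrite invr_ge0 ltW.
have := hC _ y0; rewrite hornerM hornerXn normrM (ger0_norm (exprn_ge0 2 y0)).
rewrite normrM (ger0_norm (expR_ge0 _)) mulrAC exprVn ler_pdivrMr ?exprn_gt0 //.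
Qed.

Lemma is_derive_flat_fun p x :
  is_derive (x : R^o) (1 : R^o) (flat_fun p : R^o -> R^o) (flat_fun ((p - p^`()) * 'X^2) x).
Proof.
have [x0|x0|x0] := ltgtP x 0.
- rewrite [X in is_derive _ _ _ X](_ : _ = 0); last by rewrite /flat_fun ltNge ltW.
  have := is_derive_cst (0 : R^o) (x : R^o) (1 : R^o).
  apply: near_eq_is_derive.
  by near=> y; rewrite /flat_fun ifF //; apply/negbTE; rewrite -leNgt ltW //; near: y; exact: lt_nbhsl.
- rewrite [X in is_derive _ _ _ X](_ : _ = (p^`()).[x^-1] * (- (x ^- 2)) * expR (- x^-1)
     + p.[x^-1] * (expR (- x^-1) * (x ^- 2))); last first.
    by rewrite /flat_fun x0 /= hornerM hornerXn hornerD hornerN; field; rewrite gt_eqF.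
  have dV : is_derive x (1 : R) (fun y : R => y^-1) (- x ^- 2).
    have := @is_deriveV R id x 1 1; rewrite gt_eqF // => /(_ isT (is_derive_id _ _)).
    by rewrite /GRing.scale /= mulr1.
  have h1 : is_derive x (1 : R) ((horner p) \o (fun y => y^-1)) ((p^`()).[x^-1] * (- (x ^- 2))).
    by apply: is_derive1_comp.
  have h2 : is_derive x (1 : R) (expR \o (fun y => - y^-1)) (expR (- x^-1) * (x ^- 2)).
    apply: is_derive1_comp; have := is_deriveN dV; by rewrite opprK.
  have := is_deriveM h1 h2.
  rewrite [X in is_derive _ _ _ X](_ : _ = (p^`()).[x^-1] * (- (x ^- 2)) * expR (- x^-1)
     + p.[x^-1] * (expR (- x^-1) * (x ^- 2))); last first.
    by rewrite /GRing.scale /=; ring.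
  apply: near_eq_is_derive.
  by near=> y; rewrite /flat_fun ifT //; near: y; exact: lt_nbhsr.
- rewrite {}x0.
  have [C C0 hC] := flat_fun_sqr_bound p.
  have c : h^-1 *: ((flat_fun p \o shift 0) (h *: (1 : R^o)) - flat_fun p 0 : R^o) @[h --> 0^'] --> (0 : R^o).
    apply/cvgrPdist_le => e e0; near=> h.
    have h0 : h != 0 by near: h; exact: nbhs_dnbhs_neq.
    rewrite sub0r normrN /= addr0 [_ *: 1]mulr1 {2}/flat_fun ltxx subr0.
    rewrite normrM normfV ler_pdivrMl ?normr_gt0 //.
    rewrite (le_trans (hC _)) // -(real_normK (num_real h)) expr2 mulrA [leLHS]mulrC ler_wpM2l //.
    rewrite (@le_trans _ _ ((C + 1) * `|h|)) ?ler_wpM2r ?lerDl //.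
    rewrite -ler_pdivlMl ?ltr_wpDl //; near: h.
    by apply: dnbhs0_le; rewrite mulr_gt0 ?invr_gt0 ?ltr_wpDl.
  have -> : flat_fun ((p - p^`()) * 'X^2) 0 = 0 by rewrite /flat_fun ltxx.
  by apply: DeriveDef; [apply/cvg_ex; exists 0|exact/cvg_lim].
Unshelve. all: by end_near. Qed.

Lemma flat_fun_smooth p : smooth_on (setT : set R^o) (flat_fun p : R^o -> R^o).
Proof.
apply/smooth_onP => n; elim: n p => [|n IH] p; (split; first by
  move=> z _; apply/derivable1_diffP; have [] := is_derive_flat_fun p z) => // v.
have -> : 'D_v (flat_fun p : R^o -> R^o) = flat_fun (v *: ((p - p^`()) * 'X^2)).
  apply/funext => x.
  have [d e] := is_derive_flat_fun p x.
  rewrite deriveE; last exact/derivable1_diffP.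
  rewrite -[X in 'd _ _ X]mulr1 -[_ * 1]/(_ *: (1 : R^o)) linearZ /= -deriveE; last exact/derivable1_diffP.
  by rewrite e /flat_fun; case: ifP => _; rewrite ?scaler0 // hornerZ /GRing.scale /= mulrA.
exact: IH.
Qed.

Definition flat x : R := flat_fun 1 x.

Lemma flatE x : flat x = if 0 < x then expR (- x^-1) else 0.
Proof. by rewrite /flat /flat_fun hornerC mul1r. Qed.

Lemma flat_smooth : smooth_on (setT : set R^o) (flat : R^o -> R^o).
Proof. exact: flat_fun_smooth. Qed.

Lemma flat_ge0 x : 0 <= flat x.
Proof. by rewrite flatE; case: ifP => // _; rewrite expR_ge0. Qed.

Lemma flat_gt0 x : 0 < x -> 0 < flat x.
Proof. by move=> x0; rewrite flatE x0 expR_gt0. Qed.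

Lemma flat_le0 x : x <= 0 -> flat x = 0.
Proof. by move=> x0; rewrite flatE ltNge x0. Qed.

Lemma flat_le1 x : flat x <= 1.
Proof. by rewrite flatE; case: ifP => // x0; rewrite expR_le1 oppr_le0 invr_ge0 ltW. Qed.

Lemma flat_cvg x : (fun n : nat => flat (n%:R * x)) @ \oo --> (if 0 < x then 1 else 0 : R).
Proof.
case: ltP => x0; last first.
  rewrite (_ : (fun n => _) = cst 0); first exact: cvg_cst.
  by apply/funext => n; rewrite flat_le0 // mulr_ge0_le0.
have h : (fun n : nat => expR (- (n%:R * x)^-1)) @ \oo --> expR (- 0).
  apply: (@cvg_comp _ _ _ (fun n : nat => - (n%:R * x)^-1) expR _ (nbhs (- 0 : R))); last exact: continuous_expR.
  apply: cvgN; rewrite -(mul0r x^-1) (_ : (fun n => _) = (fun n : nat => n%:R^-1 * x^-1)).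
    by apply: cvgMl; apply/gtr0_cvgV0; [near=> n; rewrite ltr0n; near: n; exists 1%N|exact: cvgr_idn].
  by apply/funext => n; rewrite invfM.
rewrite oppr0 expR0 in h; apply: cvg_trans h; apply: near_eq_cvg.
near=> n; rewrite flatE ifT // mulr_gt0 // ltr0n; near: n; by exists 1%N.
Unshelve. all: by end_near. Qed.

End Flat.

Section SmoothMore.
Context {R : realType} {V : normedModType R}.
Implicit Types (A : set V) (f g : V -> R^o).

Lemma diff_nV n A f : open A -> (forall z, A z -> f z != 0) ->
  diff_n n A f -> diff_n n A (fun z => (f z)^-1 : R^o).
Proof.
move=> oA f0; elim: n => [|n IH] hf; move: (hf) => [df Df].
  by split; [move=> z Az; apply: differentiableV; [exact: df|exact: f0]|].
split=> [z Az|v]; first by apply: differentiableV; [exact: df|exact: f0].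
have IHn := IH (diff_n_le hf).
have h := diff_nM oA (diff_nM oA (diff_n_cst n A (-1 : R^o)) (diff_nM oA IHn IHn)) (Df v).
apply: (eq_diff_n oA _ h) => z Az.
rewrite deriveV ?f0 //; last by apply: diff_derivable; exact: df.
by rewrite !fctE /GRing.scale /= expr2 mulN1r invfM.
Qed.

Lemma smooth_onV A f : open A -> (forall z, A z -> f z != 0) ->
  smooth_on A f -> smooth_on A (fun z => (f z)^-1 : R^o).
Proof. by move=> oA f0 /smooth_onP h; apply/smooth_onP => n; exact: diff_nV. Qed.

Lemma smooth_on_lin (W : normedModType R) A (f : {linear V -> W}) :
  continuous f -> smooth_on A (f : V -> W).
Proof.
move=> cf; apply/smooth_onP => -[|n]; (split; first by move=> z _; exact: linear_differentiable) => // v.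
rewrite (_ : 'D_v f = cst (f v)); first exact: diff_n_cst.
by apply/funext => z; rewrite deriveE ?diff_lin //; exact: linear_differentiable.
Qed.

Lemma smooth_on_sum A m (F : 'I_m -> V -> R^o) : open A ->
  (forall i, smooth_on A (F i)) -> smooth_on A (\sum_i F i).
Proof.
by move=> oA h; apply/smooth_onP => n; apply: diff_n_sum => // i; have /smooth_onP := h i; exact.
Qed.

Lemma smooth_on_id A : smooth_on A (id : V -> V).
Proof. by apply: (@smooth_on_lin V A idfun) => x; exact: cvg_id. Qed.

End SmoothMore.

Lemma coord_smooth {R : realType} m (A : set 'rV[R]_m) a : open A ->
  smooth_on A (fun z : 'rV[R]_m => z 0 a : R^o).
Proof. by move=> oA; apply: (smooth_on_coord a oA (G := id)); exact: smooth_on_id. Qed.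

Section Cutoff.
Context {R : realType}.
Implicit Types s a b : R.

Definition cutoff a b s : R := flat (b - s) / (flat (b - s) + flat (s - a)).

Lemma cutoff_den_gt0 a b s : a < b -> 0 < flat (b - s) + flat (s - a).
Proof.
move=> ab; have [sb|bs] := ltP s b.
  by rewrite ltr_wpDr ?flat_ge0 // flat_gt0 // subr_gt0.
by rewrite ltr_wpDl ?flat_ge0 // flat_gt0 // subr_gt0 (lt_le_trans ab).
Qed.

Lemma cutoff_ge0 a b s : 0 <= cutoff a b s.
Proof. by rewrite divr_ge0 ?addr_ge0 ?flat_ge0. Qed.

Lemma cutoff_le1 a b s : a < b -> cutoff a b s <= 1.
Proof. by move=> ab; rewrite ler_pdivrMr ?cutoff_den_gt0 // mul1r lerDl flat_ge0. Qed.

Lemma cutoff1 a b s : a < b -> s <= a -> cutoff a b s = 1.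
Proof.
move=> ab sa; rewrite /cutoff (@flat_le0 _ (s - a)) ?subr_le0 // addr0 divff //.
by rewrite gt_eqF // flat_gt0 // subr_gt0 (le_lt_trans sa).
Qed.

Lemma cutoff0 a b s : b <= s -> cutoff a b s = 0.
Proof. by move=> bs; rewrite /cutoff flat_le0 ?mul0r // subr_le0. Qed.

Lemma cutoff_smooth a b : a < b -> smooth_on (setT : set R^o) (cutoff a b : R^o -> R^o).
Proof.
move=> ab.
have sB : smooth_on (setT : set R^o) ((flat : R^o -> R^o) \o (fun s : R^o => b - s : R^o)).
  apply: (@smooth_on_comp1 _ _ _ setT) => //; [exact: openT| |exact: flat_smooth].
  rewrite (_ : (fun s : R^o => b - s : R^o) = cst (b : R^o) + (cst (-1 : R^o) * (id : R^o -> R^o))).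
    apply: smooth_onD; [exact: openT|exact: smooth_on_cst|].
    by apply: smooth_onM; [exact: openT|exact: smooth_on_cst|exact: smooth_on_id].
  by apply/funext => s; rewrite !fctE mulN1r.
have sA : smooth_on (setT : set R^o) ((flat : R^o -> R^o) \o (fun s : R^o => s - a : R^o)).
  apply: (@smooth_on_comp1 _ _ _ setT) => //; [exact: openT| |exact: flat_smooth].
  rewrite (_ : (fun s : R^o => s - a : R^o) = (id : R^o -> R^o) + cst (- a : R^o)) //.
  by apply: smooth_onD; [exact: openT|exact: smooth_on_id|exact: smooth_on_cst].
apply: smooth_onM => //; first exact: openT.
apply: smooth_onV; [exact: openT| |by apply: smooth_onD => //; exact: openT].
by move=> s _; rewrite /= gt_eqF // cutoff_den_gt0.
Qed.

(** The cutoff is constant outside a compact interval, on which its derivatives are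
    continuous. *)
Lemma cutoff_derive_bound a b : a < b -> exists2 M, 0 < M & forall s,
  `|'D_1 (cutoff a b : R^o -> R^o) s| <= M /\
  `|'D_1 ('D_1 (cutoff a b : R^o -> R^o)) s| <= M.
Proof.
move=> ab; set f := (cutoff a b : R^o -> R^o).
have sf : smooth_on (setT : set R^o) f := cutoff_smooth ab.
have z1 s : s < a -> 'D_1 f s = 0.
  move=> sa; rewrite -(derive_cst (1 : R^o) (s : R^o) (1 : R^o)); apply: near_eq_derive.
  by near=> y; rewrite /f cutoff1 // ltW //; near: y; exact: lt_nbhsl.
have z2 s : b < s -> 'D_1 f s = 0.
  move=> sb; rewrite -(derive_cst (0 : R^o) (s : R^o) (1 : R^o)); apply: near_eq_derive.
  by near=> y; rewrite /f cutoff0 // ltW //; near: y; exact: lt_nbhsr.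
have z1' s : s < a -> 'D_1 ('D_1 f) s = 0.
  move=> sa; rewrite -(derive_cst (0 : R^o) (s : R^o) (1 : R^o)); apply: near_eq_derive.
  by near=> y; rewrite z1 //; near: y; exact: lt_nbhsl.
have z2' s : b < s -> 'D_1 ('D_1 f) s = 0.
  move=> sb; rewrite -(derive_cst (0 : R^o) (s : R^o) (1 : R^o)); apply: near_eq_derive.
  by near=> y; rewrite z2 //; near: y; exact: lt_nbhsr.
have bnd (g : R^o -> R^o) : smooth_on (setT : set R^o) g ->
    (forall s, s < a -> g s = 0) -> (forall s, b < s -> g s = 0) ->
    exists2 M, 0 < M & forall s, `|g s| <= M.
  move=> sg ga gb.
  have cg : {within `[a, b], continuous (fun s : R => `|g s| : R)}.
    apply: continuous_subspaceT => s; apply: (@continuous_comp _ _ _ g (fun x : R^o => `|x|)).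
      exact: (smooth_on_continuous sg).
    exact: norm_continuous.
  have [c _ hc] := EVT_max (ltW ab) cg.
  exists (`|g c| + 1) => [|s]; first by rewrite ltr_wpDl.
  have [sa|sa] := ltP s a; first by rewrite ga // normr0 addr_ge0.
  have [sb|sb] := ltP b s; first by rewrite gb // normr0 addr_ge0.
  by rewrite (le_trans (hc s _)) ?lerDl // in_itv /= sa sb.
have sf1 := smooth_on_derive (1 : R^o) sf.
have [M1 M10 h1] := bnd _ sf1 z1 z2.
have [M2 M20 h2] := bnd _ (smooth_on_derive (1 : R^o) sf1) z1' z2'.
exists (M1 + M2) => [|s]; first by rewrite addr_gt0.
by split; [rewrite (le_trans (h1 s)) // lerDl ltW|rewrite (le_trans (h2 s)) // lerDr ltW].
Unshelve. all: by end_near. Qed.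

End Cutoff.

(** * Integrals of nonnegative functions that need not be measurable *)

Section LowerIntegral.
Context d (T : measurableType d) (R : realType) (mu : {measure set T -> \bar R}).
Implicit Types (f g : T -> \bar R) (A B : set T).
Local Open Scope ereal_scope.
Import HBNNSimple.

Lemma nnsfun_integral_le f (h : {nnsfun T >-> R}) : (forall x, 0 <= f x) ->
  (forall x, (h x)%:E <= f x) -> \int[mu]_x (h x)%:E <= \int[mu]_x f x.
Proof.
move=> f0 hf; rewrite integralT_nnsfun ge0_integralTE //.
by apply: ereal_sup_ubound; exists h.
Qed.

Lemma integral_le_nnsfun f c : (forall x, 0 <= f x) ->
  (forall h : {nnsfun T >-> R}, (forall x, (h x)%:E <= f x) -> \int[mu]_x (h x)%:E <= c) ->
  \int[mu]_x f x <= c.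
Proof.
move=> f0 H; rewrite ge0_integralTE //; apply: ge_ereal_sup => _ [h /= hf <-].
by rewrite -integralT_nnsfun; exact: H.
Qed.

Lemma measurable_nnsfun (h : {nnsfun T >-> R}) : measurable_fun setT (fun x => (h x)%:E).
Proof. by apply/measurable_EFinP. Qed.

Lemma ge0_le_integral_ae f g : (forall x, 0 <= f x) -> (forall x, 0 <= g x) ->
  {ae mu, forall x, f x <= g x} -> \int[mu]_x f x <= \int[mu]_x g x.
Proof.
move=> f0 g0 [N [mN N0 sN]]; apply: integral_le_nnsfun => // h hf.
have mC : measurable (~` N) by exact: measurableC.
pose k : {nnsfun T >-> R} := proj_nnsfun h mC.
have kE x : k x = (h x * \1_(~` N) x)%R by [].
apply: (@le_trans _ _ (\int[mu]_x (k x)%:E)); last first.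
  apply: nnsfun_integral_le => // x; rewrite kE indicE.
  have [|xN] := boolP (x \in ~` N); last by rewrite mulr0.
  rewrite mulr1 inE /= => xN; rewrite (le_trans (hf x)) //.
  by apply: contrapT => fg; apply: xN; exact: sN.
apply: ae_ge0_le_integral => //; first by move=> x _; rewrite lee_fin.
- exact: measurable_nnsfun.
- by move=> x _; rewrite lee_fin.
- exact: measurable_nnsfun.
- exists N; split=> // x /= nh; apply: contrapT => xN; apply: nh => _.
  by rewrite lee_fin [leRHS](kE x) indicE mem_set // mulr1.
Qed.

Lemma ge0_le_integral_subset A B f : (forall x, 0 <= f x) -> A `<=` B ->
  \int[mu]_(x in A) f x <= \int[mu]_(x in B) f x.
Proof.
move=> f0 AB; rewrite integral_mkcond [leRHS]integral_mkcond.
have p0 C x : 0 <= (f \_ C) x by rewrite patchE; case: ifP.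
apply: ge0_le_integral_ae => //; apply: aeW => x; rewrite !patchE.
case: ifPn => [/set_mem/AB xB|_]; first by rewrite mem_set.
by case: ifP.
Qed.

(** The integral of a nonnegative function is a supremum over the simple functions below
    it, and a sum of simple functions below f and g is a simple function below f + g. *)
Lemma integral_superadditive f g : (forall x, 0 <= f x) -> (forall x, 0 <= g x) ->
  \int[mu]_x f x + \int[mu]_x g x <= \int[mu]_x (f x + g x).
Proof.
move=> f0 g0; have fg0 x : 0 <= f x + g x by rewrite adde_ge0.
have [->|nfin] := eqVneq (\int[mu]_x (f x + g x)) +oo; first by rewrite leey.
have le_fin (k : T -> \bar R) : (forall x, 0 <= k x) -> (forall x, k x <= f x + g x) ->
    \int[mu]_x k x \is a fin_num.
  move=> k0 kfg; rewrite ge0_fin_numE ?integral_ge0 //.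
  by apply: (@le_lt_trans _ _ (\int[mu]_x (f x + g x))); [apply: ge0_le_integral_ae => //; exact: aeW|rewrite lt_neqAle nfin leey].
have fg : \int[mu]_x g x \is a fin_num by apply: le_fin => // x; rewrite leeDr.
rewrite -leeBrDr //; apply: integral_le_nnsfun => // h hf.
rewrite leeBrDr // addeC -leeBrDr; last by apply: le_fin => x; rewrite ?lee_fin // (le_trans (hf x)) // leeDl.
apply: integral_le_nnsfun => // k kg.
rewrite leeBrDr; last by apply: le_fin => x; rewrite ?lee_fin // (le_trans (hf x)) // leeDl.
rewrite -ge0_integralD //; [|by move=> x _; rewrite lee_fin|exact: measurable_nnsfun|by move=> x _; rewrite lee_fin|exact: measurable_nnsfun].
apply: ge0_le_integral_ae => //; first by move=> x; rewrite adde_ge0 ?lee_fin.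
by apply: aeW => x; rewrite addeC leeD.
Qed.

(** The usual lemma is applied to the minima of F n with a simple function below f. *)
Lemma lower_fatou A (F : nat -> T -> R) (f : T -> R) c :
  (forall n x, 0 <= F n x)%R -> (forall x, 0 <= f x)%R ->
  (forall n, measurable_fun setT (F n)) ->
  {ae mu, forall x, A x -> F n x @[n --> \oo] --> f x} ->
  (forall n, \int[mu]_(x in A) (F n x)%:E <= c) ->
  \int[mu]_(x in A) (f x)%:E <= c.
Proof.
move=> F0 f0 mF cF bF.
have p0 (g : T -> R) (C : set T) x : (forall x, 0 <= g x)%R -> 0 <= ((fun x => (g x)%:E) \_ C) x.
  by move=> g0; rewrite patchE; case: ifP => _; rewrite ?lee_fin.
rewrite integral_mkcond; apply: integral_le_nnsfun => [x|h hf]; first exact: p0.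
pose G n x := Num.min (h x) (F n x).
have G0 n x : (0 <= G n x)%R by rewrite le_min F0 fun_ge0.
have mG n : measurable_fun setT (G n) by apply: measurable_minr.
have mGE n : measurable_fun setT (fun x => (G n x)%:E) by apply/measurable_EFinP.
have lim0 x : 0 <= limn_einf (fun n => (G n x)%:E).
  rewrite limn_einf_lim; apply: lime_ge.
    by apply: is_cvg_einfs.
  by apply: nearW => n; apply: le_ereal_inf_tmp => _ [m /= nm <-]; rewrite lee_fin.
apply: (@le_trans _ _ (\int[mu]_x limn_einf (fun n => (G n x)%:E))).
  apply: ge0_le_integral_ae => // [x|]; first by rewrite lee_fin.
  apply: filterS cF => x cF.
  have hx := hf x; rewrite patchE in hx; case: ifPn hx => [/set_mem Ax|nAx] hx; last first.
    by rewrite (le_trans hx).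
  suff c1 : (G n x)%:E @[n --> \oo] --> (h x)%:E.
    by rewrite (cvg_limn_einf_sup c1).1.
  apply: cvg_EFin; first by near=> n.
  have : G n x @[n --> \oo] --> Num.min (h x) (f x).
    apply/cvgrPdist_le => e e0; move/cvgrPdist_le : (cF Ax) => /(_ e e0).
    apply: filterS => n; apply: le_trans; rewrite /G /Num.min /Order.min.
    by case: ltP => ?; case: ltP => ?; rewrite !ler_norml; case: (ltP (f x) (F n x)) => ?; apply/andP; split;
      have := ler_norm (f x - F n x); have := ler_norm (- (f x - F n x)); rewrite normrN; lra.
  by rewrite min_l.
apply: (le_trans (fatou mu measurableT mGE _)); first by move=> n x _; rewrite lee_fin.
rewrite limn_einf_lim; apply: lime_le; first exact: is_cvg_einfs.
apply: nearW => n; apply: (@le_trans _ _ (\int[mu]_x (G n x)%:E)).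
  by apply: ereal_inf_lbound; exists n => /=.
apply: le_trans (bF n); rewrite [leRHS]integral_mkcond; apply: ge0_le_integral_ae => [x|x|].
- by rewrite lee_fin.
- exact: p0.
- apply: aeW => x; rewrite patchE; case: ifPn => [_|nAx]; first by rewrite lee_fin ge_min lexx orbT.
  by have := hf x; rewrite patchE (negbTE nAx) !lee_fin => hx; rewrite ge_min hx.
Unshelve. all: by end_near. Qed.

End LowerIntegral.

(** * Integration over the plane *)

Lemma continuous_compact_bounded (R : realType) (T : topologicalType) (A : set T) (f : T -> R) :
  compact A -> (forall x, A x -> {for x, continuous f}) ->
  exists2 M, 0 < M & forall x, A x -> `|f x| <= M.
Proof.
move=> cA cf; have [A0|/set0P A0] := eqVneq A set0.
  by exists 1 => // x; rewrite A0.
have cg : {within A, continuous (fun x => `|f x|)}.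
  apply: continuous_in_subspaceT => x /set_mem Ax.
  by apply: continuous_comp; [exact: cf|exact: norm_continuous].
have [c Ac hc] := compact_EVT_max A0 cA cg.
exists (`|f c| + 1) => [|x Ax]; first by rewrite ltr_wpDl.
by rewrite (le_trans (hc x _)) ?lerDl // inE.
Qed.

Section Plane.
Context {R : realType}.
Local Notation mu := (@lebesgue_measure R).
Implicit Types (A : set (R * R)) (f : R * R -> R) (M : R).

Definition rat_box (q : (rat * rat) * (rat * rat)) : set (R * R) :=
  `]ratr q.1.1, ratr q.1.2[%classic `*` `]ratr q.2.1, ratr q.2.2[%classic.

Lemma rat_box_basis A z : open A -> A z -> exists2 q, rat_box q z & rat_box q `<=` A.
Proof.
move=> oA Az; have /nbhs_ballP[e /= e0 eA] : nbhs z A by exact: open_nbhs_nbhs.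
have P (x : R) : exists q : rat * rat, ratr q.1 < x < ratr q.2 /\ x - e < ratr q.1 /\ ratr q.2 < x + e.
  have /rat_in_itvoo[q1 /itvP h1] : x - e < x by rewrite ltrBlDr ltrDl.
  have /rat_in_itvoo[q2 /itvP h2] : x < x + e by rewrite ltrDl.
  by exists (q1, q2); rewrite /= !h1 !h2.
have [qx [/andP[x1 x2] [x3 x4]]] := P z.1; have [qy [/andP[y1 y2] [y3 y4]]] := P z.2.
exists (qx, qy); first by split; rewrite /= in_itv /= ?x1 ?x2 ?y1 ?y2.
move=> -[a b] [] /=; rewrite !in_itv /= => /andP[a1 a2] /andP[b1 b2].
by apply: eA; split; rewrite /ball /= ltr_norml; apply/andP; split; lra.
Qed.

Lemma open2_measurable A : open A -> measurable A.
Proof.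
move=> oA; have -> : A = \bigcup_q (if `[< rat_box q `<=` A >] then rat_box q else set0).
  apply/seteqP; split=> [z Az|z [q _]]; last by case: asboolP => // h /h.
  have [q qz qA] := rat_box_basis oA Az.
  by exists q => //; case: asboolP.
apply: countable_bigcupT_measurable => [|q]; first exact: countableP.
case: asboolP => // _; apply: measurableX; exact: measurable_itv.
Qed.

Lemma open_continuous2_measurable A f : open A ->
  (forall z, A z -> {for z, continuous f}) -> measurable_fun A f.
Proof.
move=> oA cf; apply: (measurability _ (RGenOpens.measurableE R)).
move=> _ [_ [a [b ->] <-]]; apply: open2_measurable.
rewrite openE => z [Az /= fz]; apply: filterI; first exact: open_nbhs_nbhs.
by apply: cf => //; apply: open_nbhs_nbhs; split => //; exact: interval_open.
Qed.

Lemma continuous2_measurable f : continuous f -> measurable_fun setT f.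
Proof. by move=> cf; apply: open_continuous2_measurable => //; [exact: openT|move=> z _; exact: cf]. Qed.

Definition square M : set (R * R) := `[- M, M]%classic `*` `[- M, M]%classic.

Lemma squareP M z : square M z <-> `|z.1| <= M /\ `|z.2| <= M.
Proof. by rewrite /square /= !in_itv /= !ler_norml. Qed.

Lemma square_compact M : compact (square M).
Proof. by apply: compact_setX; exact: segment_compact. Qed.

Lemma square_measurable M : measurable (square M).
Proof. by apply: measurableX; exact: measurable_itv. Qed.

Lemma square_finite M : (@leb2 R (square M) < +oo)%E.
Proof.
rewrite /leb2 /square product_measure1E; [|exact: measurable_itv|exact: measurable_itv].
have [r hr] : exists r : R, mu `[- M, M]%classic = r%:E.
  by rewrite lebesgue_measure_itv /=; case: ifP => _; rewrite -?EFinD; eexists.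
by rewrite -[X in (X * _)%E]/(mu _) -[X in (_ * X)%E]/(mu _) hr -EFinM ltry.
Qed.

Lemma integrable_compact_support f M : continuous f -> (forall z, ~ square M z -> f z = 0) ->
  leb2.-integrable setT (EFin \o f).
Proof.
move=> cf f0.
have [K K0 hK] := continuous_compact_bounded (@square_compact M) (fun z _ => cf z).
have i1 : leb2.-integrable (square M) (EFin \o f).
  apply: measurable_bounded_integrable; [exact: square_measurable|exact: square_finite| |].
    exact: measurable_funS (continuous2_measurable cf).
  by exists K; split; rewrite ?num_real // => k /ltW Kk z /hK; move/le_trans; apply.
have := (@integrable_mkcond _ _ _ (@leb2 R : {measure set _ -> \bar _}) _ (EFin \o f) (square_measurable M)).1 i1.
rewrite (_ : _ \_ _ = EFin \o f) //; apply/funext => z; rewrite patchE /=.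
by case: ifPn => //; rewrite notin_setE => /f0 ->.
Qed.

Lemma integral_derive_line (g dg : R -> R) M : (forall x : R, is_derive x 1 g (dg x)) ->
  continuous dg -> (forall x, M < `|x| -> g x = 0 /\ dg x = 0) ->
  (\int[mu]_x (dg x)%:E = 0)%E.
Proof.
move=> dE cdg z0; pose N : R := `|M| + 1.
have MN : M < N by rewrite /N (le_lt_trans (ler_norm M)) // ltrDl.
have N0 : 0 < N by rewrite /N ltr_wpDl.
have cg : continuous g.
  by move=> x; apply/differentiable_continuous/derivable1_diffP; have [] := dE x.
have -> : (\int[mu]_x (dg x)%:E = \int[mu]_(x in `[(- N)%R, N%R]) (dg x)%:E)%E.
  rewrite [RHS]integral_mkcond; apply: eq_integral => x _; rewrite patchE.
  case: ifPn => //; rewrite notin_setE /= in_itv /= => h; rewrite (z0 x _).2 //.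
  rewrite (lt_le_trans MN) // leNgt; apply/negP => /ltW; rewrite ler_norml => h'.
  exact: h.
rewrite (@continuous_FTC2 _ dg g) //.
- rewrite !(z0 _ _).1 ?subee //; first by rewrite normrN gtr0_norm.
  by rewrite gtr0_norm.
- by rewrite gtrN.
- exact: continuous_subspaceT.
- split; first by move=> x _; have [] := dE x.
    by apply: cvg_at_right_filter; exact: cg.
  by apply: cvg_at_left_filter; exact: cg.
- by move=> x _; rewrite derive1E; have [] := dE x.
Qed.

Lemma pair_continuous_l (y : R) : continuous (fun x : R => (x, y)).
Proof. by move=> x; apply/differentiable_continuous/differentiable_pair. Qed.

Lemma pair_continuous_r (x : R) : continuous (fun y : R => (x, y)).
Proof. by move=> y; apply/differentiable_continuous/differentiable_pair. Qed.

Lemma integral_derive_fst (F dF : R * R -> R) M :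
  (forall x y : R, is_derive x 1 (fun x => F (x, y)) (dF (x, y))) -> continuous dF ->
  (forall z, ~ square M z -> F z = 0 /\ dF z = 0) -> \int[leb2]_z dF z = 0.
Proof.
move=> dE cdF z0; rewrite /Rintegral.
have i1 : leb2.-integrable setT (EFin \o dF).
  by apply: (@integrable_compact_support _ M) => // z /z0[].
rewrite -[X in fine X](_ : (\int[mu]_y fubini_G mu (EFin \o dF) y = _)%E); last first.
  exact: integral21_prod_meas1.
rewrite (_ : fubini_G mu (EFin \o dF) = cst 0%E) ?integral0 //.
apply/funext => y; apply: (@integral_derive_line (fun x => F (x, y)) (fun x => dF (x, y)) M) => //.
- move=> x; apply: continuous_comp; last exact: cdF.
  exact: pair_continuous_l.
- by move=> x Mx; apply: z0 => /squareP[/=]; rewrite leNgt Mx.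
Qed.

Lemma integral_derive_snd (F dF : R * R -> R) M :
  (forall x y : R, is_derive y 1 (fun y => F (x, y)) (dF (x, y))) -> continuous dF ->
  (forall z, ~ square M z -> F z = 0 /\ dF z = 0) -> \int[leb2]_z dF z = 0.
Proof.
move=> dE cdF z0; rewrite /Rintegral.
have i1 : leb2.-integrable setT (EFin \o dF).
  by apply: (@integrable_compact_support _ M) => // z /z0[].
rewrite -[X in fine X](_ : (\int[mu]_y fubini_F mu (EFin \o dF) y = _)%E); last first.
  exact: integral12_prod_meas1.
rewrite (_ : fubini_F mu (EFin \o dF) = cst 0%E) ?integral0 //.
apply/funext => x; apply: (@integral_derive_line (fun y => F (x, y)) (fun y => dF (x, y)) M) => //.
- move=> y; apply: continuous_comp; last exact: cdF.
  exact: pair_continuous_r.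
- by move=> y My; apply: z0 => /squareP[/= _]; rewrite leNgt My.
Qed.

(** Differentiation under the integral sign, followed by the mean value theorem. *)
Lemma integral_growth (F dF : R -> R * R -> R) (a b M c : R) :
  (forall (t : R) z, a < t < b -> is_derive t 1 (F ^~ z) (dF t z)) ->
  (forall t, a < t < b -> continuous (F t)) ->
  (forall t z, a < t < b -> {for (t, z), continuous (fun p => dF p.1 p.2)}) ->
  (forall t z, a < t < b -> ~ square M z -> F t z = 0 /\ dF t z = 0) ->
  forall s t, a < s -> s <= t -> t < b ->
  (forall r, s <= r <= t -> \int[leb2]_z dF r z <= c) ->
  \int[leb2]_z F t z - \int[leb2]_z F s z <= c * (t - s).
Proof.
move=> dE cF cdF z0 s t as_ st tb hc.
have D (r : R) : a < r < b -> is_derive r 1 (fun r => \int[leb2]_z F r z) (\int[leb2]_z dF r z).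
  move=> /andP[ar rb].
  pose u := (a + r) / 2; pose v := (r + b) / 2.
  have ur : u < r by rewrite /u; lra.
  have rv : r < v by rewrite /v; lra.
  have au : a < u by rewrite /u; lra.
  have vb : v < b by rewrite /v; lra.
  have I x : `]u, v[%classic x -> a < x < b.
    by rewrite /= in_itv /= => /andP[h1 h2]; rewrite (lt_trans au h1) (lt_trans h2 vb).
  have cK : compact (`[u, v]%classic `*` square M).
    by apply: compact_setX; [exact: segment_compact|exact: square_compact].
  have [K K0 hK] : exists2 K, 0 < K & forall p : R * (R * R),
      (`[u, v]%classic `*` square M) p -> `|dF p.1 p.2| <= K.
    apply: continuous_compact_bounded => // -[x z] [/= + _].
    rewrite in_itv /= => /andP[h1 h2]; apply: cdF.
    by rewrite (lt_le_trans au h1) (le_lt_trans h2 vb).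
  have Ir : `]u, v[%classic r by rewrite /= in_itv /= ur.
  have intF x : `]u, v[%classic x -> leb2.-integrable setT (EFin \o F x).
    move=> /I hx; apply: (@integrable_compact_support _ M); first exact: cF.
    by move=> z /(z0 _ _ hx)[].
  have derF x y : `]u, v[%classic x -> [set: R * R] y -> derivable (F ^~ y) x 1.
    by move=> /I hx _; have [] := dE x y hx.
  pose G (z : R * R) := K * \1_(square M) z.
  have G0 z : 0 <= G z by rewrite mulr_ge0 // ltW.
  have intG : leb2.-integrable setT (EFin \o G).
    have i1 : leb2.-integrable (square M) (EFin \o (fun _ : R * R => K)).
      apply: measurable_bounded_integrable; [exact: square_measurable|exact: square_finite| |].
        exact: measurable_cst.
      by exists K; split; rewrite ?num_real // => k /ltW Kk z _; rewrite /= ger0_norm // ltW.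
    have := (@integrable_mkcond _ _ _ (@leb2 R : {measure set _ -> \bar _}) _ _ (square_measurable M)).1 i1.
    rewrite (_ : _ \_ _ = EFin \o G) //; apply/funext => z; rewrite patchE /= /G indicE.
    by case: ifP; rewrite (mulr1, mulr0).
  have bG x y : `]u, v[%classic x -> [set: R * R] y -> `|partial1of2 F x y| <= G y.
    move=> hx _; rewrite partial1of2E; have [_ ->] := dE x y (I _ hx).
    rewrite /G indicE; have [|] := boolP (y \in square M); last first.
      by rewrite notin_setE => /(z0 _ _ (I _ hx))[_ ->]; rewrite normr0 mulr0.
    rewrite inE mulr1 => yM; apply: (hK (x, y)); split => //=.
    by move: hx; rewrite /= !in_itv /= => /andP[/ltW -> /ltW ->].
  apply: DeriveDef.
    exact: (derivable_under_integral measurableT Ir intF derF G0 intG bG).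
  rewrite -derive1E (differentiation_under_integral measurableT Ir intF derF G0 intG bG).
  apply: eq_Rintegral => z _ /=; rewrite partial1of2E.
  by have [_ ->] := dE r z (I _ Ir).
have [->|st'] := eqVneq s t; first by rewrite !subrr mulr0.
have {}st' : s < t by rewrite lt_neqAle st'.
have hI r : s <= r <= t -> a < r < b.
  by move=> /andP[h1 h2]; rewrite (lt_le_trans as_ h1) (le_lt_trans h2 tb).
have [r] : exists2 r, r \in `]s, t[ & (fun r => \int[leb2]_z F r z) t - (fun r => \int[leb2]_z F r z) s
    = (\int[leb2]_z dF r z) * (t - s).
  apply: (@MVT _ (fun r => \int[leb2]_z F r z)) => // [r|].
    by rewrite in_itv /= => /andP[/ltW h1 /ltW h2]; apply/D/hI; rewrite h1 h2.
  apply: derivable_within_continuous => r; rewrite in_itv /= => hr.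
  by have [] := D r (hI _ hr).
rewrite in_itv /= => /andP[/ltW h1 /ltW h2] ->.
by rewrite ler_wpM2r ?subr_ge0 // hc // h1.
Qed.

End Plane.

Section Density.
Context d (T : measurableType d) (R : realType) (mu : {measure set T -> \bar R}).
Variable f : T -> R.
Hypothesis f0 : forall x, 0 <= f x.
Hypothesis mf : measurable_fun setT f.
Local Open Scope ereal_scope.
Import HBNNSimple.

Definition density_fun (A : set T) : \bar R := \int[mu]_(x in A) (f x)%:E.

Let density0 : density_fun set0 = 0.
Proof. by rewrite /density_fun integral_set0. Qed.

Let density_ge0 A : 0 <= density_fun A.
Proof. by apply: integral_ge0 => x _; rewrite lee_fin. Qed.

Let mfE (A : set T) : measurable_fun A (fun x => (f x)%:E).
Proof. by apply/measurable_EFinP; exact: measurable_funS mf. Qed.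

Let density_sigma_additive : semi_sigma_additive density_fun.
Proof.
move=> F mF tF mUF; rewrite /density_fun ge0_integral_bigcup //.
- by apply: is_cvg_nneseries => n _ _; exact: density_ge0.
- by move=> x _; rewrite lee_fin.
Qed.

Definition density : {measure set T -> \bar R} :=
  HB.pack density_fun (@isMeasure.Build _ _ _ density_fun density0 density_ge0 density_sigma_additive).

Lemma integral_density_nnsfun (h : {nnsfun T >-> R}) :
  \int[density]_x (h x)%:E = \int[mu]_x ((h x)%:E * (f x)%:E).
Proof.
transitivity (\sum_(k \in range h) \int[mu]_x ((k * \1_(h @^-1` [set k]) x)%:E * (f x)%:E)).
  under eq_integral do rewrite fimfunE -fsumEFin//.
  rewrite ge0_integral_fsum//; [|by move=> y; exact/measurable_EFinP/measurable_funM
    |by move=> y x _; rewrite nnfun_muleindic_ge0].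
  apply: eq_fsbigr => r _; rewrite integralZl_indic_nnsfun// integral_indic//=.
  rewrite setIT /density_fun.
  under [in RHS]eq_integral do rewrite EFinM -muleA.
  have [r0|r0] := ltP r 0%R.
    rewrite preimage_nnfun0 // integral_set0 mule0 (_ : (fun x => _) = cst 0) ?integral0 //.
    by apply/funext => x; rewrite indic0 mul0e mule0.
  rewrite ge0_integralZl//; [|by apply: emeasurable_funM; [exact/measurable_EFinP|exact: mfE]
    |by move=> x _; rewrite mule_ge0 // lee_fin].
  congr (_ * _); rewrite integral_mkcond; apply: eq_integral => x _.
  by rewrite patchE indicE; case: ifP; rewrite ?mul1e ?mul0e.
rewrite -ge0_integral_fsum//.
- apply: eq_integral => x _; rewrite [in RHS]fimfunE -fsumEFin// ge0_mule_fsuml //.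
  by move=> i; rewrite nnfun_muleindic_ge0.
- by move=> r; apply: emeasurable_funM; [exact/measurable_EFinP/measurable_funM|exact: mfE].
- by move=> r x _; rewrite EFinM mule_ge0 ?nnfun_muleindic_ge0 ?lee_fin.
Qed.

Lemma integral_density (g : T -> \bar R) : measurable_fun setT g -> (forall x, 0 <= g x) ->
  \int[density]_x g x = \int[mu]_x (g x * (f x)%:E).
Proof.
move=> mg g0; pose f_ := nnsfun_approx measurableT mg.
transitivity (limn (fun n => \int[density]_x (f_ n x)%:E)).
{ rewrite -monotone_convergence//.
  - apply: eq_integral => x _; apply/esym/cvg_lim => //.
    exact: cvg_nnsfun_approx.
  - by move=> n; exact/measurable_EFinP/measurable_funTS.
  - by move=> n x _; rewrite lee_fin.
  - by move=> x _ a b ab; rewrite lee_fin//; exact/lefP/nd_nnsfun_approx. }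
transitivity (limn (fun n => \int[mu]_x ((f_ n x)%:E * (f x)%:E))).
  by congr (limn _); apply/funext => n; rewrite integral_density_nnsfun.
rewrite -monotone_convergence//.
- apply: eq_integral => x _; apply/cvg_lim => //.
  by apply: cvgeZr => //; exact: cvg_nnsfun_approx.
- move=> n; apply: emeasurable_funM; [exact/measurable_EFinP/measurable_funTS|exact: mfE].
- by move=> n x _; rewrite mule_ge0 ?lee_fin.
- move=> x _ a b ab; rewrite lee_wpmul2r ?lee_fin//; exact/lefP/nd_nnsfun_approx.
Qed.

End Density.

Lemma ae_imp2 d (T : measurableType d) (R : realType) (mu : {measure set T -> \bar R})
    (P Q S : T -> Prop) : (forall x, P x -> Q x -> S x) ->
  {ae mu, forall x, P x} -> {ae mu, forall x, Q x} -> {ae mu, forall x, S x}.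
Proof. by move=> h; apply: filterS2. Qed.

Lemma ae_imp d (T : measurableType d) (R : realType) (mu : {measure set T -> \bar R})
    (P Q : T -> Prop) : (forall x, P x -> Q x) -> {ae mu, forall x, P x} -> {ae mu, forall x, Q x}.
Proof. by move=> h; apply: filterS. Qed.

Section Quadrants.
Context {R : realType}.
Local Notation mu := (@lebesgue_measure R).

Definition half_lines : set (set R) := [set A | A = setT \/ exists a : R, A = `]a, +oo[%classic].

Lemma half_lines_measurable A : half_lines A -> measurable A.
Proof. by case=> [->|[a ->]]; [exact: measurableT|exact: measurable_itv]. Qed.

Lemma half_lines_setI A B : half_lines A -> half_lines B -> half_lines (A `&` B).
Proof.
move=> [->|[a ->]] [->|[b ->]]; rewrite ?setTI ?setIT; try by [left|right; eexists].
right; exists (Num.max a b); apply/seteqP; split=> x /=; rewrite !in_itv /= !andbT gt_max.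
  by move=> [-> ->].
by move=> /andP.
Qed.

Lemma half_lines_generate : @measurable _ (measurableTypeR R) = <<s half_lines >>.
Proof.
apply/seteqP; split.
  rewrite [X in X `<=` _](RGenOInfty.measurableE R); apply: sub_smallest2r; first exact: smallest_sigma_algebra.
  by move=> _ [a ->]; right; exists a.
by apply: smallest_sub; [exact: sigma_algebra_measurable|exact: half_lines_measurable].
Qed.

Definition quadrants : set (set (R * R)) := [set A `*` B | A in half_lines & B in half_lines].

Local Notation bR := (g_sigma_algebraType (R.-ocitv.-measurable)).

Lemma quadrants_generate : @measurable _ (bR * bR)%type = <<s quadrants >>.
Proof.
have m1 : measurable_fun setT (fst : g_sigma_algebraType quadrants -> measurableTypeR R).
  apply: (measurability _ half_lines_generate) => _ [A hA <-]; rewrite setTI.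
  by apply: sub_sigma_algebra; exists A => //; exists setT; [left|rewrite setXT].
have m2 : measurable_fun setT (snd : g_sigma_algebraType quadrants -> measurableTypeR R).
  apply: (measurability _ half_lines_generate) => _ [A hA <-]; rewrite setTI.
  by apply: sub_sigma_algebra; exists setT; [left|exists A => //; rewrite setTX].
rewrite measurable_prod_measurableType; apply/seteqP; split.
  apply: smallest_sub; first exact: smallest_sigma_algebra.
  move=> _ [A mA [B mB <-]].
  have -> : A `*` B = (setT `&` fst @^-1` A) `&` (setT `&` snd @^-1` B).
    by apply/seteqP; split=> [[x y] []|[x y] [[_ ?] [_ ?]]].
  by apply: (@measurableI _ (g_sigma_algebraType quadrants)); [exact: m1|exact: m2].
apply: sub_smallest2r; first exact: smallest_sigma_algebra.
by move=> _ [A /half_lines_measurable mA [B /half_lines_measurable mB <-]]; exists A => //; exists B.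
Qed.

Lemma quadrants_setI : setI_closed quadrants.
Proof.
move=> _ _ [A1 a1 [B1 b1 <-]] [A2 a2 [B2 b2 <-]].
by rewrite -setXI; exists (A1 `&` A2); [exact: half_lines_setI|exists (B1 `&` B2); [exact: half_lines_setI|]].
Qed.

Lemma quadrants_setT : quadrants setT.
Proof. by exists setT; [left|exists setT; [left|rewrite setXTT]]. Qed.

Lemma measure_eq_quadrants (m1 m2 : {measure set (bR * bR) -> \bar R}) :
  (forall A, quadrants A -> m1 A = m2 A) -> (m1 setT < +oo)%E ->
  forall A, measurable A -> m1 A = m2 A.
Proof.
move=> m12 fin A mA.
have c : \bigcup_(k in [set: nat]) (fun=> setT : set (bR * bR)) k = setT.
  by rewrite bigcup_const //; exists 0%N.
exact: (@measure_unique _ R (bR * bR)%type quadrants (fun=> setT) quadrants_generate quadrants_setI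
  (fun=> quadrants_setT) c m1 m2 m12 (fun=> fin) A mA).
Qed.

(** Quadrants form a generating pi-system, so the positive and the negative part of the
    density define the same measure. *)
Lemma ae_eq0_quadrants (h : R * R -> R) : leb2.-integrable setT (EFin \o h) ->
  (forall A, quadrants A -> (\int[leb2]_(z in A) (h z)%:E = 0)%E) ->
  {ae (leb2 : {measure set (bR * bR) -> \bar R}), forall z, h z = 0}.
Proof.
move=> ih h0.
have mh : measurable_fun setT h by apply/measurable_EFinP; exact: measurable_int ih.
pose hp z := Num.max (h z) 0; pose hn z := Num.max (- h z) 0.
have hp0 z : 0 <= hp z by rewrite le_max lexx orbT.
have hn0 z : 0 <= hn z by rewrite le_max lexx orbT.
have mhp : measurable_fun setT hp by apply: measurable_maxr.
have mhn : measurable_fun setT hn by apply: measurable_maxr => //; exact: measurableT_comp.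
pose m1 := density (@leb2 R : {measure set _ -> \bar _}) hp0 mhp.
pose m2 := density (@leb2 R : {measure set _ -> \bar _}) hn0 mhn.
have mq A : quadrants A -> measurable A.
  by move=> [B /half_lines_measurable mB [C /half_lines_measurable mC <-]]; exact: measurableX.
have E A : measurable A -> (\int[leb2]_(z in A) (h z)%:E = m1 A - m2 A)%E.
  move=> mA; rewrite integralE; congr (_ - _)%E; apply: eq_integral => z _.
    by rewrite funeposE /hp EFin_max.
  by rewrite funenegE /hn EFin_max.
have fin (k : R * R -> R) (k0 : forall z, 0 <= k z) (mk : measurable_fun setT k) A : measurable A ->
    (forall z, k z <= `|h z|) -> (density (@leb2 R : {measure set _ -> \bar _}) k0 mk A < +oo)%E.
  move=> mA kh; have /integrableP[_] := ih; apply: le_lt_trans.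
  apply: (@le_trans _ _ (\int[leb2]_z (k z)%:E)%E).
    by apply: ge0_le_integral_subset => // z; rewrite lee_fin.
  by apply: ge0_le_integral_ae => [z|z|]; rewrite ?lee_fin //=; apply: aeW => z; rewrite /= lee_fin.
have hph z : hp z <= `|h z| by rewrite ge_max ler_norm normr_ge0.
have hnh z : hn z <= `|h z| by rewrite ge_max -normrN ler_norm normr_ge0.
have qT : quadrants setT by exists setT; [left|exists setT; [left|rewrite setXTT]].
have m12 A : measurable A -> m1 A = m2 A.
  apply: measure_eq_quadrants; last exact: fin.
  move=> B qB; have := h0 _ qB; rewrite E; last exact: mq.
  have f1 : m1 B \is a fin_num by rewrite ge0_fin_numE // fin //; exact: mq.
  have f2 : m2 B \is a fin_num by rewrite ge0_fin_numE // fin //; exact: mq.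
  by move/eqP; rewrite sube_eq ?add0e ?fin_num_adde_defl // => /eqP.
have key (k : R * R -> R) (k0 : forall z, 0 <= k z) (mk : measurable_fun setT k)
    (k' : R * R -> R) (k0' : forall z, 0 <= k' z) (mk' : measurable_fun setT k') :
    (forall z, k z != 0 -> k' z = 0) ->
    (forall A, measurable A -> density (@leb2 R : {measure set _ -> \bar _}) k0 mk A
       = density (@leb2 R : {measure set _ -> \bar _}) k0' mk' A) ->
    {ae (leb2 : {measure set (bR * bR) -> \bar R}), forall z, k z = 0}.
  move=> kk' e.
  have mA : measurable (k @^-1` (~` [set 0])).
    by rewrite -[_ @^-1` _]setTI; have mk2 := mk; apply: mk2 => //; apply: measurableC.
  have := e _ mA; rewrite [RHS](_ : _ = 0%E); last first.
    rewrite /density /= /density_fun integral_mkcond (_ : _ \_ _ = cst 0%E) ?integral0 //.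
    apply/funext => z; rewrite patchE; case: ifPn => // /set_mem /= /eqP /kk' -> //.
  rewrite /density /= /density_fun integral_mkcond (_ : _ \_ _ = EFin \o k); last first.
    apply/funext => z; rewrite patchE; case: ifPn => //=.
    by rewrite notin_setE /= => /contrapT ->.
  move=> e0; have : (\int[leb2]_z `|(EFin \o k) z| = 0)%E.
    by rewrite -[RHS]e0; apply: eq_integral => z _; rewrite gee0_abs ?lee_fin.
  move/ae_eq_integral_abs; move=> /(_ measurableT).
  have mkE : measurable_fun setT (EFin \o k) by apply/measurable_EFinP.
  move=> /(_ mkE); apply: filterS => z /(_ I) /= [].
  by [].
have a1 := key _ hp0 mhp _ hn0 mhn _ m12.
have a2 := key _ hn0 mhn _ hp0 mhp _ (fun A mA => esym (m12 A mA)).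
apply: ae_imp2 (a1 _) (a2 _) => [z|z|z].
- rewrite /hp /hn => p n; apply/eqP; rewrite eq_le -oppr_le0.
  by rewrite -{2}n -p !le_max !lexx.
- rewrite /hp /hn => /eqP p; apply/max_idPr; rewrite oppr_le0 leNgt; apply/negP => q; apply: p.
  by apply/max_idPr/ltW.
- rewrite /hp /hn => /eqP p; apply/max_idPr; rewrite leNgt; apply/negP => q; apply: p.
  by apply/max_idPr; rewrite oppr_le0 ltW.
Qed.

(** The ellipse lies in the parallelogram given by completing the square. *)
Lemma ellipse_area (a b c s : R) (z0 : R * R) : 0 < c -> 0 < a * c - b ^+ 2 -> 0 < s ->
  (@leb2 R [set z | (a * (z.1 - z0.1) ^+ 2 + 2 * b * (z.1 - z0.1) * (z.2 - z0.2)
     + c * (z.2 - z0.2) ^+ 2 <= s)%R] <= (4 * s / Num.sqrt (a * c - b ^+ 2))%:E)%E.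
Proof.
move=> c0 D0 s0; set D := a * c - b ^+ 2; set E := [set z | _].
pose l := Num.sqrt (s * c / D); pose m := Num.sqrt (s / c).
have l0 : 0 <= l by exact: sqrtr_ge0.
have m0 : 0 <= m by exact: sqrtr_ge0.
have l2 : l ^+ 2 = s * c / D by rewrite sqr_sqrtr // divr_ge0 ?mulr_ge0 // ltW.
have m2 : m ^+ 2 = s / c by rewrite sqr_sqrtr // divr_ge0 // ltW.
have sub x y : E (x, y) -> `|x - z0.1| <= l /\ `|y - (z0.2 - b * (x - z0.1) / c)| <= m.
  rewrite /E /=; set X := x - z0.1; set Y := y - z0.2 => h.
  have e : a * X ^+ 2 + 2 * b * X * Y + c * Y ^+ 2 = D / c * X ^+ 2 + c * (Y + b * X / c) ^+ 2.
    by rewrite /D; field; rewrite gt_eqF.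
  have h1 : 0 <= D / c * X ^+ 2 by rewrite mulr_ge0 ?sqr_ge0 // divr_ge0 // ltW.
  have h2 : 0 <= c * (Y + b * X / c) ^+ 2 by rewrite mulr_ge0 ?sqr_ge0 // ltW.
  split; rewrite -ler_sqr ?nnegrE // real_normK ?num_real //.
    rewrite l2 -/X ler_pdivlMr // -ler_pdivrMr //.
    by move: h; rewrite e; nra.
  rewrite (_ : y - _ = Y + b * X / c); last by rewrite /Y; ring.
  by rewrite m2 ler_pdivlMr //; move: h; rewrite e; nra.
pose I1 : set R := `[z0.1 - l, z0.1 + l]%classic.
have muI (u v : R) : u <= v -> mu `[u, v]%classic = (v - u)%:E.
  by move=> uv; rewrite lebesgue_measure_itv /= lte_fin; case: ltgtP uv => // ->; rewrite subrr.
rewrite /leb2 /product_measure1.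
apply: (@le_trans _ _ (\int[mu]_x ((2 * m)%:E * (\1_I1 x)%:E))%E).
{ apply: ge0_le_integral_ae => [x|x|].
  - exact: measure_ge0.
  - by rewrite mule_ge0 ?lee_fin // mulr_ge0.
  - apply: aeW => x; rewrite indicE; have [xI|xI] := boolP (x \in I1).
      rewrite mule1; apply: (@le_trans _ _ (mu `[z0.2 - b * (x - z0.1) / c - m, z0.2 - b * (x - z0.1) / c + m]%classic)).
        apply: le_outer_measure => y /xsectionP /sub[_].
        by rewrite /= in_itv /= ler_distl.
      rewrite muI; last by rewrite lerD2l (le_trans _ m0) // oppr_le0.
      by rewrite lee_fin; lra.
    rewrite mule0 (_ : (mu \o xsection E) x = mu (xsection E x)) // (_ : xsection E x = set0) ?measure0 //.
    apply/seteqP; split=> // y /xsectionP /sub[+ _].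
    by move=> h; case/negP: xI; rewrite inE /I1 /= in_itv /= -ler_distl. }
rewrite ge0_integralZl //; [|by apply/measurable_EFinP; apply: measurable_indic; exact: measurable_itv
  |by rewrite lee_fin mulr_ge0].
rewrite integral_indic //; last exact: measurable_itv.
rewrite setIT [X in (_ * X)%E](_ : _ = mu I1) // muI; last by rewrite lerD2l (le_trans _ l0) // oppr_le0.
rewrite -EFinM lee_fin.
have lm : l * m = s / Num.sqrt D.
  apply: (@pexpIrn _ 2) => //; rewrite ?nnegrE ?mulr_ge0 ?invr_ge0 ?sqrtr_ge0 // 1?ltW //.
  rewrite exprMn l2 m2 exprMn exprVn sqr_sqrtr; last exact: ltW.
  by field; rewrite !gt_eqF.
rewrite (_ : 2 * m * _ = 4 * (l * m)); last by ring.
by rewrite lm mulrA.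
Qed.

End Quadrants.


(** * Charts and the Riemannian measure *)

Section PlaneCoordinates.
Context {R : realType}.

Definition coord2 (v : 'rV[R]_2) : R * R := (v 0 ord0, v 0 (lift ord0 ord0)).

Lemma ord2P (i : 'I_2) : i = ord0 \/ i = lift ord0 ord0.
Proof. by case: i => -[|[|//]] p; [left|right]; apply: val_inj. Qed.

Lemma big_ord2 (V : nmodType) (F : 'I_2 -> V) : \sum_i F i = F ord0 + F (lift ord0 ord0).
Proof. by rewrite big_ord_recl big_ord1. Qed.

Lemma row2K : cancel (@row2 R) coord2.
Proof. by move=> [a b]; rewrite /coord2 !mxE. Qed.

Lemma coord2K : cancel coord2 (@row2 R).
Proof. by move=> v; apply/rowP => i; rewrite mxE; case: (ord2P i) => ->. Qed.

Lemma row2_continuous : continuous (@row2 R).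
Proof.
move=> z; have -> : @row2 R = fun z : R * R => z.1 *: basis_vec ord0 + z.2 *: basis_vec (lift ord0 ord0).
  by apply/funext => y; apply/rowP => i; rewrite !mxE; case: (ord2P i) => ->; rewrite /= ?(eqxx, mulr0, mulr1, addr0, add0r).
by apply: cvgD; apply: cvgZl; [exact: cvg_fst|exact: cvg_snd].
Qed.

Lemma det2E (M : 'M[R]_2) : \det M = M ord0 ord0 * M (lift ord0 ord0) (lift ord0 ord0)
  - M ord0 (lift ord0 ord0) * M (lift ord0 ord0) ord0.
Proof.
rewrite (expand_det_row _ ord0) big_ord2 /cofactor !det_mx11 !mxE /= expr0 expr1 mul1r mulN1r mulrN.
congr (_ * M _ _ - _ * M _ _); by apply: val_inj.
Qed.

End PlaneCoordinates.

Section Borel.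
Context {R : realType} {n : nat} (M : riemannian_manifold R n).

Lemma open_borel (A : set (borel M)) : @open M A -> measurable A.
Proof. by move=> oA; exact: sub_sigma_algebra. Qed.

Lemma ichart_dom (x : M) z : img x z -> dom x (ichart x z).
Proof. by move=> [y xy <-]; rewrite chartK. Qed.

Lemma ichartK (x : M) z : img x z -> chart x (ichart x z) = z.
Proof. by move=> [y xy <-]; rewrite chartK. Qed.

Lemma chart_img (x : M) y : dom x y -> img x (chart x y).
Proof. by exists y. Qed.

Lemma metric_continuous (x : M) z i j : img x z -> {for z, continuous (fun z => metric x z i j)}.
Proof. by move=> xz; exact: (smooth_on_continuous (@metric_smooth _ _ _ x i j) xz). Qed.

Lemma continuous_borel (D : set M) (f : M -> R) : open D ->
  (forall y, D y -> {for y, continuous f}) -> measurable_fun (D : set (borel M)) (f : borel M -> R).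
Proof.
move=> oD cf; apply: (measurability _ (RGenOpens.measurableE R)).
move=> _ [_ [a [b ->] <-]]; apply: open_borel.
rewrite openE => z [Dz /= fz]; apply: filterI; first exact: open_nbhs_nbhs.
by apply: cf => //; apply: open_nbhs_nbhs; split => //; exact: interval_open.
Qed.

End Borel.

Section ChartIntegral.
Context {R : realType} (S : riemannian_manifold R 2).
Variable vol : {measure set (borel S) -> \bar R}.
Hypothesis volS : is_volume vol.
Variable x : S.
Local Notation mu2 := (leb2 : {measure set (g_sigma_algebraType (R.-ocitv.-measurable) * g_sigma_algebraType (R.-ocitv.-measurable)) -> \bar R}).

Definition img2 : set (R * R) := [set z | img x (row2 z)].

Lemma img2_open : open img2.
Proof. by have /continuousP := @row2_continuous R; apply; exact: img_open. Qed.

Lemma img2_measurable : measurable (img2 : set (g_sigma_algebraType (R.-ocitv.-measurable) * g_sigma_algebraType (R.-ocitv.-measurable))).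
Proof. exact: open2_measurable img2_open. Qed.

Lemma det_metric_gt0 z : img x z -> 0 < \det (metric x z).
Proof.
move=> xz; have h := metric_pos xz.
have sy : metric x z ord0 (lift ord0 ord0) = metric x z (lift ord0 ord0) ord0.
  by rewrite -[in LHS](Defs.metric_sym xz) mxE.
set g := metric x z in h sy *; rewrite det2E sy.
set a := g ord0 ord0; set b := g (lift ord0 ord0) ord0; set c := g _ _.
have q (u v : R) : (u != 0) || (v != 0) -> 0 < a * u ^+ 2 + 2 * b * u * v + c * v ^+ 2.
  move=> uv; have := h (row2 (u, v)); rewrite mxE big_ord2 !mxE !big_ord2 !mxE /= -/b -/c -/a sy -/b.
  rewrite (_ : (u * a + v * b) * u + (u * b + v * c) * v = a * u ^+ 2 + 2 * b * u * v + c * v ^+ 2); last by ring.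
  apply; apply: contraTneq uv => /rowP e; have := e ord0; have := e (lift ord0 ord0).
  by rewrite !mxE /= => -> ->; rewrite eqxx.
have a0 : 0 < a by have := q 1 0; rewrite oner_eq0 => /(_ isT); rewrite !(expr1n, mulr0, expr0n, mulr1, addr0).
have := q (- b) a; rewrite (gt_eqF a0) orbT => /(_ isT).
rewrite (_ : _ + _ + _ = a * (a * c - b * b)); last by ring.
by rewrite pmulr_rgt0.
Qed.

Definition area_density (z : R * R) : R :=
  if `[< img2 z >] then Num.sqrt (\det (metric x (row2 z))) else 0.

Lemma area_density_ge0 z : 0 <= area_density z.
Proof. by rewrite /area_density; case: ifP. Qed.

Lemma area_densityE z : img2 z -> area_density z = Num.sqrt (\det (metric x (row2 z))).
Proof. by move=> h; rewrite /area_density; case: asboolP. Qed.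

Lemma area_density0 z : ~ img2 z -> area_density z = 0.
Proof. by move=> h; rewrite /area_density; case: asboolP. Qed.

Lemma area_density_measurable : measurable_fun setT area_density.
Proof.
have -> : area_density = (fun z => Num.sqrt (\det (metric x (row2 z)))) \_ img2.
  apply/funext => z; rewrite patchE /area_density; case: asboolP => h.
    by rewrite mem_set.
  by rewrite memNset.
apply/(measurable_restrictT _ img2_measurable).
apply: open_continuous2_measurable; first exact: img2_open.
move=> z xz; apply: continuous_comp; last exact: sqrt_continuous.
rewrite (_ : (fun z => _) = (fun M : 'M[R]_2 => M ord0 ord0 * M (lift ord0 ord0) (lift ord0 ord0)
  - M ord0 (lift ord0 ord0) * M (lift ord0 ord0) ord0) \o (fun z => metric x (row2 z))); last first.
  by apply/funext => y; rewrite /= det2E.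
have c i j : {for z, continuous (fun z => metric x (row2 z) i j)}.
  apply: (@continuous_comp _ _ _ (@row2 R) (fun z => metric x z i j)); first exact: row2_continuous.
  exact: metric_continuous.
by apply: cvgB; apply: cvgM; exact: c.
Qed.

Definition area_measure : {measure set _ -> \bar R} :=
  density (mu2) area_density_ge0 area_density_measurable.

Definition param (z : R * R) : borel S := if `[< img2 z >] then ichart x (row2 z) else point.

Lemma paramE z : img2 z -> param z = ichart x (row2 z).
Proof. by move=> h; rewrite /param; case: asboolP. Qed.

Lemma param_measurable : measurable_fun setT param.
Proof.
apply: (@measurability _ _ _ _ setT param (@open S)) => //.
move=> _ [A oA <-]; rewrite setTI.
have -> : param @^-1` A = (img2 `&` [set z | A (ichart x (row2 z))]) `|` (if `[< A point >] then ~` img2 else set0).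
  apply/seteqP; split=> z /=; rewrite /param; case: asboolP => h; [by left|by move=> Ap; right; case: asboolP
    |by case=> [[]//|]; case: asboolP|by case=> [[]//|]; case: asboolP].
apply: measurableU; last first.
  by case: asboolP => _ //; apply: measurableC; exact: img2_measurable.
apply: open2_measurable; rewrite openE => z [xz Az]; apply: filterI.
  by apply: open_nbhs_nbhs; split => //; exact: img2_open.
have c : {for z, continuous (fun z => ichart x (row2 z))}.
  apply: (@continuous_comp _ _ _ (@row2 R) (ichart x)); first exact: row2_continuous.
  exact: ichart_continuous.
by apply: c; apply: open_nbhs_nbhs.
Qed.

Lemma dom_measurable : measurable (dom x : set (borel S)).
Proof. by apply: open_borel; exact: dom_open. Qed.

Lemma vol_param (A : set (borel S)) : measurable A -> A `<=` dom x ->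
  vol A = area_measure (param @^-1` A).
Proof.
move=> mA Ax; rewrite (volS mA Ax) /area_measure /density /= /density_fun.
rewrite [LHS](@integral_mkcond _ _ _ mu2) [RHS]integral_mkcond; apply: eq_integral => z _.
rewrite !patchE; case: ifPn => [/set_mem [h1 h2]|].
  by rewrite mem_set ?area_densityE //= paramE.
rewrite notin_setE /= => h; case: ifPn => // /set_mem /=.
by rewrite /param /area_density; case: asboolP => // h1 h2; case: h.
Qed.

Lemma integral_chart (G : S -> R) : (forall y, 0 <= G y) ->
  measurable_fun setT (G : borel S -> R) ->
  (\int[vol]_(y in dom x) (G y)%:E = \int[leb2]_(z in img2) (G (ichart x (row2 z)) * area_density z)%:E)%E.
Proof.
move=> G0 mG.
have mGE : measurable_fun setT (fun y : borel S => (G y)%:E) by apply/measurable_EFinP.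
have -> : (\int[vol]_(y in dom x) (G y)%:E = \int[pushforward area_measure param]_(y in dom x) (G y)%:E)%E.
  by apply: eq_measure_integral; [exact: param_measurable|move=> mp A mA Ax; rewrite vol_param].
rewrite ge0_integral_pushforward; [|exact: param_measurable|exact: dom_measurable|exact: measurable_funS mGE|by move=> y _; rewrite lee_fin].
have mD : measurable (param @^-1` dom x).
  by rewrite -[_ @^-1` _]setTI; apply: param_measurable => //; exact: dom_measurable.
rewrite integral_mkcond integral_density.
- rewrite [RHS]integral_mkcond; apply: eq_integral => z _; rewrite !patchE.
  case: (pselect (img2 z)) => xz.
    by rewrite mem_set /= ?paramE //; [rewrite mem_set //|exact: ichart_dom].
  by rewrite area_density0 // mule0 memNset.
- apply/(measurable_restrictT _ mD); apply: measurable_funS (measurableT_comp mGE param_measurable) => //.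
- by move=> z; rewrite patchE; case: ifP => //; rewrite lee_fin.
Qed.

Lemma chart_measurable : measurable_fun (dom x : set (borel S)) (coord2 \o chart x : borel S -> R * R).
Proof.
apply/(measurable_restrictT _ dom_measurable).
have mc i : measurable_fun setT ((fun y : borel S => chart x y 0 i) \_ (dom x : set (borel S))).
  apply/(measurable_restrictT _ dom_measurable); apply: continuous_borel; first exact: dom_open.
  move=> y xy; apply: (@continuous_comp _ _ _ (chart x) (fun v : 'rV[R]_2 => v 0 i)).
    exact: chart_continuous.
  exact: coord_continuous.
rewrite (_ : _ \_ _ = fun y => (((fun y : borel S => chart x y 0 ord0) \_ (dom x : set (borel S))) y,
  ((fun y : borel S => chart x y 0 (lift ord0 ord0)) \_ (dom x : set (borel S))) y)).
  exact: measurable_fun_pair.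
by apply/funext => y; rewrite !patchE; case: ifP.
Qed.

Lemma ae_chart (P : S -> Prop) :
  {ae mu2, forall z, img2 z -> P (ichart x (row2 z))} ->
  {ae vol, forall y, dom x y -> P y}.
Proof.
move=> [N [mN N0 sN]].
pose A : set (borel S) := dom x `&` (coord2 \o chart x) @^-1` N.
have mA : measurable A by apply: chart_measurable => //; exact: dom_measurable.
exists A; split => //.
  rewrite vol_param //; last by move=> y [].
  rewrite /area_measure /density /= /density_fun.
  apply/eqP; rewrite eq_le; apply/andP; split; last by apply: integral_ge0 => z _; rewrite lee_fin area_density_ge0.
  have mp : measurable (param @^-1` A).
    by rewrite -[_ @^-1` _]setTI; exact: param_measurable.
  rewrite -[leRHS](@integral0 _ _ _ mu2 setT) integral_mkcond.
  apply: (@ge0_le_integral_ae _ _ _ mu2) => [z|z|]; rewrite ?patchE //.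
    by case: ifP => // _; rewrite lee_fin area_density_ge0.
  exists N; split => // z /= h; apply: contrapT => Nz; apply: h; rewrite patchE.
  case: ifPn => // /set_mem /=; have [xz|xz] := pselect (img2 z); last by rewrite area_density0.
  by rewrite /A /= paramE // => -[_ /=]; rewrite ichartK // row2K => /Nz.
move=> y /= h; have xy : dom x y by apply: contrapT => nxy; apply: h.
split => //; apply: sN => /= h'; apply: h => _; have := h' _; rewrite /img2 /= coord2K chartK //; apply.
exact: chart_img.
Qed.

End ChartIntegral.

Section C1.
Context {R : realType} {V : normedModType R}.
Implicit Types (A K : set V) (f g : V -> R^o).

Definition C1_at f z := differentiable f z /\ forall v, {for z, continuous ('D_v f)}.

Lemma C1_near f g z : (\near z, f z = g z) -> C1_at f z -> C1_at g z.
Proof.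
move=> fg [df cf]; split; first exact: near_eq_differentiable df.
have dfg v : \near z, 'D_v f z = 'D_v g z.
  have := nbhs_interior fg; apply: filterS => y /=.
  by rewrite /interior => h; apply: near_eq_derive.
move=> v; have e := nbhs_singleton (dfg v).
by rewrite /prop_for /continuous_at -e; apply: cvg_trans (cf v); exact: near_eq_cvg (dfg v).
Qed.

Lemma C1_smooth A f z : smooth_on A f -> A z -> C1_at f z.
Proof.
move=> sf Az; split; first exact: smooth_on_diff Az.
by move=> v; exact: smooth_on_continuous (smooth_on_derive v sf) Az.
Qed.

Lemma C1_cst (c : R^o) z : C1_at (cst c) z.
Proof. by apply: (@C1_smooth setT) => //; exact: smooth_on_cst. Qed.

Lemma C1_continuous f z : C1_at f z -> {for z, continuous f}.
Proof. by move=> [df _]; exact: differentiable_continuous. Qed.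

Lemma C1D f g z : (\forall z \near z, C1_at f z) -> (\forall z \near z, C1_at g z) ->
  C1_at (f + g) z.
Proof.
move=> nf ng; have [df cf] := nbhs_singleton nf; have [dg cg] := nbhs_singleton ng.
split; first exact: differentiableD.
move=> v; rewrite /prop_for /continuous_at deriveD; [|exact: diff_derivable|exact: diff_derivable].
apply: cvg_trans (cvgD (cf v) (cg v)); apply: near_eq_cvg.
apply: filterS2 nf ng => y [dfy _] [dgy _].
by rewrite [RHS]deriveD //; exact: diff_derivable.
Qed.

Lemma C1M f g z : (\forall z \near z, C1_at f z) -> (\forall z \near z, C1_at g z) ->
  C1_at (f * g : V -> R^o) z.
Proof.
move=> nf ng; have [df cf] := nbhs_singleton nf; have [dg cg] := nbhs_singleton ng.
split; first exact: differentiableM.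
have c0 := differentiable_continuous df; have c1 := differentiable_continuous dg.
move=> v; rewrite /prop_for /continuous_at deriveM; [|exact: diff_derivable|exact: diff_derivable].
apply: cvg_trans (cvgD (cvgM c0 (cg v)) (cvgM c1 (cf v))); apply: near_eq_cvg.
apply: filterS2 nf ng => y [dfy _] [dgy _].
by rewrite [RHS]deriveM //; exact: diff_derivable.
Qed.

End C1.

Section C1Open.
Context {R : realType} {V : normedModType R}.
Variable A : set V.
Hypothesis oA : open A.
Implicit Types (f g : V -> R^o).

Definition C1_on f := forall z, A z -> C1_at f z.

Lemma C1_on_near f z : C1_on f -> A z -> \forall z \near z, C1_at f z.
Proof. by move=> hf Az; apply: filterS (open_nbhs_nbhs (conj oA Az)) => y; exact: hf. Qed.

Lemma C1_onD f g : C1_on f -> C1_on g -> C1_on (f + g).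
Proof. by move=> hf hg z Az; apply: C1D; exact: C1_on_near. Qed.

Lemma C1_onM f g : C1_on f -> C1_on g -> C1_on (f * g : V -> R^o).
Proof. by move=> hf hg z Az; apply: C1M; exact: C1_on_near. Qed.

Lemma C1_on_cst c : C1_on (cst c).
Proof. by move=> z _; exact: C1_cst. Qed.

Lemma C1_onZ c f : C1_on f -> C1_on (fun z => c * f z).
Proof. by move=> hf; apply: C1_onM => //; exact: C1_on_cst. Qed.

Lemma C1_onB f g : C1_on f -> C1_on g -> C1_on (f - g).
Proof.
move=> hf hg; apply: (C1_onD hf); rewrite (_ : - g = fun z => -1 * g z); first exact: (C1_onZ (-1) hg).
by apply/funext => z; rewrite mulN1r.
Qed.

Lemma C1_on_sum m (F : 'I_m -> V -> R^o) : (forall i, C1_on (F i)) -> C1_on (fun z => \sum_i F i z).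
Proof.
move=> h; rewrite (_ : (fun z => _) = \sum_i F i); last by apply/funext => z; rewrite fct_sumE.
by elim/big_ind : _ => [|x y|i _]; [exact: C1_on_cst|exact: C1_onD|exact: h].
Qed.

Lemma C1_on_eq f g : (forall z, A z -> f z = g z) -> C1_on f -> C1_on g.
Proof.
move=> fg hf z Az; apply: C1_near (hf z Az).
by apply: filterS (open_nbhs_nbhs (conj oA Az)) => y /fg.
Qed.

Lemma C1_on_smooth f : smooth_on A f -> C1_on f.
Proof. by move=> sf z Az; exact: C1_smooth sf Az. Qed.

Lemma C1_onV f : (forall z, A z -> f z != 0) -> C1_on f -> C1_on (fun z => (f z)^-1).
Proof.
move=> f0 hf z Az; have [df cf] := hf z Az.
have dfy y : A y -> differentiable f y by move=> Ay; have [] := hf y Ay.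
split; first by apply: differentiableV => //; exact: f0.
move=> v; have c0 : {for z, continuous f} := differentiable_continuous df.
have c1 : (fun y => (f y)^-1) @ z --> (f z)^-1 by apply: cvgV => //; exact: f0.
rewrite /prop_for /continuous_at deriveV; [|exact: f0|exact: diff_derivable].
have -> : - f z ^- 2 *: 'D_v f z = - ((f z)^-1 * (f z)^-1) * 'D_v f z by rewrite -invfM expr2.
apply: cvg_trans (cvgM (cvgN (cvgM c1 c1)) (cf v)).
apply: near_eq_cvg; apply: filterS (open_nbhs_nbhs (conj oA Az)) => y Ay.
rewrite [RHS]deriveV; [|exact: f0|by apply: diff_derivable; exact: dfy].
by rewrite !fctE /GRing.scale /= expr2 invfM.
Qed.

(** Outside A the function vanishes in a neighbourhood, since a compact set is closed. *)
Lemma C1_cutoff (K : set V) f : hausdorff_space V -> compact K -> K `<=` A -> (forall z, ~ K z -> f z = 0) ->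
  C1_on f -> forall z, C1_at f z.
Proof.
move=> hV cK KA f0 hf z; have [/hf//|nAz] := pselect (A z).
have nK : ~ K z by move=> /KA.
apply: C1_near (C1_cst (0 : R^o) z).
have oK : open (~` K) by apply: closed_openC; exact: compact_closed.
by apply: filterS (open_nbhs_nbhs (conj oK nK : open_nbhs z (~` K))) => y /= /f0 ->.
Qed.

End C1Open.

Lemma cvg_bigsum (R : realType) (V : topologicalType) (z : V) m (F : 'I_m -> V -> R) (l : 'I_m -> R) :
  (forall i, F i @ z --> l i) -> (fun y => \sum_i F i y) @ z --> \sum_i l i.
Proof.
elim: m F l => [|m IH] F l h.
  by rewrite big_ord0 (_ : (fun y => _) = cst 0); [exact: cvg_cst|apply/funext => y; rewrite big_ord0].
rewrite big_ord_recl (_ : (fun y => _) = fun y => F ord0 y + \sum_i F (lift ord0 i) y).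
  by apply: cvgD; [exact: h|apply: IH => i; exact: h].
by apply/funext => y; rewrite big_ord_recl.
Qed.

Section C1Comp.
Context {R : realType} {V : normedModType R} {m : nat}.

Lemma C1_comp (A : set V) (B : set 'rV[R]_m) (G : V -> 'rV[R]_m) (f : 'rV[R]_m -> R^o) :
  open A -> (forall z, A z -> B (G z)) -> (forall z, A z -> differentiable G z) ->
  (forall a, C1_on A (fun z => G z 0 a : R^o)) -> C1_on B f -> C1_on A (f \o G : V -> R^o).
Proof.
move=> oA AB dG cG cf z Az; have [df cdf] := cf _ (AB z Az).
split; first by apply: differentiable_comp => //; exact: dG.
have cGz : {for z, continuous G} by apply: differentiable_continuous; exact: dG.
have E v y : A y -> 'D_v (f \o G) y = \sum_a 'D_(basis_vec a) f (G y) * 'D_v (fun y => G y 0 a : R^o) y.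
  move=> Ay; apply: derive_rV_comp; first exact: dG.
  by have [] := cf _ (AB y Ay).
move=> v; rewrite /prop_for /continuous_at E //.
have : (fun y => \sum_a 'D_(basis_vec a) f (G y) * 'D_v (fun y => G y 0 a : R^o) y) @ z -->
    \sum_a 'D_(basis_vec a) f (G z) * 'D_v (fun y => G y 0 a : R^o) z.
  apply: cvg_bigsum => a; apply: cvgM; last by have [_] := cG a z Az; exact.
  by apply: (@continuous_comp _ _ _ G ('D_(basis_vec a) f)) => //; exact: cdf.
apply: cvg_trans; apply: near_eq_cvg.
by apply: filterS (open_nbhs_nbhs (conj oA Az)) => y Ay; rewrite E.
Qed.

End C1Comp.

Section PlaneDivergence.
Context {R : realType}.

Definition cube {n} (c : 'rV[R]_n) (r : R) : set 'rV[R]_n := [set z | forall i, `|z 0 i - c 0 i| <= r].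

Lemma cube_compact {n} (c : 'rV[R]_n) r : compact (cube c r).
Proof.
have -> : cube c r = [set v : 'rV[R]_n | forall i, `[c 0 i - r, c 0 i + r]%classic (v 0 i)].
  by apply/seteqP; split=> v h i; have := h i; rewrite /= in_itv /= ler_distl.
by apply: (@rV_compact R n (fun i => `[c 0 i - r, c 0 i + r]%classic)) => i; exact: segment_compact.
Qed.

Lemma compact_square (K : set 'rV[R]_2) : compact K -> exists M, forall z, K (row2 z) -> square M z.
Proof.
move=> cK.
have [M1 M10 h1] := continuous_compact_bounded cK (fun v _ => @coord_continuous _ _ _ 0 ord0 v).
have [M2 M20 h2] := continuous_compact_bounded cK (fun v _ => @coord_continuous _ _ _ 0 (lift ord0 ord0) v).
exists (M1 + M2) => z Kz; apply/squareP; have := h1 _ Kz; have := h2 _ Kz; rewrite !mxE /= => a b.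
by split; [rewrite (le_trans b) // lerDl ltW|rewrite (le_trans a) // lerDr ltW].
Qed.

Lemma integrable_compact_rV (f : 'rV[R]_2 -> R) K : compact K -> continuous f ->
  (forall z, ~ K z -> f z = 0) -> leb2.-integrable setT (fun z => (f (row2 z))%:E).
Proof.
move=> cK cf f0; have [M hM] := compact_square cK.
apply: (@integrable_compact_support _ (f \o row2) M).
  by move=> z; apply: continuous_comp; [exact: row2_continuous|exact: cf].
by move=> z nz; apply: f0 => /hM.
Qed.

Lemma derive_notin (K : set 'rV[R]_2) (F : 'rV[R]_2 -> R^o) v z : compact K -> (forall z, ~ K z -> F z = 0) ->
  ~ K z -> 'D_v F z = 0.
Proof.
move=> cK F0 nK; rewrite -(derive_cst (0 : R^o) z v); apply: near_eq_derive.
have oK : open (~` K) by apply: closed_openC; apply: compact_closed => //; exact: norm_hausdorff.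
by apply: filterS (open_nbhs_nbhs (conj oK nK : open_nbhs z (~` K))) => y /= /F0 ->.
Qed.

(** Fubini's theorem reduces this to the fundamental theorem of calculus on lines. *)
Lemma integral_derive_plane (F : 'rV[R]_2 -> R^o) K (j : 'I_2) : compact K ->
  (forall z, C1_at F z) -> (forall z, ~ K z -> F z = 0) ->
  \int[leb2]_z ('D_(basis_vec j) F (row2 z)) = 0.
Proof.
move=> cK cF F0; have [M hM] := compact_square cK.
have c : continuous (fun z => 'D_(basis_vec j) F (row2 z)).
  move=> z; apply: (@continuous_comp _ _ _ (@row2 R) ('D_(basis_vec j) F)); first exact: row2_continuous.
  by have [_] := cF (row2 z); exact.
have z0 z : ~ square M z -> F (row2 z) = 0 /\ 'D_(basis_vec j) F (row2 z) = 0.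
  move=> nz; have nK : ~ K (row2 z) by move=> /hM.
  by rewrite F0 // (derive_notin _ cK F0).
have e0 (x y : R) : row2 (x, y) = x *: basis_vec ord0 + row2 (0, y).
  by apply/rowP => i; rewrite !mxE; case: (ord2P i) => ->; rewrite /= ?(mulr1, mulr0, addr0, add0r).
have e1 (x y : R) : row2 (x, y) = y *: basis_vec (lift ord0 ord0) + row2 (x, 0).
  by apply/rowP => i; rewrite !mxE; case: (ord2P i) => ->; rewrite /= ?(mulr1, mulr0, addr0, add0r).
case: (ord2P j) => jE; rewrite jE in c z0 *.
  apply: (@integral_derive_fst _ (F \o row2) _ M) => // x y /=.
  rewrite (_ : (fun x => _) = (fun x : R => F (x *: basis_vec ord0 + row2 (0, y)))); last by apply/funext => t; rewrite e0.
  by rewrite e0; apply: is_derive_line; apply: diff_derivable; have [] := cF (x *: basis_vec ord0 + row2 (0, y)).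
apply: (@integral_derive_snd _ (F \o row2) _ M) => // x y /=.
rewrite (_ : (fun y => _) = (fun y : R => F (y *: basis_vec (lift ord0 ord0) + row2 (x, 0)))); last by apply/funext => t; rewrite e1.
by rewrite e1; apply: is_derive_line; apply: diff_derivable; have [] := cF (y *: basis_vec (lift ord0 ord0) + row2 (x, 0)).
Qed.

End PlaneDivergence.

Section Jacobian.
Context {R : realType}.

Lemma jacobian_comp l m n (f : 'rV[R]_l -> 'rV[R]_m) (g : 'rV[R]_m -> 'rV[R]_n) z :
  differentiable f z -> differentiable g (f z) ->
  jacobian (g \o f) z = jacobian f z *m jacobian g (f z).
Proof.
move=> df dg; have dgf : differentiable (g \o f) z by exact: differentiable_comp.
apply/row_matrixP => i; rewrite !rowE mulmxA.
rewrite -(deriveEjacobian _ dgf) -(deriveEjacobian _ df) -(deriveEjacobian _ dg).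
by rewrite (deriveE _ dgf) (diff_comp df dg) (deriveE _ df) (deriveE _ dg).
Qed.

Lemma jacobian_id n z : jacobian (id : 'rV[R]_n -> 'rV[R]_n) z = 1%:M.
Proof.
have d : differentiable (id : 'rV[R]_n -> 'rV[R]_n) z by [].
by apply/row_matrixP => i; rewrite !rowE mulmx1 -(deriveEjacobian _ d) derive_id.
Qed.

Lemma near_eq_jacobian m n (f g : 'rV[R]_m -> 'rV[R]_n) z : differentiable f z ->
  (\near z, f z = g z) -> jacobian f z = jacobian g z.
Proof.
move=> df fg; have dg := near_eq_differentiable fg df.
apply/row_matrixP => i; rewrite [LHS]rowE [RHS]rowE.
apply: (etrans (esym (deriveEjacobian (delta_mx 0 i) df))).
by apply: (etrans _ (deriveEjacobian (delta_mx 0 i) dg)); exact: near_eq_derive.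
Qed.

Definition grad {n} (f : 'rV[R]_n -> R^o) z : 'cV[R]_n := \col_a 'D_(basis_vec a) f z.

Lemma grad_comp m n (G : 'rV[R]_m -> 'rV[R]_n) (f : 'rV[R]_n -> R^o) z :
  differentiable G z -> differentiable f (G z) -> grad (f \o G) z = jacobian G z *m grad f (G z).
Proof.
move=> dG df; apply/colP => i; rewrite !mxE (derive_rV_comp _ dG df); apply: eq_bigr => a _.
rewrite !mxE mulrC; congr (_ * _).
rewrite derive_coord; last exact: diff_derivable.
by rewrite deriveE.
Qed.

Lemma near_eq_grad n (f g : 'rV[R]_n -> R^o) z : (\near z, f z = g z) -> grad f z = grad g z.
Proof. by move=> fg; apply/colP => a; rewrite !mxE; exact: near_eq_derive. Qed.

End Jacobian.

Section Transition.
Context {R : realType} {n : nat} (M : riemannian_manifold R n).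
Implicit Types x y w : M.

Definition overlap x y : set 'rV[R]_n := [set z | img x z /\ dom y (ichart x z)].

Lemma overlapE x y : overlap x y = chart x @` (dom x `&` dom y).
Proof.
apply/seteqP; split=> z.
  by move=> [xz yz]; exists (ichart x z); [split => //; exact: ichart_dom|rewrite ichartK].
by move=> [w [xw yw] <-]; split; [exists w|rewrite chartK].
Qed.

Lemma near_ichart_open x z (A : set M) : open A -> img x z -> A (ichart x z) ->
  \forall z \near z, A (ichart x z).
Proof. by move=> oA xz Az; apply: (ichart_continuous xz); exact: open_nbhs_nbhs. Qed.

Lemma overlap_open x y : open (overlap x y).
Proof.
rewrite openE => z [xz yz]; apply: filterI.
  by apply: open_nbhs_nbhs; split => //; exact: img_open.
by apply: near_ichart_open => //; exact: dom_open.
Qed.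

Lemma transition_diff x y z : overlap x y z -> differentiable (chart y \o ichart x) z.
Proof. by rewrite overlapE; exact: smooth_on_diff (@transition_smooth _ _ M x y). Qed.

Lemma overlap_transition x y w z : overlap x y z -> dom w (ichart x z) ->
  overlap y w (chart y (ichart x z)).
Proof.
by move=> [xz yz] wz; split; rewrite ?chartK //; exact: chart_img.
Qed.

Definition tmx x y z : 'M[R]_n := jacobian (chart y \o ichart x) z.

Lemma tmx_cocycle x y w z : overlap x y z -> dom w (ichart x z) ->
  tmx x w z = tmx x y z *m tmx y w (chart y (ichart x z)).
Proof.
move=> oxy dw; have oyw := overlap_transition oxy dw.
rewrite /tmx -[chart y (ichart x z)]/((chart y \o ichart x) z) -(jacobian_comp (transition_diff oxy) (transition_diff oyw)).
apply: near_eq_jacobian; first by apply: transition_diff; split => //; case: oxy.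
have := open_nbhs_nbhs (conj (@overlap_open x y) oxy : open_nbhs z (overlap x y)).
by apply: filterS => v [xv yv] /=; rewrite chartK.
Qed.

Lemma tmx_self x z : img x z -> tmx x x z = 1%:M.
Proof.
move=> xz; rewrite -(jacobian_id z); apply: near_eq_jacobian.
  by apply: transition_diff; split => //; exact: ichart_dom.
have := open_nbhs_nbhs (conj (@img_open _ _ M x) xz : open_nbhs z (img x)).
by apply: filterS => v xv /=; rewrite ichartK.
Qed.

Lemma tmx_inv x y z : overlap x y z -> tmx x y z *m tmx y x (chart y (ichart x z)) = 1%:M.
Proof.
move=> oxy; rewrite -tmx_cocycle // ?tmx_self //; first by case: oxy.
by apply: ichart_dom; case: oxy.
Qed.

Lemma tmx_unit x y z : overlap x y z -> tmx x y z \in unitmx.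
Proof. move=> oxy; have [h _] := @mulmx1_unit _ _ (tmx x y z) (tmx y x (chart y (ichart x z))) (tmx_inv oxy).
exact: h. Qed.

Lemma transition_jacE x y : transition_jac x y = tmx x y (chart x y).
Proof. by []. Qed.

Lemma metric_tmx x y z : overlap x y z ->
  metric x z = tmx x y z *m metric y (chart y (ichart x z)) *m (tmx x y z)^T.
Proof. by move=> oxy; apply: metric_transition; rewrite -overlapE. Qed.

Lemma metric_at_tmx x y : dom x y ->
  metric x (chart x y) = transition_jac x y *m metric_at y *m (transition_jac x y)^T.
Proof.
move=> xy; have := @metric_tmx x y (chart x y); rewrite chartK //; apply.
by split; [exact: chart_img|rewrite chartK //; exact: dom_self].
Qed.

Lemma transition_jac_unit x y : dom x y -> transition_jac x y \in unitmx.
Proof.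
move=> xy; apply: tmx_unit; split; [exact: chart_img|rewrite chartK //; exact: dom_self].
Qed.

Lemma grad_tmx (f : M -> R) x y z : overlap x y z -> smooth_fun f ->
  grad (f \o ichart x) z = tmx x y z *m grad (f \o ichart y) (chart y (ichart x z)).
Proof.
move=> oxy sf; have [xz yz] := oxy.
have dg : differentiable (f \o ichart y : 'rV[R]_n -> R^o) (chart y (ichart x z)).
  by apply: smooth_on_diff (sf y) _; exact: chart_img.
rewrite -[chart y (ichart x z)]/((chart y \o ichart x) z) -(grad_comp (transition_diff oxy) dg).
apply: near_eq_grad.
have := open_nbhs_nbhs (conj (@overlap_open x y) oxy : open_nbhs z (overlap x y)).
by apply: filterS => v [xv yv] /=; rewrite chartK.
Qed.

End Transition.

Section Patch.
Context {R : realType} {n : nat} (M : riemannian_manifold R n).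
Implicit Types (x y : M) (c z : 'rV[R]_n) (r : R).

Definition box_bump (c : 'rV[R]_n) (r : R) (z : 'rV[R]_n) : R := \prod_i flat (r ^+ 2 - (z 0 i - c 0 i) ^+ 2).

Lemma box_bump_smooth c r : smooth_on setT (box_bump c r : 'rV[R]_n -> R^o).
Proof.
rewrite /box_bump; have -> : (fun z => \prod_i flat (r ^+ 2 - (z 0 i - c 0 i) ^+ 2)) =
  (fun z => \prod_(i <- enum 'I_n) flat (r ^+ 2 - (z 0 i - c 0 i) ^+ 2)) :> ('rV[R]_n -> R^o).
  by apply/funext => z; rewrite big_enum.
elim: (enum 'I_n) => [|i s IH].
  rewrite (_ : (fun z => _) = cst (1 : R^o)); first exact: smooth_on_cst.
  by apply/funext => z; rewrite big_nil.
rewrite (_ : (fun z => _) = (fun z : 'rV[R]_n => flat (r ^+ 2 - (z 0 i - c 0 i) ^+ 2) : R^o) *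
  (fun z : 'rV[R]_n => \prod_(i <- s) flat (r ^+ 2 - (z 0 i - c 0 i) ^+ 2) : R^o)); last first.
  by apply/funext => z; rewrite big_cons.
have oT : open (setT : set 'rV[R]_n) by exact: openT.
apply: smooth_onM => //.
apply: (@smooth_on_comp1 _ _ setT setT (fun z : 'rV[R]_n => r ^+ 2 - (z 0 i - c 0 i) ^+ 2 : R^o) flat) => //; last exact: flat_smooth.
have s1 : smooth_on (setT : set 'rV[R]_n) ((fun z : 'rV[R]_n => z 0 i : R^o) + cst (- c 0 i : R^o)).
  by apply: smooth_onD => //; [exact: coord_smooth|exact: smooth_on_cst].
rewrite (_ : (fun z => _) = cst (r ^+ 2 : R^o) + cst (-1 : R^o) *
   (((fun z : 'rV[R]_n => z 0 i : R^o) + cst (- c 0 i : R^o)) * ((fun z : 'rV[R]_n => z 0 i : R^o) + cst (- c 0 i : R^o)))).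
  by apply: smooth_onD => //; [exact: smooth_on_cst|apply: smooth_onM => //; [exact: smooth_on_cst|exact: smooth_onM]].
by apply/funext => z; rewrite !fctE expr2 mulN1r.
Qed.

Lemma box_bump_gt0 c r z : 0 < r -> (forall i, `|z 0 i - c 0 i| < r) -> 0 < box_bump c r z.
Proof.
move=> r0 h; apply: prodr_gt0 => i _; apply: flat_gt0; rewrite subr_gt0 -real_normK ?num_real //.
by rewrite ltr_sqr ?nnegrE // ltW.
Qed.

Lemma box_bump_gt0_inv c r z : 0 < r -> box_bump c r z != 0 -> forall i, `|z 0 i - c 0 i| < r.
Proof.
move=> r0 + i; apply: contra_neqT; rewrite -leNgt => h.
rewrite /box_bump (bigD1 i) //= flat_le0 ?mul0r // subr_le0 -[leRHS]real_normK ?num_real //.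
by rewrite ler_sqr ?nnegrE // ltW.
Qed.

Lemma box_bump_cube c r z : 0 < r -> ~ cube c r z -> box_bump c r z = 0.
Proof.
move=> r0 nc; apply/eqP; apply: contra_notT nc => h i.
by apply: ltW; apply: box_bump_gt0_inv h i.
Qed.

Definition patch_fun y (g : 'rV[R]_n -> R) (w : M) : R := if `[< dom y w >] then g (chart y w) else 0.

Lemma patch_funE y g w : dom y w -> patch_fun y g w = g (chart y w).
Proof. by move=> h; rewrite /patch_fun; case: asboolP. Qed.

Lemma patch_fun_smooth y (g : 'rV[R]_n -> R^o) (K : set 'rV[R]_n) : compact K -> K `<=` img y ->
  smooth_on (img y) g -> (forall z, ~ K z -> g z = 0) -> smooth_fun (patch_fun y g).
Proof.
move=> cK Ky sg g0 x.
have oK : open (~` (ichart y @` K)).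
  apply: closed_openC; apply: compact_closed; first exact: manifold_hausdorff.
  apply: continuous_compact => //; apply: continuous_in_subspaceT => z /set_mem Kz.
  by apply: ichart_continuous; exact: Ky.
have s1 : smooth_on (overlap x y) (patch_fun y g \o ichart x : 'rV[R]_n -> R^o).
  apply: (@eq_smooth_on _ _ _ _ (g \o (chart y \o ichart x))); first exact: overlap_open.
    by move=> z [_ yz]; rewrite /= patch_funE.
  apply: (@smooth_on_comp _ _ _ _ (img y)) => //; first exact: overlap_open.
    by move=> z [_ yz]; exact: chart_img.
  by rewrite overlapE; exact: transition_smooth.
pose B := [set z | img x z /\ (~` (ichart y @` K)) (ichart x z)].
have oB : open B.
  rewrite openE => z [xz Kz]; apply: filterI.
    by apply: open_nbhs_nbhs; split => //; exact: img_open.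
  exact: near_ichart_open.
have s2 : smooth_on B (patch_fun y g \o ichart x : 'rV[R]_n -> R^o).
  apply: (@eq_smooth_on _ _ _ _ (cst (0 : R^o))) => //; last exact: smooth_on_cst.
  move=> z [xz Kz]; rewrite /= /patch_fun; case: asboolP => // yz; rewrite g0 // => Kyz.
  by apply: Kz; exists (chart y (ichart x z)) => //; rewrite chartK.
move=> s z xz; have [yz|nyz] := pselect (dom y (ichart x z)); first exact: s1.
by apply: s2; split => // -[v Kv e]; apply: nyz; rewrite -e; apply: ichart_dom; exact: Ky.
Qed.

Lemma cube_radius y : exists2 r, 0 < r & cube (chart y y) r `<=` img y.
Proof.
have h : nbhs (chart y y) (img y).
  by apply: open_nbhs_nbhs; split; [exact: img_open|apply: chart_img; exact: dom_self].
have /nbhs_ballP[e /= e0 he] := h.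
exists (e / 2); first by rewrite divr_gt0.
move=> z cz; apply: he => /=; split=> // i j; rewrite /ball /= ord1 distrC.
by rewrite (le_lt_trans (cz j)) // ltr_pdivrMr // ltr_pMr // ltr1n.
Qed.

End Patch.


(** * Weak differentials *)

Section TestFunctions.
Context {R : realType}.
Local Notation bR := (g_sigma_algebraType (R.-ocitv.-measurable)).
Local Notation mu2 := (leb2 : {measure set (bR * bR) -> \bar R}).

(** The functions flat (k (s - a)) converge to the indicator of the half-line beyond a. *)
Lemma half_lines_approx (A : set R) : half_lines A -> exists psi : nat -> R -> R,
  [/\ forall k, smooth_on setT (psi k : R^o -> R^o), forall k s, 0 <= psi k s <= 1 &
      forall s, psi k s @[k --> \oo] --> (\1_A s : R)].
Proof.
move=> [->|[a ->]].
  exists (fun _ => cst 1); split => [k|k s|s]; first exact: smooth_on_cst.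
    by rewrite /= ler01 lexx.
  by rewrite indicT; exact: cvg_cst.
exists (fun k s => flat (k%:R * (s - a))); split => [k|k s|s].
- have oT : open (setT : set R^o) by exact: openT.
  apply: (@smooth_on_comp1 _ _ setT setT (fun s : R^o => k%:R * (s - a) : R^o) flat) => //; last exact: flat_smooth.
  rewrite (_ : (fun s : R^o => _) = cst (k%:R : R^o) * ((id : R^o -> R^o) + cst (- a : R^o))) //.
  by apply: smooth_onM => //; [exact: smooth_on_cst|apply: smooth_onD => //; [exact: smooth_on_id|exact: smooth_on_cst]].
- by rewrite flat_ge0 flat_le1.
- have := @flat_cvg R (s - a); rewrite subr_gt0 indicE.
  suff -> : ((s \in `]a, +oo[%classic)%:R : R) = if a < s then 1 else 0 by [].
  by case: ifP => h; [rewrite mem_set //= in_itv /= h|rewrite memNset //= in_itv /= h].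
Qed.

Context (S : riemannian_manifold R 2).
Implicit Types x y : S.

Lemma test_fun_bump x (c : 'rV[R]_2) r : 0 < r -> cube c r `<=` img x -> test_fun x (box_bump c r).
Proof.
move=> r0 cx; split; first exact: box_bump_smooth.
exists (cube c r); split => //; first exact: cube_compact.
by move=> z; exact: box_bump_cube.
Qed.

Lemma test_funM x (phi psi : 'rV[R]_2 -> R) : test_fun x phi ->
  smooth_on setT (psi : 'rV[R]_2 -> R^o) -> test_fun x (fun z => phi z * psi z).
Proof.
move=> [sphi [K [cK Kx phi0]]] spsi; split.
  by apply: (@smooth_onM _ _ _ phi psi) => //; exact: openT.
by exists K; split => // z /phi0 ->; rewrite mul0r.
Qed.

(** Test functions may be multiplied by the functions of [half_lines_approx], which turns
    their integrals against h into integrals over quadrants. *)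
Lemma fundamental_lemma x (c : 'rV[R]_2) r (h : R * R -> R) : 0 < r -> cube c r `<=` img x ->
  (forall phi, test_fun x phi -> leb2.-integrable setT (fun z => (h z * phi (row2 z))%:E) /\
    \int[leb2]_z (h z * phi (row2 z)) = 0) ->
  {ae mu2, forall z, (forall i, `|row2 z 0 i - c 0 i| < r) -> h z = 0}.
Proof.
move=> r0 cx H; pose g z := h z * box_bump c r (row2 z).
have tb := test_fun_bump r0 cx.
have [ig _] := H _ tb.
suff : {ae mu2, forall z, g z = 0}.
  apply: ae_imp => z; rewrite /g => /eqP; rewrite mulf_eq0 => /orP[/eqP //|/eqP b0] zc.
  by have := box_bump_gt0 r0 zc; rewrite b0 ltxx.
apply: ae_eq0_quadrants => // _ [A hA [B hB <-]].
have [pA [sA bA cA]] := half_lines_approx hA.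
have [pB [sB bB cB]] := half_lines_approx hB.
have mAB : measurable (A `*` B : set (bR * bR)).
  by apply: measurableX; exact: half_lines_measurable.
have sco (i : 'I_2) (p : R -> R) : smooth_on setT (p : R^o -> R^o) ->
    smooth_on setT (fun z : 'rV[R]_2 => p (z 0 i) : R^o).
  move=> sp; have oT : open (setT : set 'rV[R]_2) by exact: openT.
  apply: (@smooth_on_comp1 _ _ setT setT (fun z : 'rV[R]_2 => z 0 i : R^o) p) => //.
  exact: coord_smooth.
pose F k z := g z * (pA k z.1 * pB k z.2).
have FE k : leb2.-integrable setT (EFin \o F k) /\ \int[leb2]_z F k z = 0.
  have [] := H (fun z => box_bump c r z * (pA k (z 0 ord0) * pB k (z 0 (lift ord0 ord0)))).
    have sp : smooth_on setT ((fun z : 'rV[R]_2 => pA k (z 0 ord0) : R^o) * (fun z : 'rV[R]_2 => pB k (z 0 (lift ord0 ord0)) : R^o)).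
      by apply: smooth_onM; [exact: openT|exact: sco|exact: sco].
    exact: (test_funM tb sp).
  have E : (fun z => h z * (box_bump c r (row2 z) * (pA k (row2 z 0 ord0) * pB k (row2 z 0 (lift ord0 ord0))))) = F k.
    by apply/funext => -[a b]; rewrite /F /g !mxE /= mulrA.
  by rewrite -E.
have mF k : measurable_fun setT (EFin \o F k : bR * bR -> \bar R) by have [i _] := FE k; exact: measurable_int i.
have cF z : (EFin \o F k) z @[k --> \oo] --> ((g z * \1_(A `*` B) z)%:E : \bar R).
  apply: cvg_EFin; first by apply: nearW.
  apply: cvgMr => //; rewrite (_ : \1_(A `*` B) z = \1_A z.1 * \1_B z.2 :> R); last first.
    by rewrite !indicE in_setX; case: (_ \in A); case: (_ \in B); rewrite /= ?(mulr0, mulr1).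
  by apply: cvgM; [exact: cA|exact: cB].
have mg : measurable_fun setT (EFin \o g : bR * bR -> \bar R) by exact: measurable_int ig.
have mgAB : measurable_fun setT ((fun z => (g z * \1_(A `*` B) z)%:E) : bR * bR -> \bar R).
  apply/measurable_EFinP; apply: measurable_funM; first exact/measurable_EFinP.
  exact: measurable_indic.
have bF k z : (`|(EFin \o F k) z| <= `|(EFin \o g) z|)%E.
  rewrite /= lee_fin /F normrM ler_piMr // normrM.
  have /andP[a1 a2] := bA k z.1; have /andP[b1 b2] := bB k z.2.
  by rewrite !ger0_norm // mulr_ile1.
have iag : mu2.-integrable setT (fun z => `|(EFin \o g) z|)%E by exact: integrable_abse.
have ae1 : {ae mu2, forall z, setT z -> (EFin \o F k) z @[k --> \oo] --> ((g z * \1_(A `*` B) z)%:E : \bar R)}.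
  by apply: aeW => z _; exact: cF.
have ae2 : {ae mu2, forall z k, setT z -> (`|(EFin \o F k) z| <= `|(EFin \o g) z|)%E}.
  by apply: aeW => z k _; exact: bF.
have [_ _ lim] := dominated_convergence (mu := mu2) measurableT mF mgAB ae1 iag ae2.
have E0 : (fun k => \int[mu2]_z (EFin \o F k) z)%E = cst 0%E.
  apply/funext => k; have [ik] := FE k; rewrite /Rintegral => e0.
  have fin := integrable_fin_num (mu := mu2) measurableT ik.
  by rewrite -(fineK fin) e0.
rewrite E0 in lim.
have -> : (\int[leb2]_(z in A `*` B) (g z)%:E = \int[mu2]_z (g z * \1_(A `*` B) z)%:E)%E.
  rewrite (@integral_mkcond _ _ _ mu2); apply: eq_integral => z _; rewrite patchE indicE.
  by case: ifP => _; rewrite (mulr1, mulr0).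
by apply: (cvg_unique (@ereal_hausdorff R) lim); exact: cvg_cst.
Qed.

End TestFunctions.

Section WeakDifferential.
Context {R : realType} {n : nat} (S : riemannian_manifold R 2) (N : riemannian_manifold R n).
Local Notation bR := (g_sigma_algebraType (R.-ocitv.-measurable)).
Local Notation mu2 := (leb2 : {measure set (bR * bR) -> \bar R}).
Implicit Types (u w : S -> N) (D : S -> 'M[R]_(2, n)) (x : S).

(** The weak partial derivative of f o u in the direction j of the chart x. *)
Definition pdiff u D (f : N -> R) x j (y : S) : R :=
  (transition_jac x y *m (D y *m dfun f (u y))) j 0.

(** Both partial derivatives have the same integrals against all test functions. *)
Lemma weak_differential_unique u D1 D2 (f : N -> R) x j (c : 'rV[R]_2) r :
  weak_differential u D1 -> weak_differential u D2 -> smooth_fun f ->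
  0 < r -> cube c r `<=` img x ->
  {ae mu2, forall z, (forall i, `|row2 z 0 i - c 0 i| < r) ->
     pdiff u D1 f x j (ichart x (row2 z)) = pdiff u D2 f x j (ichart x (row2 z))}.
Proof.
move=> w1 w2 sf r0 cx.
pose h z := pdiff u D1 f x j (ichart x (row2 z)) - pdiff u D2 f x j (ichart x (row2 z)).
suff : {ae mu2, forall z, (forall i, `|row2 z 0 i - c 0 i| < r) -> h z = 0}.
  by apply: ae_imp => z hz /hz /eqP; rewrite subr_eq0 => /eqP.
apply: (fundamental_lemma r0 cx) => phi tphi.
have [i1 e1] := w1 f x phi j sf tphi; have [i2 e2] := w2 f x phi j sf tphi.
have E : (fun z => h z * phi (row2 z)) = (fun z => pdiff u D1 f x j (ichart x (row2 z)) * phi (row2 z)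
  - pdiff u D2 f x j (ichart x (row2 z)) * phi (row2 z)).
  by apply/funext => z; rewrite /h mulrBl.
split.
  rewrite (_ : (fun z => _) = (fun z => (pdiff u D1 f x j (ichart x (row2 z)) * phi (row2 z))%:E
    - (pdiff u D2 f x j (ichart x (row2 z)) * phi (row2 z))%:E)%E).
    exact: (integrableB (mu := mu2)).
  by apply/funext => z; rewrite /h mulrBl EFinB.
rewrite E (@RintegralB _ _ _ mu2) //.
by apply/eqP; rewrite subr_eq0 -(inj_eq (@oppr_inj R)); apply/eqP; rewrite -[LHS]e1 -[RHS]e2.
Qed.

(** The product with a positive bump function is integrable, hence measurable. *)
Lemma weak_differential_measurable u D (f : N -> R) x j (c : 'rV[R]_2) r :
  weak_differential u D -> smooth_fun f -> 0 < r -> cube c r `<=` img x ->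
  measurable_fun ([set z | forall i, `|row2 z 0 i - c 0 i| < r] : set (bR * bR))
    (fun z => pdiff u D f x j (ichart x (row2 z))).
Proof.
move=> w sf r0 cx; have [i1 _] := w f x _ j sf (test_fun_bump r0 cx).
have mb : measurable_fun setT (fun z : bR * bR => box_bump c r (row2 z)).
  apply: continuous2_measurable => z; apply: (@continuous_comp _ _ _ (@row2 R) (box_bump c r)).
    exact: row2_continuous.
  exact: (smooth_on_continuous (box_bump_smooth c r)).
have o : open [set z : R * R | forall i, `|row2 z 0 i - c 0 i| < r].
  rewrite (_ : [set z | _] = (@row2 R) @^-1` [set v : 'rV[R]_2 | forall i, `|v 0 i - c 0 i| < r]) //.
  have /continuousP := @row2_continuous R; apply.
  rewrite openE => v hv; rewrite /interior.
  have h (i : 'I_2) : \forall y \near v, `|(y : 'rV[R]_2) 0 i - c 0 i| < r.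
    have cv : {for v, continuous ((fun s : R => `|s - c 0 i|) \o (fun v : 'rV[R]_2 => v 0 i))}.
      apply: continuous_comp; first exact: coord_continuous.
      by apply: cvg_norm; apply: cvgB; [exact: cvg_id|exact: cvg_cst].
    exact: (cv [set s | s < r] (lt_nbhsl (hv i))).
  by apply: filterS2 (h ord0) (h (lift ord0 ord0)) => y h0 h1 i; case: (ord2P i) => ->.
have mo := open2_measurable o.
pose F z := pdiff u D f x j (ichart x (row2 z)).
have : measurable_fun ([set z | forall i, `|row2 z 0 i - c 0 i| < r] : set (bR * bR))
   (fun z => (F z * box_bump c r (row2 z)) * (box_bump c r (row2 z))^-1).
  apply: measurable_funM.
    by apply: measurable_funS (measurableT) _ _ => //; apply/measurable_EFinP; exact: measurable_int i1.
  apply: open_continuous2_measurable => // z zo.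
  apply: (@continuous_comp _ _ _ (fun z => box_bump c r (row2 z)) (fun s : R => s^-1)).
    apply: (@continuous_comp _ _ _ (@row2 R) (box_bump c r)); first exact: row2_continuous.
    exact: (smooth_on_continuous (box_bump_smooth c r)).
  by apply: inv_continuous; rewrite gt_eqF // box_bump_gt0.
apply: eq_measurable_fun => z /set_mem zo.
by rewrite mulfK // gt_eqF // box_bump_gt0.
Qed.

(** Differentiability is asked of the vector of coordinates as a whole, as jacobians refer
    to it; the C1 condition concerns the coordinates one by one. *)
Definition C1_map w := continuous w /\ forall x y a,
  C1_on [set z | img x z /\ dom y (w (ichart x z))] (fun z => chart y (w (ichart x z)) 0 a : R^o) /\
  forall z, img x z -> dom y (w (ichart x z)) -> differentiable (fun z => chart y (w (ichart x z))) z.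

Definition classical_diff w (y : S) : 'M[R]_(2, n) := jacobian (chart (w y) \o w \o ichart y) (chart y y).

End WeakDifferential.

Section ClassicalDifferential.
Context {R : realType} {n : nat} (S : riemannian_manifold R 2) (N : riemannian_manifold R n).
Local Notation bR := (g_sigma_algebraType (R.-ocitv.-measurable)).
Local Notation mu2 := (leb2 : {measure set (bR * bR) -> \bar R}).
Implicit Types (x : S).
Variable w : S -> N.
Hypothesis cw : C1_map w.

Definition map_dom x (b : N) : set 'rV[R]_2 := [set z | img x z /\ dom b (w (ichart x z))].

Lemma map_dom_open x b : open (map_dom x b).
Proof.
rewrite openE => z [xz bz]; apply: filterI.
  by apply: open_nbhs_nbhs; split => //; exact: img_open.
have [c _] := cw; apply: (near_ichart_open (A := w @^-1` dom b)) => //.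
by apply: open_comp; [move=> y _; exact: c|exact: dom_open].
Qed.

Lemma map_diff x b z : map_dom x b z -> differentiable (chart b \o w \o ichart x) z.
Proof.
move=> [xz bz]; have [_ h] := cw; case: n N w cw b bz h => [|m] N' w' cw' b bz h; last first.
  by have [_] := h x b ord0; apply.
rewrite (_ : _ \o _ = cst 0); first exact: differentiable_cst.
by apply/funext => y; apply/rowP => -[].
Qed.

Lemma jacobian_map x b z : map_dom x b z ->
  jacobian (chart b \o w \o ichart x) z =
  transition_jac x (ichart x z) *m classical_diff w (ichart x z)
    *m tmx (w (ichart x z)) b (chart (w (ichart x z)) (w (ichart x z))).
Proof.
move=> [xz bz]; set y := ichart x z in bz *.
have xy : dom x y by exact: ichart_dom.
have oxy : overlap x y z by split => //; exact: dom_self.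
have wd : dom (w y) (w y) by exact: dom_self.
have my : map_dom y (w y) (chart y y).
  by split; [apply: chart_img; exact: dom_self|rewrite chartK //; exact: dom_self].
have ob : overlap (w y) b (chart (w y) (w y)).
  by split; [exact: chart_img|rewrite chartK].
have d1 := transition_diff oxy; have d2 := map_diff my; have d3 := transition_diff ob.
have zy : (chart y \o ichart x) z = chart y y by [].
have wy : (chart (w y) \o w \o ichart y) (chart y y) = chart (w y) (w y).
  by rewrite /= chartK //; exact: dom_self.
have d2' : differentiable (chart (w y) \o w \o ichart y) ((chart y \o ichart x) z) by rewrite zy.
have d12 := differentiable_comp d1 d2'.
have e12 : ((chart (w y) \o w \o ichart y) \o (chart y \o ichart x)) z = chart (w y) (w y).
  by rewrite -wy.
have d3' : differentiable (chart b \o ichart (w y)) (((chart (w y) \o w \o ichart y) \o (chart y \o ichart x)) z).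
  by rewrite e12.
have e : jacobian ((chart b \o ichart (w y)) \o ((chart (w y) \o w \o ichart y) \o (chart y \o ichart x))) z
  = transition_jac x y *m classical_diff w y *m tmx (w y) b (chart (w y) (w y)).
  rewrite (jacobian_comp d12 d3') (jacobian_comp d1 d2') e12 zy.
  by rewrite transition_jacE /tmx /classical_diff ichartK.
rewrite -e; apply/esym; apply: near_eq_jacobian; first exact: differentiable_comp d12 d3'.
have N1 : \forall v \near z, overlap x y v by apply: open_nbhs_nbhs; split => //; exact: overlap_open.
have N2 : \forall v \near z, map_dom x (w y) v by apply: open_nbhs_nbhs; split => //; exact: map_dom_open.
by apply: filterS2 N1 N2 => v [xv yv] [_ bv]; rewrite /= (chartK yv) (chartK bv).
Qed.

Lemma comp_map_C1 x (f : N -> R) : smooth_fun f -> C1_on (img x) (fun z => f (w (ichart x z)) : R^o).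
Proof.
move=> sf z xz; pose b := w (ichart x z).
have mz : map_dom x b z by split => //; exact: dom_self.
have h : C1_on (map_dom x b) ((f \o ichart b : 'rV[R]_n -> R^o) \o (chart b \o w \o ichart x)).
{ apply: (@C1_comp _ _ _ _ (img b)).
  - exact: map_dom_open.
  - by move=> v [_ bv]; exact: chart_img.
  - by move=> v; exact: map_diff.
  - by move=> a; have [_ h] := cw; have [] := h x b a.
  - exact: C1_on_smooth (sf b). }
have E v : map_dom x b v -> ((f \o ichart b : 'rV[R]_n -> R^o) \o (chart b \o w \o ichart x)) v = f (w (ichart x v)).
  by move=> [_ bv] /=; rewrite chartK.
exact: (@C1_on_eq _ _ _ (@map_dom_open x b) _ (fun z => f (w (ichart x z)) : R^o) E h z mz).
Qed.

Lemma pdiff_classical x (f : N -> R) j z : smooth_fun f -> img x z ->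
  pdiff w (classical_diff w) f x j (ichart x z) =
  'D_(basis_vec j) (fun z => f (w (ichart x z)) : R^o) z.
Proof.
move=> sf xz; pose b := w (ichart x z).
have mz : map_dom x b z by split => //; exact: dom_self.
have bb : dom b b by exact: dom_self.
have db : differentiable (f \o ichart b : 'rV[R]_n -> R^o) ((chart b \o w \o ichart x) z).
  by apply: smooth_on_diff (sf b) _; exact: chart_img.
have e : grad ((f \o ichart b : 'rV[R]_n -> R^o) \o (chart b \o w \o ichart x)) z =
   grad (fun z => f (w (ichart x z)) : R^o) z.
  apply: near_eq_grad; have N2 : \forall v \near z, map_dom x b v.
    by apply: open_nbhs_nbhs; split => //; exact: map_dom_open.
  by apply: filterS N2 => v [_ bv] /=; rewrite chartK.
have : (grad (fun z => f (w (ichart x z)) : R^o) z) j 0 = 'D_(basis_vec j) (fun z => f (w (ichart x z)) : R^o) z by rewrite mxE.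
move=> <-; rewrite -e (grad_comp (map_diff mz) db) (jacobian_map mz) -/b (tmx_self (chart_img bb)) mulmx1.
by rewrite /pdiff mulmxA.
Qed.

Lemma cutoff_continuous (A K : set 'rV[R]_2) (f : 'rV[R]_2 -> R) : compact K -> K `<=` A ->
  (forall z, A z -> {for z, continuous f}) -> (forall z, ~ K z -> f z = 0) -> continuous f.
Proof.
move=> cK KA cf f0 z; have [/cf//|nA] := pselect (A z).
have nK : ~ K z by move/KA.
have oK : open (~` K) by apply: closed_openC; apply: compact_closed => //; exact: norm_hausdorff.
have h : \forall y \near z, cst (0 : R) y = f y.
  by apply: filterS (open_nbhs_nbhs (conj oK nK : open_nbhs z (~` K))) => y /= /f0 ->.
by rewrite /continuous_at (f0 _ nK); exact: cvg_trans (near_eq_cvg h) (cvg_cst (0 : R)).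
Qed.

(** Integration by parts: the product of f o w and a test function is C1 with compact
    support in the chart. *)
Lemma classical_diff_weak : weak_differential w (classical_diff w).
Proof.
move=> f x phi j sf [sphi [K [cK Kx phi0]]] df.
pose F : 'rV[R]_2 -> R^o := fun z => f (w (ichart x z)).
have cF : C1_on (img x) F by exact: comp_map_C1.
have cphi : C1_on (img x) (phi : 'rV[R]_2 -> R^o) by apply: C1_on_smooth; apply: smooth_on_sub sphi.
have dphi0 z : ~ K z -> 'D_(basis_vec j) (phi : 'rV[R]_2 -> R^o) z = 0.
  by move=> nK; exact: derive_notin cK phi0 nK.
pose H1 z := 'D_(basis_vec j) F z * phi z.
pose H2 z := F z * 'D_(basis_vec j) (phi : 'rV[R]_2 -> R^o) z.
have E1 z : df (ichart x z) * phi z = H1 z.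
  have [xz|nx] := pselect (img x z); first by rewrite /H1 /df -[X in X * _ = _]/(pdiff w (classical_diff w) f x j (ichart x z)) pdiff_classical.
  by rewrite /H1 phi0 ?mulr0 // => /Kx.
have c1 : continuous H1.
  apply: (cutoff_continuous cK Kx) => [z xz|z nK]; last by rewrite /H1 phi0 ?mulr0.
  have [_ h] := cF z xz; have h' := C1_continuous (cphi z xz).
  exact: (cvgM (h (basis_vec j)) h').
have c2 : continuous H2.
  apply: (cutoff_continuous cK Kx) => [z xz|z nK]; last by rewrite /H2 dphi0 ?mulr0.
  have [_ h] := cphi z xz; have h' := C1_continuous (cF z xz).
  exact: (cvgM h' (h (basis_vec j))).
have i1 : leb2.-integrable setT (fun z => (H1 (row2 z))%:E).
  by apply: (integrable_compact_rV cK c1) => z nK; rewrite /H1 phi0 ?mulr0.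
have i2 : leb2.-integrable setT (fun z => (H2 (row2 z))%:E).
  by apply: (integrable_compact_rV cK c2) => z nK; rewrite /H2 dphi0 ?mulr0.
have EF : (fun z => df (ichart x (row2 z)) * phi (row2 z)) = H1 \o row2.
  by apply/funext => z; rewrite E1.
split; first by rewrite (_ : (fun z => _) = (fun z => (H1 (row2 z))%:E)) //; apply/funext => z; rewrite E1.
rewrite EF; apply/eqP; rewrite -subr_eq0 opprK -[X in X + _]/(\int[mu2]_z H2 (row2 z)) -[X in _ + X]/(\int[mu2]_z H1 (row2 z)).
rewrite -RintegralD //; apply/eqP.
have hV : hausdorff_space 'rV[R]_2 by exact: norm_hausdorff.
have cG : forall z, C1_at (F * (phi : 'rV[R]_2 -> R^o) : 'rV[R]_2 -> R^o) z.
  apply: (C1_cutoff hV cK Kx) => [z nK|]; first by rewrite /= !fctE phi0 ?mulr0.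
  by apply: C1_onM => //; exact: img_open.
have G0 z : ~ K z -> (F * (phi : 'rV[R]_2 -> R^o)) z = 0 by move=> nK; rewrite !fctE phi0 ?mulr0.
rewrite -[RHS](integral_derive_plane j cK cG G0); apply: (@eq_Rintegral _ _ _ mu2) => z _.
have [xz|nx] := pselect (img x (row2 z)); last first.
  have nK : ~ K (row2 z) by move/Kx.
  by rewrite (derive_notin _ cK G0 nK) /H1 /H2 phi0 // dphi0 // !mulr0 addr0.
rewrite deriveM; first by rewrite /H1 /H2 /GRing.scale /= [X in _ + X]mulrC.
- by apply: diff_derivable; have [] := cF _ xz.
- by apply: diff_derivable; have [] := cphi _ xz.
Qed.

End ClassicalDifferential.

Section PatchFrame.
Context {R : realType} {n : nat} (N : riemannian_manifold R n).
Implicit Types (b y : N).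

Definition patch_rad b : R := s2val (cid2 (cube_radius b)).

Lemma patch_rad_gt0 b : 0 < patch_rad b.
Proof. by rewrite /patch_rad; case: cid2. Qed.

Lemma patch_rad_cube b : cube (chart b b) (patch_rad b) `<=` img b.
Proof. by rewrite /patch_rad; case: cid2. Qed.

Definition patch_set b : set N :=
  [set y | dom b y /\ forall i, `|chart b y 0 i - chart b b 0 i| < patch_rad b].

Definition patch_bump b : 'rV[R]_n -> R^o := box_bump (chart b b) (patch_rad b).

(** A bump function around b and its products with the coordinates are smooth on the
    whole target; together they recover the coordinates near b. *)
Definition patch_weight b : N -> R := patch_fun b (patch_bump b).

Definition patch_coord b a : N -> R := patch_fun b (fun z => patch_bump b z * z 0 a).

Lemma patch_bump_smooth b (A : set 'rV[R]_n) : smooth_on A (patch_bump b).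
Proof. by apply: smooth_on_sub (@box_bump_smooth _ _ _ _). Qed.

Lemma patch_bump0 b z : ~ cube (chart b b) (patch_rad b) z -> patch_bump b z = 0.
Proof. by apply: box_bump_cube; exact: patch_rad_gt0. Qed.

Lemma patch_weight_smooth b : smooth_fun (patch_weight b).
Proof.
apply: (patch_fun_smooth (@cube_compact _ _ (chart b b) (patch_rad b)) (@patch_rad_cube b)).
  exact: patch_bump_smooth.
by move=> z; exact: patch_bump0.
Qed.

Lemma patch_coord_smooth b a : smooth_fun (patch_coord b a).
Proof.
apply: (patch_fun_smooth (g := fun z => patch_bump b z * z 0 a) (@cube_compact _ _ (chart b b) (patch_rad b)) (@patch_rad_cube b)).
  apply: (@smooth_onM _ _ _ (patch_bump b) (fun z : 'rV[R]_n => z 0 a : R^o)); first exact: img_open.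
    exact: patch_bump_smooth.
  by apply: coord_smooth; exact: img_open.
by move=> z /patch_bump0 ->; rewrite mul0r.
Qed.

Lemma patch_bump_gt0 b y : patch_set b y -> 0 < patch_bump b (chart b y).
Proof. by move=> [_ h]; apply: box_bump_gt0 => //; exact: patch_rad_gt0. Qed.

Lemma patch_weightE b y : dom b y -> patch_weight b y = patch_bump b (chart b y).
Proof. exact: patch_funE. Qed.

Lemma patch_coordE b a y : dom b y -> patch_coord b a y = patch_bump b (chart b y) * chart b y 0 a.
Proof. exact: patch_funE. Qed.

Lemma dfun_tmx (f : N -> R) b y : smooth_fun f -> dom b y ->
  dfun f y = tmx y b (chart y y) *m grad (f \o ichart b) (chart b y).
Proof.
move=> sf bH; have o : overlap y b (chart y y).
  by split; [apply: chart_img; exact: dom_self|rewrite chartK //; exact: dom_self].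
by have := grad_tmx o sf; rewrite (chartK (dom_self y)).
Qed.

(** The product rule for a coordinate times the bump function. The differentials of the
    patch functions thus determine a linear map, and do so continuously. *)
Lemma patch_frame b y a m (D : 'M[R]_(m, n)) : dom b y ->
  D *m dfun (patch_coord b a) y = chart b y 0 a *: (D *m dfun (patch_weight b) y)
    + patch_bump b (chart b y) *: col a (D *m tmx y b (chart y y)).
Proof.
move=> bH; rewrite (dfun_tmx (patch_weight_smooth b) bH) (dfun_tmx (patch_coord_smooth b a) bH).
have nb : \forall z \near chart b y, img b z.
  by apply: open_nbhs_nbhs; split; [exact: img_open|exact: chart_img].
have -> : grad (patch_weight b \o ichart b) (chart b y) = grad (patch_bump b) (chart b y).
  by apply: near_eq_grad; apply: filterS nb => z bz /=; rewrite patch_weightE ?ichartK //; exact: ichart_dom.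
have db : differentiable (patch_bump b) (chart b y) by apply: (smooth_on_diff (A := setT)) => //; exact: patch_bump_smooth.
have dc : differentiable (fun z : 'rV[R]_n => z 0 a : R^o) (chart b y).
  by apply: (smooth_on_diff (A := setT)) => //; apply: coord_smooth; exact: openT.
have -> : grad (patch_coord b a \o ichart b) (chart b y) =
    chart b y 0 a *: grad (patch_bump b) (chart b y) + patch_bump b (chart b y) *: delta_mx a 0.
  rewrite (_ : grad _ _ = grad (patch_bump b * (fun z : 'rV[R]_n => z 0 a : R^o)) (chart b y)); last first.
    by apply: near_eq_grad; apply: filterS nb => z bz /=; rewrite patch_coordE ?ichartK //; exact: ichart_dom.
  apply/colP => i; rewrite [LHS]mxE deriveM; [|exact: diff_derivable|exact: diff_derivable].
  rewrite (_ : 'D_(basis_vec i) (fun z : 'rV[R]_n => z 0 a : R^o) (chart b y) = (i == a)%:R).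
    by rewrite !mxE /GRing.scale /= eqxx andbT addrC.
  rewrite (@derive_coord _ _ _ id (chart b y) (basis_vec i) a (@derivable_id _ _ _ _)) derive_id.
  by rewrite !mxE eqxx /= eq_sym.
by rewrite mulmxDr mulmxDr -!scalemxAr colE -[in RHS]mulmxA.
Qed.

Lemma patch_inj b y m (D1 D2 : 'M[R]_(m, n)) : patch_set b y ->
  D1 *m dfun (patch_weight b) y = D2 *m dfun (patch_weight b) y ->
  (forall a, D1 *m dfun (patch_coord b a) y = D2 *m dfun (patch_coord b a) y) -> D1 = D2.
Proof.
move=> bH e0 e; have bp := patch_bump_gt0 bH; have db := bH.1.
have o : overlap y b (chart y y).
  by split; [apply: chart_img; exact: dom_self|rewrite chartK //; exact: dom_self].
have u := tmx_unit o.
suff E : D1 *m tmx y b (chart y y) = D2 *m tmx y b (chart y y).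
  by rewrite -(mulmxK u D1) E (mulmxK u).
apply/matrixP => i a; have := e a; rewrite (patch_frame a D1 db) (patch_frame a D2 db) e0 => /addrI /matrixP /(_ i 0).
rewrite mxE [RHS]mxE => h; have := mulfI (lt0r_neq0 bp) h.
by rewrite !mxE.
Qed.

Lemma patch_set_open b : open (patch_set b).
Proof.
have -> : patch_set b = dom b `&` \bigcap_(i in [set: 'I_n]) [set y | dom b y -> `|chart b y 0 i - chart b b 0 i| < patch_rad b].
  by apply/seteqP; split=> y [yb h]; split => // i; [move=> _ _; exact: h|exact: h i I yb].
rewrite openE => y [yb h].
have H (i : 'I_n) : \forall y \near y, `|chart b y 0 i - chart b b 0 i| < patch_rad b.
  have c : {for y, continuous ((fun s : R => `|s - chart b b 0 i|) \o (fun v : 'rV[R]_n => v 0 i) \o chart b)}.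
    apply: continuous_comp; first exact: chart_continuous.
    apply: continuous_comp; first exact: coord_continuous.
    by apply: cvg_norm; apply: cvgB; [exact: cvg_id|exact: cvg_cst].
  exact: (c [set s | s < patch_rad b] (lt_nbhsl (h i I yb))).
apply: filterI; first by apply: open_nbhs_nbhs; split => //; exact: dom_open.
have : \forall y \near y, forall i, `|chart b y 0 i - chart b b 0 i| < patch_rad b by exact: filter_forall.
by apply: filterS => v hv i _ _; exact: hv.
Qed.

Lemma patch_cover : compact [set: N] -> exists s : seq N, forall y, exists2 b, b \in s & patch_set b y.
Proof.
rewrite compact_cover => /(_ N setT patch_set (fun b _ => patch_set_open b)).
case=> [y _|s _ hs].
  by exists y => //; split=> [|i]; [exact: dom_self|rewrite subrr normr0; exact: patch_rad_gt0].
by exists (finmap.enum_fset s) => y; have [b bs yb] := hs y I; exists b.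
Qed.

End PatchFrame.

Lemma ae_seq d (T : measurableType d) (R : realType) (mu : {measure set T -> \bar R})
    (I : eqType) (s : seq I) (P : I -> T -> Prop) :
  (forall i, {ae mu, forall x, P i x}) -> {ae mu, forall x, forall i, i \in s -> P i x}.
Proof.
move=> h; elim: s => [|j s IH]; first by apply: aeW.
apply: ae_imp2 (h j) IH => x pj ps i; rewrite inE => /orP[/eqP -> //|]; exact: ps.
Qed.

Section DiffMap.
Context {R : realType} {n : nat} (S : riemannian_manifold R 2) (N : riemannian_manifold R n).
Local Notation bR := (g_sigma_algebraType (R.-ocitv.-measurable)).
Local Notation mu2 := (leb2 : {measure set (bR * bR) -> \bar R}).
Implicit Types (u w : S -> N) (x : S).

Lemma diff_map_weak u : (exists D, weak_differential u D) -> weak_differential u (diff_map u).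
Proof. by move=> [D wD]; exact: (xgetPex (fun=> 0) (ex_intro _ D wD)). Qed.

(** The patch functions of a finite cover of the target separate linear maps, and the weak
    derivatives of each of them are unique almost everywhere. *)
Lemma diff_map_classical w x (c : 'rV[R]_2) r : compact [set: N] -> C1_map w ->
  0 < r -> cube c r `<=` img x ->
  {ae mu2, forall z, (forall i, `|row2 z 0 i - c 0 i| < r) ->
    diff_map w (ichart x (row2 z)) = classical_diff w (ichart x (row2 z))}.
Proof.
move=> cN cw r0 cx.
have wc := classical_diff_weak cw.
have wd := diff_map_weak (ex_intro _ _ wc).
have [s hs] := patch_cover cN.
pose box z := forall i, `|row2 z 0 i - c 0 i| < r.
pose Q (f : N -> R) (j : 'I_2) z := box z -> pdiff w (diff_map w) f x j (ichart x (row2 z)) =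
  pdiff w (classical_diff w) f x j (ichart x (row2 z)).
pose P (i : N * option 'I_n * 'I_2) z := Q (if i.1.2 is Some a then patch_coord i.1.1 a else patch_weight i.1.1) i.2 z.
have hP i : {ae mu2, forall z, P i z}.
  apply: weak_differential_unique => //.
  by case: i.1.2 => [a|]; [exact: patch_coord_smooth|exact: patch_weight_smooth].
have := ae_seq (mu := mu2) [seq (b, i) | b <- [seq (b, a) | b <- s, a <- None :: [seq Some a | a <- enum 'I_n]], i <- enum 'I_2] hP.
apply: ae_imp => z h bz; set y := ichart x (row2 z).
have xy : dom x y.
  by apply: ichart_dom; apply: cx => i; exact: ltW.
have [b bs yb] := hs (w y).
have key a : (if a is Some a then patch_coord b a else patch_weight b) = (if a is Some a then patch_coord b a else patch_weight b) ->
   diff_map w y *m dfun (if a is Some a then patch_coord b a else patch_weight b) (w y) =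
   classical_diff w y *m dfun (if a is Some a then patch_coord b a else patch_weight b) (w y).
  move=> _; have u := transition_jac_unit xy.
  apply: (can_inj (mulKmx u)); apply/colP => j.
  apply: (h (b, a, j)) => //; apply/allpairsP; exists ((b, a), j); split => //; last by rewrite mem_enum.
  apply/allpairsP; exists (b, a); split => //; case: a => [a|]; rewrite inE //=.
  by apply/mapP; exists a => //; rewrite mem_enum.
apply: (patch_inj yb); first exact: (key None).
by move=> a; exact: (key (Some a)).
Qed.

End DiffMap.


(** * The flow equation in terms of inner products of derivatives *)

Lemma lower_index (R : fieldType) n (h : 'M[R]_n) (L G : 'I_n -> R) (k : R) d : h^T = h -> h \in unitmx ->
  (forall a, G a = k * \sum_l invmx h a l * L l) -> \sum_a G a * h a d = k * L d.
Proof.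
move=> hsym hu GE; transitivity (k * \sum_l (\sum_a h d a * invmx h a l) * L l).
  rewrite mulr_sumr; under [RHS]eq_bigr do rewrite mulr_suml mulr_sumr.
  rewrite exchange_big; apply: eq_bigr => a _.
  rewrite GE mulrAC mulr_sumr; apply: eq_bigr => l _.
  have -> : h d a = h a d by rewrite -[in LHS]hsym mxE.
  by ring.
congr (_ * _); rewrite (bigD1 d) //= [X in _ + X]big1 ?addr0 => [|l ld].
  have /matrixP/(_ d d) := mulmxV hu; rewrite !mxE eqxx => ->.
  by rewrite mul1r.
have /matrixP/(_ d l) := mulmxV hu; rewrite !mxE eq_sym (negbTE ld) => ->.
by rewrite mul0r.
Qed.

Lemma trilinear_comb (R : fieldType) n (dh : 'I_n -> 'I_n -> 'I_n -> R) (p q z : 'rV[R]_n) :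
  let T (r s t : 'rV[R]_n) := \sum_a \sum_c s 0 a * (\sum_e dh e a c * r 0 e) * t 0 c in
  \sum_b \sum_c \sum_d (p 0 b * q 0 c * z 0 d) * (2^-1 * (dh b c d + dh c b d - dh d b c)) =
  2^-1 * (T p q z + T q p z - T z p q).
Proof.
move=> T.
have E1 (r s t : 'rV[R]_n) : T r s t = \sum_e \sum_a \sum_c r 0 e * s 0 a * t 0 c * dh e a c.
  transitivity (\sum_a \sum_e \sum_c r 0 e * s 0 a * t 0 c * dh e a c); last by rewrite exchange_big.
  apply: eq_bigr => a _; rewrite exchange_big; apply: eq_bigr => c _.
  by rewrite mulr_sumr mulr_suml; apply: eq_bigr => e _; ring.
rewrite (E1 p q z) [T q p z]E1 [T z p q]E1.
rewrite [X in _ + X - _]exchange_big.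
have -> : \sum_e \sum_a \sum_c z 0 e * p 0 a * q 0 c * dh e a c = \sum_a \sum_c \sum_e z 0 e * p 0 a * q 0 c * dh e a c.
  by rewrite exchange_big; apply: eq_bigr => a _; rewrite exchange_big.
rewrite -big_split -sumrB mulr_sumr; apply: eq_bigr => b _.
rewrite -big_split -sumrB mulr_sumr; apply: eq_bigr => c _.
rewrite -big_split -sumrB mulr_sumr; apply: eq_bigr => d _ /=.
by ring.
Qed.

Lemma metric_unitmx (R : realType) n (M : riemannian_manifold R n) (y : M) v : img y v -> metric y v \in unitmx.
Proof.
move=> hv; rewrite -row_free_unit -kermx_eq0; apply/negPn/negP => /rowV0Pn [w /sub_kermxP w0 wn0].
by have := metric_pos hv wn0; rewrite w0 mul0mx mxE ltxx.
Qed.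

Section LowerChristoffel.
Context {R : realType} {n : nat} (h : 'rV[R]_n -> 'M[R]_n) (v : 'rV[R]_n).
Hypothesis hsym : (h v)^T = h v.
Hypothesis hunit : h v \in unitmx.
Hypothesis dsym : forall e a c, 'D_(basis_vec e) (fun w => h w a c : R^o) v = 'D_(basis_vec e) (fun w => h w c a : R^o) v.

Definition pairing (y z : 'rV[R]_n) : R := \sum_a \sum_c y 0 a * h v a c * z 0 c.

Definition dpairing (w y z : 'rV[R]_n) : R :=
  \sum_a \sum_c y 0 a * (\sum_e 'D_(basis_vec e) (fun x => h x a c : R^o) v * w 0 e) * z 0 c.

Lemma pairingC y z : pairing y z = pairing z y.
Proof.
rewrite /pairing exchange_big; apply: eq_bigr => a _; apply: eq_bigr => c _.
by rewrite -[in LHS]hsym mxE; ring.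
Qed.

Lemma pairing_mx y z : pairing y z = (y *m h v *m z^T) 0 0.
Proof.
rewrite mxE /pairing exchange_big; apply: eq_bigr => c _.
by rewrite mxE mulr_suml; apply: eq_bigr => a _; rewrite mxE.
Qed.

Lemma pairingDl y y' z : pairing (y + y') z = pairing y z + pairing y' z.
Proof. by rewrite !pairing_mx !mulmxDl mxE. Qed.

Lemma pairingZl k y z : pairing (k *: y) z = k * pairing y z.
Proof. by rewrite !pairing_mx -!scalemxAl mxE. Qed.

Lemma pairing_suml (I : finType) (F : I -> 'rV[R]_n) z : pairing (\sum_i F i) z = \sum_i pairing (F i) z.
Proof.
elim/big_ind2 : _ => [|x1 x2 y1 y2 <- <-|//]; last exact: pairingDl.
by rewrite pairing_mx !mul0mx mxE.
Qed.

Lemma lower_christoffel b c d :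
  \sum_a christoffel h v a b c * h v a d =
  2^-1 * ('D_(basis_vec b) (fun w => h w d c : R^o) v + 'D_(basis_vec c) (fun w => h w d b : R^o) v
    - 'D_(basis_vec d) (fun w => h w b c : R^o) v).
Proof.
exact: (lower_index (L := fun l => 'D_(basis_vec b) (fun w => h w l c : R^o) v
  + 'D_(basis_vec c) (fun w => h w l b : R^o) v - 'D_(basis_vec l) (fun w => h w b c : R^o) v)).
Qed.

(** Lowering the index of the Christoffel symbols removes the inverse metric. *)
Lemma pairing_christoffel (p q z : 'rV[R]_n) :
  pairing (\row_a \sum_b \sum_c christoffel h v a b c * p 0 b * q 0 c) z =
  2^-1 * (dpairing p q z + dpairing q p z - dpairing z p q).
Proof.
transitivity (\sum_b \sum_c \sum_d (p 0 b * q 0 c * z 0 d) * \sum_a christoffel h v a b c * h v a d).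
  rewrite /pairing; under eq_bigr do under eq_bigr do rewrite mxE.
  rewrite exchange_big.
  transitivity (\sum_d \sum_b \sum_c (p 0 b * q 0 c * z 0 d) * \sum_a christoffel h v a b c * h v a d).
    apply: eq_bigr => d _.
    transitivity (\sum_a \sum_b \sum_c (p 0 b * q 0 c * z 0 d) * (christoffel h v a b c * h v a d)).
      apply: eq_bigr => a _; rewrite -mulrA mulr_suml; apply: eq_bigr => b _.
      by rewrite mulr_suml; apply: eq_bigr => c _; ring.
    rewrite exchange_big; apply: eq_bigr => b _; rewrite exchange_big; apply: eq_bigr => c _.
    by rewrite mulr_sumr.
  by rewrite exchange_big; apply: eq_bigr => b _; rewrite exchange_big.
under eq_bigr do under eq_bigr do under eq_bigr do rewrite lower_christoffel.
have E2 b c d : 'D_(basis_vec b) (fun w => h w d c : R^o) v + 'D_(basis_vec c) (fun w => h w d b : R^o) v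
    - 'D_(basis_vec d) (fun w => h w b c : R^o) v = 'D_(basis_vec b) (fun w => h w c d : R^o) v
    + 'D_(basis_vec c) (fun w => h w b d : R^o) v - 'D_(basis_vec d) (fun w => h w b c : R^o) v.
  by rewrite (dsym b d c) (dsym c d b).
under eq_bigr do under eq_bigr do under eq_bigr do rewrite E2.
exact: (trilinear_comb (fun e a c => 'D_(basis_vec e) (fun x => h x a c : R^o) v)).
Qed.

End LowerChristoffel.

Section DeriveAlgebra.
Context {R : realType} {V : normedModType R}.
Implicit Types f g k : V -> R^o.

Lemma derive_prod3 f g k s Z : differentiable f s -> differentiable g s -> differentiable k s ->
  'D_Z (fun s => f s * g s * k s : R^o) s =
  'D_Z f s * g s * k s + f s * 'D_Z g s * k s + f s * g s * 'D_Z k s.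
Proof.
move=> df dg dk.
have df' := diff_derivable (v := Z) df; have dg' := diff_derivable (v := Z) dg; have dk' := diff_derivable (v := Z) dk.
have e1 := deriveM (derivableM df' dg') dk'; have e2 := deriveM df' dg'.
rewrite [LHS](e1 : _ = f s * g s * 'D_Z k s + k s * 'D_Z (f * g) s) e2.
rewrite [X in k s * X](_ : _ = f s * 'D_Z g s + g s * 'D_Z f s); last by [].
have alg (a b c a' b' c' : R) : a * b * c' + c * (a * b' + b * a') = a' * b * c + a * b' * c + a * b * c' by ring.
exact: alg.
Qed.

Lemma derive_bigsum m (F : 'I_m -> V -> R^o) s Z : (forall i, differentiable (F i) s) ->
  'D_Z (fun s => \sum_i F i s : R^o) s = \sum_i 'D_Z (F i) s.
Proof.
move=> dF; rewrite -derive_sum; last by move=> i; exact: diff_derivable.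
by congr ('D_Z _ s); apply/funext => r; rewrite fct_sumE.
Qed.

Lemma derive_slice_snd (W : normedModType R) (U : normedModType R) (f : U * V -> W) t z w :
  'D_((0, w)) f (t, z) = 'D_w (fun z => f (t, z)) z.
Proof.
apply: (congr1 (fun F : R -> W => lim (F @ (0:R)^'))); apply/funext => h /=.
by congr (_ *: (f _ - _)); congr pair; rewrite /= scaler0 add0r.
Qed.

Lemma derive_slice_fst (W : normedModType R) (U : normedModType R) (f : U * V -> W) t z w :
  'D_((w, 0)) f (t, z) = 'D_w (fun t => f (t, z)) t.
Proof.
apply: (congr1 (fun F : R -> W => lim (F @ (0:R)^'))); apply/funext => h /=.
by congr (_ *: (f _ - _)); congr pair; rewrite /= scaler0 add0r.
Qed.

Lemma slice_differentiable (U : normedModType R) (t : U) (z : V) : differentiable (fun w : V => (t, w) : U * V) z.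
Proof. by apply: differentiable_pair; [exact: differentiable_cst|exact: (smooth_on_diff (@smooth_on_id R V setT))]. Qed.

End DeriveAlgebra.

Section Flow.
#[local] Opaque derive.
Context {R : realType} {n : nat} (S : riemannian_manifold R 2) (N : riemannian_manifold R n).
Variables (T : \bar R) (u : R -> S -> N).
Local Notation E := (R^o * 'rV[R]_2)%type.
Hypothesis ucont : forall (t : R) (x : S), 0 < t -> (t%:E < T)%E ->
  {for (t, x), continuous (fun s : R * S => u s.1 s.2)}.
Hypothesis usmooth : forall (x : S) (y : N),
  smooth_on [set s : E | [/\ 0 < s.1, (s.1%:E < T)%E, img x s.2 & dom y (u s.1 (ichart x s.2))]]
          (fun s : E => chart y (u s.1 (ichart x s.2))).
Hypothesis uflow : forall (x : S) (y : N) (t : R) (z : 'rV[R]_2),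
  0 < t -> (t%:E < T)%E -> img x z -> dom y (u t (ichart x z)) ->
  derive1 (fun s => chart y (u s (ichart x z))) t
  = tension (metric x) (metric y) (chart y \o u t \o ichart x) z.
Variable x : S.

Definition flow_dom : set E := [set s | [/\ 0 < s.1, (s.1%:E < T)%E & img x s.2]].

Definition flow_dom_at (b : N) : set E :=
  [set s | [/\ 0 < s.1, (s.1%:E < T)%E, img x s.2 & dom b (u s.1 (ichart x s.2))]].

Definition flow_coord (b : N) (s : E) : 'rV[R]_n := chart b (u s.1 (ichart x s.2)).

Lemma open_lt_ereal : open [set t : R | (t%:E < T)%E].
Proof.
case: T => [r| |] /=.
- rewrite (_ : [set t | _] = [set t : R | t < r]); first exact: open_lt.
  by apply/seteqP; split=> t /=; rewrite lte_fin.
- by rewrite (_ : [set t | _] = setT); [exact: openT|apply/seteqP; split=> t //= _; rewrite ltry].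
- by rewrite (_ : [set t | _] = set0); [exact: open0|apply/seteqP; split=> t //=].
Qed.

Lemma flow_dom_open : open flow_dom.
Proof.
have cf : continuous (fun s : E => s.1) by move=> s; exact: cvg_fst.
have cs : continuous (fun s : E => s.2) by move=> s; exact: cvg_snd.
have -> : flow_dom = [set s : E | 0 < s.1] `&` [set s : E | (s.1%:E < T)%E] `&` [set s : E | img x s.2].
  by apply/seteqP; split=> s /= => [[]|[[]]].
apply: openI; first apply: openI.
- exact: (open_comp (fun s _ => cf s) (@open_gt R 0)).
- exact: (open_comp (fun s _ => cf s) open_lt_ereal).
- exact: (@open_comp E _ (fun s : E => s.2) (img x) (fun s _ => cs s) (@img_open _ _ S x)).
Qed.

Lemma flow_dom_at_open b : open (flow_dom_at b).
Proof.
rewrite openE => -[t z] [/= t0 tT xz bz].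
have h1 : nbhs ((t, z) : E) flow_dom by apply: open_nbhs_nbhs; split; [exact: flow_dom_open|].
have c1 : {for ((t, z) : E), continuous (fun s : E => (s.1 : R, ichart x s.2))}.
  have cs : {for ((t, z) : E), continuous (fun s : E => s.2)} by exact: cvg_snd.
  have a : (fun s : E => s.1 : R) @ ((t, z) : E) --> (t : R) by exact: cvg_fst.
  have b' := @continuous_comp _ _ _ (fun s : E => s.2) (ichart x) (t, z) cs (ichart_continuous xz).
  exact: (cvg_pair a b').
have c2 : {for ((t, z) : E), continuous (fun s : E => u s.1 (ichart x s.2))}.
  have c3 : {for ((fun s : E => (s.1 : R, ichart x s.2)) (t, z)), continuous (fun s : R * S => u s.1 s.2)}.
    exact: (@ucont t (ichart x z) t0 tT).
  exact: (@continuous_comp E (R * S)%type N (fun s : E => (s.1 : R, ichart x s.2)) (fun s : R * S => u s.1 s.2) (t, z) c1 c3).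
have h2 : nbhs ((t, z) : E) [set s : E | dom b (u s.1 (ichart x s.2))].
  by apply: (c2 (dom b)); apply: open_nbhs_nbhs; split; [exact: dom_open|].
by apply: filterS2 h1 h2 => s [? ? ?] ?; split.
Qed.

Lemma flow_dom_self s : flow_dom s -> flow_dom_at (u s.1 (ichart x s.2)) s.
Proof. by move=> [? ? ?]; split => //; exact: dom_self. Qed.

(** The inner product <D_X u, D_Y u>. It is taken in the chart at u(s); by
    [flow_pair_local] every chart of the target gives the same value. *)
Definition flow_pair (X Y : E) (s : E) : R :=
  let y := u s.1 (ichart x s.2) in
  ('D_X (flow_coord y) s *m metric_at y *m ('D_Y (flow_coord y) s)^T) 0 0.

Lemma flow_coord_diff b s : flow_dom_at b s -> differentiable (flow_coord b) s.
Proof. by move=> h; exact: smooth_on_diff (@usmooth x b) h. Qed.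

Lemma flow_coord_change b s X : flow_dom_at b s -> let y := u s.1 (ichart x s.2) in
  'D_X (flow_coord b) s = 'D_X (flow_coord y) s *m tmx y b (chart y y).
Proof.
move=> hb y; have hs : flow_dom_at y s by apply: flow_dom_self; case: hb.
have o : overlap y b (chart y y).
  by split; [apply: chart_img; exact: dom_self|rewrite chartK; [case: hb|exact: dom_self]].
have d1 := flow_coord_diff hs; have d2 := transition_diff o.
have d2' : differentiable (chart b \o ichart y) (flow_coord y s) by [].
transitivity ('D_X ((chart b \o ichart y) \o flow_coord y) s).
  apply: near_eq_derive.
  have n1 := open_nbhs_nbhs (conj (flow_dom_at_open (b := y)) hs : open_nbhs s (flow_dom_at y)).
  by apply: filterS n1 => r [_ _ _ ry]; rewrite /flow_coord /= chartK.
have d12 := differentiable_comp d1 d2'.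
rewrite (deriveE X d12) (diff_comp d1 d2') (deriveE X d1).
have := deriveEjacobian ('d (flow_coord y) s X) d2.
by rewrite (deriveE _ d2) => <-.
Qed.

Lemma flow_pair_local b s X Y : flow_dom_at b s ->
  flow_pair X Y s = ('D_X (flow_coord b) s *m metric b (flow_coord b s) *m ('D_Y (flow_coord b) s)^T) 0 0.
Proof.
move=> hb; rewrite [in RHS](flow_coord_change X hb) [in RHS](flow_coord_change Y hb) /flow_pair.
set y := u s.1 (ichart x s.2).
have o : overlap y b (chart y y).
  by split; [apply: chart_img; exact: dom_self|rewrite chartK; [case: hb|exact: dom_self]].
have := metric_tmx o; rewrite (chartK (dom_self y)) -/(metric_at y) => ->.
by rewrite /flow_coord -/y trmx_mul !mulmxA.
Qed.

Definition flow_deriv b X s a : R^o := 'D_X (fun s => flow_coord b s 0 a : R^o) s.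

Lemma flow_derivE b X s a : flow_dom_at b s -> ('D_X (flow_coord b) s) 0 a = flow_deriv b X s a.
Proof. by move=> h; rewrite /flow_deriv derive_coord //; apply: diff_derivable; exact: flow_coord_diff. Qed.

Lemma flow_deriv_smooth b X a : smooth_on (flow_dom_at b) (fun s => flow_deriv b X s a : R^o).
Proof.
apply: smooth_on_derive; apply: smooth_on_coord; first exact: flow_dom_at_open.
exact: usmooth.
Qed.

Lemma flow_pair_sum b s X Y : flow_dom_at b s ->
  flow_pair X Y s = \sum_a \sum_c flow_deriv b X s a * metric b (flow_coord b s) a c * flow_deriv b Y s c.
Proof.
move=> hb; rewrite [LHS](flow_pair_local X Y hb) -[LHS](pairing_mx (metric b)).
by apply: eq_bigr => a _; apply: eq_bigr => c _; rewrite -(flow_derivE X a hb) -(flow_derivE Y c hb).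
Qed.

Lemma flow_coord_img b s : flow_dom_at b s -> img b (flow_coord b s).
Proof. by move=> [_ _ _ h]; exact: chart_img. Qed.

Lemma flow_metric_C1 b a c : C1_on (flow_dom_at b) (fun s => metric b (flow_coord b s) a c : R^o).
Proof.
apply: (@C1_comp _ _ _ _ (img b) (flow_coord b) (fun w => metric b w a c : R^o)).
- exact: flow_dom_at_open.
- by move=> s; exact: flow_coord_img.
- by move=> s; exact: flow_coord_diff.
- move=> e; apply: C1_on_smooth; apply: smooth_on_coord; first exact: flow_dom_at_open.
  exact: usmooth.
- by apply: C1_on_smooth; exact: metric_smooth.
Qed.

Lemma flow_pair_C1 X Y : C1_on flow_dom (flow_pair X Y : E -> R^o).
Proof.
move=> s hs; have hb := flow_dom_self hs; set b := u _ _ in hb.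
have oA := flow_dom_at_open (b := b).
have h : C1_on (flow_dom_at b) (fun s => \sum_a \sum_c flow_deriv b X s a * metric b (flow_coord b s) a c * flow_deriv b Y s c : R^o).
  apply: C1_on_sum => // a; apply: C1_on_sum => // c.
  have sd Z e : C1_on (flow_dom_at b) (fun s => flow_deriv b Z s e) by apply: C1_on_smooth; exact: flow_deriv_smooth.
  exact: (C1_onM oA (C1_onM oA (sd X a) (flow_metric_C1 (b := b) a c)) (sd Y c)).
have h' s' : flow_dom_at b s' -> \sum_a \sum_c flow_deriv b X s' a * metric b (flow_coord b s') a c * flow_deriv b Y s' c = flow_pair X Y s'.
  by move=> hs'; rewrite (flow_pair_sum X Y hs').
exact: (@C1_on_eq _ _ _ oA _ (flow_pair X Y : E -> R^o) h' h s hb).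
Qed.

Lemma flow_pairC X Y s : flow_dom s -> flow_pair X Y s = flow_pair Y X s.
Proof.
move=> hs; have hb := flow_dom_self hs; set y := u s.1 (ichart x s.2) in hb.
rewrite [LHS](flow_pair_local X Y hb) [RHS](flow_pair_local Y X hb) -[LHS](pairing_mx (metric y)) -[RHS](pairing_mx (metric y)).
by apply: pairingC; apply: Defs.metric_sym; exact: flow_coord_img.
Qed.

Lemma flow_pair_ge0 X s : flow_dom s -> 0 <= flow_pair X X s.
Proof.
move=> hs; have hb := flow_dom_self hs; rewrite (flow_pair_local _ _ hb).
set v := 'D_X _ s; have [->|v0] := eqVneq v 0; first by rewrite !mul0mx mxE.
by apply: ltW; apply: metric_pos v0; exact: flow_coord_img.
Qed.

Local Notation metric_along b s := (metric b (flow_coord b s)).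

Definition flow_deriv2 b X Y s : 'rV[R]_n := \row_a 'D_X (fun s => flow_deriv b Y s a : R^o) s.

Lemma flow_deriv2E b X Y s a : flow_deriv2 b X Y s 0 a = 'D_X (fun s => flow_deriv b Y s a : R^o) s.
Proof. exact: mxE. Qed.

Lemma flow_deriv2C b X Y s : flow_dom_at b s -> flow_deriv2 b X Y s = flow_deriv2 b Y X s.
Proof.
move=> hb; apply/rowP => a; rewrite [LHS]flow_deriv2E [RHS]flow_deriv2E.
apply: (derive_comm X Y (flow_dom_at_open (b := b)) hb).
apply: smooth_on_coord; first exact: flow_dom_at_open.
exact: usmooth.
Qed.

Lemma flow_deriv_diff b X a s : flow_dom_at b s -> differentiable (fun s => flow_deriv b X s a : R^o) s.
Proof. by move=> hb; exact: smooth_on_diff (flow_deriv_smooth X a) hb. Qed.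

Lemma flow_metric_derive b s Z a c : flow_dom_at b s ->
  'D_Z (fun s => metric_along b s a c : R^o) s =
  \sum_e 'D_(basis_vec e) (fun w => metric b w a c : R^o) (flow_coord b s) * ('D_Z (flow_coord b) s) 0 e.
Proof.
move=> hb.
have dm : differentiable (fun w => metric b w a c : R^o) (flow_coord b s).
  exact: smooth_on_diff (@metric_smooth _ _ N b a c) (flow_coord_img hb).
rewrite [LHS](derive_rV_comp Z (flow_coord_diff hb) dm); apply: eq_bigr => e _.
by congr (_ * _); rewrite (flow_derivE Z e hb).
Qed.

Lemma flow_pair_derive b s X Y Z : flow_dom_at b s ->
  'D_Z (flow_pair X Y : E -> R^o) s =
  dpairing (metric b) (flow_coord b s) ('D_Z (flow_coord b) s) ('D_X (flow_coord b) s) ('D_Y (flow_coord b) s)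
  + pairing (metric b) (flow_coord b s) (flow_deriv2 b Z X s) ('D_Y (flow_coord b) s)
  + pairing (metric b) (flow_coord b s) ('D_X (flow_coord b) s) (flow_deriv2 b Z Y s).
Proof.
move=> hb; have oA := flow_dom_at_open (b := b).
transitivity ('D_Z (fun s => \sum_a \sum_c flow_deriv b X s a * metric_along b s a c * flow_deriv b Y s c : R^o) s).
  apply: near_eq_derive; apply: filterS (open_nbhs_nbhs (conj oA hb : open_nbhs s (flow_dom_at b))) => r hr.
  exact: flow_pair_sum.
have dX e Z' := @flow_deriv_diff b Z' e s hb.
have dm a c : differentiable (fun s => metric_along b s a c : R^o) s by have [] := flow_metric_C1 a c hb.
have dXm a c : differentiable ((fun s => flow_deriv b X s a : R^o) * (fun s => metric_along b s a c : R^o) * (fun s => flow_deriv b Y s c : R^o)) s.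
  exact: (differentiableM (differentiableM (dX a X) (dm a c)) (dX c Y)).
have dS a : differentiable (fun s => \sum_c flow_deriv b X s a * metric_along b s a c * flow_deriv b Y s c : R^o) s.
  rewrite (_ : (fun s => _) = \sum_c ((fun s => flow_deriv b X s a : R^o) * (fun s => metric_along b s a c : R^o) * (fun s => flow_deriv b Y s c : R^o))).
    by apply: differentiable_sum => c; exact: dXm.
  by apply/funext => r; rewrite fct_sumE.
rewrite [LHS](derive_bigsum Z dS) /dpairing /pairing -!big_split; apply: eq_bigr => a _ /=.
rewrite [LHS](derive_bigsum Z (F := fun c s => flow_deriv b X s a * metric_along b s a c * flow_deriv b Y s c) (dXm a)).
rewrite -!big_split; apply: eq_bigr => c _ /=.
rewrite [LHS](derive_prod3 Z (dX a X) (dm a c) (dX c Y)).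
have add3 (a1 a2 a3 b1 b2 b3 : R) : a1 = b2 -> a2 = b1 -> a3 = b3 -> a1 + a2 + a3 = b1 + b2 + b3.
  by move=> -> -> ->; rewrite [b2 + b1]addrC.
have mul3 (a1 a2 a3 b1 b2 b3 : R) : a1 = b1 -> a2 = b2 -> a3 = b3 -> a1 * a2 * a3 = b1 * b2 * b3.
  by move=> -> -> ->.
apply: add3; apply: mul3.
- exact: (esym (flow_deriv2E b Z X s a)).
- exact: erefl.
- exact: (esym (flow_derivE Y c hb)).
- exact: (esym (flow_derivE X a hb)).
- exact: (flow_metric_derive Z a c hb).
- exact: (esym (flow_derivE Y c hb)).
- exact: (esym (flow_derivE X a hb)).
- exact: erefl.
- exact: (esym (flow_deriv2E b Z Y s c)).
Qed.

Definition time_dir : E := (1, 0).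

Definition space_dir (i : 'I_2) : E := (0, basis_vec i).

(** Koszul's formula for the connection along u: the Christoffel symbols of the target come
    from differentiating its metric along u, and second derivatives commute. *)
Lemma koszul b s X Y Z : flow_dom_at b s ->
  2^-1 * ('D_X (flow_pair Y Z : E -> R^o) s + 'D_Y (flow_pair X Z : E -> R^o) s - 'D_Z (flow_pair X Y : E -> R^o) s) =
  pairing (metric b) (flow_coord b s)
    (flow_deriv2 b X Y s + \row_a \sum_e \sum_c christoffel (metric b) (flow_coord b s) a e c
        * ('D_X (flow_coord b) s) 0 e * ('D_Y (flow_coord b) s) 0 c) ('D_Z (flow_coord b) s).
Proof.
move=> hb; have hi := flow_coord_img hb.
have hs : (metric b (flow_coord b s))^T = metric b (flow_coord b s) by exact: Defs.metric_sym.
have hu : metric b (flow_coord b s) \in unitmx by exact: metric_unitmx.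
have ds e a c : 'D_(basis_vec e) (fun w => metric b w a c : R^o) (flow_coord b s) =
    'D_(basis_vec e) (fun w => metric b w c a : R^o) (flow_coord b s).
  apply: near_eq_derive; apply: filterS (open_nbhs_nbhs (conj (@img_open _ _ N b) hi : open_nbhs _ (img b))) => w hw.
  by rewrite -[in LHS](Defs.metric_sym hw) mxE.
rewrite [RHS]pairingDl (pairing_christoffel hs hu ds).
have alg (q2 q3 A B C D1 D2 D3 k1 : R) : A = D1 + k1 + q2 -> B = D2 + k1 + q3 -> C = D3 + q2 + q3 ->
  2^-1 * (A + B - C) = k1 + 2^-1 * (D1 + D2 - D3) by lra.
apply: (alg (pairing (metric b) (flow_coord b s) (flow_deriv2 b X Z s) ('D_Y (flow_coord b) s))
  (pairing (metric b) (flow_coord b s) (flow_deriv2 b Y Z s) ('D_X (flow_coord b) s))).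
- rewrite [LHS](flow_pair_derive Y Z X hb).
  by congr (_ + _ + _); exact: pairingC.
- rewrite [LHS](flow_pair_derive X Z Y hb) (flow_deriv2C Y X hb).
  by congr (_ + _ + _); exact: pairingC.
- rewrite [LHS](flow_pair_derive X Y Z hb) (flow_deriv2C Z X hb) (flow_deriv2C Z Y hb).
  by congr (_ + _ + _); exact: pairingC.
Qed.

Lemma flow_tension b s : flow_dom_at b s ->
  'D_time_dir (flow_coord b) s =
  \sum_i \sum_j invmx (metric x s.2) i j *:
    (flow_deriv2 b (space_dir i) (space_dir j) s
     - \sum_k christoffel (metric x) s.2 k i j *: 'D_(space_dir k) (flow_coord b) s
     + \row_a \sum_e \sum_c christoffel (metric b) (flow_coord b s) a e c
        * ('D_(space_dir i) (flow_coord b) s) 0 e * ('D_(space_dir j) (flow_coord b) s) 0 c).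
Proof.
case: s => t z hb; have [/= t0 tT xz bz] := hb.
rewrite /time_dir [LHS]derive_slice_fst -[LHS]derive1E [LHS](uflow t0 tT xz bz).
have n1 : \forall w \near z, flow_dom_at b ((t, w) : E).
  have : nbhs ((t, z) : E) (flow_dom_at b) by exact: open_nbhs_nbhs (conj (flow_dom_at_open (b := b)) hb).
  have cp : {for z, continuous (fun w => (t, w) : E)} by apply: differentiable_continuous; exact: slice_differentiable.
  by move=> /cp.
have Dk k : 'D_(space_dir k) (flow_coord b) (t, z) = 'D_(basis_vec k) (chart b \o u t \o ichart x) z.
  exact: derive_slice_snd.
rewrite /tension; apply: eq_bigr => i _; apply: eq_bigr => j _; congr (_ *: _).
apply/rowP => a; rewrite [LHS]mxE [RHS]mxE [X in _ = X + _]mxE.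
congr (_ + _); last first.
  rewrite [RHS]mxE; apply: eq_bigr => e _; apply: eq_bigr => c _.
  by rewrite (Dk i) (Dk j).
congr (_ + _).
  rewrite [RHS]flow_deriv2E.
  have -> : 'D_(space_dir i) (fun s => flow_deriv b (space_dir j) s a : R^o) (t, z) =
     'D_(basis_vec i) (fun w => flow_deriv b (space_dir j) (t, w) a : R^o) z by exact: derive_slice_snd.
  have dw : derivable (fun w => 'D_(space_dir j) (flow_coord b) (t, w)) z (basis_vec i).
    apply: diff_derivable; apply: (@differentiable_comp _ _ _ _ (fun w => (t, w) : E) ('D_(space_dir j) (flow_coord b))).
      exact: slice_differentiable.
    exact: smooth_on_diff (smooth_on_derive (space_dir j) (@usmooth x b)) hb.
  have -> : (fun w => 'D_(basis_vec j) (chart b \o u t \o ichart x) w) =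
      (fun w => 'D_(space_dir j) (flow_coord b) (t, w)).
    by apply/funext => w; apply/esym; exact: derive_slice_snd.
  rewrite -[LHS](derive_coord a dw); apply: near_eq_derive.
  by apply: filterS n1 => w hw; exact: (flow_derivE (space_dir j) a hw).
rewrite mxE; congr (- _); rewrite summxE; apply: eq_bigr => k _.
by rewrite mxE (Dk k).
Qed.

(** The flow equation paired with D_Z u. By Koszul's formula only derivatives of the inner
    products <D_X u, D_Y u> remain, and the target enters only through these. *)
Lemma flow_identity s Z : flow_dom s ->
  flow_pair time_dir Z s =
  \sum_i \sum_j invmx (metric x s.2) i j *
   (2^-1 * ('D_(space_dir i) (flow_pair (space_dir j) Z : E -> R^o) s
     + 'D_(space_dir j) (flow_pair (space_dir i) Z : E -> R^o) s
     - 'D_Z (flow_pair (space_dir i) (space_dir j) : E -> R^o) s)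
    - \sum_k christoffel (metric x) s.2 k i j * flow_pair (space_dir k) Z s).
Proof.
move=> hs; have hb := flow_dom_self hs; set b := u _ _ in hb.
have P X Y : flow_pair X Y s = pairing (metric b) (flow_coord b s) ('D_X (flow_coord b) s) ('D_Y (flow_coord b) s).
  by rewrite [LHS](flow_pair_local X Y hb) -[LHS](pairing_mx (metric b)).
rewrite [LHS]P (flow_tension hb) pairing_suml; apply: eq_bigr => i _.
rewrite pairing_suml; apply: eq_bigr => j _; rewrite pairingZl; congr (_ * _).
rewrite (koszul (space_dir i) (space_dir j) Z hb) !pairingDl.
rewrite (_ : \sum_k _ = pairing (metric b) (flow_coord b s) (\sum_k christoffel (metric x) s.2 k i j *: 'D_(space_dir k) (flow_coord b) s) ('D_Z (flow_coord b) s)).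
  rewrite -scaleN1r pairingZl mulN1r.
  have alg (a c d : R) : a - c + d = a + d - c by ring.
  exact: alg.
rewrite pairing_suml; apply: eq_bigr => k _; rewrite pairingZl; congr (_ * _); exact: P.
Qed.

End Flow.


(** * The weight of the conformal structure *)

Notation e0 := (ord0 : 'I_2).
Notation e1 := (lift ord0 ord0 : 'I_2).

Section Sqrt.
Context {R : realType} {V : normedModType R} (A : set V).
Hypothesis oA : open A.
Variable f : V -> R^o.
Hypothesis f_gt0 : forall z, A z -> 0 < f z.

Lemma derive_sqrt_comp z v : A z -> differentiable f z ->
  differentiable (fun z => Num.sqrt (f z) : R^o) z /\
  'D_v (fun z => Num.sqrt (f z) : R^o) z = 'D_v f z / (2 * Num.sqrt (f z)).
Proof.
move=> Az df.
have ds : is_derive (f z : R^o) 1 (Num.sqrt : R^o -> R^o) ((2 * Num.sqrt (f z))^-1) by exact: is_derive1_sqrt (f_gt0 Az).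
have dd : differentiable (Num.sqrt : R^o -> R^o) (f z) by apply/derivable1_diffP; exact: ex_derive.
have dc : differentiable ((Num.sqrt : R^o -> R^o) \o f) z by exact: differentiable_comp.
split; first exact: dc.
transitivity ('d (Num.sqrt : R^o -> R^o) (f z) ('D_v f z)).
  by rewrite (deriveE v df) [LHS](deriveE v dc) (diff_comp df dd).
have -> : 'D_v f z = 'D_v f z *: (1 : R^o) by rewrite [RHS]mulr1.
rewrite linearZ /= -(deriveE _ dd) (@derive_val _ _ _ _ _ _ _ ds).
by rewrite scaler1.
Qed.

Lemma C1_on_sqrt : C1_on A f -> C1_on A (fun z => Num.sqrt (f z) : R^o).
Proof.
move=> cf z Az; have [df cdf] := cf z Az.
split; first by have [] := derive_sqrt_comp 0 Az df.
have s0 y : A y -> 2 * Num.sqrt (f y) != 0.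
  by move=> Ay; rewrite mulf_neq0 ?pnatr_eq0 // gt_eqF // sqrtr_gt0 f_gt0.
move=> v; have e : \forall y \near z, 'D_v f y / (2 * Num.sqrt (f y)) = 'D_v (fun z => Num.sqrt (f z) : R^o) y.
  apply: filterS (open_nbhs_nbhs (conj oA Az)) => y Ay.
  by have [dy _] := cf y Ay; have [_ ->] := derive_sqrt_comp v Ay dy.
rewrite /prop_for /continuous_at -(nbhs_singleton e).
apply: (cvg_trans (near_eq_cvg e)).
apply: cvgM; first exact: cdf.
apply: cvgV; first exact: s0.
apply: cvgM; first exact: cvg_cst.
apply: (continuous_comp (f := f)); first exact: differentiable_continuous.
exact: sqrt_continuous.
Qed.

End Sqrt.

Lemma inv2E (R : realType) (M : 'M[R]_2) : \det M != 0 ->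
  [/\ invmx M e0 e0 = M e1 e1 / \det M, invmx M e0 e1 = - M e0 e1 / \det M,
      invmx M e1 e0 = - M e1 e0 / \det M & invmx M e1 e1 = M e0 e0 / \det M].
Proof.
move=> d0.
have dE := det2E M; set D := \det M in d0 dE *.
pose B : 'M[R]_2 := \matrix_(i, j) ((if i == j then M (if i == e0 then e1 else e0) (if i == e0 then e1 else e0) else - M i j) / D).
have MB : M *m B = 1%:M.
  have dn : M e0 e0 * M e1 e1 - M e0 e1 * M e1 e0 != 0 by rewrite -dE.
  apply/matrixP => i j; rewrite mxE big_ord2 [B _ _]mxE [B _ _]mxE [RHS]mxE dE.
  by case: (ord2P i) => ->; case: (ord2P j) => -> /=; field.
have Mu : M \in unitmx by rewrite unitmxE unitfE.
have -> : invmx M = B by rewrite -[LHS]mulmx1 -MB mulKmx.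
by rewrite !mxE.
Qed.

(** The three coefficients are free parameters, so identities between rational functions of
    a positive definite form and of the root of its determinant become identities between
    rational functions. *)
Lemma cholesky2 (R : realType) (a b c : R) : 0 < a -> 0 < a * c - b ^+ 2 ->
  exists p r s, [/\ 0 < p, 0 < s, a = p ^+ 2, b = p * r & c = r ^+ 2 + s ^+ 2] /\
    Num.sqrt (a * c - b ^+ 2) = p * s.
Proof.
move=> a0 d0; pose p := Num.sqrt a; pose d := Num.sqrt (a * c - b ^+ 2).
have p0 : 0 < p by rewrite sqrtr_gt0.
have dd0 : 0 < d by rewrite sqrtr_gt0.
have pa : p ^+ 2 = a by rewrite sqr_sqrtr // ltW.
have dE : d ^+ 2 = a * c - b ^+ 2 by rewrite sqr_sqrtr // ltW.
have pn : p != 0 by rewrite gt_eqF.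
exists p, (b / p), (d / p); split; [split|].
- by [].
- by rewrite divr_gt0.
- by rewrite pa.
- by field.
- rewrite !expr_div_n -mulrDl dE pa; have an : a != 0 by rewrite gt_eqF.
  by field.
- by rewrite -/d; field.
Qed.

Section ConformalWeight.
Context {R : realType} (S : riemannian_manifold R 2) (x : S).
Local Notation g := (metric x).

Definition dens z : R := Num.sqrt (\det (g z)).

(** This matrix depends on the conformal class only and has determinant 1. *)
Definition conf i j z : R := dens z * invmx (g z) i j.

Lemma metric_sym01 z : img x z -> g z e1 e0 = g z e0 e1.
Proof. by move=> xz; rewrite -[in LHS](Defs.metric_sym xz) mxE. Qed.

Lemma det_metricE z : img x z -> \det (g z) = g z e0 e0 * g z e1 e1 - g z e0 e1 ^+ 2.
Proof. by move=> xz; rewrite det2E metric_sym01. Qed.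

Lemma metric_diag_gt0 z i : img x z -> 0 < g z i i.
Proof.
move=> xz; have b0 : (basis_vec i : 'rV[R]_2) != 0.
  by apply/eqP => /rowP/(_ i)/eqP; rewrite !mxE !eqxx oner_eq0.
have := metric_pos xz b0.
by rewrite /basis_vec -rowE trmx_delta -colE !mxE.
Qed.

Lemma dens_gt0 z : img x z -> 0 < dens z.
Proof. by move=> xz; rewrite sqrtr_gt0 det_metric_gt0. Qed.

Lemma dens_sqr z : img x z -> dens z ^+ 2 = \det (g z).
Proof. by move=> xz; rewrite sqr_sqrtr // ltW // det_metric_gt0. Qed.

Lemma metric_cholesky z : img x z -> exists p r s, [/\ 0 < p, 0 < s, dens z = p * s &
  [/\ g z e0 e0 = p ^+ 2, g z e0 e1 = p * r, g z e1 e0 = p * r & g z e1 e1 = r ^+ 2 + s ^+ 2]].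
Proof.
move=> xz; have d0 := det_metric_gt0 xz; rewrite (det_metricE xz) in d0.
have [p [r [s [[p0 s0 h1 h2 h3] h4]]]] := cholesky2 (metric_diag_gt0 e0 xz) d0.
exists p, r, s; split=> //; first by rewrite /dens (det_metricE xz).
by split=> //; rewrite metric_sym01.
Qed.

Lemma confE z : img x z ->
  [/\ conf e0 e0 z = g z e1 e1 / dens z, conf e0 e1 z = - (g z e0 e1 / dens z),
      conf e1 e0 z = - (g z e0 e1 / dens z) & conf e1 e1 z = g z e0 e0 / dens z].
Proof.
move=> xz; have d0 := dens_gt0 xz; have dn : dens z != 0 by rewrite gt_eqF.
have detn : \det (g z) != 0 by rewrite gt_eqF // det_metric_gt0.
have [h1 h2 h3 h4] := inv2E detn; rewrite /conf h1 h2 h3 h4 -(dens_sqr xz) (metric_sym01 xz).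
by split; field.
Qed.

Lemma metric_C1 i j : C1_on (img x) (fun z => g z i j : R^o).
Proof. by apply: C1_on_smooth; exact: metric_smooth. Qed.

Lemma dens_C1 : C1_on (img x) (dens : 'rV[R]_2 -> R^o).
Proof.
have oA := @img_open _ _ S x.
apply: (C1_on_sqrt oA) => [z|]; first exact: det_metric_gt0.
have h := C1_onB oA (C1_onM oA (metric_C1 e0 e0) (metric_C1 e1 e1)) (C1_onM oA (metric_C1 e0 e1) (metric_C1 e1 e0)).
by apply: (C1_on_eq oA _ h) => z xz; rewrite det2E.
Qed.

Lemma densV_C1 : C1_on (img x) (fun z => (dens z)^-1 : R^o).
Proof.
apply: (C1_onV (@img_open _ _ S x)) dens_C1 => z xz; by rewrite gt_eqF // dens_gt0.
Qed.

Lemma conf_C1 i j : C1_on (img x) (conf i j : 'rV[R]_2 -> R^o).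
Proof.
have oA := @img_open _ _ S x.
have h k l : C1_on (img x) (fun z => g z k l * (dens z)^-1 : R^o) by exact: (C1_onM oA (metric_C1 k l) densV_C1).
have hN k l : C1_on (img x) (fun z => -1 * (g z k l * (dens z)^-1) : R^o) by exact: (C1_onZ oA (-1) (h k l)).
case: (ord2P i) => ->; case: (ord2P j) => ->.
- by apply: (C1_on_eq oA _ (h e1 e1)) => z xz; have [-> _ _ _] := confE xz.
- by apply: (C1_on_eq oA _ (hN e0 e1)) => z xz; have [_ -> _ _] := confE xz; rewrite mulN1r.
- by apply: (C1_on_eq oA _ (hN e0 e1)) => z xz; have [_ _ -> _] := confE xz; rewrite mulN1r.
- by apply: (C1_on_eq oA _ (h e0 e0)) => z xz; have [_ _ _ ->] := confE xz.
Qed.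

End ConformalWeight.

Section ConformalDivergence.
Context {R : realType} (S : riemannian_manifold R 2) (x : S).
Local Notation g := (metric x).
Local Notation Dg k i j z := ('D_(basis_vec k) (fun w => g w i j : R^o) z).

Lemma derive_quotient (V : normedModType R) (f h : V -> R^o) z v : differentiable f z -> differentiable h z ->
  h z != 0 -> 'D_v (fun z => f z / h z : R^o) z = ('D_v f z * h z - f z * 'D_v h z) / h z ^+ 2.
Proof.
move=> df dh h0; have dV := differentiableV dh h0.
have e := deriveM (diff_derivable (v := v) df) (diff_derivable (v := v) dV).
rewrite [LHS](e : _ = f z * 'D_v (fun z => (h z)^-1 : R^o) z + (h z)^-1 * 'D_v f z).
rewrite (deriveV h0 (diff_derivable (v := v) dh)).
have alg (a b a' b' : R) : b != 0 -> a * (- b ^- 2 * b') + b^-1 * a' = (a' * b - a * b') / b ^+ 2.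
  by move=> b0; field.
exact: alg.
Qed.

Lemma metric_diffble i j z : img x z -> differentiable (fun w => g w i j : R^o) z.
Proof. by move=> xz; have [] := metric_C1 (x := x) i j xz. Qed.

Lemma dens_diffble z : img x z -> differentiable (dens x : 'rV[R]_2 -> R^o) z.
Proof. by move=> xz; have [] := dens_C1 (x := x) xz. Qed.

Lemma near_img z : img x z -> \forall w \near z, img x w.
Proof. by move=> xz; apply: open_nbhs_nbhs; split=> //; exact: img_open. Qed.

Lemma derive_metric_sym k z : img x z -> Dg k e1 e0 z = Dg k e0 e1 z.
Proof.
by move=> xz; apply: near_eq_derive; apply: filterS (near_img xz) => w; exact: metric_sym01.
Qed.

Lemma derive_dens k z : img x z ->
  'D_(basis_vec k) (dens x : 'rV[R]_2 -> R^o) z =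
  (Dg k e0 e0 z * g z e1 e1 + g z e0 e0 * Dg k e1 e1 z - 2 * g z e0 e1 * Dg k e0 e1 z) / (2 * dens x z).
Proof.
move=> xz; have dM i j := diff_derivable (v := basis_vec k) (metric_diffble i j xz).
pose f : 'rV[R]_2 -> R^o := (fun w => g w e0 e0 : R^o) * (fun w => g w e1 e1 : R^o) - (fun w => g w e0 e1 : R^o) * (fun w => g w e0 e1 : R^o).
have fE w : img x w -> f w = \det (g w) by move=> xw; rewrite (det_metricE xw) expr2.
have df : differentiable f z by exact: differentiableB (differentiableM (metric_diffble e0 e0 xz) (metric_diffble e1 e1 xz)) (differentiableM (metric_diffble e0 e1 xz) (metric_diffble e0 e1 xz)).
have f0 w : img x w -> 0 < f w by move=> xw; rewrite (fE _ xw); exact: det_metric_gt0.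
have [_ h] := derive_sqrt_comp f0 (basis_vec k) xz df.
transitivity ('D_(basis_vec k) (fun z => Num.sqrt (f z) : R^o) z).
  by apply: near_eq_derive; apply: filterS (near_img xz) => w xw; rewrite (fE _ xw).
rewrite h [in RHS]/dens -(fE _ xz); congr (_ / _).
rewrite /f [LHS]deriveB; [|exact: derivableM|exact: derivableM].
rewrite !deriveM //.
have alg (a c b a' c' b' : R) : a * c' + c * a' - (b * b' + b * b') = a' * c + a * c' - 2 * b * b' by ring.
exact: alg.
Qed.

Lemma derive_conf k z : img x z ->
  let d := dens x z in let dd := 'D_(basis_vec k) (dens x : 'rV[R]_2 -> R^o) z in
  [/\ 'D_(basis_vec k) (conf x e0 e0 : 'rV[R]_2 -> R^o) z = (Dg k e1 e1 z * d - g z e1 e1 * dd) / d ^+ 2,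
      'D_(basis_vec k) (conf x e0 e1 : 'rV[R]_2 -> R^o) z = - ((Dg k e0 e1 z * d - g z e0 e1 * dd) / d ^+ 2),
      'D_(basis_vec k) (conf x e1 e0 : 'rV[R]_2 -> R^o) z = - ((Dg k e0 e1 z * d - g z e0 e1 * dd) / d ^+ 2)
    & 'D_(basis_vec k) (conf x e1 e1 : 'rV[R]_2 -> R^o) z = (Dg k e0 e0 z * d - g z e0 e0 * dd) / d ^+ 2].
Proof.
move=> xz d dd; have dn : d != 0 by rewrite gt_eqF // dens_gt0.
have q i j := derive_quotient (basis_vec k) (metric_diffble i j xz) (dens_diffble xz) dn.
have dq i j : derivable (fun w => g w i j / dens x w : R^o) z (basis_vec k).
  by apply: diff_derivable; exact: differentiableM (metric_diffble i j xz) (differentiableV (dens_diffble xz) dn).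
have qN i j : 'D_(basis_vec k) (fun w => - (g w i j / dens x w) : R^o) z = - ((Dg k i j z * d - g z i j * dd) / d ^+ 2).
  by rewrite -(q i j) -[RHS](deriveN (dq i j)).
have near4 i j f : (forall w, img x w -> conf x i j w = f w) ->
   'D_(basis_vec k) (conf x i j : 'rV[R]_2 -> R^o) z = 'D_(basis_vec k) (f : 'rV[R]_2 -> R^o) z.
  by move=> h; apply: near_eq_derive; apply: filterS (near_img xz).
split.
- by rewrite -(q e1 e1); apply: near4 => w /confE[].
- by rewrite -(qN e0 e1); apply: near4 => w /confE[].
- by rewrite -(qN e0 e1); apply: near4 => w /confE[].
- by rewrite -(q e0 e0); apply: near4 => w /confE[].
Qed.

(** Up to the area density, both sides are the Laplacian of the k-th coordinate. *)
Lemma conf_divergence k z : img x z ->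
  'D_(basis_vec e0) (conf x e0 k : 'rV[R]_2 -> R^o) z + 'D_(basis_vec e1) (conf x e1 k : 'rV[R]_2 -> R^o) z =
  - \sum_i \sum_j conf x i j z * christoffel g z k i j.
Proof.
move=> xz; have [c00 c01 c10 c11] := confE xz.
have [a00 a01 _ _] := derive_conf e0 xz; have [_ _ b10 b11] := derive_conf e1 xz.
have dd0 := derive_dens e0 xz; have dd1 := derive_dens e1 xz.
have detn : \det (g z) != 0 by rewrite gt_eqF // det_metric_gt0.
have [i00 i01 i10 i11] := inv2E detn.
rewrite -(dens_sqr xz) in i00 i01 i10 i11.
have [p [r [s [p0 s0 dE [h00 h01 h10 h11]]]]] := metric_cholesky xz.
have pn : p != 0 by rewrite gt_eqF.
have sn : s != 0 by rewrite gt_eqF.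
have s0' := derive_metric_sym e0 xz; have s1' := derive_metric_sym e1 xz.
rewrite !big_ord2 c00 c01 c10 c11 /christoffel !big_ord2 s0' s1'.
case: (ord2P k) => ->; rewrite ?(a00, a01, b10, b11) ?(i00, i01, i10, i11) dd0 dd1 dE h00 h01 ?h10 h11.
- move: (Dg e0 e0 e0 z) (Dg e0 e0 e1 z) (Dg e0 e1 e1 z) (Dg e1 e0 e0 z) (Dg e1 e0 e1 z) (Dg e1 e1 e1 z) => a b c a' b' c'.
  by field; rewrite pn sn.
- move: (Dg e0 e0 e0 z) (Dg e0 e0 e1 z) (Dg e0 e1 e1 z) (Dg e1 e0 e0 z) (Dg e1 e0 e1 z) (Dg e1 e1 e1 z) => a b c a' b' c'.
  by field; rewrite pn sn.
Qed.

(** The determinant of the conformal weight is constant. *)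
Lemma derive_conf_trace k z : img x z ->
  \sum_i \sum_j 'D_(basis_vec k) (conf x i j : 'rV[R]_2 -> R^o) z * g z i j = 0.
Proof.
move=> xz; have [a00 a01 a10 a11] := derive_conf k xz; have dd := derive_dens k xz.
have [p [r [s [p0 s0 dE [h00 h01 h10 h11]]]]] := metric_cholesky xz.
have pn : p != 0 by rewrite gt_eqF.
have sn : s != 0 by rewrite gt_eqF.
rewrite !big_ord2 a00 a01 a10 a11 dd dE h00 h01 h10 h11.
move: (Dg k e0 e0 z) (Dg k e0 e1 z) (Dg k e1 e1 z) => a b c.
by field; rewrite pn sn.
Qed.

End ConformalDivergence.

(** * The local energy identity *)

Section DeriveRules.
Context {R : realType} {V : normedModType R}.
Implicit Types f h : V -> R^o.

Lemma derive_mul f h z v : differentiable f z -> differentiable h z ->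
  'D_v (fun z => f z * h z : R^o) z = 'D_v f z * h z + f z * 'D_v h z.
Proof.
move=> df dh; rewrite [LHS](deriveM (diff_derivable (v := v) df) (diff_derivable (v := v) dh)).
have alg (a b a' b' : R) : a * b' + b * a' = a' * b + a * b' by ring.
exact: alg.
Qed.

Lemma derive_sub f h z v : differentiable f z -> differentiable h z ->
  'D_v (fun z => f z - h z : R^o) z = 'D_v f z - 'D_v h z.
Proof. by move=> df dh; exact: (deriveB (diff_derivable (v := v) df) (diff_derivable (v := v) dh)). Qed.

End DeriveRules.

(** The Christoffel terms of the flow equation are absorbed by the derivatives of the
    conformal weight, through [conf_divergence]. *)
Lemma divergence_algebra (R : realFieldType) (Dc c Dp DZ : 'I_2 -> 'I_2 -> R) (p : 'I_2 -> R) (Gam : 'I_2 -> 'I_2 -> 'I_2 -> R) :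
  c e1 e0 = c e0 e1 -> (forall k, Dc e0 k + Dc e1 k = - \sum_i \sum_j c i j * Gam k i j) ->
  \sum_i \sum_j (Dc i j * p j + c i j * Dp i j) =
  \sum_i \sum_j (c i j * (2^-1 * (Dp i j + Dp j i - DZ i j)) - \sum_k c i j * Gam k i j * p k)
  + 2^-1 * \sum_i \sum_j c i j * DZ i j.
Proof.
move=> c10 h; have h0 := h e0; have h1 := h e1; rewrite !big_ord2 !c10 in h0 h1 *.
have solve (a b X : R) : a + b = - X -> a = - b - X by move=> h'; lra.
by rewrite (solve _ _ _ h0) (solve _ _ _ h1); field.
Qed.

Lemma energy_algebra (R : realFieldType) (ph A : R) (dph F DF X B C : 'I_2 -> R) (DX W dW : 'I_2 -> 'I_2 -> R) :
  \sum_i DF i = A -> (forall l, \sum_i dW l i = B l - 2^-1 * C l) -> \sum_i dph i * F i = \sum_l X l * B l ->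
  \sum_i (dph i * F i + ph * DF i - \sum_l (DX i l * W l i + X l * dW l i)) =
  ph * A - (\sum_i \sum_l DX i l * W l i - 2^-1 * \sum_l X l * C l).
Proof.
move=> <- hW hF; have := hW e0; have := hW e1; move: hF; rewrite !big_ord2 => hF h1 h0.
have solve (a b c : R) : a + b = c -> a = c - b by move=> h'; lra.
by rewrite (solve _ _ _ h0) (solve _ _ _ h1) (solve _ _ _ hF); field.
Qed.

Section EnergyIdentity.
#[local] Opaque derive.
Context {R : realType} (S : riemannian_manifold R 2) (T : \bar R) (x : S).
Local Notation E := (R^o * 'rV[R]_2)%type.
Local Notation td := (@time_dir R).
Local Notation sd := (@space_dir R).
Local Notation g := (metric x).
Local Notation bv := (@basis_vec R 2).
Variable P : E -> E -> E -> R^o.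
Hypothesis P_C1 : forall X Y, C1_on (flow_dom T x) (P X Y).
Hypothesis P_C : forall X Y s, flow_dom T x s -> P X Y s = P Y X s.
Hypothesis P_identity : forall s Z, flow_dom T x s ->
  P td Z s = \sum_i \sum_j invmx (g s.2) i j *
   (2^-1 * ('D_(sd i) (P (sd j) Z) s + 'D_(sd j) (P (sd i) Z) s - 'D_Z (P (sd i) (sd j)) s)
    - \sum_k christoffel g s.2 k i j * P (sd k) Z s).

(** A density with respect to the coordinate area. *)
Definition energy_density (s : E) : R := 2^-1 * \sum_i \sum_j conf x i j s.2 * P (sd i) (sd j) s.

Section TimeSlice.
Variable t : R.
Hypotheses (t0 : 0 < t) (tT : (t%:E < T)%E).
Local Notation oA := (@img_open _ _ S x).

Lemma flow_dom_slice z : img x z -> flow_dom T x (t, z).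
Proof. by split. Qed.

Lemma slice_C1 (f : E -> R^o) : C1_on (flow_dom T x) f -> C1_on (img x) (fun z => f (t, z) : R^o).
Proof.
move=> cf z xz; have [df cdf] := cf _ (flow_dom_slice xz).
have ds : differentiable (fun w => (t, w) : E) z by exact: slice_differentiable.
split; first exact: (differentiable_comp ds df).
move=> v; rewrite (_ : 'D_v _ = fun w => 'D_((0, v) : E) f (t, w)); last first.
  by apply/funext => w; apply/esym; exact: derive_slice_snd.
exact: (continuous_comp (differentiable_continuous ds) (cdf _)).
Qed.

Lemma slice_derive (f : E -> R^o) k z : 'D_(bv k) (fun w => f (t, w) : R^o) z = 'D_(sd k) f (t, z).
Proof. by apply/esym; exact: derive_slice_snd. Qed.

Definition flux Z i z : R := \sum_j conf x i j z * P (sd j) Z (t, z).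

Lemma flux_C1 Z i : C1_on (img x) (flux Z i : 'rV[R]_2 -> R^o).
Proof.
apply: C1_on_sum => [|j]; first exact: oA.
exact: (C1_onM oA (conf_C1 (x := x) i j) (slice_C1 (@P_C1 (sd j) Z))).
Qed.

Lemma confC i j z : img x z -> conf x i j z = conf x j i z.
Proof.
by move=> /confE[_ h1 h2 _]; case: (ord2P i) => ->; case: (ord2P j) => -> //; rewrite h1 h2.
Qed.

Lemma diffble_slice X Y z : img x z -> differentiable (fun w => P X Y (t, w) : R^o) z.
Proof. by move=> xz; have [] := slice_C1 (@P_C1 X Y) xz. Qed.

Lemma diffble_conf i j z : img x z -> differentiable (conf x i j : 'rV[R]_2 -> R^o) z.
Proof. by move=> xz; have [] := conf_C1 (x := x) i j xz. Qed.

Lemma diffble_term Z i j z : img x z -> differentiable (fun w => conf x i j w * P (sd j) Z (t, w) : R^o) z.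
Proof. by move=> xz; exact: (differentiableM (diffble_conf i j xz) (diffble_slice (sd j) Z xz)). Qed.

Lemma derive_flux Z i k z : img x z -> 'D_(bv k) (flux Z i : 'rV[R]_2 -> R^o) z =
  \sum_j ('D_(bv k) (conf x i j : 'rV[R]_2 -> R^o) z * P (sd j) Z (t, z)
    + conf x i j z * 'D_(sd k) (P (sd j) Z) (t, z)).
Proof.
move=> xz; rewrite [LHS](derive_bigsum (bv k) (F := fun j w => conf x i j w * P (sd j) Z (t, w)) (fun j => diffble_term Z i j xz)).
apply: eq_bigr => j _; rewrite [LHS](derive_mul (bv k) (diffble_conf i j xz) (diffble_slice (sd j) Z xz)).
by rewrite slice_derive.
Qed.

Lemma divergence_flux Z z : img x z ->
  \sum_i 'D_(bv i) (flux Z i : 'rV[R]_2 -> R^o) z =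
  dens x z * P td Z (t, z) + 2^-1 * \sum_i \sum_j conf x i j z * 'D_Z (P (sd i) (sd j)) (t, z).
Proof.
move=> xz; rewrite (P_identity Z (flow_dom_slice xz)).
rewrite (eq_bigr _ (fun i _ => derive_flux Z i i xz)) /=.
have E1 i j : dens x z * (invmx (g z) i j * (2^-1 * ('D_(sd i) (P (sd j) Z) (t, z) + 'D_(sd j) (P (sd i) Z) (t, z)
  - 'D_Z (P (sd i) (sd j)) (t, z)) - \sum_k christoffel g z k i j * P (sd k) Z (t, z)))
  = conf x i j z * (2^-1 * ('D_(sd i) (P (sd j) Z) (t, z) + 'D_(sd j) (P (sd i) Z) (t, z)
  - 'D_Z (P (sd i) (sd j)) (t, z))) - \sum_k conf x i j z * christoffel g z k i j * P (sd k) Z (t, z).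
  rewrite mulrA -/(conf x i j z) mulrBr; congr (_ - _); rewrite mulr_sumr.
  by apply: eq_bigr => k _; rewrite mulrA.
rewrite mulr_sumr (eq_bigr _ (fun i _ => etrans (mulr_sumr _ _ _ _) (eq_bigr _ (fun j _ => E1 i j)))).
exact: (@divergence_algebra R (fun i j => 'D_(bv i) (conf x i j : _ -> R^o) z) (fun i j => conf x i j z)
  (fun i j => 'D_(sd i) (P (sd j) Z) (t, z)) (fun i j => 'D_Z (P (sd i) (sd j)) (t, z))
  (fun j => P (sd j) Z (t, z)) (christoffel g z) (confC e1 e0 xz) (fun k => conf_divergence k xz)).
Qed.

(** The stress-energy tensor with one index raised by the conformal weight. *)
Definition stress_flux l i z : R := flux (sd l) i z - (i == l)%:R * energy_density (t, z).

Lemma energy_density_C1 : C1_on (img x) (fun z => energy_density (t, z) : R^o).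
Proof.
apply: C1_onZ oA _ _ _; apply: C1_on_sum => [|i]; first exact: oA.
apply: C1_on_sum => [|j]; first exact: oA.
exact: (C1_onM oA (conf_C1 (x := x) i j) (slice_C1 (@P_C1 (sd i) (sd j)))).
Qed.

Lemma stress_flux_C1 l i : C1_on (img x) (stress_flux l i : 'rV[R]_2 -> R^o).
Proof. exact: (C1_onB oA (@flux_C1 (sd l) i) (C1_onZ oA (i == l)%:R energy_density_C1)). Qed.

Lemma derive_density k z : img x z -> 'D_(bv k) (fun z => energy_density (t, z) : R^o) z =
  2^-1 * \sum_i \sum_j ('D_(bv k) (conf x i j : 'rV[R]_2 -> R^o) z * P (sd i) (sd j) (t, z)
    + conf x i j z * 'D_(sd k) (P (sd i) (sd j)) (t, z)).
Proof.
move=> xz.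
have dt i j : differentiable (fun w => conf x i j w * P (sd i) (sd j) (t, w) : R^o) z.
  exact: (differentiableM (diffble_conf i j xz) (diffble_slice (sd i) (sd j) xz)).
have ds i : differentiable (fun w => \sum_j conf x i j w * P (sd i) (sd j) (t, w) : R^o) z.
  rewrite (_ : (fun w => _) = \sum_j (fun w => conf x i j w * P (sd i) (sd j) (t, w) : R^o)).
    by apply: differentiable_sum => j; exact: dt.
  by apply/funext => r; rewrite fct_sumE.
have dS : differentiable (fun w => \sum_i \sum_j conf x i j w * P (sd i) (sd j) (t, w) : R^o) z.
  rewrite (_ : (fun w => _) = \sum_i (fun w => \sum_j conf x i j w * P (sd i) (sd j) (t, w) : R^o)).
    by apply: differentiable_sum => j; exact: ds.
  by apply/funext => r; rewrite fct_sumE.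
rewrite [LHS](derive_mul (bv k) (@differentiable_cst _ _ _ (2^-1 : R^o) z) dS) derive_cst mul0r add0r.
congr (_ * _); rewrite [LHS](derive_bigsum (bv k) ds); apply: eq_bigr => i _.
rewrite [LHS](derive_bigsum (bv k) (dt i)); apply: eq_bigr => j _.
by rewrite [LHS](derive_mul (bv k) (diffble_conf i j xz) (diffble_slice (sd i) (sd j) xz)) slice_derive.
Qed.

(** The divergence of the stress-energy tensor is the velocity paired with the differential
    of the map. The last term is the one that Christoffel symbols contribute to a covariant
    divergence. *)
Lemma divergence_stress l z : img x z ->
  \sum_i 'D_(bv i) (stress_flux l i : 'rV[R]_2 -> R^o) z =
  dens x z * P td (sd l) (t, z)
  - 2^-1 * \sum_i \sum_j 'D_(bv l) (conf x i j : 'rV[R]_2 -> R^o) z * P (sd i) (sd j) (t, z).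
Proof.
move=> xz.
have dF i : differentiable (flux (sd l) i : 'rV[R]_2 -> R^o) z by have [] := @flux_C1 (sd l) i z xz.
have dE : differentiable (fun z => energy_density (t, z) : R^o) z by have [] := energy_density_C1 xz.
have dc i : differentiable (fun z => (i == l)%:R * energy_density (t, z) : R^o) z.
  by exact: (differentiableM (@differentiable_cst _ _ _ ((i == l)%:R : R^o) z) dE).
have e i : 'D_(bv i) (stress_flux l i : 'rV[R]_2 -> R^o) z =
  'D_(bv i) (flux (sd l) i : 'rV[R]_2 -> R^o) z - (i == l)%:R * 'D_(bv l) (fun z => energy_density (t, z) : R^o) z.
  rewrite [LHS](derive_sub (bv i) (dF i) (dc i)); congr (_ - _).
  rewrite [LHS](derive_mul (bv i) (@differentiable_cst _ _ _ ((i == l)%:R : R^o) z) dE) derive_cst mul0r add0r.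
  by have [->|_] := eqVneq i l; rewrite ?mul0r.
rewrite (eq_bigr _ (fun i _ => e i)) sumrB (divergence_flux (sd l) xz).
have -> : \sum_i (i == l)%:R * 'D_(bv l) (fun z => energy_density (t, z) : R^o) z = 'D_(bv l) (fun z => energy_density (t, z) : R^o) z.
  rewrite (bigD1 l) //= eqxx mul1r big1 ?addr0 // => i il.
  by rewrite (negbTE il) mul0r.
rewrite (derive_density l xz).
have sp (A B : 'I_2 -> 'I_2 -> R) : \sum_i \sum_j (A i j + B i j) = \sum_i \sum_j A i j + \sum_i \sum_j B i j.
  by rewrite -big_split; apply: eq_bigr => i _; rewrite big_split.
rewrite sp mulrDr.
have alg (a b c : R) : a + b - (c + b) = a - c by ring.
exact: alg.
Qed.

Lemma derive_density_time z : img x z ->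
  is_derive (t : R^o) (1 : R^o) (fun r => energy_density (r, z) : R^o)
    (2^-1 * \sum_i \sum_j conf x i j z * 'D_td (P (sd i) (sd j)) (t, z)).
Proof.
move=> xz.
have dp i j : differentiable (fun r => P (sd i) (sd j) (r, z) : R^o) (t : R^o).
  have ds : differentiable (fun r : R^o => (r, z) : E) (t : R^o).
    by apply: differentiable_pair; [exact: (smooth_on_diff (@smooth_on_id R R^o setT))|exact: differentiable_cst].
  have [df _] := @P_C1 (sd i) (sd j) _ (flow_dom_slice xz).
  exact: (differentiable_comp ds df).
have dt i j : differentiable (fun r => conf x i j z * P (sd i) (sd j) (r, z) : R^o) (t : R^o).
  exact: (differentiableM (@differentiable_cst _ _ _ (conf x i j z : R^o) (t : R^o)) (dp i j)).
have ds i : differentiable (fun r => \sum_j conf x i j z * P (sd i) (sd j) (r, z) : R^o) (t : R^o).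
  rewrite (_ : (fun w => _) = \sum_j (fun r => conf x i j z * P (sd i) (sd j) (r, z) : R^o)).
    by apply: differentiable_sum => j; exact: dt.
  by apply/funext => r; rewrite fct_sumE.
have dS : differentiable (fun r => \sum_i \sum_j conf x i j z * P (sd i) (sd j) (r, z) : R^o) (t : R^o).
  rewrite (_ : (fun w => _) = \sum_i (fun r => \sum_j conf x i j z * P (sd i) (sd j) (r, z) : R^o)).
    by apply: differentiable_sum => j; exact: ds.
  by apply/funext => r; rewrite fct_sumE.
have dc := @differentiable_cst _ _ _ (2^-1 : R^o) (t : R^o).
apply: DeriveDef; first by apply: diff_derivable; exact: (differentiableM dc dS).
rewrite [LHS](derive_mul (1 : R^o) dc dS) derive_cst mul0r add0r.
congr (_ * _); rewrite [LHS](derive_bigsum (1 : R^o) ds); apply: eq_bigr => i _.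
rewrite [LHS](derive_bigsum (1 : R^o) (dt i)); apply: eq_bigr => j _.
rewrite [LHS](derive_mul (1 : R^o) (@differentiable_cst _ _ _ (conf x i j z : R^o) (t : R^o)) (dp i j)) derive_cst mul0r add0r.
by congr (_ * _); apply/esym; exact: derive_slice_fst.
Qed.

Section TestFunction.
Variable phi : 'rV[R]_2 -> R^o.
Hypothesis phi_smooth : smooth_on setT phi.

Definition grad_field l z : R := \sum_m invmx (g z) l m * 'D_(bv m) phi z.

Lemma invmx_conf i j z : img x z -> invmx (g z) i j = conf x i j z / dens x z.
Proof. by move=> xz; rewrite /conf mulrAC divff ?mul1r // gt_eqF // dens_gt0. Qed.

Lemma invmx_C1 i j : C1_on (img x) (fun z => invmx (g z) i j : R^o).
Proof.
apply: (C1_on_eq oA _ (C1_onM oA (conf_C1 (x := x) i j) (densV_C1 (x := x)))) => z xz.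
by rewrite invmx_conf.
Qed.

Lemma grad_field_C1 l : C1_on (img x) (grad_field l : 'rV[R]_2 -> R^o).
Proof.
apply: C1_on_sum => [|m]; first exact: oA.
apply: (C1_onM oA (invmx_C1 l m)); apply: C1_on_smooth.
exact: smooth_on_sub (subsetT _) (smooth_on_derive (bv m) phi_smooth).
Qed.

Definition current i z : R := phi z * flux td i z - \sum_l grad_field l z * stress_flux l i z.

(** The stress-energy tensor paired with the Hessian of the test function: the derivative
    of its gradient, and a term from the Christoffel symbols. *)
Definition bracket z : R :=
  \sum_i \sum_l 'D_(bv i) (grad_field l : 'rV[R]_2 -> R^o) z * stress_flux l i z
  - 2^-1 * \sum_l grad_field l z *
      \sum_i \sum_j 'D_(bv l) (conf x i j : 'rV[R]_2 -> R^o) z * P (sd i) (sd j) (t, z).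

Lemma phi_C1 : C1_on (img x) phi.
Proof. by apply: C1_on_smooth; exact: smooth_on_sub (subsetT _) phi_smooth. Qed.

Lemma current_C1 i : C1_on (img x) (current i : 'rV[R]_2 -> R^o).
Proof.
apply: (C1_onB oA (C1_onM oA phi_C1 (@flux_C1 td i))).
apply: C1_on_sum => [|l]; first exact: oA.
exact: (C1_onM oA (grad_field_C1 l) (@stress_flux_C1 l i)).
Qed.

(** The test function multiplies [divergence_flux] in the direction of time, its gradient
    multiplies [divergence_stress]; the terms in which the differential of the test function
    meets the velocity cancel. *)
Lemma energy_identity z : img x z ->
  \sum_i 'D_(bv i) (current i : 'rV[R]_2 -> R^o) z =
  phi z * (dens x z * P td td (t, z) + 2^-1 * \sum_i \sum_j conf x i j z * 'D_td (P (sd i) (sd j)) (t, z))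
  - bracket z.
Proof.
move=> xz.
have dphi : differentiable phi z by exact: smooth_on_diff phi_smooth I.
have dF i : differentiable (flux td i : 'rV[R]_2 -> R^o) z by have [] := @flux_C1 td i z xz.
have dX l : differentiable (grad_field l : 'rV[R]_2 -> R^o) z by have [] := @grad_field_C1 l z xz.
have dW l i : differentiable (stress_flux l i : 'rV[R]_2 -> R^o) z by have [] := @stress_flux_C1 l i z xz.
have dXW i l : differentiable (fun z => grad_field l z * stress_flux l i z : R^o) z.
  exact: (differentiableM (dX l) (dW l i)).
have dS i : differentiable (fun z => \sum_l grad_field l z * stress_flux l i z : R^o) z.
  rewrite (_ : (fun w => _) = \sum_l (fun z => grad_field l z * stress_flux l i z : R^o)).
    by apply: differentiable_sum => j; exact: dXW.
  by apply/funext => r; rewrite fct_sumE.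
have e i : 'D_(bv i) (current i : 'rV[R]_2 -> R^o) z =
  'D_(bv i) phi z * flux td i z + phi z * 'D_(bv i) (flux td i : 'rV[R]_2 -> R^o) z
  - \sum_l ('D_(bv i) (grad_field l : 'rV[R]_2 -> R^o) z * stress_flux l i z
            + grad_field l z * 'D_(bv i) (stress_flux l i : 'rV[R]_2 -> R^o) z).
  rewrite [LHS](derive_sub (bv i) (differentiableM dphi (dF i) : differentiable (fun z => phi z * flux td i z : R^o) z) (dS i)).
  congr (_ - _); first by rewrite [LHS](derive_mul (bv i) dphi (dF i)).
  rewrite [LHS](derive_bigsum (bv i) (dXW i)); apply: eq_bigr => l _.
  by rewrite [LHS](derive_mul (bv i) (dX l) (dW l i)).
rewrite (eq_bigr _ (fun i _ => e i)).
apply: (@energy_algebra R (phi z) _ (fun i => 'D_(bv i) phi z) (fun i => flux td i z) _ (fun l => grad_field l z)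
  (fun l => dens x z * P td (sd l) (t, z)) _ (fun i l => 'D_(bv i) (grad_field l : 'rV[R]_2 -> R^o) z)
  (fun l i => stress_flux l i z) (fun l i => 'D_(bv i) (stress_flux l i : 'rV[R]_2 -> R^o) z)).
- exact: divergence_flux.
- by move=> l; exact: divergence_stress.
- rewrite /grad_field; under [RHS]eq_bigr do rewrite mulr_suml.
  rewrite exchange_big; apply: eq_bigr => i _; rewrite /flux mulr_sumr; apply: eq_bigr => j _.
  rewrite (P_C td (sd j) (flow_dom_slice xz)) (confC i j xz) /conf.
  by move: (dens x z) (invmx (g z) j i) ('D_(bv i) phi z) (P (sd j) td (t, z)) => a b c d; ring.
Qed.

End TestFunction.
End TimeSlice.
End EnergyIdentity.

(** * Cutoff functions of a quadratic form *)

Definition quad {R : realType} (A : 'M[R]_2) (v : 'I_2 -> R) : R := \sum_i \sum_j v i * A i j * v j.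

Section QuadBump.
#[local] Opaque derive.
Context {R : realType} (a b lam : R) (A : 'M[R]_2) (c : 'rV[R]_2).
Hypothesis ab : a < b.
Hypothesis A01 : A e1 e0 = A e0 e1.
Local Notation bv := (@basis_vec R 2).
Local Notation chi := (cutoff a b : R^o -> R^o).

Definition qform (z : 'rV[R]_2) : R := lam^-1 ^+ 2 * quad A (fun i => z 0 i - c 0 i).

Definition qlin m (z : 'rV[R]_2) : R := \sum_k A m k * (z 0 k - c 0 k).

Definition quad_bump : 'rV[R]_2 -> R^o := chi \o (qform : 'rV[R]_2 -> R^o).

Lemma shift_smooth k : smooth_on setT (fun z : 'rV[R]_2 => z 0 k - c 0 k : R^o).
Proof.
apply: (smooth_onD openT (coord_smooth k openT) (@smooth_on_cst R _ _ (- c 0 k : R^o))).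
Qed.

Lemma qform_smooth : smooth_on setT (qform : 'rV[R]_2 -> R^o).
Proof.
have h : smooth_on setT ((cst (lam^-1 ^+ 2) : 'rV[R]_2 -> R^o) * (\sum_i \sum_j ((fun z : 'rV[R]_2 => z 0 i - c 0 i : R^o) * (cst (A i j) : 'rV[R]_2 -> R^o) * (fun z : 'rV[R]_2 => z 0 j - c 0 j : R^o)))).
  apply: smooth_onM openT (smooth_on_cst _) _; apply: smooth_on_sum openT _ => i; apply: smooth_on_sum openT _ => j.
  exact: smooth_onM openT (smooth_onM openT (shift_smooth i) (smooth_on_cst _)) (shift_smooth j).
apply: (eq_smooth_on openT _ h) => z _; rewrite /qform /quad; congr (_ * _).
by rewrite fct_sumE; apply: eq_bigr => i _; rewrite fct_sumE.
Qed.

Lemma quad_bump_smooth : smooth_on setT quad_bump.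
Proof. exact: (smooth_on_comp1 openT (B := setT) _ qform_smooth (cutoff_smooth ab)). Qed.

Lemma derive_coordE k v (z : 'rV[R]_2) : 'D_v (fun z : 'rV[R]_2 => z 0 k : R^o) z = v 0 k.
Proof. by rewrite (derive_coord k (@derivable_id _ _ z v)) derive_id. Qed.

Lemma derive_shift k v z : 'D_v (fun z : 'rV[R]_2 => z 0 k - c 0 k : R^o) z = v 0 k.
Proof.
have d1 : differentiable (fun z : 'rV[R]_2 => z 0 k : R^o) z by exact: (smooth_on_diff (coord_smooth k openT)).
by rewrite [LHS](derive_sub v d1 (@differentiable_cst _ _ _ (c 0 k : R^o) z)) derive_cst subr0 derive_coordE.
Qed.

Lemma shift_diff k z : differentiable (fun z : 'rV[R]_2 => z 0 k - c 0 k : R^o) z.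
Proof. exact: smooth_on_diff (shift_smooth k) I. Qed.

Lemma derive_qlin m i z : 'D_(bv i) (qlin m : 'rV[R]_2 -> R^o) z = A m i.
Proof.
have d k : differentiable (fun z : 'rV[R]_2 => A m k * (z 0 k - c 0 k) : R^o) z.
  exact: (differentiableM (@differentiable_cst _ _ _ (A m k : R^o) z) (shift_diff k z)).
rewrite [LHS](derive_bigsum (bv i) d) (bigD1 i) //= big1 ?addr0 => [|k ki].
  rewrite [LHS](derive_mul (bv i) (@differentiable_cst _ _ _ (A m i : R^o) z) (shift_diff i z)).
  by rewrite derive_cst mul0r add0r derive_shift mxE !eqxx mulr1.
rewrite [LHS](derive_mul (bv i) (@differentiable_cst _ _ _ (A m k : R^o) z) (shift_diff k z)).
by rewrite derive_cst mul0r add0r derive_shift mxE (negbTE ki) mulr0.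
Qed.

Lemma qlin_diff m z : differentiable (qlin m : 'rV[R]_2 -> R^o) z.
Proof.
rewrite (_ : qlin m = \sum_k (fun z : 'rV[R]_2 => A m k * (z 0 k - c 0 k) : R^o)).
  apply: differentiable_sum => k.
  exact: (differentiableM (@differentiable_cst _ _ _ (A m k : R^o) z) (shift_diff k z)).
by apply/funext => r; rewrite fct_sumE.
Qed.

Lemma quad_qlin (z : 'rV[R]_2) : quad A (fun i => z 0 i - c 0 i) = \sum_i (z 0 i - c 0 i) * qlin i z.
Proof.
apply: eq_bigr => i _; rewrite /qlin mulr_sumr; apply: eq_bigr => j _.
by rewrite mulrA.
Qed.

Lemma derive_qform m z : 'D_(bv m) (qform : 'rV[R]_2 -> R^o) z = 2 * lam^-1 ^+ 2 * qlin m z.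
Proof.
have dt i : differentiable (fun z : 'rV[R]_2 => (z 0 i - c 0 i) * qlin i z : R^o) z.
  exact: (differentiableM (shift_diff i z) (qlin_diff i z)).
have dS : differentiable (fun z : 'rV[R]_2 => \sum_i (z 0 i - c 0 i) * qlin i z : R^o) z.
  rewrite (_ : (fun z => _) = \sum_i (fun z : 'rV[R]_2 => (z 0 i - c 0 i) * qlin i z : R^o)).
    by apply: differentiable_sum => i; exact: dt.
  by apply/funext => r; rewrite fct_sumE.
have -> : (qform : 'rV[R]_2 -> R^o) = fun z : 'rV[R]_2 => lam^-1 ^+ 2 * \sum_i (z 0 i - c 0 i) * qlin i z : R^o.
  by apply/funext => w; rewrite /qform quad_qlin.
rewrite [LHS](derive_mul (bv m) (@differentiable_cst _ _ _ (lam^-1 ^+ 2 : R^o) z) dS) derive_cst mul0r add0r.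
rewrite (derive_bigsum (bv m) dt).
have e i : 'D_(bv m) (fun z : 'rV[R]_2 => (z 0 i - c 0 i) * qlin i z : R^o) z = (i == m)%:R * qlin i z + (z 0 i - c 0 i) * A i m.
  by rewrite [LHS](derive_mul (bv m) (shift_diff i z) (qlin_diff i z)) derive_shift derive_qlin mxE eqxx.
rewrite (eq_bigr _ (fun i _ => e i)) big_ord2 /qlin.
by case: (ord2P m) => ->; rewrite !big_ord2 /= ?A01; ring.
Qed.

Lemma chi_diff s : differentiable chi (s : R^o) /\ differentiable ('D_1 chi) (s : R^o).
Proof.
split; first exact: smooth_on_diff (cutoff_smooth ab) I.
exact: smooth_on_diff (smooth_on_derive (1 : R^o) (cutoff_smooth ab)) I.
Qed.

Lemma derive_comp1 (f : R^o -> R^o) (h : 'rV[R]_2 -> R^o) z v : differentiable h z -> differentiable f (h z) ->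
  'D_v (f \o h) z = 'D_1 f (h z) * 'D_v h z.
Proof.
move=> dh df; have dc : differentiable (f \o h) z by exact: differentiable_comp.
transitivity ('d f (h z) ('D_v h z)).
  by rewrite (deriveE v dh) [LHS](deriveE v dc) (diff_comp dh df).
have -> : 'D_v h z = 'D_v h z *: (1 : R^o) by rewrite [RHS]mulr1.
rewrite linearZ /= -(deriveE _ df).
have alg (x y : R) : x * y = y * (x * 1) by rewrite mulr1 mulrC.
exact: alg.
Qed.

Lemma qform_diff z : differentiable (qform : 'rV[R]_2 -> R^o) z.
Proof. exact: smooth_on_diff qform_smooth I. Qed.

Lemma derive_quad_bump m z : 'D_(bv m) quad_bump z = 'D_1 chi (qform z) * (2 * lam^-1 ^+ 2 * qlin m z).
Proof. by rewrite [LHS](derive_comp1 (bv m) (qform_diff z) (chi_diff _).1) derive_qform. Qed.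

Lemma derive2_quad_bump i m z : 'D_(bv i) ('D_(bv m) quad_bump) z =
  'D_1 ('D_1 chi) (qform z) * (4 * lam^-1 ^+ 4) * qlin i z * qlin m z + 'D_1 chi (qform z) * (2 * lam^-1 ^+ 2) * A m i.
Proof.
have -> : 'D_(bv m) quad_bump = fun z => ('D_1 chi \o (qform : 'rV[R]_2 -> R^o)) z * (2 * lam^-1 ^+ 2 * qlin m z) : R^o.
  by apply/funext => w; rewrite derive_quad_bump.
have dl := differentiableM (@differentiable_cst _ _ _ (2 * lam^-1 ^+ 2 : R^o) z) (qlin_diff m z).
rewrite [LHS](derive_mul (bv i) (differentiable_comp (qform_diff z) (chi_diff (qform z)).2) dl).
rewrite (derive_comp1 (bv i) (qform_diff z) (chi_diff (qform z)).2) derive_qform.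
rewrite (derive_mul (bv i) (@differentiable_cst _ _ _ (2 * lam^-1 ^+ 2 : R^o) z) (qlin_diff m z)) derive_cst mul0r add0r derive_qlin.
rewrite /=; have alg (x y k l p q : R) : x * (2 * k ^+ 2 * p) * (2 * k ^+ 2 * q) + y * (2 * k ^+ 2 * l) =
  x * (4 * k ^+ 4) * p * q + y * (2 * k ^+ 2) * l by ring.
exact: alg.
Qed.

Lemma quad_bump_ge0 z : 0 <= quad_bump z.
Proof. exact: cutoff_ge0. Qed.

Lemma quad_bump_le1 z : quad_bump z <= 1.
Proof. exact: cutoff_le1. Qed.

Lemma quad_bump0 z : b <= qform z -> quad_bump z = 0.
Proof. exact: cutoff0. Qed.

Lemma quad_bump1 z : qform z <= a -> quad_bump z = 1.
Proof. exact: cutoff1. Qed.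

Lemma near_quad_bump0 z : b < qform z -> \forall w \near z, quad_bump w = 0.
Proof.
move=> bz; have cz : {for z, continuous (qform : 'rV[R]_2 -> R^o)} by exact: differentiable_continuous (qform_diff z).
have : \forall w \near z, b < qform w by apply: (cz [set s | b < s]); exact: lt_nbhsr.
by apply: filterS => w bw; apply: quad_bump0; exact: ltW.
Qed.

End QuadBump.

(** * The stress tensor against the Hessian of a cutoff *)

Section StressBound.
Context {R : realType} (S : riemannian_manifold R 2) (x : S) (z : 'rV[R]_2).
Hypothesis xz : img x z.
Local Notation g := (metric x z).
Local Notation gV := (invmx (metric x z)).

Lemma invmx_sym i j : gV i j = gV j i.
Proof.
by rewrite (invmx_conf i j xz) (invmx_conf j i xz) (confC i j xz).
Qed.

Lemma metric_symE i j : g i j = g j i.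
Proof. by rewrite -[in LHS](Defs.metric_sym xz) mxE. Qed.

(** The squared norm of a covariant tensor for the metric g'. *)
Definition tensor_sq (g' A : 'M[R]_2) : R := \tr (invmx g' *m A *m invmx g' *m A^T).

Lemma tensor_sqE (A : 'M[R]_2) : A e1 e0 = A e0 e1 -> exists p r s, [/\ 0 < p, 0 < s,
   (forall v, quad g v = (p * v e0 + r * v e1) ^+ 2 + (s * v e1) ^+ 2) &
   tensor_sq g A = (A e0 e0 / p ^+ 2) ^+ 2 + 2 * ((A e0 e1 - r * A e0 e0 / p) / (p * s)) ^+ 2
     + ((r ^+ 2 * A e0 e0 / p ^+ 2 - 2 * r * A e0 e1 / p + A e1 e1) / s ^+ 2) ^+ 2 /\
   forall v, quad A v = (p * v e0 + r * v e1) ^+ 2 * (A e0 e0 / p ^+ 2)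
     + 2 * (p * v e0 + r * v e1) * (s * v e1) * ((A e0 e1 - r * A e0 e0 / p) / (p * s))
     + (s * v e1) ^+ 2 * ((r ^+ 2 * A e0 e0 / p ^+ 2 - 2 * r * A e0 e1 / p + A e1 e1) / s ^+ 2)].
Proof.
move=> A01; have [p [r [s [p0 s0 dE [h00 h01 h10 h11]]]]] := metric_cholesky xz.
have pn : p != 0 by rewrite gt_eqF.
have sn : s != 0 by rewrite gt_eqF.
exists p, r, s; split=> //; first by move=> v; rewrite /quad !big_ord2 h00 h01 h10 h11; ring.
split; last by move=> v; rewrite /quad !big_ord2 A01; field; rewrite sn pn.
have detn : \det g != 0 by rewrite gt_eqF // det_metric_gt0.
have [i00 i01 i10 i11] := inv2E detn; rewrite -(dens_sqr xz) dE h00 ?h01 ?h10 ?h11 in i00 i01 i10 i11.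
rewrite /tensor_sq /mxtrace big_ord2 ![(_ *m _ *m _ *m _) _ _]mxE !big_ord2.
rewrite ![(_ *m _ *m _) _ _]mxE !big_ord2 ![(_ *m _) _ _]mxE !big_ord2 ![_^T _ _]mxE i00 i01 i10 i11 A01.
by field; rewrite pn sn.
Qed.

(** A vector extends to an orthogonal frame of vectors of the same length, so its value is
    one of the four components of the tensor in an orthogonal frame. *)
Lemma tensor_sq_bound (A : 'M[R]_2) v : A e1 e0 = A e0 e1 ->
  `|quad A v| <= Num.sqrt (tensor_sq g A) * quad g v.
Proof.
move=> A01; have [p [r [s [p0 s0 qg [tA qA]]]]] := tensor_sqE A01.
rewrite qA qg tA; move: (A e0 e0 / p ^+ 2) (_ / (p * s)) (_ / s ^+ 2) (p * v e0 + r * v e1) (s * v e1) => a b d x' y'.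
have q0 : 0 <= x' ^+ 2 + y' ^+ 2 by rewrite addr_ge0 ?sqr_ge0.
rewrite -[x' ^+ 2 + y' ^+ 2]ger0_norm // -sqrtr_sqr -[`|_|]sqrtr_sqr -sqrtrM; last first.
  by have := sqr_ge0 a; have := sqr_ge0 b; have := sqr_ge0 d; lra.
apply: ler_wsqrtr; rewrite -subr_ge0.
have -> : (a ^+ 2 + 2 * b ^+ 2 + d ^+ 2) * (x' ^+ 2 + y' ^+ 2) ^+ 2 - (x' ^+ 2 * a + 2 * x' * y' * b + y' ^+ 2 * d) ^+ 2 =
  2 * (x' ^+ 2 * b - x' * y' * a) ^+ 2 + (x' ^+ 2 * d - y' ^+ 2 * a) ^+ 2 + 2 * (x' * y' * d - y' ^+ 2 * b) ^+ 2 by ring.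
have := sqr_ge0 (x' ^+ 2 * b - x' * y' * a); have := sqr_ge0 (x' ^+ 2 * d - y' ^+ 2 * a).
by have := sqr_ge0 (x' * y' * d - y' ^+ 2 * b); lra.
Qed.

Lemma quad_metric_ge0 v : 0 <= quad g v.
Proof.
have z01 : (0 : 'M[R]_2) e1 e0 = (0 : 'M[R]_2) e0 e1 by rewrite [LHS]mxE [RHS]mxE.
have [p [r [s [p0 s0 qg _]]]] := tensor_sqE z01.
by rewrite qg addr_ge0 ?sqr_ge0.
Qed.

Lemma tensor_sq_entry (A : 'M[R]_2) i j : A e1 e0 = A e0 e1 ->
  `|A i j| <= Num.sqrt (tensor_sq g A) * (g e0 e0 + g e1 e1).
Proof.
move=> A01; set n := Num.sqrt _; have n0 : 0 <= n by exact: sqrtr_ge0.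
have g0 := metric_diag_gt0 e0 xz; have g1 := metric_diag_gt0 e1 xz.
have qb v := tensor_sq_bound v A01; rewrite -/n in qb.
have alg (a b c k l m : R) : 0 < k -> 0 < m -> `|a| <= n * k -> `|c| <= n * m ->
    `|a + b + (b + c)| <= n * (k + l + (l + m)) -> `|a - b + (- b + c)| <= n * (k - l + (- l + m)) ->
    [/\ `|a| <= n * (k + m), `|b| <= n * (k + m) & `|c| <= n * (k + m)].
  move=> k0 m0 b0 b1 b2 b3.
  have p1 : 0 <= n * k by rewrite mulr_ge0 // ltW.
  have p2 : 0 <= n * m by rewrite mulr_ge0 // ltW.
  split; [by rewrite mulrDr; lra| |by rewrite mulrDr; lra].
  by move: b2 b3; rewrite !ler_norml => /andP[b21 b22] /andP[b31 b32]; apply/andP; split; lra.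
have qE (B : 'M[R]_2) (c d : R) : quad B (fun i => if i == e0 then c else d) =
    c * B e0 e0 * c + c * B e0 e1 * d + (d * B e1 e0 * c + d * B e1 e1 * d).
  by rewrite /quad !big_ord2.
have [||||h0 h1 h2] := alg (A e0 e0) (A e0 e1) (A e1 e1) (g e0 e0) (g e0 e1) (g e1 e1) g0 g1.
- by have := qb (fun i => if i == e0 then 1 else 0); rewrite !qE !mul0r !mulr0 !mul1r !mulr1 !addr0.
- by have := qb (fun i => if i == e0 then 0 else 1); rewrite !qE !mul0r !mulr0 !mul1r !mulr1 !addr0 !add0r.
- have := qb (fun i => if i == e0 then 1 else 1); rewrite !qE !mul1r !mulr1 A01.
  by rewrite (metric_symE e1 e0).
- have := qb (fun i => if i == e0 then 1 else - 1); rewrite !qE !mul1r !mulr1 !mulN1r !mulrN1 !opprK A01.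
  by rewrite (metric_symE e1 e0).
- by case: (ord2P i) => ->; case: (ord2P j) => ->; rewrite ?A01.
Qed.

End StressBound.

Section BracketBound.
#[local] Opaque derive.
Context {R : realType} (S : riemannian_manifold R 2) (x : S).
Local Notation E := (R^o * 'rV[R]_2)%type.
Local Notation sd := (@space_dir R).
Local Notation g := (metric x).
Local Notation bv := (@basis_vec R 2).
Variable P : E -> E -> E -> R^o.
Variables (t : R) (z : 'rV[R]_2).
Hypothesis xz : img x z.
Hypothesis P_C : forall i j, P (sd i) (sd j) (t, z) = P (sd j) (sd i) (t, z).

Definition pull_mx : 'M[R]_2 := \matrix_(i, j) P (sd i) (sd j) (t, z).

Definition stress_mx : 'M[R]_2 := pull_mx - (2^-1 * \tr (invmx (g z) *m pull_mx)) *: g z.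

Lemma energy_density_trace : energy_density x P (t, z) = dens x z * (2^-1 * \tr (invmx (g z) *m pull_mx)).
Proof.
rewrite [RHS]mulrCA /energy_density /mxtrace; congr (2^-1 * _); rewrite mulr_sumr; apply: eq_bigr => i _.
rewrite mxE mulr_sumr; apply: eq_bigr => j _.
by rewrite [pull_mx _ _]mxE /conf mulrA (P_C i j).
Qed.

Lemma stress_mxE i j : stress_mx i j = P (sd i) (sd j) (t, z) - 2^-1 * \tr (invmx (g z) *m pull_mx) * g z i j.
Proof. by rewrite mxE; congr (_ + _); [exact: mxE|rewrite mxE; congr (- _); exact: mxE]. Qed.

Lemma stress_mx_sym i j : stress_mx i j = stress_mx j i.
Proof. by rewrite [LHS]stress_mxE [RHS]stress_mxE (P_C i j) (metric_symE xz i j). Qed.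

Lemma invmx_metric i l : \sum_j invmx (g z) i j * g z j l = (i == l)%:R.
Proof. by have /matrixP/(_ i l) := mulVmx (metric_unitmx xz); rewrite !mxE. Qed.

Lemma stress_flux_stress l i : stress_flux x P t l i z = \sum_j conf x i j z * stress_mx j l.
Proof.
under eq_bigr do rewrite stress_mxE mulrBr.
rewrite sumrB /stress_flux /flux; congr (_ - _).
rewrite energy_density_trace; under [RHS]eq_bigr do rewrite mulrCA.
rewrite -mulr_sumr /conf.
under [in RHS]eq_bigr do rewrite -mulrA.
by rewrite -mulr_sumr invmx_metric; ring.
Qed.

(** The trace part drops out by [derive_conf_trace]. *)
Lemma derive_conf_stress l :
  \sum_i \sum_j 'D_(bv l) (conf x i j : 'rV[R]_2 -> R^o) z * P (sd i) (sd j) (t, z) =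
  \sum_i \sum_j 'D_(bv l) (conf x i j : 'rV[R]_2 -> R^o) z * stress_mx i j.
Proof.
have h := derive_conf_trace l xz; set w := 2^-1 * \tr (invmx (g z) *m pull_mx).
transitivity (\sum_i \sum_j 'D_(bv l) (conf x i j : 'rV[R]_2 -> R^o) z * stress_mx i j
  + w * \sum_i \sum_j 'D_(bv l) (conf x i j : 'rV[R]_2 -> R^o) z * g z i j); last by rewrite h mulr0 addr0.
rewrite mulr_sumr -big_split; apply: eq_bigr => i _; rewrite mulr_sumr -big_split; apply: eq_bigr => j _ /=.
rewrite stress_mxE -/w.
by move: ('D_(bv l) (conf x i j : 'rV[R]_2 -> R^o) z) (P (sd i) (sd j) (t, z)) (g z i j) => d p c; ring.
Qed.

Variable phi : 'rV[R]_2 -> R^o.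
Hypothesis phi_smooth : smooth_on setT phi.
Local Notation dphi m := ('D_(bv m) phi z).
Local Notation ddphi i m := ('D_(bv i) ('D_(bv m) phi) z).
Local Notation dgV i l m := ('D_(bv i) (fun w => invmx (g w) l m : R^o) z).

Lemma derive_grad_field i l : 'D_(bv i) (grad_field x phi l : 'rV[R]_2 -> R^o) z =
  \sum_m (dgV i l m * dphi m + invmx (g z) l m * ddphi i m).
Proof.
have d1 m : differentiable (fun w => invmx (g w) l m : R^o) z by have [] := invmx_C1 (x := x) l m xz.
have d2 m : differentiable ('D_(bv m) phi) z by exact: smooth_on_diff (smooth_on_derive (bv m) phi_smooth) I.
have d3 m : differentiable (fun w => invmx (g w) l m * 'D_(bv m) phi w : R^o) z by exact: (differentiableM (d1 m) (d2 m)).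
rewrite [LHS](derive_bigsum (bv i) d3); apply: eq_bigr => m _.
by rewrite [LHS](derive_mul (bv i) (d1 m) (d2 m)).
Qed.

Definition sharp (al : 'I_2 -> R) l : R := \sum_m invmx (g z) l m * al m.

Lemma quad_sharp al : quad (g z) (sharp al) = quad (invmx (g z)) al.
Proof.
have h i : \sum_j g z i j * sharp al j = al i.
  transitivity ((g z *m (invmx (g z) *m (\col_m al m))) i 0).
    rewrite mxE; apply: eq_bigr => j _; rewrite mxE; congr (_ * _).
    by apply: eq_bigr => m _; rewrite mxE.
  by rewrite mulKVmx ?metric_unitmx // mxE.
rewrite /quad; transitivity (\sum_i sharp al i * al i).
  apply: eq_bigr => i _; rewrite -(h i) mulr_sumr; apply: eq_bigr => j _.
  by rewrite mulrA.
apply: eq_bigr => i _; rewrite /sharp mulr_suml; apply: eq_bigr => j _.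
by move: (invmx (g z) i j) (al i) (al j) => c d f; ring.
Qed.

(** Raising the indices of the square of a covector gives the square of the dual vector, on
    which [tensor_sq_bound] estimates the stress-energy tensor. *)
Lemma hessian_rank_one al :
  \sum_i \sum_l (\sum_m invmx (g z) l m * (al i * al m)) * (\sum_j conf x i j z * stress_mx j l) =
  dens x z * quad stress_mx (sharp al).
Proof.
transitivity (\sum_j \sum_l dens x z * (sharp al j * stress_mx j l * sharp al l)); last first.
  rewrite /quad mulr_sumr; apply: eq_bigr => j _; rewrite mulr_sumr; exact: eq_bigr.
rewrite exchange_big [RHS]exchange_big; apply: eq_bigr => l _.
transitivity (\sum_i \sum_j al i * sharp al l * (conf x i j z * stress_mx j l)).
  apply: eq_bigr => i _.
  have -> : \sum_m invmx (g z) l m * (al i * al m) = al i * sharp al l.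
    by rewrite /sharp mulr_sumr; apply: eq_bigr => m _; rewrite mulrCA.
  by rewrite mulr_sumr.
rewrite exchange_big; apply: eq_bigr => j _.
have -> : sharp al j * stress_mx j l * sharp al l = \sum_i invmx (g z) j i * al i * (stress_mx j l * sharp al l).
  by rewrite -mulrA /sharp mulr_suml.
rewrite mulr_sumr; apply: eq_bigr => i _; rewrite /conf (invmx_sym xz i j).
by move: (dens x z) (invmx (g z) j i) (stress_mx j l) (al i) (sharp al l) => a b c d f; ring.
Qed.

Lemma sum2_le (F : 'I_2 -> R) M : (forall i, `|F i| <= M) -> `|\sum_i F i| <= 2 * M.
Proof.
move=> h; rewrite big_ord2; apply: le_trans (ler_normD _ _) _.
have := h e0; have := h e1; lra.
Qed.

(** The Hessian of the test function is a combination of squares of covectors, to which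
    [hessian_rank_one] applies. Derivatives of the metric meet only first derivatives of the
    test function, so they come with the factor F, which is of lower order in the scale. *)
Lemma bracket_bound (K F H h1 h2 : R) (al be ga : 'I_2 -> R) :
  (forall i j, `|invmx (g z) i j| <= K) -> (forall l i j, `|dgV l i j| <= K) ->
  (forall i j, `|conf x i j z| <= K) ->
  (forall l i j, `|'D_(bv l) (conf x i j : 'rV[R]_2 -> R^o) z| <= K) ->
  g z e0 e0 + g z e1 e1 <= K -> 1 <= K * dens x z ->
  (forall m, `|dphi m| <= F) ->
  (forall i m, ddphi i m = h1 * (al i * al m) + h2 * (be i * be m + ga i * ga m)) ->
  `|h1| * quad (invmx (g z)) al + `|h2| * (quad (invmx (g z)) be + quad (invmx (g z)) ga) <= H ->
  `|bracket x P t phi z| <= (H + 24 * K ^+ 4 * F) * (Num.sqrt (tensor_sq (g z) stress_mx) * dens x z).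
Proof.
move=> kV kdV kc kdc kg kd kF hess hH.
set n := Num.sqrt _; set d := dens x z; have d0 : 0 < d by exact: dens_gt0.
have n0 : 0 <= n by exact: sqrtr_ge0.
have K0 : 0 <= K by apply: le_trans (normr_ge0 _) (kV e0 e0).
have F0 : 0 <= F by apply: le_trans (normr_ge0 _) (kF e0).
have S01 : stress_mx e1 e0 = stress_mx e0 e1 by exact: stress_mx_sym.
have sb i j : `|stress_mx i j| <= n * K.
  apply: le_trans (tensor_sq_entry xz i j S01) _; exact: ler_wpM2l.
have Wb l i : `|\sum_j conf x i j z * stress_mx j l| <= 2 * (K * (n * K)).
  by apply: sum2_le => j; rewrite normrM; apply: ler_pM.
pose W l i := \sum_j conf x i j z * stress_mx j l.
(* The first sum carries the Hessian of phi, the other two only its first derivatives. *)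
have -> : bracket x P t phi z =
  (\sum_i \sum_l (\sum_m invmx (g z) l m * ddphi i m) * W l i) +
  (\sum_i \sum_l (\sum_m dgV i l m * dphi m) * W l i
   - 2^-1 * \sum_l grad_field x phi l z * \sum_i \sum_j 'D_(bv l) (conf x i j : 'rV[R]_2 -> R^o) z * stress_mx i j).
  rewrite /bracket addrA; congr (_ - _ * _); last by apply: eq_bigr => l _; rewrite derive_conf_stress.
  rewrite -big_split; apply: eq_bigr => i _; rewrite -big_split; apply: eq_bigr => l _ /=.
  by rewrite stress_flux_stress derive_grad_field big_split mulrDl addrC.
have lead : `|\sum_i \sum_l (\sum_m invmx (g z) l m * ddphi i m) * W l i| <= H * (n * d).
  have -> : \sum_i \sum_l (\sum_m invmx (g z) l m * ddphi i m) * W l i =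
    h1 * (d * quad stress_mx (sharp al)) + h2 * (d * quad stress_mx (sharp be) + d * quad stress_mx (sharp ga)).
    rewrite -!hessian_rank_one -[in RHS]big_split /= !mulr_sumr -big_split; apply: eq_bigr => i _ /=.
    rewrite -[in RHS]big_split /= !mulr_sumr -big_split; apply: eq_bigr => l _ /=.
    rewrite -/(W l i); under eq_bigr do rewrite hess.
    by rewrite !big_ord2; move: (W l i) => w; ring.
  have qb v : `|quad stress_mx (sharp v)| <= n * quad (invmx (g z)) v.
    by rewrite -quad_sharp; exact: tensor_sq_bound.
  apply: le_trans (ler_normD _ _) _; rewrite !normrM -mulrDr !normrM (gtr0_norm d0).
  have q3 : `|quad stress_mx (sharp be) + quad stress_mx (sharp ga)| <=
     n * (quad (invmx (g z)) be + quad (invmx (g z)) ga).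
    by apply: le_trans (ler_normD _ _) _; rewrite mulrDr lerD.
  have := ler_wpM2l (normr_ge0 h1) (qb al); have := ler_wpM2l (normr_ge0 h2) q3.
  have := ler_wpM2r (mulr_ge0 n0 (ltW d0)) hH.
  move: (`|h1|) (`|h2|) (`|quad stress_mx (sharp al)|) (`|quad stress_mx (sharp be) + _|) (quad _ al) (quad _ be + quad _ ga) => p1 p2 q1 q2 q4 q5 u1 u2 u3.
  have := ler_wpM2r (ltW d0) u2; have := ler_wpM2r (ltW d0) u3.
  by nra.
have low1 : `|\sum_i \sum_l (\sum_m dgV i l m * dphi m) * W l i| <= 2 * (2 * (2 * (K * F) * (2 * (K * (n * K))))).
  apply: sum2_le => i; apply: sum2_le => l; rewrite normrM; apply: (ler_pM _ _ _ (Wb l i)) => //.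
  by apply: sum2_le => m; rewrite normrM; apply: ler_pM.
have low2 : `|2^-1 * \sum_l grad_field x phi l z * \sum_i \sum_j 'D_(bv l) (conf x i j : 'rV[R]_2 -> R^o) z * stress_mx i j|
   <= 2^-1 * (2 * (2 * (K * F) * (2 * (2 * (K * (n * K)))))).
  rewrite normrM ger0_norm ?invr_ge0 //; apply: ler_wpM2l; first by rewrite invr_ge0.
  apply: sum2_le => l; rewrite normrM; apply: ler_pM; [exact: normr_ge0|exact: normr_ge0| |].
    by apply: sum2_le => m; rewrite normrM; apply: ler_pM.
  by apply: sum2_le => i; apply: sum2_le => j; rewrite normrM; apply: ler_pM.
apply: le_trans (ler_normD _ _) _; rewrite mulrDl; apply: lerD => //.
apply: le_trans (ler_normB _ _) _; apply: le_trans (lerD low1 low2) _.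
(* The two lower order terms add up to (16 + 8) K^3 F n, and 1 <= K d. *)
have p : 0 <= K ^+ 3 * F * n by rewrite !mulr_ge0 ?exprn_ge0.
have := ler_wpM2l p kd; rewrite -/d.
by lra.
Qed.

End BracketBound.


(** * Coordinate boxes with almost constant metric *)

Lemma form_comparison (R : realType) (A : 'rV[R]_2 -> 'M[R]_2) z0 (k : R) : 1 < k ->
  (forall i j, {for z0, continuous (fun z => A z i j)}) -> A z0 e1 e0 = A z0 e0 e1 ->
  0 < A z0 e0 e0 -> 0 < A z0 e0 e0 * A z0 e1 e1 - A z0 e0 e1 ^+ 2 ->
  \forall z \near z0, forall v, quad (A z) v <= k * quad (A z0) v /\ quad (A z0) v <= k * quad (A z) v.
Proof.
move=> k1 cA s01 a0 d0; set a := A z0 e0 e0 in a0 d0 *; set b := A z0 e0 e1 in s01 d0 *.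
set c := A z0 e1 e1 in d0 *.
have c0 : 0 < c.
  have : 0 < a * c by apply: lt_le_trans d0 _; rewrite lerBlDr lerDl sqr_ge0.
  by rewrite pmulr_rgt0.
have k0 : 0 < k by apply: lt_trans k1.
pose mu := (a * c - b ^+ 2) / (a + c); have mu0 : 0 < mu by rewrite divr_gt0 // addr_gt0.
have lower v : mu * (v e0 ^+ 2 + v e1 ^+ 2) <= quad (A z0) v.
  have ac : a + c != 0 by rewrite gt_eqF // addr_gt0.
  have -> : quad (A z0) v = mu * (v e0 ^+ 2 + v e1 ^+ 2) + ((a * v e0 + b * v e1) ^+ 2 + (b * v e0 + c * v e1) ^+ 2) / (a + c).
    by rewrite /quad !big_ord2 s01 -/a -/b -/c /mu; field.
  by rewrite lerDl divr_ge0 ?addr_ge0 ?sqr_ge0 // ltW.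
pose del := mu * (k - 1) / (2 * k).
have del0 : 0 < del by apply: divr_gt0; apply: mulr_gt0 => //; rewrite subr_gt0.
have near_entry i j : \forall z \near z0, `|A z i j - A z0 i j| < del.
  by have /cvgrPdist_lt/(_ _ del0) := cA i j; apply: filterS => z; rewrite distrC.
have n1 : \forall z \near z0, `|A z e0 e0 - A z0 e0 e0| < del /\ `|A z e0 e1 - A z0 e0 e1| < del.
  by apply: filterS2 (near_entry e0 e0) (near_entry e0 e1).
have n2 : \forall z \near z0, `|A z e1 e0 - A z0 e1 e0| < del /\ `|A z e1 e1 - A z0 e1 e1| < del.
  by apply: filterS2 (near_entry e1 e0) (near_entry e1 e1).
apply: filterS2 n1 n2 => z [h00 h01] [h10 h11] v.
have diff : `|quad (A z) v - quad (A z0) v| <= 2 * del * (v e0 ^+ 2 + v e1 ^+ 2).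
  have -> : quad (A z) v - quad (A z0) v = (A z e0 e0 - A z0 e0 e0) * v e0 ^+ 2 +
    ((A z e0 e1 - A z0 e0 e1) + (A z e1 e0 - A z0 e1 e0)) * (v e0 * v e1) + (A z e1 e1 - A z0 e1 e1) * v e1 ^+ 2.
    by rewrite /quad !big_ord2; ring.
  move: (A z e0 e0 - _) (A z e0 e1 - _) (A z e1 e0 - _) (A z e1 e1 - _) h00 h01 h10 h11 => p q r s hp hq hr hs.
  have xy : `|v e0 * v e1| <= 2^-1 * (v e0 ^+ 2 + v e1 ^+ 2).
    have := sqr_ge0 (v e0 - v e1); have := sqr_ge0 (v e0 + v e1); rewrite ler_norml => h1 h2.
    by apply/andP; split; nra.
  have t1 : `|p * v e0 ^+ 2| <= del * v e0 ^+ 2 by rewrite normrM [`|_ ^+ 2|]ger0_norm ?sqr_ge0 // ler_wpM2r ?sqr_ge0 // ltW.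
  have t3 : `|s * v e1 ^+ 2| <= del * v e1 ^+ 2 by rewrite normrM [`|_ ^+ 2|]ger0_norm ?sqr_ge0 // ler_wpM2r ?sqr_ge0 // ltW.
  have t2 : `|(q + r) * (v e0 * v e1)| <= (2 * del) * (2^-1 * (v e0 ^+ 2 + v e1 ^+ 2)).
    rewrite normrM; apply: ler_pM => //; apply: le_trans (ler_normD _ _) _; lra.
  apply: le_trans (ler_normD _ _) _; apply: le_trans (lerD (ler_normD _ _) (lexx _)) _; lra.
have th : 2 * del * (v e0 ^+ 2 + v e1 ^+ 2) <= (k - 1) / k * quad (A z0) v.
  have -> : 2 * del * (v e0 ^+ 2 + v e1 ^+ 2) = (k - 1) / k * (mu * (v e0 ^+ 2 + v e1 ^+ 2)).
    by rewrite /del; field; rewrite gt_eqF.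
  by apply: ler_wpM2l (lower v); rewrite divr_ge0 ?subr_ge0 // ltW.
have q0 : 0 <= quad (A z0) v by apply: le_trans (lower v); rewrite mulr_ge0 ?addr_ge0 ?sqr_ge0 // ltW.
have := le_trans diff th; rewrite ler_norml => /andP[g1 g2].
have kk : (k - 1) / k <= k - 1 by rewrite ler_pdivrMr // ler_peMr ?subr_ge0 // ltW.
split; first by have := ler_wpM2r q0 kk; lra.
have : quad (A z0) v / k <= quad (A z) v.
  have -> : quad (A z0) v / k = quad (A z0) v - (k - 1) / k * quad (A z0) v by field; rewrite gt_eqF.
  lra.
by rewrite ler_pdivrMr // mulrC.
Qed.

Lemma common_bound (R : realType) (V : Type) (I : finType) (B : set V) (F : I -> V -> R) :
  (forall i, exists2 M, 0 < M & forall z, B z -> `|F i z| <= M) ->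
  exists2 M, 0 < M & forall i z, B z -> `|F i z| <= M.
Proof.
move=> h; pose M i := s2val (cid2 (h i)).
have M0 i : 0 < M i := s2valP (cid2 (h i)).
exists (1 + \sum_i M i) => [|i z Bz].
  by rewrite ltr_pwDl // sumr_ge0 // => i _; exact: ltW.
apply: le_trans (s2valP' (cid2 (h i)) z Bz) _; rewrite -/(M i) (bigD1 i) //=.
have : 0 <= \sum_(j | j != i) M j by rewrite sumr_ge0 // => j _; exact: ltW.
lra.
Qed.

Lemma near_cube (R : realType) n (z0 : 'rV[R]_n) (A : set 'rV[R]_n) : (\forall z \near z0, A z) ->
  exists2 r, 0 < r & cube z0 r `<=` A.
Proof.
move=> /nbhs_ballP[e e0 h]; exists (e / 2) => [|z zr]; first by rewrite divr_gt0.
apply: h; split=> // i j; rewrite (ord1 i) /ball /= distrC.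
apply: le_lt_trans (zr j) _; rewrite ltr_pdivrMr // ltr_pMr // ltr1n //.
Qed.

Section MetricBox.
Context {R : realType} (S : riemannian_manifold R 2) (x : S).
Local Notation g := (metric x).
Local Notation bv := (@basis_vec R 2).
Local Notation z0 := (chart x x).

(** The factor k enters the final constant and is fixed in advance. The bound K, which
    depends on the surface, only restricts the scales. *)
Record metric_box (k r K : R) : Prop := MetricBox {
  box_r0 : 0 < r ;
  box_img : cube z0 r `<=` img x ;
  box_invmx : forall z, cube z0 r z -> forall i j, `|invmx (g z) i j| <= K ;
  box_dinvmx : forall z, cube z0 r z -> forall l i j, `|'D_(bv l) (fun w => invmx (g w) i j : R^o) z| <= K ;
  box_conf : forall z, cube z0 r z -> forall i j, `|conf x i j z| <= K ;
  box_dconf : forall z, cube z0 r z -> forall l i j, `|'D_(bv l) (conf x i j : 'rV[R]_2 -> R^o) z| <= K ;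
  box_trace : forall z, cube z0 r z -> g z e0 e0 + g z e1 e1 <= K ;
  box_dens : forall z, cube z0 r z -> 1 <= K * dens x z ;
  box_dens_le : forall z, cube z0 r z -> dens x z <= k * dens x z0 ;
  box_metric_le : forall z, cube z0 r z -> forall v, quad (g z) v <= k * quad (g z0) v ;
  box_metric_ge : forall z, cube z0 r z -> forall v, quad (g z0) v <= k * quad (g z) v ;
  box_cometric : forall z, cube z0 r z -> forall v, quad (invmx (g z)) v <= k * quad (invmx (g z0)) v
}.

Lemma img_self : img x z0.
Proof. by apply: chart_img; exact: dom_self. Qed.

Lemma metric_box_exists k : 1 < k -> exists r K, metric_box k r K.
Proof.
move=> k1; have xz := img_self; have d0 := dens_gt0 xz; have det0 := det_metric_gt0 xz.
have cC f : C1_on (img x) (f : 'rV[R]_2 -> R^o) -> forall z, img x z -> {for z, continuous f}.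
  by move=> h z xz'; exact: C1_continuous (h z xz').
have near_dens : \forall z \near z0, dens x z <= k * dens x z0.
  have kd : dens x z0 < k * dens x z0 by rewrite ltr_pMl.
  have h : \forall z \near z0, dens x z < k * dens x z0.
    exact: (cC _ (dens_C1 (x := x)) _ xz [set s | s < k * dens x z0] (lt_nbhsl kd)).
  by apply: filterS h => z; exact: ltW.
have near_g : \forall z \near z0, forall v, quad (g z) v <= k * quad (g z0) v /\ quad (g z0) v <= k * quad (g z) v.
{ apply: form_comparison => //.
  - by move=> i j; exact: (cC _ (metric_C1 (x := x) i j)).
  - exact: metric_sym01.
  - exact: metric_diag_gt0.
  - by rewrite -det_metricE. }
have near_gV : \forall z \near z0, forall v, quad (invmx (g z)) v <= k * quad (invmx (g z0)) v /\
    quad (invmx (g z0)) v <= k * quad (invmx (g z)) v.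
{ have detn : \det (g z0) != 0 by rewrite gt_eqF.
  have [i00 i01 i10 i11] := inv2E detn.
  apply: form_comparison => //.
  - by move=> i j; exact: (cC _ (invmx_C1 (x := x) i j)).
  - exact: invmx_sym.
  - by rewrite i00 divr_gt0 // metric_diag_gt0.
  - have alg (a b c D : R) : D != 0 -> D = a * c - b ^+ 2 -> c / D * (a / D) - (- b / D) ^+ 2 = D^-1.
      move=> D0 DE; transitivity ((a * c - b ^+ 2) / D ^+ 2); first by field.
      by rewrite -DE; field.
    by rewrite i00 i01 i11 (alg _ _ _ _ detn (det_metricE xz)) invr_gt0. }
have near1 : \forall z \near z0, img x z /\ dens x z <= k * dens x z0.
  by apply: filterS2 (near_img xz) near_dens.
have near2 : \forall z \near z0, (img x z /\ dens x z <= k * dens x z0) /\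
    ((forall v, quad (g z) v <= k * quad (g z0) v /\ quad (g z0) v <= k * quad (g z) v) /\
     forall v, quad (invmx (g z)) v <= k * quad (invmx (g z0)) v /\ quad (invmx (g z0)) v <= k * quad (invmx (g z)) v).
  by apply: filterS3 near1 near_g near_gV.
have [r r0 hr] := near_cube near2.
have im : cube z0 r `<=` img x by move=> z /hr[[]].
have bnd (f : 'rV[R]_2 -> R) : (forall z, img x z -> {for z, continuous f}) -> exists2 M : R, 0 < M & forall z, cube z0 r z -> `|f z| <= M.
  by move=> h; apply: continuous_compact_bounded => [|z /im]; [exact: cube_compact|exact: h].
have cD f v : C1_on (img x) (f : 'rV[R]_2 -> R^o) -> forall z, img x z -> {for z, continuous ('D_v (f : 'rV[R]_2 -> R^o))}.
  by move=> h z xz'; have [_] := h z xz'; exact.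
have [K1 K10 b1] := @common_bound R _ _ (cube z0 r) (fun ij z => invmx (g z) ij.1 ij.2) (fun ij => bnd _ (cC _ (invmx_C1 (x := x) ij.1 ij.2))).
have [K2 K20 b2] := @common_bound R _ _ (cube z0 r) (fun lij z => 'D_(bv lij.1) (fun w => invmx (g w) lij.2.1 lij.2.2 : R^o) z)
  (fun lij => bnd _ (cD _ _ (invmx_C1 (x := x) lij.2.1 lij.2.2))).
have [K3 K30 b3] := @common_bound R _ _ (cube z0 r) (fun ij z => conf x ij.1 ij.2 z) (fun ij => bnd _ (cC _ (conf_C1 (x := x) ij.1 ij.2))).
have [K4 K40 b4] := @common_bound R _ _ (cube z0 r) (fun lij z => 'D_(bv lij.1) (conf x lij.2.1 lij.2.2 : _ -> R^o) z)
  (fun lij => bnd _ (cD _ _ (conf_C1 (x := x) lij.2.1 lij.2.2))).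
have [K5 K50 b5] := @common_bound R _ _ (cube z0 r) (fun i z => g z i i) (fun i => bnd _ (cC _ (metric_C1 (x := x) i i))).
have [K6 K60 b6] := bnd _ (cC _ (densV_C1 (x := x))).
pose K := K1 + K2 + K3 + K4 + 2 * K5 + K6.
exists r, K; split=> //.
- by move=> z zr i j; apply: le_trans (b1 (i, j) z zr) _; rewrite /K; lra.
- by move=> z zr l i j; apply: le_trans (b2 (l, (i, j)) z zr) _; rewrite /K; lra.
- by move=> z zr i j; apply: le_trans (b3 (i, j) z zr) _; rewrite /K; lra.
- by move=> z zr l i j; apply: le_trans (b4 (l, (i, j)) z zr) _; rewrite /K; lra.
- move=> z zr; have := ler_norm (g z e0 e0); have := ler_norm (g z e1 e1).
  have := b5 e0 z zr; have := b5 e1 z zr; rewrite /K /=; lra.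
- move=> z zr; have dz := dens_gt0 (im z zr); have := b6 z zr; rewrite gtr0_norm ?invr_gt0 // => h.
  have : (dens x z)^-1 <= K by apply: le_trans h _; rewrite /K; lra.
  by move=> /(ler_wpM2r (ltW dz)); rewrite mulVf // gt_eqF.
- by move=> z /hr[[]].
- by move=> z /hr[_ [h _]] v; have [] := h v.
- by move=> z /hr[_ [h _]] v; have [] := h v.
- by move=> z /hr[_ [_ h]] v; have [] := h v.
Qed.

End MetricBox.

Section BumpBracket.
#[local] Opaque derive.
Context {R : realType} (S : riemannian_manifold R 2) (x : S).
Local Notation E := (R^o * 'rV[R]_2)%type.
Local Notation sd := (@space_dir R).
Local Notation g := (metric x).
Local Notation bv := (@basis_vec R 2).
Local Notation z0 := (chart x x).
Variables (a b k r K M : R).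
Hypotheses (ab : a < b) (k_gt1 : 1 < k) (k_le2 : k <= 2).
Hypothesis box : metric_box x k r K.
Hypothesis cutoff_bound : forall s, `|'D_1 (cutoff a b : R^o -> R^o) s| <= M /\
  `|'D_1 ('D_1 (cutoff a b : R^o -> R^o)) s| <= M.
Variables (c : 'rV[R]_2) (lam : R).
Hypothesis lam_gt0 : 0 < lam.
Hypothesis lam_small : 48 * K ^+ 4 * M * Num.sqrt (K * b) * lam <= 1.
Local Notation A := (g z0).
Local Notation q := (qform lam A c).
Local Notation phi := (quad_bump a b lam A c).

(** The first term bounds the Hessian of the bump function at scale 1; the summand 1 absorbs
    the derivatives of the metric at small scales. *)
Definition hessian_const : R := 8 * M * (b + 1) + 1.

Let M_ge0 : 0 <= M. Proof. by apply: le_trans (normr_ge0 _) (cutoff_bound 0).1. Qed.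

Let A01 : A e1 e0 = A e0 e1. Proof. by apply: metric_sym01; exact: img_self. Qed.

Let cube_self : cube z0 r z0.
Proof. by move=> i; rewrite subrr normr0 ltW // (box_r0 box). Qed.

Let K_gt0 : 0 < K.
Proof.
apply: lt_le_trans (box_trace box cube_self); rewrite addr_gt0 // metric_diag_gt0 //; exact: img_self.
Qed.

Lemma qform_quad (z : 'rV[R]_2) : quad A (fun i => z 0 i - c 0 i) = lam ^+ 2 * q z.
Proof. by rewrite /qform mulrA -exprMn divff ?expr1n ?mul1r // gt_eqF. Qed.

Lemma quad_qlin_inv z : quad (invmx A) (fun i => qlin A c i z) = lam ^+ 2 * q z.
Proof.
rewrite -qform_quad (quad_qlin A c z) /quad; apply: eq_bigr => i _.
transitivity (qlin A c i z * \sum_j invmx A i j * qlin A c j z).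
  by rewrite mulr_sumr; apply: eq_bigr => j _; rewrite mulrA.
rewrite mulrC; congr (_ * _).
transitivity (\sum_l (\sum_j invmx A i j * A j l) * (z 0 l - c 0 l)).
  rewrite /qlin; under eq_bigr do rewrite mulr_sumr.
  rewrite exchange_big; apply: eq_bigr => l _; rewrite mulr_suml; apply: eq_bigr => j _.
  by rewrite mulrA.
rewrite (bigD1 i) //= (invmx_metric (img_self x)) eqxx mul1r big1 ?addr0 // => l li.
by rewrite (invmx_metric (img_self x)) eq_sym (negbTE li) mul0r.
Qed.

Lemma qlin_bound m z : q z <= b -> `|qlin A c m z| <= lam * Num.sqrt (K * b).
Proof.
move=> qb; have [p [s [w [p0 w0 _ [h00 h01 h10 h11]]]]] := metric_cholesky (img_self x).
have tr := box_trace box cube_self; rewrite h00 h11 in tr.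
set X := p * (z 0 e0 - c 0 e0) + s * (z 0 e1 - c 0 e1); set Y := w * (z 0 e1 - c 0 e1).
have qE : X ^+ 2 + Y ^+ 2 = lam ^+ 2 * q z.
  by rewrite -qform_quad /quad !big_ord2 h00 h01 h10 h11 /X /Y; ring.
have XY : X ^+ 2 + Y ^+ 2 <= lam ^+ 2 * b by rewrite qE ler_wpM2l // sqr_ge0.
have X0 := sqr_ge0 X; have Y0 := sqr_ge0 Y.
have lb : (qlin A c m z) ^+ 2 <= K * (lam ^+ 2 * b).
  apply: (@le_trans _ _ (K * (X ^+ 2 + Y ^+ 2))); last by rewrite ler_wpM2l // ltW.
  case: (ord2P m) => ->.
    have -> : qlin A c e0 z = p * X by rewrite /qlin big_ord2 h00 h01 /X; ring.
    have := ler_wpM2r X0 tr; have := sqr_ge0 (s * X); have := sqr_ge0 (w * X); have := mulr_ge0 (ltW K_gt0) Y0; nra.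
  have -> : qlin A c e1 z = s * X + w * Y by rewrite /qlin big_ord2 h10 h11 /X /Y; ring.
  have XY0 : 0 <= X ^+ 2 + Y ^+ 2 by rewrite addr_ge0.
  have := ler_wpM2r XY0 tr; have := sqr_ge0 (s * Y - w * X).
  have := mulr_ge0 (sqr_ge0 p) XY0; nra.
have -> : lam * Num.sqrt (K * b) = Num.sqrt (lam ^+ 2 * (K * b)).
  by rewrite [RHS]sqrtrM ?sqr_ge0 // sqrtr_sqr gtr0_norm.
by rewrite -sqrtr_sqr; apply: ler_wsqrtr; rewrite mulrCA.
Qed.

Variable P : E -> E -> E -> R^o.
Variables (t : R).

Lemma bump_bracket_bound z : cube z0 r z -> (forall i j, P (sd i) (sd j) (t, z) = P (sd j) (sd i) (t, z)) -> q z <= b ->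
  `|bracket x P t phi z| <= lam^-1 ^+ 2 * hessian_const * (Num.sqrt (tensor_sq (g z) (stress_mx x P t z)) * dens x z).
Proof.
move=> zr P_C qb; have xz := box_img box zr.
have [p [s [w [p0 w0 _ [h00 h01 h10 h11]]]]] := metric_cholesky (img_self x).
have pn : p != 0 by rewrite gt_eqF.
have wn : w != 0 by rewrite gt_eqF.
have l0 : 0 < lam^-1 ^+ 2 by rewrite exprn_gt0 // invr_gt0.
have [cb1 cb2] := cutoff_bound (q z).
set X1 := 'D_1 (cutoff a b : R^o -> R^o) _ in cb1.
set X2 := 'D_(1 : R^o) ('D_(1 : R^o) (cutoff a b : R^o -> R^o)) _ in cb2.
pose be (i : 'I_2) : R := if i == e0 then p else s; pose ga (i : 'I_2) : R := if i == e0 then 0 else w.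
have AE i m : A m i = be i * be m + ga i * ga m.
  by case: (ord2P i) => ->; case: (ord2P m) => ->; rewrite ?h00 ?h01 ?h10 ?h11 /be /ga /=; ring.
have bg : quad (invmx A) be + quad (invmx A) ga = 2.
  have detn : \det A != 0 by rewrite gt_eqF // det_metric_gt0 //; exact: img_self.
  have [i00 i01 i10 i11] := inv2E detn; rewrite (det_metricE (img_self x)) in i00 i01 i10 i11.
  rewrite /quad !big_ord2 i00 i01 i10 i11 h00 h01 h10 h11 /be /ga /=.
  by field; rewrite (_ : _ - _ = (p * w) ^+ 2) ?expf_neq0 ?mulf_neq0 //; ring.
(* The second derivative of the cutoff contributes M (4 lam^-4) (2 lam^2 b) to the
   Hessian, its first derivative M (2 lam^-2) 4. *)
pose F := 2 * M * Num.sqrt (K * b) * lam^-1.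
have bound := @bracket_bound R S x P t z xz P_C phi (quad_bump_smooth lam A c ab) K F
  (lam^-1 ^+ 2 * (8 * M * (b + 1))) (X2 * (4 * lam^-1 ^+ 4)) (X1 * (2 * lam^-1 ^+ 2))
  (fun i => qlin A c i z) be ga (box_invmx box zr) (box_dinvmx box zr) (box_conf box zr) (box_dconf box zr)
  (box_trace box zr) (box_dens box zr).
apply: le_trans (bound _ _ _) _.
- move=> m; rewrite (derive_quad_bump lam c ab A01) -/X1 normrM; rewrite /F.
  have -> : 2 * M * Num.sqrt (K * b) / lam = M * (2 * lam^-1 ^+ 2 * (lam * Num.sqrt (K * b))).
    by field; rewrite gt_eqF.
  apply: ler_pM => //; rewrite normrM ger0_norm; last by rewrite mulr_ge0 // ltW.
  by apply: ler_wpM2l (qlin_bound m qb); rewrite mulr_ge0 // ltW.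
- move=> i m; rewrite (derive2_quad_bump lam c ab A01) -/X1 -/X2 AE.
  move: (qlin A c i z) (qlin A c m z) (be i * be m + _) => u1 u2 u3; ring.
- have e1' : `|X2 * (4 * lam^-1 ^+ 4)| * quad (invmx (g z)) (fun i => qlin A c i z) <= M * (4 * lam^-1 ^+ 4) * (2 * (lam ^+ 2 * b)).
  { apply: ler_pM => //.
    + rewrite -quad_sharp //; exact: quad_metric_ge0.
    + rewrite normrM [`|4 * _|]ger0_norm; last by rewrite mulr_ge0 // exprn_ge0 // invr_ge0 ltW.
      by rewrite ler_wpM2r // mulr_ge0 // exprn_ge0 // invr_ge0 ltW.
    + apply: le_trans (box_cometric box zr _) _; rewrite quad_qlin_inv.
      apply: ler_pM => //; first exact: le_trans (ltW k_gt1).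
      * by rewrite -qform_quad; exact: quad_metric_ge0 (img_self x) _.
      * by rewrite ler_wpM2l // sqr_ge0. }
  have e2' : `|X1 * (2 * lam^-1 ^+ 2)| * (quad (invmx (g z)) be + quad (invmx (g z)) ga) <= M * (2 * lam^-1 ^+ 2) * 4.
  { apply: ler_pM => //.
    + by apply: addr_ge0; rewrite -quad_sharp //; exact: quad_metric_ge0.
    + rewrite normrM [`|2 * _|]ger0_norm; last by rewrite mulr_ge0 // ltW.
      by rewrite ler_wpM2r // mulr_ge0 // ltW.
    + apply: le_trans (lerD (box_cometric box zr _) (box_cometric box zr _)) _; rewrite -mulrDr bg.
      have -> : 4 = 2 * 2 :> R by ring.
      by rewrite ler_wpM2r. }
  apply: le_trans (lerD e1' e2') _.
  rewrite (_ : M * (4 * lam^-1 ^+ 4) * (2 * (lam ^+ 2 * b)) = lam^-1 ^+ 2 * (8 * M * b)); first lra.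
  by field; rewrite gt_eqF.
- apply: ler_wpM2r; first by rewrite mulr_ge0 ?sqrtr_ge0 // ltW // dens_gt0.
  have -> : lam^-1 ^+ 2 * hessian_const = lam^-1 ^+ 2 * (8 * M * (b + 1)) + lam^-1 ^+ 2 by rewrite /hessian_const; ring.
  rewrite lerD2l.
  have -> : 24 * K ^+ 4 * F = lam^-1 ^+ 2 * (48 * K ^+ 4 * M * Num.sqrt (K * b) * lam).
    by rewrite /F; field; rewrite gt_eqF.
  by rewrite -[leRHS]mulr1 ler_wpM2l // ltW.
Qed.

End BumpBracket.

(** * Growth of the localized energy *)

Lemma Rintegral_le_lower d (T : measurableType d) (R : realType) (mu : {measure set T -> \bar R})
    (h : T -> R) (be : T -> \bar R) (c : R) : mu.-integrable setT (EFin \o h) ->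
  (forall z, (0 <= be z)%E) -> (forall z, ((h z)%:E <= be z)%E) -> (\int[mu]_z be z <= c%:E)%E ->
  \int[mu]_z h z <= c.
Proof.
move=> ih b0 hb ic; rewrite -lee_fin /Rintegral fineK; last exact: integrable_fin_num.
apply: le_trans ic; rewrite integralE.
apply: (@le_trans _ _ (\int[mu]_z (EFin \o h)^\+ z)%E).
  by rewrite leeBlDr ?leeDl ?integral_ge0 //; apply: integrable_neg_fin_num.
apply: ge0_le_integral_ae => //.
by apply: aeW => z; rewrite funeposE ge_max hb b0.
Qed.

(** Either y is at most m, or the first term alone is at least y. *)
Lemma powR_young (R : realType) (q m y : R) : 1 <= q -> 0 < m -> 0 <= y ->
  y <= m `^ (1 - q) * y `^ q + m.
Proof.
move=> q1 m0 y0; have [ym|my] := leP y m.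
  by apply: le_trans ym _; rewrite lerDr mulr_ge0 ?powR_ge0.
have y_gt0 : 0 < y by apply: lt_trans my.
have e : y = y `^ (1 - q) * y `^ q.
  rewrite -powRD; first by rewrite subrK powRr1.
  by rewrite (gt_eqF y_gt0) implybT.
rewrite {1}e; apply: (@le_trans _ _ (m `^ (1 - q) * y `^ q)); last by rewrite lerDl ltW.
apply: ler_wpM2r; first exact: powR_ge0.
have -> : 1 - q = - (q - 1) by rewrite opprB.
rewrite !powRN lef_pV2 ?posrE ?powR_gt0 //.
by apply: ge0_ler_powR; rewrite ?nnegrE ?subr_ge0 // ltW.
Qed.

Lemma lt_ereal_between (R : realType) (T : \bar R) (t : R) : (t%:E < T)%E -> exists2 b, t < b & (b%:E < T)%E.
Proof.
case: T => [s|_|//]; last by exists (t + 1); rewrite ?ltrDl ?ltry.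
by rewrite lte_fin => ts; exists ((t + s) / 2); rewrite ?lte_fin; lra.
Qed.

Section MatrixC1.
Context {R : realType} {V : normedModType R} (A : set V).
Hypothesis oA : open A.

Lemma C1_mulmx m n p (M : V -> 'M[R]_(m, n)) (N : V -> 'M[R]_(n, p)) :
  (forall i j, C1_on A (fun z => M z i j : R^o)) -> (forall i j, C1_on A (fun z => N z i j : R^o)) ->
  forall i j, C1_on A (fun z => (M z *m N z) i j : R^o).
Proof.
move=> hM hN i j.
have h : C1_on A (fun z => \sum_k M z i k * N z k j : R^o).
  by apply: C1_on_sum => // k; exact: (C1_onM oA (hM i k) (hN k j)).
by apply: (C1_on_eq oA _ h) => z _; rewrite mxE.
Qed.

Lemma C1_mxtrace n (M : V -> 'M[R]_n) : (forall i j, C1_on A (fun z => M z i j : R^o)) ->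
  C1_on A (fun z => \tr (M z) : R^o).
Proof. by move=> hM; apply: C1_on_sum => // i; exact: hM. Qed.

End MatrixC1.

Section LocalGrowth.
#[local] Opaque derive.
Context {R : realType} (S : riemannian_manifold R 2) (T : \bar R) (x : S).
Local Notation E := (R^o * 'rV[R]_2)%type.
Local Notation td := (@time_dir R).
Local Notation sd := (@space_dir R).
Local Notation g := (metric x).
Local Notation bv := (@basis_vec R 2).
Local Notation z0 := (chart x x).
Local Notation bR := (g_sigma_algebraType (R.-ocitv.-measurable)).
Local Notation mu2 := (leb2 : {measure set (bR * bR) -> \bar R}).
Variables (a b k r K M : R).
Hypotheses (a_ge0 : 0 <= a) (ab : a < b) (k_gt1 : 1 < k) (k_le2 : k <= 2).
Hypothesis box : metric_box x k r K.
Hypothesis cutoff_bound : forall s, `|'D_1 (cutoff a b : R^o -> R^o) s| <= M /\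
  `|'D_1 ('D_1 (cutoff a b : R^o -> R^o)) s| <= M.
Variables (c : 'rV[R]_2) (lam : R).
Hypothesis lam_gt0 : 0 < lam.
Hypothesis lam_small : 48 * K ^+ 4 * M * Num.sqrt (K * b) * lam <= 1.
Local Notation A := (g z0).
Local Notation q := (qform lam A c).
Local Notation phi := (quad_bump a b lam A c).
Hypothesis ell_cube : forall z, q z <= b -> cube z0 r z.
Variable P : E -> E -> E -> R^o.
Hypothesis P_C1 : forall X Y, C1_on (flow_dom T x) (P X Y).
Hypothesis P_C : forall X Y s, flow_dom T x s -> P X Y s = P Y X s.
Hypothesis P_identity : forall s Z, flow_dom T x s ->
  P td Z s = \sum_i \sum_j invmx (g s.2) i j *
   (2^-1 * ('D_(sd i) (P (sd j) Z) s + 'D_(sd j) (P (sd i) Z) s - 'D_Z (P (sd i) (sd j)) s)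
    - \sum_k christoffel g s.2 k i j * P (sd k) Z s).
Hypothesis P_ge0 : forall s, flow_dom T x s -> 0 <= P td td s.

Let A01 : A e1 e0 = A e0 e1. Proof. by apply: metric_sym01; exact: img_self. Qed.

Let q_diff z : {for z, continuous (q : 'rV[R]_2 -> R^o)}.
Proof. by apply: differentiable_continuous; exact: qform_diff. Qed.

Lemma ell_compact : compact [set z | q z <= b].
Proof.
apply: (@subclosed_compact _ _ (cube z0 r)); [|exact: cube_compact|exact: ell_cube].
by apply: (continuous_closedP (q : 'rV[R]_2 -> R^o)).1 (@closed_le R b) => z; exact: q_diff.
Qed.

Lemma ell_img z : q z <= b -> img x z.
Proof. by move=> /ell_cube; exact: (box_img box). Qed.

Lemma phi_notin z : ~ q z <= b -> phi z = 0.
Proof. by move=> /negP; rewrite -ltNge => h; apply: quad_bump0 => //; exact: ltW. Qed.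

Lemma bump_joint_continuous (f : E -> R^o) t (z : R * R) : 0 < t -> (t%:E < T)%E ->
  (forall s, flow_dom T x s -> {for s, continuous f}) ->
  {for (t, z), continuous (fun p : R * (R * R) => phi (row2 p.2) * f (p.1, row2 p.2))}.
Proof.
move=> t0 tT cf.
have c2 : {for (t, z), continuous (fun p : R * (R * R) => row2 p.2 : 'rV[R]_2)}.
  have cs : continuous (fun p : R * (R * R) => p.2) by move=> p; exact: cvg_snd.
  exact: (@continuous_comp _ _ _ (fun p : R * (R * R) => p.2) (@row2 R) (t, z) (cs (t, z)) (@row2_continuous R z)).
have [xz|nz] := pselect (img x (row2 z)).
  have c1 : {for (t, z), continuous (fun p : R * (R * R) => (p.1, row2 p.2) : E)}.
    have cs : continuous (fun p : R * (R * R) => p.1) by move=> p; exact: cvg_fst.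
    exact: (cvg_pair (cs (t, z)) c2).
  have cp : {for (t, z), continuous (fun p : R * (R * R) => phi (row2 p.2))}.
    apply: (continuous_comp c2); apply: differentiable_continuous.
    exact: smooth_on_diff (quad_bump_smooth lam A c ab) I.
  have cf' := cf (t, row2 z) (flow_dom_slice t0 tT xz).
  exact: (cvgM cp (continuous_comp c1 cf')).
have bz : b < q (row2 z) by rewrite ltNge; apply/negP => /ell_img.
have n0 : \forall p \near (t, z), 0 = phi (row2 p.2) * f (p.1, row2 p.2).
  have h : \forall p \near (t, z), phi (row2 p.2) = 0 := c2 _ (near_quad_bump0 a bz).
  by apply: filterS h => p /= ->; rewrite mul0r.
rewrite /prop_for /continuous_at -(nbhs_singleton n0).
exact: (cvg_trans (near_eq_cvg n0) (cvg_cst _)).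
Qed.

Definition ell2 : set (bR * bR) := [set z : R * R | q (row2 z) <= b].

Lemma ell_measurable : measurable ell2.
Proof.
have cq : continuous (fun z : R * R => q (row2 z)).
  move=> z; exact: (@continuous_comp _ _ _ (@row2 R) q z (@row2_continuous R z) (@q_diff (row2 z))).
have := @continuous2_measurable R _ cq measurableT _ (@measurable_itv R `]-oo, b]).
by rewrite setTI; congr measurable; apply/seteqP; split => z /=; rewrite in_itv.
Qed.

Definition density_dot (s : E) : R := 2^-1 * \sum_i \sum_j conf x i j s.2 * 'D_td (P (sd i) (sd j)) s.

Lemma flow_snd_continuous (h : 'rV[R]_2 -> R) s : (forall z, img x z -> {for z, continuous h}) ->
  flow_dom T x s -> {for s, continuous (fun s : E => h s.2)}.
Proof.
case: s => t z hc [_ _ xz].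
have cs : continuous (fun s : E => s.2) by move=> s; exact: cvg_snd.
exact: (@continuous_comp _ _ _ (fun s : E => s.2) h (t, z) (cs (t, z)) (hc z xz)).
Qed.

Lemma energy_density_continuous s : flow_dom T x s -> {for s, continuous (energy_density x P : E -> R^o)}.
Proof.
move=> hs; rewrite /prop_for /continuous_at.
apply: (cvgM (cvg_cst _)); apply: cvg_bigsum => i; apply: cvg_bigsum => j; apply: cvgM.
  apply: (@flow_snd_continuous (conf x i j)) => // z xz; exact: C1_continuous (conf_C1 (x := x) i j xz).
by have [d _] := @P_C1 (sd i) (sd j) s hs; exact: differentiable_continuous.
Qed.

Lemma density_dot_continuous s : flow_dom T x s -> {for s, continuous (density_dot : E -> R^o)}.
Proof.
move=> hs; rewrite /prop_for /continuous_at.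
apply: (cvgM (cvg_cst _)); apply: cvg_bigsum => i; apply: cvg_bigsum => j; apply: cvgM.
  apply: (@flow_snd_continuous (conf x i j)) => // z xz; exact: C1_continuous (conf_C1 (x := x) i j xz).
by have [_ d] := @P_C1 (sd i) (sd j) s hs; exact: d.
Qed.

Section Slice.
Variable t : R.
Hypotheses (t0 : 0 < t) (tT : (t%:E < T)%E).

Lemma slice_continuous (f : E -> R^o) : (forall s, flow_dom T x s -> {for s, continuous f}) ->
  continuous (fun z : R * R => phi (row2 z) * f (t, row2 z)).
Proof.
move=> cf z; have cp : {for z, continuous (fun z : R * R => (t, z))} by exact: (differentiable_continuous (@slice_differentiable R (R^o * R^o)%type R^o t z)).
exact: (continuous_comp cp (@bump_joint_continuous f t z t0 tT cf)).
Qed.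

Lemma slice_integrable (f : E -> R^o) : (forall s, flow_dom T x s -> {for s, continuous f}) ->
  leb2.-integrable setT (EFin \o (fun z : R * R => phi (row2 z) * f (t, row2 z))).
Proof.
move=> cf; have [m hm] := compact_square ell_compact.
apply: (@integrable_compact_support _ _ m); first exact: slice_continuous.
by move=> z nz; rewrite phi_notin ?mul0r // => /hm.
Qed.

Definition stress_size z : R := Num.sqrt (tensor_sq (g z) (stress_mx x P t z)).

Lemma stress_size_ge0 z : 0 <= stress_size z.
Proof. exact: sqrtr_ge0. Qed.

Lemma stress_size_continuous z : img x z -> {for z, continuous stress_size}.
Proof.
move=> xz; have oA := @img_open _ _ S x.
have cP i j : C1_on (img x) (fun z => pull_mx P t z i j : R^o).
  have h := slice_C1 t0 tT (@P_C1 (sd i) (sd j)).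
  by apply: (C1_on_eq oA _ h) => w _; rewrite mxE.
have cV := invmx_C1 (x := x).
have cS i j : C1_on (img x) (fun z => stress_mx x P t z i j : R^o).
  have h := C1_onB oA (cP i j) (C1_onM oA (C1_onZ oA 2^-1 (C1_mxtrace oA (C1_mulmx oA cV cP))) (metric_C1 (x := x) i j)).
  by apply: (C1_on_eq oA _ h) => w _; rewrite stress_mxE [in RHS]/pull_mx; congr (_ - _); rewrite [LHS]mxE.
have cST i j : C1_on (img x) (fun z => (stress_mx x P t z)^T i j : R^o).
  by apply: (C1_on_eq oA _ (cS j i)) => w _; rewrite [RHS]mxE.
have h := C1_mxtrace oA (C1_mulmx oA (C1_mulmx oA (C1_mulmx oA cV cS) cV) cST).
by apply: (continuous_comp (C1_continuous (h z xz))); exact: sqrt_continuous.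
Qed.

Let cur i : 'rV[R]_2 -> R^o := current x P t phi i.

Lemma current_notin i z : ~ q z <= b -> cur i z = 0.
Proof.
move=> nz; rewrite /cur /current (phi_notin nz) mul0r big1 ?subr0 // => l _.
rewrite /grad_field big1 ?mul0r // => m _.
by rewrite (derive_notin (bv m) ell_compact phi_notin nz) mulr0.
Qed.

Lemma current_C1_all i z : C1_at (cur i) z.
Proof.
apply: (C1_cutoff (@norm_hausdorff _ _) ell_compact ell_img (@current_notin i)).
exact: (current_C1 P_C1 t0 tT (quad_bump_smooth lam A c ab)).
Qed.

Lemma divergence_integrable i : leb2.-integrable setT (EFin \o (fun z => 'D_(bv i) (cur i) (row2 z))).
Proof.
apply: (@integrable_compact_rV R ('D_(bv i) (cur i) : 'rV[R]_2 -> R) _ ell_compact).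
  by move=> z; have [_ h] := current_C1_all i z; exact: h.
by move=> z nz; exact: (derive_notin (bv i) ell_compact (@current_notin i) nz).
Qed.

Lemma ell2_img2 : ell2 `<=` img2 x.
Proof. by move=> z; exact: ell_img. Qed.

Lemma stress_measurable : measurable_fun ell2 (fun z : R * R => stress_size (row2 z) * dens x (row2 z) : R).
Proof.
apply: (@measurable_funS _ _ _ _ (img2 x) _ _ (img2_measurable x) ell2_img2).
apply: open_continuous2_measurable; first exact: img2_open.
move=> z xz.
have c1 := @continuous_comp _ _ _ (@row2 R) stress_size z (@row2_continuous R z) (stress_size_continuous xz).
have c2 := @continuous_comp _ _ _ (@row2 R) (dens x : 'rV[R]_2 -> R) z (@row2_continuous R z) (C1_continuous (dens_C1 xz)).
exact: (cvgM c1 c2).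
Qed.

(** The kinetic term has a sign and the current integrates to zero. *)
Lemma growth_rate (C : R) :
  (\int[mu2]_(z in ell2) (stress_size (row2 (z : R * R)) * dens x (row2 (z : R * R)))%:E <= C%:E)%E ->
  \int[mu2]_z (phi (row2 (z : R * R)) * density_dot (t, row2 (z : R * R))) <= lam^-1 ^+ 2 * hessian_const b M * C.
Proof.
move=> hC; pose H := lam^-1 ^+ 2 * hessian_const b M.
have M0 : 0 <= M by apply: le_trans (normr_ge0 _) (cutoff_bound 0).1.
have b0 : 0 < b by exact: le_lt_trans ab.
have H0 : 0 <= H.
  by rewrite mulr_ge0 ?sqr_ge0 // /hessian_const addr_ge0 // mulr_ge0 ?mulr_ge0 // addr_ge0 // ltW.
pose f (z : R * R) := phi (row2 z) * density_dot (t, row2 z).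
pose d i (z : R * R) := 'D_(bv i) (cur i) (row2 z).
have fi : mu2.-integrable setT (EFin \o f) by exact: slice_integrable density_dot_continuous.
have di i : mu2.-integrable setT (EFin \o d i) by exact: divergence_integrable.
have d0 i : \int[mu2]_z d i z = 0 by exact: (integral_derive_plane i ell_compact (current_C1_all i) (@current_notin i)).
have f1i : mu2.-integrable setT (EFin \o (fun z => f z - d e0 z)) by exact: (integrableB measurableT fi (di e0)).
have f2i : mu2.-integrable setT (EFin \o (fun z => f z - d e0 z - d e1 z)) by exact: (integrableB measurableT f1i (di e1)).
have -> : \int[mu2]_z f z = \int[mu2]_z (f z - d e0 z - d e1 z).
  rewrite (RintegralB measurableT f1i (di e1)) (RintegralB measurableT fi (di e0)) (d0 e0) (d0 e1).
  by rewrite !subr0.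
pose be (z : R * R) : \bar R := (H%:E * (((fun z : R * R => (stress_size (row2 z) * dens x (row2 z))%:E) \_ (ell2 : set (R * R))) z))%E.
have sd0 (z : R * R) : q (row2 z) <= b -> 0 <= stress_size (row2 z) * dens x (row2 z).
  by move=> qb; rewrite mulr_ge0 ?stress_size_ge0 // ltW // dens_gt0 //; exact: ell_img.
apply: (@Rintegral_le_lower _ _ _ mu2 _ be _ f2i) => [z|z|].
- rewrite /be mule_ge0 ?lee_fin // patchE; case: ifPn => // /set_mem /= qb.
  by rewrite lee_fin sd0.
- rewrite /be patchE; case: ifPn => [/set_mem /= qb|/negP nq].
    have xz := ell_img qb; rewrite -EFinM lee_fin.
    have idt := energy_identity P_C1 P_C P_identity t0 tT (quad_bump_smooth lam A c ab) xz.
    rewrite -/(cur _) big_ord2 in idt.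
    have hb := bump_bracket_bound ab k_gt1 k_le2 box cutoff_bound lam_gt0 lam_small
      (P := P) (t := t) (ell_cube qb) (fun i j => P_C (sd i) (sd j) (flow_dom_slice t0 tT xz)) qb.
    have p0 : 0 <= phi (row2 z) * (dens x (row2 z) * P td td (t, row2 z)).
      rewrite mulr_ge0 ?quad_bump_ge0 // mulr_ge0 //; first by rewrite ltW // dens_gt0.
      exact: P_ge0 (flow_dom_slice t0 tT xz).
    have := ler_norm (bracket x P t phi (row2 z)).
    rewrite /f /d /density_dot /=; move: idt; rewrite mulrDr => idt.
    move: hb; rewrite -/(stress_size (row2 z)) -/H; move: p0 idt; lra.
  have nz : ~ q (row2 z) <= b by move=> qb; apply: nq; rewrite inE.
  rewrite mule0 lee_fin /f (phi_notin nz) mul0r /d.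
  rewrite (derive_notin (bv e0) ell_compact (@current_notin e0) nz).
  by rewrite (derive_notin (bv e1) ell_compact (@current_notin e1) nz) !subr0.
- rewrite /be ge0_integralZl_EFin //.
  + rewrite [leRHS](EFinM H C) -integral_mkcond.
    by apply: (@lee_wpmul2l _ H%:E) => //; rewrite lee_fin.
  + by move=> z _; rewrite patchE; case: ifPn => // /set_mem /= qb; rewrite lee_fin sd0.
  + have hm : measurable_fun ell2 (fun z : R * R => (stress_size (row2 z) * dens x (row2 z))%:E).
      by apply/measurable_EFinP; exact: stress_measurable.
    exact: ((measurable_restrictT _ ell_measurable).1 hm).
Qed.

End Slice.

Lemma dens_ell_measurable : measurable_fun ell2 (fun z : R * R => dens x (row2 z) : R).
Proof.
apply: (@measurable_funS _ _ _ _ (img2 x) _ _ (img2_measurable x) ell2_img2).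
apply: open_continuous2_measurable; first exact: img2_open.
move=> z xz.
exact: (@continuous_comp _ _ _ (@row2 R) (dens x : 'rV[R]_2 -> R) z (@row2_continuous R z) (C1_continuous (dens_C1 xz))).
Qed.

Lemma stress_pow_measurable t e : 0 < t -> (t%:E < T)%E ->
  measurable_fun ell2 (fun z : R * R => stress_size t (row2 z) `^ e * dens x (row2 z) : R).
Proof.
move=> t0 tT; apply: measurable_funM dens_ell_measurable.
apply: (measurableT_comp (measurable_powR e)).
apply: (@measurable_funS _ _ _ _ (img2 x) _ _ (img2_measurable x) ell2_img2).
apply: open_continuous2_measurable; first exact: img2_open.
move=> z xz.
exact: (@continuous_comp _ _ _ (@row2 R) (stress_size t) z (@row2_continuous R z) (stress_size_continuous t0 tT xz)).
Qed.

Let b_gt0 : 0 < b. Proof. exact: le_lt_trans ab. Qed.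

Lemma ell_mass : (\int[mu2]_(z in ell2) (dens x (row2 (z : R * R)))%:E <= (8 * b * lam ^+ 2)%:E)%E.
Proof.
have xz := img_self x; have d0 := dens_gt0 xz.
have a00 := metric_diag_gt0 e0 xz; have a11 := metric_diag_gt0 e1 xz.
have det0 := det_metric_gt0 xz; rewrite (det_metricE xz) in det0.
have s0 : 0 < lam ^+ 2 * b by rewrite mulr_gt0 // exprn_gt0.
have area : (mu2 ell2 <= (4 * (lam ^+ 2 * b) / dens x z0)%:E)%E.
  have := ellipse_area (coord2 c) a11 det0 s0; rewrite -(det_metricE xz) -/(dens x z0).
  congr (_ <= _)%E; congr (mu2 _); apply/seteqP.
  have qE (z : R * R) : A e0 e0 * (z.1 - (coord2 c).1) ^+ 2 + 2 * A e0 e1 * (z.1 - (coord2 c).1) * (z.2 - (coord2 c).2)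
      + A e1 e1 * (z.2 - (coord2 c).2) ^+ 2 = lam ^+ 2 * q (row2 z).
    have -> : lam ^+ 2 * q (row2 z) = quad A (fun i => row2 z 0 i - c 0 i) by apply/esym; exact: qform_quad.
    rewrite /quad !big_ord2 A01 /coord2 !mxE /=.
    by move: (A e0 e0) (A e0 e1) (A e1 e1) => a1 a2 a3; ring.
  have l2 : 0 < lam ^+ 2 by rewrite exprn_gt0.
  by split => z /=; rewrite qE (ler_pM2l l2).
apply: (@le_trans _ _ (\int[mu2]_(z in ell2) (k * dens x z0)%:E)%E).
{ apply: ge0_le_integral.
  - exact: ell_measurable.
  - by move=> z /ell2_img2 xz'; rewrite lee_fin ltW // dens_gt0.
  - by apply/measurable_EFinP; exact: dens_ell_measurable.
  - exact: measurable_cst.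
  - by move=> z hz; rewrite lee_fin (box_dens_le box) //; exact: ell_cube. }
rewrite integral_cst; last exact: ell_measurable.
have kd0 : 0 <= k * dens x z0 by rewrite mulr_ge0 // ltW // (lt_trans _ k_gt1).
apply: le_trans (lee_wpmul2l _ area) _; first by rewrite lee_fin.
rewrite -EFinM lee_fin.
have -> : k * dens x z0 * (4 * (lam ^+ 2 * b) / dens x z0) = k * (4 * (lam ^+ 2 * b)) by field; rewrite gt_eqF.
have h4 : 0 <= 4 * (lam ^+ 2 * b) by rewrite mulr_ge0 // ltW.
by apply: le_trans (ler_wpM2r h4 k_le2) _; lra.
Qed.

(** Young's inequality at the level m = sigma lam^(-2/e), where both terms have the size of m
    times the area of the ellipse. *)
Lemma stress_mass t e sigma : 0 < t -> (t%:E < T)%E -> 1 <= e -> 0 < sigma ->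
  (\int[mu2]_(z in ell2) (stress_size t (row2 (z : R * R)) `^ e * dens x (row2 (z : R * R)))%:E <= (sigma `^ e)%:E)%E ->
  (\int[mu2]_(z in ell2) (stress_size t (row2 (z : R * R)) * dens x (row2 (z : R * R)))%:E <=
    ((1 + 8 * b) * sigma * lam `^ (- 2 / e) * lam ^+ 2)%:E)%E.
Proof.
move=> t0 tT e1' s0 hs; have e0' : 0 < e by apply: lt_le_trans e1'.
pose m := sigma * lam `^ (- 2 / e); have m0 : 0 < m by rewrite mulr_gt0 // powR_gt0.
have N0 z := stress_size_ge0 t z.
have dz (z : R * R) : ell2 z -> 0 <= dens x (row2 z) by move=> /ell2_img2 xz; rewrite ltW // dens_gt0.
have mp := stress_pow_measurable e t0 tT; have md := dens_ell_measurable.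
apply: (@le_trans _ _ (\int[mu2]_(z in ell2) ((m `^ (1 - e))%:E * (stress_size t (row2 (z : R * R)) `^ e * dens x (row2 (z : R * R)))%:E
   + m%:E * (dens x (row2 (z : R * R)))%:E))%E).
{ apply: ge0_le_integral.
  - exact: ell_measurable.
  - by move=> z hz; rewrite lee_fin mulr_ge0 // dz.
  - by apply/measurable_EFinP; exact: stress_measurable.
  - apply: emeasurable_funD; apply: measurable_funeM; exact/measurable_EFinP.
  - move=> z hz; rewrite -!EFinM -EFinD lee_fin.
    have := ler_wpM2r (dz z hz) (powR_young e1' m0 (N0 (row2 z))).
    by rewrite mulrDl mulrA. }
have p1 : (0 <= (m `^ (1 - e))%:E)%E by rewrite lee_fin powR_ge0.
have p2 : (0 <= m%:E)%E by rewrite lee_fin ltW.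
have mp' := (measurable_EFinP _ _).2 mp; have md' := (measurable_EFinP _ _).2 md.
have h1 (z : R * R) : ell2 z -> (0 <= (stress_size t (row2 z) `^ e * dens x (row2 z))%:E)%E.
  by move=> hz; rewrite lee_fin mulr_ge0 ?powR_ge0 // dz.
have h2 (z : R * R) : ell2 z -> (0 <= (dens x (row2 z))%:E)%E by move=> hz; rewrite lee_fin dz.
rewrite (ge0_integralD mu2 ell_measurable (fun z hz => mule_ge0 p1 (h1 z hz)) (measurable_funeM _ mp')
  (fun z hz => mule_ge0 p2 (h2 z hz)) (measurable_funeM _ md')).
rewrite (ge0_integralZl_EFin mu2 ell_measurable h1 mp' (powR_ge0 _ _)).
rewrite (ge0_integralZl_EFin mu2 ell_measurable h2 md' (ltW m0)).
apply: le_trans (leeD (lee_wpmul2l p1 hs) (lee_wpmul2l p2 ell_mass)) _.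
rewrite -!EFinM -EFinD lee_fin.
have -> : m `^ (1 - e) * sigma `^ e = sigma * lam `^ (- 2 / e) * lam ^+ 2.
  rewrite /m powRM ?powR_ge0 ?(ltW s0) // mulrAC -powRD ?(gt_eqF s0) ?implybT // subrK powRr1 ?(ltW s0) //.
  rewrite -mulrA; congr (_ * _); rewrite -powRrM -(powR_mulrn 2 (ltW lam_gt0)) -powRD ?(gt_eqF lam_gt0) ?implybT //.
  by congr (_ `^ _); field; rewrite gt_eqF.
rewrite /m; move: (lam `^ _) (lam ^+ 2) => u v; lra.
Qed.

(** The time derivative is bounded by [growth_rate], whose hypothesis is [stress_mass]. *)
Lemma local_growth s t e sigma : 0 < s -> s <= t -> (t%:E < T)%E -> 1 <= e -> 0 < sigma ->
  (forall r, s <= r <= t ->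
    (\int[mu2]_(z in ell2) (stress_size r (row2 (z : R * R)) `^ e * dens x (row2 (z : R * R)))%:E <= (sigma `^ e)%:E)%E) ->
  \int[leb2]_z (phi (row2 (z : R * R)) * energy_density x P (t, row2 (z : R * R)))
    - \int[leb2]_z (phi (row2 (z : R * R)) * energy_density x P (s, row2 (z : R * R)))
  <= hessian_const b M * (1 + 8 * b) * sigma * lam `^ (- 2 / e) * (t - s).
Proof.
move=> s0 st tT e1' sg0 hs.
have [b1 tb b1T] : exists2 b1, t < b1 & (b1%:E < T)%E.
  by exact: lt_ereal_between.
have [m hm] := compact_square ell_compact.
have inT w : 0 < w < b1 -> 0 < w /\ (w%:E < T)%E.
  by move=> /andP[w0 wb]; split => //; apply: lt_trans b1T; rewrite lte_fin.
have H := @integral_growth R (fun t z => phi (row2 z) * energy_density x P (t, row2 z))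
  (fun t z => phi (row2 z) * density_dot (t, row2 z)) 0 b1 m
  (hessian_const b M * (1 + 8 * b) * sigma * lam `^ (- 2 / e)).
apply: (H _ _ _ _ s t s0 st tb) => {H}.
- move=> w z /inT[r0 rT]; have [xz|nz] := pselect (img x (row2 z)).
    have d := derive_density_time P_C1 r0 rT xz.
    exact: (@is_deriveZ _ _ _ _ (phi (row2 z)) _ _ _ d).
  have nq : ~ q (row2 z) <= b by move=> /ell_img.
  rewrite (phi_notin nq) (_ : (fun _ => _) = cst 0); last by apply/funext => v; rewrite mul0r.
  by rewrite mul0r; exact: is_derive_cst.
- by move=> w /inT[r0 rT]; exact: (slice_continuous r0 rT energy_density_continuous).
- by move=> w z /inT[r0 rT]; exact: (bump_joint_continuous r0 rT density_dot_continuous).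
- move=> w z _ nz; have nq : ~ q (row2 z) <= b by move=> /hm.
  by rewrite (phi_notin nq) !mul0r.
- move=> w /andP[sr rt]; have r0 : 0 < w by apply: lt_le_trans sr.
  have rT : (w%:E < T)%E by apply: le_lt_trans tT; rewrite lee_fin.
  have := growth_rate r0 rT (stress_mass r0 rT e1' sg0 (hs w _)); rewrite sr rt => /(_ isT).
  move=> h; apply: le_trans h _; rewrite le_eqVlt; apply/orP; left; apply/eqP.
  by move: (lam `^ _) => u; field; rewrite gt_eqF.
Qed.

End LocalGrowth.


(** * Energy and stress in a chart *)

Section Congruence.
Context {R : realType} {n : nat}.
Implicit Types (g h J B : 'M[R]_n).

Lemma invmx_congruence g h J : J \in unitmx -> h \in unitmx -> g = J *m h *m J^T ->
  invmx g = (invmx J)^T *m invmx h *m invmx J.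
Proof.
move=> uJ uh ->; have uJT : J^T \in unitmx by rewrite unitmx_tr.
have e : (J *m h *m J^T) *m ((invmx J)^T *m invmx h *m invmx J) = 1%:M.
  by rewrite trmx_inv !mulmxA (mulmxK uJT) (mulmxK uh) mulmxV.
have u : J *m h *m J^T \in unitmx by rewrite !unitmx_mul uJ uh.
by rewrite -[LHS]mulmx1 -e mulKmx.
Qed.

Lemma trace_congruence g h J B : J \in unitmx -> h \in unitmx -> g = J *m h *m J^T ->
  \tr (invmx g *m (J *m B *m J^T)) = \tr (invmx h *m B).
Proof.
move=> uJ uh /(invmx_congruence uJ uh) ->.
have -> : (invmx J)^T *m invmx h *m invmx J *m (J *m B *m J^T) = ((invmx J)^T *m (invmx h *m B)) *m J^T.
  by rewrite !mulmxA mulmxKV.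
have uJT : J^T \in unitmx by rewrite unitmx_tr.
by rewrite mxtrace_mulC trmx_inv mulKVmx.
Qed.

End Congruence.

Lemma tensor_sq_congruence (R : realType) (g h J B : 'M[R]_2) : J \in unitmx -> h \in unitmx ->
  g = J *m h *m J^T -> tensor_sq g (J *m B *m J^T) = tensor_sq h B.
Proof.
move=> uJ uh gE; rewrite /tensor_sq.
have -> : (J *m B *m J^T)^T = J *m B^T *m J^T by rewrite !trmx_mul trmxK mulmxA.
have -> : invmx g *m (J *m B *m J^T) *m invmx g *m (J *m B^T *m J^T) = invmx g *m (J *m (B *m invmx h *m B^T) *m J^T).
  rewrite [X in _ *m X *m _](invmx_congruence uJ uh gE).
  have uJT : J^T \in unitmx by rewrite unitmx_tr.
  by rewrite trmx_inv -!mulmxA; congr (_ *m (_ *m (_ *m _))); rewrite !mulmxA mulmxV // mul1mx mulmxKV.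
by rewrite (trace_congruence _ uJ uh gE) !mulmxA.
Qed.

Section ClassicalPullback.
Context {R : realType} {n : nat} (S : riemannian_manifold R 2) (N : riemannian_manifold R n).
Variable w : S -> N.
Hypothesis cw : C1_map w.

Definition classical_pullback y : 'M[R]_2 :=
  classical_diff w y *m metric_at (w y) *m (classical_diff w y)^T.

Variables (x : S) (z : 'rV[R]_2).
Hypothesis xz : img x z.
Local Notation y := (ichart x z).
Local Notation J := (transition_jac x y).

Lemma chart_map_diff : differentiable (chart (w y) \o w \o ichart x) z.
Proof. by apply: (map_diff cw); split => //; exact: dom_self. Qed.

Lemma pullback_frame i j :
  ('D_(basis_vec i) (chart (w y) \o w \o ichart x) z *m metric_at (w y)
     *m ('D_(basis_vec j) (chart (w y) \o w \o ichart x) z)^T) 0 0 =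
  (J *m classical_pullback y *m J^T) i j.
Proof.
have md : map_dom w x (w y) z by split => //; exact: dom_self.
have jE := jacobian_map cw md; rewrite tmx_self ?mulmx1 in jE; last by apply: chart_img; exact: dom_self.
have De k : 'D_(basis_vec k) (chart (w y) \o w \o ichart x) z = row k (J *m classical_diff w y).
  rewrite [LHS](deriveEjacobian (basis_vec k) chart_map_diff) jE rowE; exact: erefl.
rewrite (De i) (De j) /classical_pullback.
have -> : J *m (classical_diff w y *m metric_at (w y) *m (classical_diff w y)^T) *m J^T =
   (J *m classical_diff w y) *m metric_at (w y) *m (J *m classical_diff w y)^T by rewrite trmx_mul !mulmxA.
rewrite -row_mul mxE [RHS]mxE; apply: eq_bigr => l _; congr (_ * _); first exact: mxE.
by rewrite mxE [RHS]mxE; exact: mxE.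
Qed.

End ClassicalPullback.

Section FlowSlice.
Context {R : realType} {n : nat} (S : riemannian_manifold R 2) (N : riemannian_manifold R n).
Variables (T : \bar R) (u : R -> S -> N).
Local Notation E := (R^o * 'rV[R]_2)%type.
Hypothesis ucont : forall (t : R) (x : S), 0 < t -> (t%:E < T)%E ->
  {for (t, x), continuous (fun s : R * S => u s.1 s.2)}.
Hypothesis usmooth : forall (x : S) (y : N),
  smooth_on [set s : E | [/\ 0 < s.1, (s.1%:E < T)%E, img x s.2 & dom y (u s.1 (ichart x s.2))]]
          (fun s : E => chart y (u s.1 (ichart x s.2))).
Variable t : R.
Hypotheses (t0 : 0 < t) (tT : (t%:E < T)%E).

Lemma flow_slice_C1 : C1_map (u t).
Proof.
split.
  move=> y; have cp : {for y, continuous (fun y => (t, y) : R * S)}.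
    move=> A [B [/= Bt By] BA]; apply: filterS By => v Bv; apply: BA; split => //=.
    exact: nbhs_singleton Bt.
  exact: (@continuous_comp _ _ _ (fun y : S => (t, y) : R * S) (fun s : R * S => u s.1 s.2) y cp (@ucont t y t0 tT)).
move=> x b a.
have ds z : differentiable (fun w => (t, w) : E) z by exact: slice_differentiable.
have hd z : img x z -> dom b (u t (ichart x z)) -> flow_dom_at T u x b (t, z) by move=> *; split.
split=> [z [xz bz]|z xz bz]; last first.
  have d := flow_coord_diff usmooth (hd z xz bz).
  exact: (differentiable_comp (ds z) d).
have oA := flow_dom_at_open ucont (x := x) (b := b).
have sc := smooth_on_coord a oA (usmooth (x := x) (y := b)).
have [df cdf] := C1_smooth sc (hd z xz bz).
split; first exact: (differentiable_comp (ds z) df).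
move=> v; rewrite (_ : 'D_v _ = fun w => 'D_((0, v) : E) (fun s : E => chart b (u s.1 (ichart x s.2)) 0 a : R^o) (t, w)); last first.
  by apply/funext => w; apply/esym; exact: derive_slice_snd.
exact: (continuous_comp (differentiable_continuous (ds z)) (cdf _)).
Qed.

Variables (x : S) (z : 'rV[R]_2).
Hypothesis xz : img x z.
Local Notation y := (ichart x z).
Local Notation J := (transition_jac x y).
Local Notation P := (flow_pair u x : E -> E -> E -> R^o).

Lemma pull_mx_classical : pull_mx P t z = J *m classical_pullback (u t) y *m J^T.
Proof.
apply/matrixP => i j; rewrite mxE -(pullback_frame flow_slice_C1 xz i j) /flow_pair /=.
have De k : 'D_(space_dir k) (flow_coord u x (u t y)) (t, z) = 'D_(basis_vec k) (chart (u t y) \o u t \o ichart x) z.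
  exact: derive_slice_snd.
by rewrite (De i) (De j).
Qed.

Hypothesis classical : diff_map (u t) y = classical_diff (u t) y.

Let xy : dom x y. Proof. exact: ichart_dom. Qed.

Let gE : metric x z = J *m metric_at y *m J^T.
Proof. by have := metric_at_tmx xy; rewrite ichartK. Qed.

Let uJ : J \in unitmx. Proof. exact: transition_jac_unit. Qed.

Let uh : metric_at y \in unitmx.
Proof. by apply: metric_unitmx; apply: chart_img; exact: dom_self. Qed.

Let pullE : pull_mx P t z = J *m pullback (u t) y *m J^T.
Proof. by rewrite pull_mx_classical /pullback classical. Qed.

Lemma diff_sqnorm_chart : diff_sqnorm (u t) y = \tr (invmx (metric x z) *m pull_mx P t z).
Proof. by rewrite pullE (trace_congruence _ uJ uh gE). Qed.

Lemma stress_chart : tensor_norm y (stress_energy (u t) y) = stress_size x P t z.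
Proof.
rewrite /tensor_norm /stress_size.
have -> : stress_mx x P t z = J *m stress_energy (u t) y *m J^T.
  rewrite /stress_mx /stress_energy diff_sqnorm_chart pullE mulmxBr mulmxBl; congr (_ - _).
  by rewrite -scalemxAr -scalemxAl -gE.
by rewrite (tensor_sq_congruence _ uJ uh gE).
Qed.

End FlowSlice.

Section PatchIntegral.
Context {R : realType} (S : riemannian_manifold R 2).
Variable vol : {measure set (borel S) -> \bar R}.
Hypothesis volS : is_volume vol.
Variable x : S.
Local Notation bR := (g_sigma_algebraType (R.-ocitv.-measurable)).
Local Notation mu2 := (leb2 : {measure set (bR * bR) -> \bar R}).

Lemma patch_fun_integral (h : 'rV[R]_2 -> R) : (forall z, img x z -> 0 <= h z) ->
  measurable_fun (img2 x) (h \o @row2 R : bR * bR -> R) ->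
  (\int[vol]_y (patch_fun x h y)%:E = \int[mu2]_(z in img2 x) (h (row2 (z : R * R)) * dens x (row2 (z : R * R)))%:E)%E.
Proof.
move=> h0 mh.
have P0 y : 0 <= patch_fun x h y.
  by rewrite /patch_fun; case: asboolP => // xy; apply: h0; exact: chart_img.
have pE : patch_fun x h = (h \o chart x) \_ (dom x).
  apply/funext => y; rewrite patchE /patch_fun; case: asboolP => xy; first by rewrite mem_set.
  by rewrite memNset.
have mP : measurable_fun setT (patch_fun x h : borel S -> R).
  have mD : measurable (dom x : set (borel S)) by exact: dom_measurable.
  rewrite pE; apply/(measurable_restrictT _ mD).
  have -> : h \o chart x = (h \o @row2 R) \o (coord2 \o chart x).
    by apply/funext => y; rewrite /= coord2K.
  apply: (measurable_comp (F := img2 x : set (bR * bR)) (img2_measurable x) _ mh (chart_measurable (x := x))).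
  by move=> _ [y xy <-]; rewrite /img2 /= coord2K; exact: chart_img.
transitivity (\int[vol]_(y in dom x) (patch_fun x h y)%:E)%E.
  rewrite [RHS]integral_mkcond; apply: eq_integral => y _.
  by rewrite patchE; case: ifPn => //; rewrite notin_setE /patch_fun; case: asboolP.
rewrite (integral_chart volS x P0 mP); apply: eq_integral => z /set_mem xz.
have xy : dom x (ichart x (row2 z)) by exact: ichart_dom.
by rewrite (patch_funE _ xy) ichartK // area_densityE.
Qed.

End PatchIntegral.

Lemma pullback_trace_ge0 (R : realType) n (S : riemannian_manifold R 2) (N : riemannian_manifold R n) (y : S) (b : N)
    (D : 'M[R]_(2, n)) : 0 <= \tr (invmx (metric_at y) *m (D *m metric_at b *m D^T)).
Proof.
have xz := img_self y.
have hb (v : 'rV[R]_n) : v != 0 -> 0 < (v *m metric_at b *m v^T) 0 0.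
  by apply: metric_pos; exact: (chart_img (dom_self b)).
set B := D *m _ *m _; have [p [r [s [p0 s0 dE [h00 h01 h10 h11]]]]] := metric_cholesky xz.
have B0 (v : 'rV[R]_2) : 0 <= (v *m B *m v^T) 0 0.
  have -> : v *m B *m v^T = (v *m D) *m metric_at b *m (v *m D)^T by rewrite /B trmx_mul !mulmxA.
  by have [->|/hb/ltW//] := eqVneq (v *m D) 0; rewrite !mul0mx mxE.
have BT : B^T = B by rewrite /B !trmx_mul trmxK (Defs.metric_sym (chart_img (dom_self b))) mulmxA.
clearbody B.
have Bs : B e1 e0 = B e0 e1 by rewrite -[in LHS]BT [LHS]mxE.
have BE (v : 'rV[R]_2) : (v *m B *m v^T) 0 0 = v 0 e0 * B e0 e0 * v 0 e0 + 2 * (v 0 e0 * B e0 e1 * v 0 e1) + v 0 e1 * B e1 e1 * v 0 e1.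
  by rewrite mxE big_ord2 ![(_ *m _) _ _]mxE !big_ord2 ![_^T _ _]mxE Bs; ring.
have detn : \det (metric_at y) != 0 by rewrite gt_eqF // det_metric_gt0.
have [i00 i01 i10 i11] := inv2E detn; rewrite -(dens_sqr xz) dE /metric_at h00 ?h01 ?h10 ?h11 in i00 i01 i10 i11.
rewrite /mxtrace big_ord2 !mxE !big_ord2 i00 i01 i10 i11 Bs.
have b1 := B0 (row2 (r, - p)); have b2 := B0 (row2 (1, 0)); rewrite !BE !mxE /= in b1 b2.
have pn : p != 0 by rewrite gt_eqF.
have sn : s != 0 by rewrite gt_eqF.
have -> : (r ^+ 2 + s ^+ 2) / (p * s) ^+ 2 * B e0 e0 + - (p * r) / (p * s) ^+ 2 * B e0 e1 +
  (- (p * r) / (p * s) ^+ 2 * B e0 e1 + p ^+ 2 / (p * s) ^+ 2 * B e1 e1) =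
  ((r * B e0 e0 * r + 2 * (r * B e0 e1 * - p) + - p * B e1 e1 * - p) + s ^+ 2 * B e0 e0) / (p * s) ^+ 2.
  by field; rewrite sn pn.
rewrite divr_ge0 ?sqr_ge0 // addr_ge0 // mulr_ge0 ?sqr_ge0 //.
by move: b2; lra.
Qed.

Lemma diff_sqnorm_ge0 (R : realType) n (S : riemannian_manifold R 2) (N : riemannian_manifold R n) (u : S -> N) y :
  0 <= diff_sqnorm u y.
Proof. exact: pullback_trace_ge0. Qed.

Section Localized.
Context {R : realType} {n : nat} (S : riemannian_manifold R 2) (N : riemannian_manifold R n).
Variable vol : {measure set (borel S) -> \bar R}.
Hypothesis volS : is_volume vol.
Hypothesis compactN : compact [set: N].
Variables (T : \bar R) (u : R -> S -> N).
Local Notation E := (R^o * 'rV[R]_2)%type.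
Local Notation bR := (g_sigma_algebraType (R.-ocitv.-measurable)).
Local Notation mu2 := (leb2 : {measure set (bR * bR) -> \bar R}).
Hypothesis ucont : forall (t : R) (x : S), 0 < t -> (t%:E < T)%E ->
  {for (t, x), continuous (fun s : R * S => u s.1 s.2)}.
Hypothesis usmooth : forall (x : S) (y : N),
  smooth_on [set s : E | [/\ 0 < s.1, (s.1%:E < T)%E, img x s.2 & dom y (u s.1 (ichart x s.2))]]
          (fun s : E => chart y (u s.1 (ichart x s.2))).
Variable t : R.
Hypotheses (t0 : 0 < t) (tT : (t%:E < T)%E).
Variables (x : S) (r : R).
Hypotheses (r_gt0 : 0 < r) (r_img : cube (chart x x) r `<=` img x).
Local Notation z0 := (chart x x).
Local Notation P := (flow_pair u x : E -> E -> E -> R^o).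

Lemma ae_classical : {ae vol, forall y, dom x y -> (forall i, `|chart x y 0 i - z0 0 i| < r) ->
  diff_map (u t) y = classical_diff (u t) y}.
Proof.
have cw := flow_slice_C1 ucont usmooth t0 tT.
apply: (ae_chart volS (x := x)); apply: ae_imp (diff_map_classical compactN cw r_gt0 r_img) => z h xz.
by rewrite ichartK.
Qed.

Lemma flow_pair_sym z i j : img x z -> P (space_dir i) (space_dir j) (t, z) = P (space_dir j) (space_dir i) (t, z).
Proof. by move=> xz; apply: (flow_pairC ucont usmooth (x := x)); split. Qed.

Lemma energy_density_ge0 z : img x z -> 0 <= energy_density x P (t, z).
Proof.
move=> xz; rewrite (@energy_density_trace R S x P t _ (fun i j => flow_pair_sym i j xz)).
rewrite mulr_ge0 ?(ltW (dens_gt0 xz)) // mulr_ge0 ?invr_ge0 //.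
rewrite (pull_mx_classical ucont usmooth t0 tT xz).
have xy := ichart_dom xz.
have gE := metric_at_tmx xy; rewrite ichartK // in gE.
rewrite (trace_congruence _ (transition_jac_unit xy) _ gE); first exact: pullback_trace_ge0.
by apply: metric_unitmx; apply: chart_img; exact: dom_self.
Qed.

(** Almost everywhere the weak differential is the classical one, whose squared norm is given
    in the chart by the inner products of partial derivatives. *)
Lemma energy_localized (phi : 'rV[R]_2 -> R) (K : set 'rV[R]_2) : (forall z, 0 <= phi z) -> continuous phi ->
  compact K -> (forall z, ~ K z -> phi z = 0) -> (forall z, K z -> forall i, `|z 0 i - z0 0 i| < r) ->
  (\int[vol]_y (patch_fun x phi y * (2^-1 * diff_sqnorm (u t) y))%:E =
   (\int[leb2]_z (phi (row2 z) * energy_density x P (t, row2 z)))%:E)%E.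
Proof.
move=> p0 cp cK pK Kr.
have Kimg : K `<=` img x by move=> z /Kr h; apply: r_img => i; exact: ltW.
pose h z := phi z * (energy_density x P (t, z) / dens x z).
have h0 z : img x z -> 0 <= h z.
  by move=> xz; rewrite mulr_ge0 // divr_ge0 ?energy_density_ge0 // ltW // dens_gt0.
have ec z : img x z -> {for z, continuous (fun z => energy_density x P (t, z))}.
  move=> xz; apply: C1_continuous; apply: (energy_density_C1 _ t0 tT xz) => X Y.
  exact: (flow_pair_C1 ucont usmooth).
have hc z : img x z -> {for z, continuous h}.
  move=> xz; apply: (cvgM (cp z)); apply: (cvgM (ec z xz)).
  exact: C1_continuous (densV_C1 xz).
have hm : measurable_fun (img2 x) (h \o @row2 R : bR * bR -> R).
  apply: open_continuous2_measurable; first exact: img2_open.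
  by move=> z xz; exact: (@continuous_comp _ _ _ (@row2 R) h z (@row2_continuous R z) (hc _ xz)).
transitivity (\int[vol]_y (patch_fun x h y)%:E)%E.
  have ae : {ae vol, forall y, (patch_fun x phi y * (2^-1 * diff_sqnorm (u t) y)) = patch_fun x h y}.
    apply: ae_imp ae_classical => y hy; have [xy|nxy] := pselect (dom x y); last first.
      by rewrite /patch_fun; case: asboolP => //; rewrite mul0r.
    rewrite !patch_funE // /h; have [Ky|nKy] := pselect (K (chart x y)); last by rewrite pK // !mul0r.
    have xz : img x (chart x y) by exact: chart_img.
    have cl := hy xy (Kr _ Ky).
    rewrite -[in diff_sqnorm _ _](chartK xy) (diff_sqnorm_chart ucont usmooth t0 tT xz); last by rewrite chartK.
    rewrite (@energy_density_trace R S x P t _ (fun i j => flow_pair_sym i j xz)).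
    by rewrite [dens _ _ * _]mulrC mulfK // gt_eqF // dens_gt0.
  have l0 y : (0 <= (patch_fun x phi y * (2^-1 * diff_sqnorm (u t) y))%:E)%E.
    rewrite lee_fin mulr_ge0 ?mulr_ge0 ?invr_ge0 ?diff_sqnorm_ge0 //.
    by rewrite /patch_fun; case: asboolP.
  have l1 y : (0 <= (patch_fun x h y)%:E)%E.
    by rewrite lee_fin /patch_fun; case: asboolP => // xy; apply: h0; exact: chart_img.
  apply/eqP; rewrite eq_le; apply/andP; split; apply: ge0_le_integral_ae => //.
    by apply: ae_imp ae => y ->.
  by apply: ae_imp ae => y ->.
rewrite (patch_fun_integral volS h0 hm) /Rintegral fineK; last first.
  apply: integrable_fin_num => //; apply: (@integrable_compact_rV R (fun z => phi z * energy_density x P (t, z)) K cK).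
    apply: (cutoff_continuous cK Kimg) => [z xz|z nz]; last by rewrite pK // mul0r.
    exact: (cvgM (cp z) (ec z xz)).
  by move=> z nz; rewrite pK // mul0r.
rewrite [LHS]integral_mkcond; apply: (@eq_integral _ _ _ mu2) => z _; rewrite patchE; case: ifPn => [/set_mem xz|].
  by congr EFin; rewrite /h -!mulrA mulVf ?mulr1 // gt_eqF // dens_gt0.
rewrite notin_setE => nx; rewrite pK ?mul0r // => Kz; apply: nx; exact: Kimg.
Qed.

Lemma stress_localized (e sigma : R) (B : set (bR * bR)) : 1 <= e -> 0 < sigma -> measurable B ->
  (forall z : R * R, B z -> forall i, `|row2 z 0 i - z0 0 i| < r) ->
  (stress_norm vol e (u t) <= sigma%:E)%E ->
  (\int[mu2]_(z in B) (stress_size x P t (row2 (z : R * R)) `^ e * dens x (row2 (z : R * R)))%:E <= (sigma `^ e)%:E)%E.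
Proof.
move=> e1' s0 mB Br hs; have e_gt0 : 0 < e by apply: lt_le_trans e1'.
have Bimg : B `<=` img2 x by move=> z /Br h; apply: r_img => i; exact: ltW.
pose h (z : 'rV[R]_2) := if `[< B (coord2 z) >] then stress_size x P t z `^ e else 0.
have h0 z : img x z -> 0 <= h z by rewrite /h; case: asboolP => // _ _; exact: powR_ge0.
have hE : h \o @row2 R = (fun z : R * R => stress_size x P t (row2 z) `^ e) \_ (B : set (R * R)).
  apply/funext => z; rewrite patchE /h /= row2K; case: asboolP => Bz; first by rewrite mem_set.
  by rewrite memNset.
have hm : measurable_fun (img2 x) (h \o @row2 R : bR * bR -> R).
  apply: (measurable_funS measurableT (subsetT _)); rewrite hE.
  apply/(measurable_restrictT _ mB); apply: (measurableT_comp (measurable_powR e)).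
  apply: (measurable_funS (img2_measurable x) Bimg).
  apply: open_continuous2_measurable; first exact: img2_open.
  move=> z xz; apply: (@continuous_comp _ _ _ (@row2 R) (stress_size x P t) z (@row2_continuous R z)).
  apply: (stress_size_continuous _ t0 tT xz) => X Y.
  exact: (flow_pair_C1 ucont usmooth).
have -> : (\int[mu2]_(z in B) (stress_size x P t (row2 (z : R * R)) `^ e * dens x (row2 (z : R * R)))%:E =
    \int[mu2]_(z in img2 x) (h (row2 (z : R * R)) * dens x (row2 (z : R * R)))%:E)%E.
  rewrite integral_mkcond [RHS]integral_mkcond; apply: eq_integral => z _; rewrite !patchE.
  have -> : h (row2 z) = (h \o @row2 R) z by []. rewrite hE patchE.
  case: ifPn => [/set_mem Bz|_]; first by rewrite mem_set //; exact: Bimg.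
  by case: ifPn => // _; rewrite mul0r.
rewrite -(patch_fun_integral volS h0 hm).
have L : (\int[vol]_y (`|(EFin \o (fun y => tensor_norm y (stress_energy (u t) y))) y| `^ e) <= (sigma `^ e)%:E)%E.
  rewrite -(poweR_Lnorm vol _ (lt0r_neq0 e_gt0)).
  have -> : (sigma `^ e)%:E = (sigma%:E `^ e)%E by rewrite poweR_EFin.
  apply: (gt0_ler_poweR (ltW e_gt0)) hs; rewrite in_itv /= leey andbT ?Lnorm_ge0 // lee_fin ltW //.
apply: le_trans L; apply: ge0_le_integral_ae.
- by move=> y; rewrite lee_fin /patch_fun; case: asboolP => // xy; apply: h0; exact: chart_img.
- by move=> y; exact: poweR_ge0.
- apply: ae_imp ae_classical => y hy; rewrite /patch_fun; case: asboolP => xy; last exact: poweR_ge0.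
  rewrite /h; case: asboolP => By; last exact: poweR_ge0.
  have xz : img x (chart x y) by exact: chart_img.
  have cl := hy xy (fun i => _); rewrite -[chart x y]coord2K in cl; have {}cl := cl (Br _ By).
  have sc := stress_chart ucont usmooth t0 tT xz; rewrite (chartK xy) in sc; rewrite -(sc cl).
  by rewrite /= ger0_norm ?sqrtr_ge0.
Qed.

End Localized.


(** * Geodesic balls in a chart *)

Section Curves.
Context {R : realType} (S : riemannian_manifold R 2).
Variable x : S.

Lemma derive_curve_comp (f : 'rV[R]_2 -> 'rV[R]_2) (c : R -> 'rV[R]_2) (t : R) : derivable c t 1 ->
  differentiable f (c t) ->
  derivable (f \o c) t 1 /\ derive1 (f \o c) t = derive1 c t *m jacobian f (c t).
Proof.
move=> dc df; have dc' : differentiable (c : R^o -> 'rV[R]_2) (t : R^o) by apply/derivable1_diffP.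
have d := differentiable_comp dc' df; split; first exact/derivable1_diffP.
rewrite !derive1E [LHS](deriveE (1 : R^o) d) (diff_comp dc' df).
rewrite [X in _ = X *m _](deriveE (1 : R^o) dc') -(deriveEjacobian _ df).
by rewrite (deriveE _ df).
Qed.

Lemma speed_chart (c : R -> S) t : C1_curve c -> dom x (c t) ->
  speed c t = Num.sqrt (quad (metric x (chart x (c t))) (fun i => derive1 (chart x \o c) t 0 i)).
Proof.
move=> [cc hc] xt; have yt := dom_self (c t).
have [dy _] := hc (c t) t yt.
have o : overlap (c t) x (chart (c t) (c t)) by split; [exact: chart_img|rewrite chartK].
have dT := transition_diff o.
have [_ e] := derive_curve_comp (f := chart x \o ichart (c t)) dy dT.
have nr : \forall s \near t, (chart x \o c) s = ((chart x \o ichart (c t)) \o (chart (c t) \o c)) s.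
  have : \forall s \near t, dom (c t) (c s) by apply: (cc t); apply: open_nbhs_nbhs; split; [exact: dom_open|].
  by apply: filterS => s ys; rewrite /= chartK.
have e2 : derive1 (chart x \o c) t = derive1 (chart (c t) \o c) t *m tmx (c t) x (chart (c t) (c t)).
  by rewrite -[RHS]e !derive1E; exact: near_eq_derive.
rewrite e2 /speed; congr Num.sqrt.
have := metric_tmx o; rewrite (chartK yt) -/(metric_at (c t)) => ->.
set v := derive1 _ t; set J := tmx _ _ _; set M := metric x _.
have -> : v *m (J *m M *m J^T) *m v^T = (v *m J) *m M *m (v *m J)^T by rewrite trmx_mul !mulmxA.
rewrite mxE /quad exchange_big; apply: eq_bigr => j _; rewrite mxE mulr_suml; apply: eq_bigr => i _.
by congr (_ * _); exact: mxE.
Qed.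

Variables (zp w : 'rV[R]_2).

(** Curves are parametrised by the whole line, while a chart contains only a bounded part of
    the line through two of its points. This parameter is 0 at 0 and 1 at 1, and its values and
    its derivative stay between -5/4 and 5/4. *)
Definition line_param (t : R) : R := 5 * t / (4 + t ^+ 2).

Lemma line_param_den t : 0 < 4 + t ^+ 2 :> R.
Proof. by rewrite ltr_pwDl // sqr_ge0. Qed.

Lemma line_param0 : line_param 0 = 0.
Proof. by rewrite /line_param mulr0 mul0r. Qed.

Lemma line_param1 : line_param 1 = 1.
Proof.
rewrite /line_param expr1n mulr1.
have -> : 5 = 4 + 1 :> R by rewrite -natr1.
by rewrite divff // gt_eqF // addr_gt0.
Qed.

Lemma line_param_bound t : `|line_param t| <= 5 / 4.
Proof.
have d0 := line_param_den t; rewrite /line_param normrM normfV (gtr0_norm d0) ler_pdivrMr //.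
have := sqr_ge0 (t - 2); have := sqr_ge0 (t + 2); rewrite ler_norml => h1 h2.
by apply/andP; split; nra.
Qed.

Definition line_rate (t : R) : R := 5 * (4 - t ^+ 2) / (4 + t ^+ 2) ^+ 2.

Lemma line_param_derive t : is_derive (t : R^o) (1 : R^o) (line_param : R^o -> R^o) (line_rate t).
Proof.
have dn : 4 + t ^+ 2 != 0 :> R by rewrite gt_eqF // line_param_den.
have h1 : is_derive (t : R^o) (1 : R^o) (fun t : R^o => 5 *: t : R^o) (5 *: 1) by exact: is_deriveZ.
have h2 : is_derive (t : R^o) (1 : R^o) (cst 4 + (id : R^o -> R^o) ^+ 2) (0 + (2%:R * t) *: 1).
  exact: is_deriveD.
have e2 : cst 4 + (id : R^o -> R^o) ^+ 2 = (fun t : R^o => 4 + t ^+ 2 : R^o) by apply/funext.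
rewrite e2 in h2.
have d1 : differentiable (fun t : R^o => 5 *: t : R^o) (t : R^o) by apply/derivable1_diffP.
have d2 : differentiable (fun t : R^o => 4 + t ^+ 2 : R^o) (t : R^o) by apply/derivable1_diffP.
have q := derive_quotient (1 : R^o) d1 d2 dn.
split; first by apply: diff_derivable; exact: (differentiableM d1 (differentiableV d2 dn)).
rewrite [LHS]q (@derive_val _ _ _ _ _ _ _ h1) (@derive_val _ _ _ _ _ _ _ h2) /line_rate; congr (_ / _).
rewrite add0r !scaler1 /GRing.scale /=; ring.
Qed.

Lemma line_rate_continuous : continuous line_rate.
Proof.
move=> t; have dn : 4 + t ^+ 2 != 0 :> R by rewrite gt_eqF // line_param_den.
have sq : (fun t : R => t ^+ 2) @ t --> t ^+ 2 by exact: exprn_continuous.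
apply: cvgM; first by apply: cvgM; [exact: cvg_cst|apply: cvgB => //; exact: cvg_cst].
apply: cvgV; first by rewrite expf_neq0.
have c : (fun t : R => 4 + t ^+ 2) @ t --> 4 + t ^+ 2 by apply: cvgD => //; exact: cvg_cst.
exact: (continuous_comp c (@exprn_continuous R 2 _)).
Qed.

Lemma line_rate_bound t : `|line_rate t| <= 5 / 4.
Proof.
have d0 := line_param_den t; rewrite /line_rate normrM normfV (gtr0_norm (exprn_gt0 2 d0)) ler_pdivrMr ?exprn_gt0 //.
have := sqr_ge0 t; have := sqr_ge0 (t ^+ 2); rewrite ler_norml => h1 h2.
by apply/andP; split; nra.
Qed.

Definition line_curve (t : R) : S := ichart x (zp + line_param t *: w).

Hypothesis line_img : forall s, `|s| <= 5 / 4 -> img x (zp + s *: w).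

Lemma line_curve_img t : img x (zp + line_param t *: w).
Proof. exact: line_img (line_param_bound t). Qed.

Lemma line_derive t : derivable (fun t : R => zp + line_param t *: w) t 1 /\
  derive1 (fun t : R => zp + line_param t *: w) t = line_rate t *: w.
Proof.
have ds := line_param_derive t.
have dd : differentiable (line_param : R^o -> R^o) (t : R^o) by apply/derivable1_diffP.
have dl := differentiableZl w dd.
have dc : differentiable (cst zp : R^o -> 'rV[R]_2) (t : R^o) by exact: differentiable_cst.
have dD := differentiableD dc dl.
split; first exact: (diff_derivable dD).
rewrite derive1E.
have -> := deriveD (diff_derivable (v := 1 : R^o) dc) (diff_derivable (v := 1 : R^o) dl).
rewrite derive_cst add0r [LHS](deriveE (1 : R^o) dl) (diffZl _ dd) -(deriveE (1 : R^o) dd).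
by rewrite (@derive_val _ _ _ _ _ _ _ ds).
Qed.

Lemma line_curve_C1 : C1_curve line_curve.
Proof.
have cl : continuous (fun t : R => zp + line_param t *: w).
  by move=> t; have [d _] := line_derive t; apply: differentiable_continuous; apply/derivable1_diffP.
split=> [t|x' t xt]; first exact: (continuous_comp (cl t) (ichart_continuous (line_curve_img t))).
have tr : smooth_on (overlap x x') (chart x' \o ichart x) by rewrite overlapE; exact: transition_smooth.
have o s : dom x' (line_curve s) -> overlap x x' (zp + line_param s *: w) by move=> ?; split => //; exact: line_curve_img.
have D s : dom x' (line_curve s) -> derivable (chart x' \o line_curve) s 1 /\
    derive1 (chart x' \o line_curve) s = line_rate s *: 'D_w (chart x' \o ichart x) (zp + line_param s *: w).
  move=> xs; have [dl el] := line_derive s.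
  have dT := smooth_on_diff tr (o s xs).
  have [d e] := derive_curve_comp dl dT; split; first exact: d.
  by rewrite [LHS]e el -scalemxAl -(deriveEjacobian _ dT).
split; first by have [] := D t xt.
have cc : {for t, continuous line_curve} by exact: (continuous_comp (cl t) (ichart_continuous (line_curve_img t))).
have nr : \forall s \near t, line_rate s *: 'D_w (chart x' \o ichart x) (zp + line_param s *: w) = derive1 (chart x' \o line_curve) s.
  have : \forall s \near t, dom x' (line_curve s) by apply: cc; apply: open_nbhs_nbhs; split; [exact: dom_open|].
  by apply: filterS => s /D[_ ->].
rewrite /prop_for /continuous_at -(nbhs_singleton nr).
apply: (cvg_trans (near_eq_cvg nr)); apply: cvgZ; first exact: line_rate_continuous.
exact: (continuous_comp (cl t) (smooth_on_continuous (smooth_on_derive w tr) (o t xt))).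
Qed.

Lemma line_curve_speed t : speed line_curve t =
  `|line_rate t| * Num.sqrt (quad (metric x (zp + line_param t *: w)) (fun i => w 0 i)).
Proof.
have xt : dom x (line_curve t) by apply: ichart_dom; exact: line_curve_img.
rewrite (speed_chart line_curve_C1 xt) {1}/line_curve (ichartK (line_curve_img t)).
have [dl el] := line_derive t.
have -> : derive1 (chart x \o line_curve) t = line_rate t *: w.
  rewrite -el !derive1E; congr ('D_1 _ t); apply/funext => s.
  by rewrite /= ichartK //; exact: line_curve_img.
rewrite -[`|_|]sqrtr_sqr -sqrtrM ?sqr_ge0 //; congr Num.sqrt.
by rewrite /quad !big_ord2 !mxE; ring.
Qed.

End Curves.

Lemma ge0_le_integral_in d (T : measurableType d) (R : realType) (mu : {measure set T -> \bar R}) (D : set T)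
    (f g : T -> \bar R) : (forall t, 0 <= f t)%E -> (forall t, 0 <= g t)%E -> (forall t, D t -> f t <= g t)%E ->
  (\int[mu]_(t in D) f t <= \int[mu]_(t in D) g t)%E.
Proof.
move=> f0 g0 fg; rewrite integral_mkcond [leRHS]integral_mkcond.
apply: ge0_le_integral_ae => [t|t|].
- by rewrite patchE; case: ifP.
- by rewrite patchE; case: ifP.
- by apply: aeW => t; rewrite !patchE; case: ifP => // /set_mem /fg.
Qed.

Section Distance.
Context {R : realType} (S : riemannian_manifold R 2).
Variables (x : S) (k r K : R).
Local Notation z0 := (chart x x).
Local Notation A := (metric x z0).
Variable kappa : R.
Hypotheses (kappa_gt0 : 0 < kappa) (kE : k = kappa ^+ 2).
Hypothesis box : metric_box x k r K.

Let kappa_ge0 : 0 <= kappa. Proof. exact: ltW. Qed.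

(** The reparametrised segment has length at most 5/4 of the length of the segment, and on the
    box the metric differs from A by a factor at most k. *)
Lemma dist_upper p (w : 'rV[R]_2) (l : R) : dom x p -> (forall s : R, `|s| <= 5 / 4 -> cube z0 r (chart x p + s *: w)) -> 0 <= l ->
  quad A (fun i => w 0 i) <= l ^+ 2 -> (dist p (ichart x (chart x p + w)) <= (5 / 4 * kappa * l)%:E)%E.
Proof.
move=> xp wr l0 ql.
have wi (s : R) : `|s| <= 5 / 4 -> img x (chart x p + s *: w) by move=> /wr; exact: (box_img box).
apply: (@le_trans _ _ (curve_length (line_curve x (chart x p) w))).
{ apply: ereal_inf_lbound; exists (line_curve x (chart x p) w) => //; split; first exact: line_curve_C1.
  - by rewrite /line_curve line_param0 scale0r addr0 chartK.
  - by rewrite /line_curve line_param1 scale1r. }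
have c0 : 0 <= 5 / 4 * kappa * l by rewrite !mulr_ge0.
have ec : (\int[lebesgue_measure]_(t in `[0%R, 1%R]) (5 / 4 * kappa * l)%:E = (5 / 4 * kappa * l)%:E)%E.
  rewrite integral_cst; last exact: measurable_itv.
  transitivity ((5 / 4 * kappa * l)%:E * lebesgue_measure (`[0%R, 1%R]%classic : set R))%E; first by [].
  by rewrite lebesgue_measure_itv /= lte_fin ltr01 oppr0 adde0 mule1.
rewrite -[X in (_ <= X)%E]ec; apply: ge0_le_integral_in => t; rewrite ?lee_fin ?sqrtr_ge0 // => _.
rewrite (line_curve_speed wi) -mulrA; apply: ler_pM => //; first exact: line_rate_bound.
rewrite -[leRHS]ger0_norm ?mulr_ge0 // -[leRHS]sqrtr_sqr.
apply: ler_wsqrtr; apply: (le_trans (box_metric_le box (wr _ (line_param_bound t)) _)).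
by rewrite kE exprMn ler_wpM2l // sqr_ge0.
Qed.

Lemma quad_cauchy z (v w : 'I_2 -> R) : img x z ->
  (\sum_i \sum_j v i * metric x z i j * w j) ^+ 2 <= quad (metric x z) v * quad (metric x z) w.
Proof.
move=> xz; have d0 := det_metric_gt0 xz; rewrite (det_metricE xz) in d0.
rewrite /quad !big_ord2 (metric_sym01 xz).
have alg (a b d v0 v1 w0 w1 : R) : 0 < a * d - b ^+ 2 -> (v0 * a * w0 + v0 * b * w1 + (v1 * b * w0 + v1 * d * w1)) ^+ 2 <=
  (v0 * a * v0 + v0 * b * v1 + (v1 * b * v0 + v1 * d * v1)) * (w0 * a * w0 + w0 * b * w1 + (w1 * b * w0 + w1 * d * w1)).
  move=> D0; rewrite -subr_ge0 (_ : _ - _ = (a * d - b ^+ 2) * (v0 * w1 - v1 * w0) ^+ 2); last by ring.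
  by rewrite mulr_ge0 ?sqr_ge0 // ltW.
exact: alg.
Qed.

(** The supremum of the times until which the curve has stayed in the closed set. *)
Lemma exit_time (T : topologicalType) (c : R -> T) (D : set T) : continuous c -> closed D -> D (c 0) -> ~ D (c 1) ->
  exists t, [/\ 0 <= t <= 1, forall s, 0 <= s <= t -> D (c s) & ~ \forall s \near t, D (c s)].
Proof.
move=> cc cD D0 D1; pose B := [set t | 0 <= t <= 1 /\ forall s, 0 <= s <= t -> D (c s)].
have B0 : B 0.
  by split; [rewrite lexx ler01|move=> s /andP[s0 s0']; rewrite (_ : s = 0) //; apply/eqP; rewrite eq_le s0 s0'].
have sB : has_sup B by split; [exists 0|exists 1 => t [/andP[_ ?] _]].
have t1 : sup B <= 1 by apply: ge_sup; [exists 0|move=> t [/andP[_ ?] _]].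
have t0 : 0 <= sup B by apply: ub_le_sup => //; case: sB.
have Dlt s : 0 <= s -> s < sup B -> D (c s).
  move=> s0 st; have e0 : 0 < sup B - s by rewrite subr_gt0.
  have [t [_ Bt] st'] := sup_adherent e0 sB; apply: Bt; rewrite s0 /= ltW //.
  by apply: le_lt_trans st'; lra.
have Dt : D (c (sup B)).
  apply: contrapT => nD.
  have : \forall s \near sup B, (~` D) (c s).
    by apply: (cc (sup B)); apply: open_nbhs_nbhs; split; [exact: closed_openC|].
  move=> /nbhs_ballP[e /= e0 he]; have [t Bt' st'] := sup_adherent e0 sB.
  have [/andP[tt0 tt1] Bt] := Bt'.
  have tB : t <= sup B by apply: ub_le_sup => //; case: sB.
  apply: (he t) => //; last by apply: Bt; rewrite tt0 lexx.
  by rewrite /ball /= ger0_norm ?subr_ge0 // ltrBlDr -ltrBlDl.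
have Dall s : 0 <= s <= sup B -> D (c s).
  by move=> /andP[s0]; rewrite le_eqVlt => /orP[/eqP ->//|]; exact: Dlt.
exists (sup B); split => //; first by rewrite t0.
move=> /nbhs_ballP[e /= e0 he].
have lt1 : sup B < 1.
  by rewrite lt_neqAle t1 andbT; apply: contra_notN D1 => /eqP <-.
pose t' := Num.min 1 (sup B + e / 2).
have tt' : sup B < t' by rewrite lt_min lt1 /= ltrDl divr_gt0.
have : B t'.
  split=> [|s /andP[s0 st]]; first by rewrite (ltW (le_lt_trans t0 tt')) ge_min lexx.
  have [ss|ss] := leP s (sup B); first by apply: Dall; rewrite s0.
  apply: he; rewrite /ball /= ltr0_norm ?subr_lt0 // opprB ltrBlDr.
  have : t' <= sup B + e / 2 by rewrite ge_min lexx orbT.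
  by move: e0 st; move: (t') (sup B) => *; lra.
by move=> /(ub_le_sup sB.2); rewrite leNgt tt'.
Qed.

Lemma sublevel_closed (D : set 'rV[R]_2) : closed D -> D `<=` cube z0 r -> closed (ichart x @` D).
Proof.
move=> cD Dr; apply: compact_closed; first exact: manifold_hausdorff.
have kD : compact D by apply: (subclosed_compact cD) Dr; exact: cube_compact.
apply: continuous_compact kD; apply: continuous_in_subspaceT => z /set_mem/Dr/(box_img box).
exact: ichart_continuous.
Qed.

(** The fundamental theorem of calculus for a linear function of the curve. *)
Lemma linear_curve_bound (z : R -> 'rV[R]_2) (l : 'I_2 -> R) (f : R -> R) (t : R) : 0 < t ->
  (forall s : R, 0 <= s <= t -> derivable z s 1 /\ {for s, continuous (derive1 z)}) ->
  (forall s, 0 <= f s) -> (forall s : R, 0 <= s <= t -> `|\sum_j l j * derive1 z s 0 j| <= f s) ->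
  ((\sum_j l j * (z t 0 j - z 0 0 j))%:E <= \int[lebesgue_measure]_(s in `[0%R, t]) (f s)%:E)%E.
Proof.
move=> t0 dz f0 lf; pose h s := \sum_j l j * z s 0 j; pose h' s := \sum_j l j * derive1 z s 0 j.
have dh (s : R) : 0 <= s <= t -> is_derive (s : R^o) (1 : R^o) (h : R^o -> R^o) (h' s).
  move=> /dz[ds _]; rewrite /h; have -> : (fun s => \sum_j l j * z s 0 j) = \sum_j (fun s : R^o => l j *: (z s 0 j : R^o) : R^o).
    by apply/funext => r'; rewrite fct_sumE.
  apply: is_derive_sum => j; apply: is_deriveZ; split.
    by apply: diff_derivable; apply: coord_differentiable; apply/derivable1_diffP.
  by rewrite [LHS](derive_coord j ds) derive1E.
have ch (s : R) : 0 <= s <= t -> {for s, continuous h'}.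
  move=> /dz[_ cs]; rewrite /h' /prop_for /continuous_at; rewrite !big_ord2.
  have cj j : (fun s => l j * derive1 z s 0 j) @ s --> l j * derive1 z s 0 j.
    by apply: cvgM; [exact: cvg_cst|exact: (continuous_comp cs (@coord_continuous R _ _ 0 j _))].
  under eq_fun do rewrite big_ord2; exact: cvgD.
have cs (s : R) : 0 <= s <= t -> {for s, continuous h}.
  move=> /dh hd; apply: (@differentiable_continuous _ (R^o) (R^o)); exact/derivable1_diffP.
have cw : {within `[0, t], continuous h'}.
  by apply: continuous_in_subspaceT => s; rewrite inE /= in_itv /=; exact: ch.
have I01 : (0 : R) <= 0 <= t by rewrite lexx ltW.
have It : 0 <= t <= t by rewrite lexx ltW.
have e : (\int[lebesgue_measure]_(s in `[0%R, t]) (h' s)%:E = (h t)%:E - (h 0)%:E)%E.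
{ apply: continuous_FTC2 => //.
  - split.
    + by move=> s; rewrite in_itv /= => /andP[s0 st]; have := dh s; rewrite !ltW // => /(_ isT) hd.
    + exact: cvg_at_right_filter (cs _ I01).
    + exact: cvg_at_left_filter (cs _ It).
  - move=> s; rewrite in_itv /= => /andP[s0 st]; have := dh s; rewrite !ltW // => /(_ isT) hd.
    by rewrite derive1E derive_val. }
have -> : (\sum_j l j * (z t 0 j - z 0 0 j))%:E = ((h t)%:E - (h 0)%:E)%E.
  by rewrite -EFinB /h -sumrB; congr EFin; apply: eq_bigr => j _; rewrite mulrBr.
rewrite -e; have mh : measurable_fun `[0, t] (fun s => (h' s)%:E).
  by apply/measurable_EFinP; exact: subspace_continuous_measurable_fun (measurable_itv _) cw.
have ab := @le_abse_integral _ _ R lebesgue_measure `[0%R, t]%classic (fun s => (h' s)%:E) (measurable_itv _) mh.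
apply: (le_trans (lee_abs _)); apply: (le_trans ab).
by apply: ge0_le_integral_in => [s|s|s /=]; rewrite ?lee_fin // in_itv /=; exact: lf.
Qed.

(** Until it leaves the ellipse the curve stays in the chart. The Cauchy-Schwarz inequality is
    applied to its velocity and the vector from the centre to the exit point. *)
Lemma dist_lower p y (lam a : R) : dom x p -> 0 < lam -> 0 < a -> (forall z, qform lam A (chart x p) z <= a -> cube z0 r z) ->
  ~ (dom x y /\ qform lam A (chart x p) (chart x y) <= a) ->
  ((Num.sqrt a * lam / kappa)%:E <= dist p y)%E.
Proof.
move=> xp lam0 a0 ar ny; set zp := chart x p; pose q := (qform lam A zp : 'rV[R]_2 -> R^o).
have cq z : {for z, continuous q} by apply: differentiable_continuous; exact: qform_diff.
apply: le_ereal_inf_tmp => _ [c [C1c c0 c1] <-]; have [cc dc] := C1c.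
have cD : closed [set z | q z <= a] by exact: ((continuous_closedP q).1 cq _ (@closed_le R a)).
have cD' := sublevel_closed cD ar.
have qp : q zp = 0 by rewrite /q /qform /quad big1 ?mulr0 // => i _; rewrite big1 // => j _; rewrite subrr !mul0r.
have D0 : (ichart x @` [set z | q z <= a]) (c 0).
  by exists zp; rewrite /= ?qp ?(ltW a0) // c0 chartK.
have D1 : ~ (ichart x @` [set z | q z <= a]) (c 1).
  by rewrite c1 => -[z /= qz zy]; apply: ny; have xz := box_img box (ar z qz); rewrite -zy ichartK //; split => //; exact: ichart_dom.
(* At the exit time q is at least a, since the points with q < a are interior. *)
have [t [/andP[t0 t1] tD tn]] := exit_time cc cD' D0 D1.
have st (s : R) : 0 <= s <= t -> dom x (c s) /\ q (chart x (c s)) <= a /\ cube z0 r (chart x (c s)).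
  move=> /tD[z /= qz <-]; have xz := box_img box (ar z qz).
  by rewrite ichartK //; split; [exact: ichart_dom|split=> //; exact: ar].
have It : 0 <= t <= t by rewrite t0 lexx.
have [xt _] := st t It; have ct : {for t, continuous (chart x \o c)}.
  exact: (continuous_comp (cc t) (chart_continuous xt)).
have qt : a <= q (chart x (c t)).
  rewrite leNgt; apply/negP => ltq; apply: tn.
  have h1 : \forall s \near t, q ((chart x \o c) s) < a.
    exact: (@continuous_comp _ _ _ (chart x \o c) q t ct (cq _) [set s | s < a] (lt_nbhsl ltq)).
  have h2 : \forall s \near t, dom x (c s) by apply: (cc t); apply: open_nbhs_nbhs; split; [exact: dom_open|].
  by apply: filterS2 h1 h2 => s h1 h2; exists (chart x (c s)); [exact: ltW|rewrite chartK].
have tpos : 0 < t.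
  rewrite lt_neqAle t0 andbT; apply/negP => /eqP te; move: qt.
  by rewrite -te c0 qp leNgt a0.
pose w i := chart x (c t) 0 i - zp 0 i; pose Q := quad A w.
have Qge : a * lam ^+ 2 <= Q.
  by move: qt; rewrite /q /qform -/Q -ler_pdivrMl ?exprn_gt0 ?invr_gt0 // exprVn invrK mulrC.
have Q0 : 0 < Q by apply: lt_le_trans Qge; rewrite mulr_gt0 ?exprn_gt0.
have sQ0 : 0 < Num.sqrt Q by rewrite sqrtr_gt0.
(* The pairing with the unit vector in the direction w, divided by kappa, is at most
   the speed. *)
pose l j := (\sum_i w i * A i j) / (Num.sqrt Q * kappa).
have A01 : A e1 e0 = A e0 e1 by apply: metric_sym01; exact: img_self.
have h := @linear_curve_bound (chart x \o c) l (speed c) t tpos _ (fun s => sqrtr_ge0 _) _.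
apply: (@le_trans _ _ (Num.sqrt Q / kappa)%:E).
  rewrite lee_fin ler_pM2r ?invr_gt0 //.
  by rewrite -[lam in leLHS]ger0_norm ?(ltW lam0) // -[`|lam|]sqrtr_sqr -sqrtrM ?(ltW a0) // ler_wsqrtr.
have -> : Num.sqrt Q / kappa = \sum_j l j * ((chart x \o c) t 0 j - (chart x \o c) 0 0 j).
  have -> : \sum_j l j * ((chart x \o c) t 0 j - (chart x \o c) 0 0 j) = Q / (Num.sqrt Q * kappa).
    have QE : Q = \sum_j \sum_i w i * A i j * w j by rewrite /Q /quad exchange_big.
    rewrite [Q in Q / _]QE mulr_suml; apply: eq_bigr => j _.
    have -> : (chart x \o c) t 0 j - (chart x \o c) 0 0 j = w j by rewrite /w /zp -c0.
    rewrite /l mulrAC; congr (_ * _); exact: mulr_suml.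
  have sn : Num.sqrt Q != 0 by rewrite gt_eqF.
  have kn : kappa != 0 by rewrite gt_eqF.
  have sQ : Q = Num.sqrt Q ^+ 2 by rewrite sqr_sqrtr ?ltW.
  have alg (m d : R) : m != 0 -> d != 0 -> m / d = m ^+ 2 / (m * d) by move=> m0 d0; field; rewrite m0 d0.
  by rewrite (alg _ _ sn kn) -sQ.
apply: (le_trans (h _ _)) => [s /st[xs _]|s Is|]; last first.
- apply: ge0_le_integral_subset => [s|s /=]; first by rewrite lee_fin sqrtr_ge0.
  by rewrite !in_itv /= => /andP[-> sT]; exact: le_trans sT t1.
- have [xs [_ cs]] := st s Is; rewrite (speed_chart C1c xs).
  set v := fun i => derive1 (chart x \o c) s 0 i.
  have -> : \sum_j l j * derive1 (chart x \o c) s 0 j = (\sum_i \sum_j w i * A i j * v j) / (Num.sqrt Q * kappa).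
    rewrite exchange_big mulr_suml; apply: eq_bigr => j _.
    rewrite /l mulrAC; congr (_ * _); exact: mulr_suml.
  have D0' : 0 < Num.sqrt Q * kappa by rewrite mulr_gt0.
  rewrite normrM normfV (gtr0_norm D0') ler_pdivrMr //.
  rewrite -sqrtr_sqr (le_trans (ler_wsqrtr (quad_cauchy w v (img_self x)))) // -/Q sqrtrM ?(ltW Q0) //.
  rewrite [leRHS]mulrCA ler_wpM2l ?sqrtr_ge0 //.
  have -> : kappa = Num.sqrt k by rewrite kE sqrtr_sqr ger0_norm.
  have gv0 : 0 <= quad (metric x (chart x (c s))) v by exact: quad_metric_ge0 (box_img box cs) v.
  rewrite -sqrtrM // ler_wsqrtr // mulrC; exact: (box_metric_ge box cs).
- exact: dc.
Qed.

End Distance.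


(** * The local estimate *)

Lemma scale_growth (R : realType) (H sigma d eps L : R) : 0 < L -> 0 < eps ->
  4 * H * sigma * d / eps <= L -> H * sigma * L^-1 * d <= eps / 4.
Proof. by move=> L0 eps0; rewrite ler_pdivrMr // => hl; rewrite mulrAC ler_pdivrMr //; lra. Qed.

Lemma energy_balance (R : realType) (X Y eps : R) : Y - X <= eps / 4 -> Y + eps / 2 - X <= 3 / 4 * eps.
Proof. by lra. Qed.

Section LocalEstimate.
#[local] Opaque derive.
Context {R : realType} (S : riemannian_manifold R 2).
Variables (alpha beta kappa : R).
Hypotheses (alpha_gt0 : 0 < alpha) (alpha_beta : alpha < beta) (kappa_gt1 : 1 < kappa) (kappa_le : kappa ^+ 2 <= 2).
Hypotheses (outer_room : 5 / 4 * kappa * beta <= 1 / 2) (inner_room : 1 / 4 <= alpha / kappa).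
Local Notation a := (alpha ^+ 2).
Local Notation b := (beta ^+ 2).
Local Notation k := (kappa ^+ 2).
Variable M : R.
Hypothesis cutoff_bound : forall s, `|'D_1 (cutoff a b : R^o -> R^o) s| <= M /\
  `|'D_1 ('D_1 (cutoff a b : R^o -> R^o)) s| <= M.
Variables (x : S) (r K : R).
Hypothesis box : metric_box x k r K.
Local Notation z0 := (chart x x).
Local Notation A := (metric x z0).

Let kappa_gt0 : 0 < kappa. Proof. exact: lt_trans kappa_gt1. Qed.
Let beta_gt0 : 0 < beta. Proof. exact: lt_trans alpha_beta. Qed.
Let a_ge0 : 0 <= a. Proof. exact: sqr_ge0. Qed.
Let ab : a < b. Proof. by rewrite ltr_sqr ?nnegrE ?ltW. Qed.
Let k_gt1 : 1 < k. Proof. by rewrite expr_gt1 ?ltW. Qed.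

Definition coord_const : R := (A e0 e0 + A e1 e1) / \det A.

Lemma coord_const_gt0 : 0 < coord_const.
Proof.
have xz := img_self x; rewrite divr_gt0 ?det_metric_gt0 //.
by rewrite addr_gt0 ?metric_diag_gt0.
Qed.

Lemma coord_quad_bound (w : 'I_2 -> R) i : w i ^+ 2 <= coord_const * quad A w.
Proof.
have xz := img_self x; have d0 := det_metric_gt0 xz.
rewrite /coord_const mulrAC ler_pdivlMr // /quad !big_ord2 (metric_sym01 xz).
rewrite (det_metricE xz) in d0 *; have a0 := metric_diag_gt0 e0 xz; have a1 := metric_diag_gt0 e1 xz.
have alg (a b d w0 w1 y : R) : 0 < a -> 0 < d -> 0 < a * d - b ^+ 2 -> y = w0 \/ y = w1 ->
    y ^+ 2 * (a * d - b ^+ 2) <= (a + d) * (w0 * a * w0 + w0 * b * w1 + (w1 * b * w0 + w1 * d * w1)).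
  move=> p0 p1 D0 hy.
  have := sqr_ge0 (a * w0 + b * w1); have := sqr_ge0 (d * w1 + b * w0).
  have := mulr_ge0 (ltW D0) (sqr_ge0 w0); have := mulr_ge0 (ltW D0) (sqr_ge0 w1).
  by case: hy => ->; lra.
by apply: alg => //; case: (ord2P i) => ->; [left|right].
Qed.

(** The first bound makes the derivatives of the metric negligible in the local energy
    inequality. The second keeps in the box the ellipses around points near x, and the longer
    segments of [dist_upper]. *)
Definition small_scale (lam : R) : Prop :=
  48 * K ^+ 4 * M * Num.sqrt (K * b) * lam <= 1 /\ 5 / 4 * Num.sqrt (coord_const * b) * lam < r / 2.

Variable p : S.
Hypotheses (xp : dom x p) (pr : forall i, `|chart x p 0 i - z0 0 i| <= r / 2).
Variable lam : R.
Hypotheses (lam_gt0 : 0 < lam) (lam_small : small_scale lam).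
Local Notation zp := (chart x p).
Local Notation q := (qform lam A zp).
Local Notation phi := (quad_bump a b lam A zp).

Lemma qform_scale (z : 'rV[R]_2) : quad A (fun i => z 0 i - zp 0 i) = lam ^+ 2 * q z.
Proof. by rewrite /qform mulrA -exprMn divff ?expr1n ?mul1r // gt_eqF. Qed.

Lemma ellipse_coord z i : q z <= b -> `|z 0 i - zp 0 i| <= Num.sqrt (coord_const * b) * lam.
Proof.
move=> qz; rewrite -sqrtr_sqr -[lam]gtr0_norm // -[`|lam|]sqrtr_sqr -sqrtrM; last first.
  exact: mulr_ge0 (ltW coord_const_gt0) (sqr_ge0 beta).
apply: ler_wsqrtr; apply: (le_trans (coord_quad_bound (fun i => z 0 i - zp 0 i) i)).
rewrite qform_scale -[leRHS]mulrA; apply: (ler_wpM2l (ltW coord_const_gt0)).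
by rewrite mulrC; apply: ler_wpM2r => //; exact: sqr_ge0.
Qed.

Lemma ellipse_segment z s i : q z <= b -> `|s| <= 5 / 4 -> `|zp 0 i + s * (z 0 i - zp 0 i) - z0 0 i| < r.
Proof.
move=> qz s54; have := ellipse_coord i qz; have [_ sm] := lam_small.
set m := Num.sqrt _ in sm *; move=> h; have := pr i.
have h2 : `|s * (z 0 i - zp 0 i)| <= 5 / 4 * (m * lam) by rewrite normrM ler_pM.
move: h2 sm; rewrite mulrA !ler_norml ltr_norml => /andP[h3 h4] sm /andP[h5 h6].
by apply/andP; split; lra.
Qed.

Lemma ellipse_in_box z i : q z <= b -> `|z 0 i - z0 0 i| < r.
Proof.
move=> qz; have := @ellipse_segment z 1 i qz; rewrite normr1 mul1r.
rewrite (_ : zp 0 i + (z 0 i - zp 0 i) = z 0 i); last by rewrite addrC subrK.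
by apply; lra.
Qed.

Lemma ellipse_cube z : q z <= b -> cube z0 r z.
Proof. by move=> qz i; apply: ltW; exact: ellipse_in_box. Qed.

Lemma ellipse_dist y : dom x y -> q (chart x y) <= b -> (dist p y <= (lam / 2)%:E)%E.
Proof.
move=> xy qy; set w := chart x y - zp.
have -> : y = ichart x (zp + w) by rewrite /w addrC subrK chartK.
have wE i : w 0 i = chart x y 0 i - zp 0 i by rewrite /w !mxE.
have l0 : 0 <= lam * beta by rewrite mulr_ge0 ?ltW.
apply: (le_trans (dist_upper kappa_gt0 erefl box xp _ l0 _)).
- move=> s s54 i; rewrite [(zp + _) 0 i]mxE [(s *: w) 0 i]mxE wE; apply: ltW; exact: ellipse_segment.
- have -> : quad A (fun i => w 0 i) = quad A (fun i => chart x y 0 i - zp 0 i).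
    by congr quad; apply/funext => i; exact: wE.
  by rewrite qform_scale exprMn ler_wpM2l // sqr_ge0.
- rewrite lee_fin; move: outer_room; set o := 5 / 4 * kappa => h.
  by have := ler_wpM2l (ltW lam_gt0) h; lra.
Qed.

Lemma near_in_ellipse y : (dist p y < (lam / 4)%:E)%E -> dom x y /\ q (chart x y) <= a.
Proof.
move=> dy; apply: contrapT => ny; move: dy; apply/negP; rewrite -leNgt.
have ar z : q z <= a -> cube z0 r z by move=> qz; apply: ellipse_cube; apply: le_trans qz (ltW ab).
have a0 : 0 < a by rewrite exprn_gt0.
apply: le_trans (dist_lower kappa_gt0 erefl box xp lam_gt0 a0 ar ny).
rewrite lee_fin sqrtr_sqr gtr0_norm // mulrAC; have := ler_wpM2r (ltW lam_gt0) inner_room; lra.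
Qed.

Definition scale_bump (y : S) : R := patch_fun x phi y.

Lemma bump_ge0 y : 0 <= scale_bump y.
Proof. by rewrite /scale_bump /patch_fun; case: ifP => // _; exact: quad_bump_ge0. Qed.

Lemma bump_le1 y : scale_bump y <= 1.
Proof. by rewrite /scale_bump /patch_fun; case: ifP => // _; exact: quad_bump_le1. Qed.

Lemma bump_support y : scale_bump y != 0 -> (dist p y <= (lam / 2)%:E)%E.
Proof.
rewrite /scale_bump /patch_fun; case: asboolP => [xy|_]; last by rewrite eqxx.
move=> qy; apply: ellipse_dist => //; rewrite leNgt; apply/negP => h; move: qy.
by rewrite quad_bump0 ?eqxx // ltW.
Qed.

Lemma bump1 y : (dist p y < (lam / 4)%:E)%E -> scale_bump y = 1.
Proof. by move=> /near_in_ellipse[xy qy]; rewrite /scale_bump (patch_funE _ xy) quad_bump1. Qed.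

Section Energy.
Context {n : nat} (N : riemannian_manifold R n).
Variable vol : {measure set (borel S) -> \bar R}.

Definition half_density (v : S -> N) (y : S) : \bar R := (2^-1 * diff_sqnorm v y)%:E.

Lemma half_density_ge0 (v : S -> N) y : (0 <= half_density v y)%E.
Proof. by rewrite lee_fin mulr_ge0 ?invr_ge0 // diff_sqnorm_ge0. Qed.

Definition bump_energy (v : S -> N) : \bar R := (\int[vol]_y (scale_bump y * (2^-1 * diff_sqnorm v y))%:E)%E.

Let bump_density_ge0 (v : S -> N) y : (0 <= (scale_bump y * (2^-1 * diff_sqnorm v y))%:E)%E.
Proof. by rewrite lee_fin mulr_ge0 ?bump_ge0 // -lee_fin; exact: half_density_ge0. Qed.

Let patch_density_ge0 (v : S -> N) (D : set S) y : (0 <= (half_density v \_ D) y)%E.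
Proof. by rewrite patchE; case: ifP => // _; exact: half_density_ge0. Qed.

(** The annulus is disjoint from the support of the bump, which lies in the ball of radius
    s / 2. *)
Lemma annulus_bump_bound (v : S -> N) (s rho : R) : lam < s -> s <= rho ->
  (energy vol v (annulus p (s / 2) s) + bump_energy v <= energy vol v (geodesic_ball p rho))%E.
Proof.
move=> ls sr; rewrite /energy [X in (X + _)%E]integral_mkcond [leRHS]integral_mkcond.
apply: (le_trans (@integral_superadditive _ (borel S) R vol _ _ (patch_density_ge0 v _) (bump_density_ge0 v))).
apply: ge0_le_integral_ae => [y|y|]; [|exact: patch_density_ge0|].
  exact: adde_ge0 (patch_density_ge0 v _ y) (bump_density_ge0 v y).
apply: aeW => y.
have far : scale_bump y != 0 -> (dist p y < (s / 2)%:E)%E.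
  by move=> /bump_support h; apply: le_lt_trans h _; rewrite lte_fin ltr_pM2r.
have s0 : 0 < s by apply: lt_trans ls.
have in_ball t : (dist p y < t%:E)%E -> t <= rho -> y \in (geodesic_ball p rho : set (borel S)).
  by move=> h ts; rewrite inE; apply: lt_le_trans h _; rewrite lee_fin.
rewrite !patchE; case: ifPn => [/set_mem[ys nys]|_].
  rewrite (in_ball _ ys sr); have -> : scale_bump y = 0.
    by apply/eqP; apply: contra_notT nys => /far h; exact: subset_closure.
  by rewrite mul0r adde0.
rewrite add0e; have [->|b0] := eqVneq (scale_bump y) 0; first by rewrite mul0r; case: ifP => // _; exact: half_density_ge0.
rewrite (in_ball _ (far b0)); last by lra.
rewrite lee_fin ler_piMl ?bump_le1 // -lee_fin; exact: half_density_ge0.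
Qed.

Lemma ball_bump_bound (v : S -> N) (s : R) : s <= lam / 4 -> (energy vol v (geodesic_ball p s) <= bump_energy v)%E.
Proof.
move=> sl; rewrite /energy integral_mkcond; apply: ge0_le_integral_ae => [y|y|]; first exact: patch_density_ge0.
  exact: bump_density_ge0.
apply: aeW => y; rewrite patchE; case: ifPn => [/set_mem ys|_]; last exact: bump_density_ge0.
rewrite bump1 ?mul1r //; apply: lt_le_trans ys _; by rewrite lee_fin.
Qed.

Hypothesis volS : is_volume vol.
Hypothesis compactN : compact [set: N].
Variables (T : \bar R) (u : R -> S -> N).
Local Notation E := (R^o * 'rV[R]_2)%type.
Hypothesis ucont : forall (t : R) (x : S), 0 < t -> (t%:E < T)%E ->
  {for (t, x), continuous (fun s : R * S => u s.1 s.2)}.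
Hypothesis usmooth : forall (x : S) (y : N),
  smooth_on [set s : E | [/\ 0 < s.1, (s.1%:E < T)%E, img x s.2 & dom y (u s.1 (ichart x s.2))]]
          (fun s : E => chart y (u s.1 (ichart x s.2))).
Hypothesis uflow : forall (x : S) (y : N) (t : R) (z : 'rV[R]_2),
  0 < t -> (t%:E < T)%E -> img x z -> dom y (u t (ichart x z)) ->
  derive1 (fun s => chart y (u s (ichart x z))) t
  = tension (metric x) (metric y) (chart y \o u t \o ichart x) z.

Definition local_energy t : R :=
  \int[leb2]_z (phi (row2 (z : R * R)) * energy_density x (flow_pair u x : E -> E -> E -> R^o) (t, row2 (z : R * R))).

Lemma bump_energyE t : 0 < t -> (t%:E < T)%E -> bump_energy (u t) = (local_energy t)%:E.
Proof.
move=> t0 tT; have xz := img_self x.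
have A01 : A e1 e0 = A e0 e1 by exact: metric_sym01.
have cp : continuous phi.
  by move=> z; apply: (smooth_on_continuous (A := setT)) => //; exact: quad_bump_smooth.
have r0 := box_r0 box.
apply: (energy_localized volS compactN (@ucont) (@usmooth) t0 tT r0 (box_img box) (phi := phi) (K := [set z | q z <= b])).
- by move=> z; exact: quad_bump_ge0.
- exact: cp.
- exact: (ell_compact ellipse_cube).
- by move=> z; move/negP; rewrite -ltNge => h; apply: quad_bump0 => //; exact: ltW.
- by move=> z qz i; exact: ellipse_in_box.
Qed.

Lemma local_energy_growth (s t e sigma : R) : 0 < s -> s <= t -> (t%:E < T)%E -> 1 <= e -> 0 < sigma ->
  (forall r : R, s <= r <= t -> (stress_norm vol e (u r) <= sigma%:E)%E) ->
  local_energy t - local_energy s <= hessian_const b M * (1 + 8 * b) * sigma * lam `^ (- 2 / e) * (t - s).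
Proof.
move=> s0 st tT e1 sg0 hS; have [sm _] := lam_small.
apply: (@local_growth _ S T x a b k r K M a_ge0 ab k_gt1 kappa_le box cutoff_bound zp lam lam_gt0 sm ellipse_cube
  (flow_pair u x : E -> E -> E -> R^o) _ _ _ _ s t e sigma s0 st tT e1 sg0 _).
- exact: (flow_pair_C1 (@ucont) (@usmooth) (x := x)).
- exact: (flow_pairC (@ucont) (@usmooth) (x := x)).
- exact: (flow_identity (@ucont) (@usmooth) (@uflow) (x := x)).
- move=> z hz; exact: (flow_pair_ge0 (@ucont) (@usmooth) (x := x) (@time_dir R) hz).
- move=> r' /andP[sr' r't].
  have r'T : (r'%:E < T)%E by apply: le_lt_trans tT; rewrite lee_fin.
  apply: (stress_localized volS compactN (@ucont) (@usmooth) (lt_le_trans s0 sr') r'T (box_r0 box) (box_img box) e1 sg0 _ _ _).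
  + exact: ell_measurable.
  + by move=> z qz i; exact: ellipse_in_box.
  + by apply: hS; rewrite sr'.
Qed.

(** The energy of the annulus plus the bump energy at time t is at most the energy of the ball
    of radius rho, hence at most the energy of the inner ball at time t2 plus eps / 2, hence at
    most the bump energy at time t2 plus eps / 2; and the bump energy has grown by eps / 4 at
    most. *)
Lemma annulus_small (t t2 e sigma eps s rho rr : R) : 0 < t -> t <= t2 -> (t2%:E < T)%E -> 1 <= e -> 0 < sigma -> 0 < eps ->
  (forall r : R, t <= r <= t2 -> (stress_norm vol e (u r) <= sigma%:E)%E) ->
  (energy vol (u t) (geodesic_ball p rho) <= energy vol (u t2) (geodesic_ball p rr) + (eps / 2)%:E)%E ->
  4 * (hessian_const b M * (1 + 8 * b)) * sigma * (t2 - t) / eps <= lam `^ (2 / e) ->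
  rr <= lam / 4 -> lam < s -> s <= rho ->
  (energy vol (u t) (annulus p (s / 2) s) <= (3 / 4 * eps)%:E)%E.
Proof.
move=> t0 tt2 t2T e1 sg0 eps0 hS hE hl rl ls sr.
have tT : (t%:E < T)%E by apply: le_lt_trans t2T; rewrite lee_fin.
have t20 : 0 < t2 by apply: lt_le_trans tt2.
have h1 := annulus_bump_bound (u t) ls sr; have h2 := ball_bump_bound (u t2) rl.
rewrite (bump_energyE t0 tT) in h1; rewrite (bump_energyE t20 t2T) in h2.
have g := local_energy_growth t0 tt2 t2T e1 sg0 hS.
have g4 : local_energy t2 - local_energy t <= eps / 4.
  apply: (le_trans g); rewrite mulNr powRN.
  exact: scale_growth (powR_gt0 _ lam_gt0) eps0 hl.
have h3 : (energy vol (u t) (annulus p (s / 2) s) + (local_energy t)%:E <= (local_energy t2 + eps / 2)%:E)%E.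
  apply: (le_trans h1); apply: (le_trans hE); rewrite EFinD; exact: leeD2r.
rewrite -leeBrDr // -EFinB in h3; apply: (le_trans h3); rewrite lee_fin; exact: energy_balance.
Qed.

End Energy.

End LocalEstimate.


(** * The initial time *)

(** The sum of the functions is integrable, hence finite almost everywhere. *)
Lemma ae_cvg0_geometric d (T : measurableType d) (R : realType) (mu : {measure set T -> \bar R}) (F : nat -> T -> R) :
  (forall k, measurable_fun setT (F k)) -> (forall k x, 0 <= F k x) ->
  (forall k, (\int[mu]_x (F k x)%:E <= (1 / (2 ^ (k + 1))%:R)%:E)%E) ->
  {ae mu, forall x, F k x @[k --> \oo] --> 0}.
Proof.
move=> mF F0 bF; pose S x := (\sum_(k <oo) (F k x)%:E)%E.
have mFE k : measurable_fun setT (fun x => (F k x)%:E) by apply/measurable_EFinP.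
have FE0 k x : (0 <= (F k x)%:E)%E by rewrite lee_fin.
have mS : measurable_fun setT S by apply: ge0_emeasurable_sum.
have S0 x : (0 <= S x)%E by apply: nneseries_ge0.
have iS : (\int[mu]_x S x < +oo)%E.
  rewrite integral_nneseries //.
  apply: (@le_lt_trans _ _ (\sum_(k <oo) (1 / (2 ^ (k + 1))%:R)%:E)%E).
    apply: lee_nneseries => [k _ _|k _]; [exact: integral_ge0|exact: bF].
  have /cvg_lim -> // := @cvg_geometric_eseries_half R 1 0.
  by rewrite ltry.
have : mu.-integrable setT S.
  apply/integrableP; split => //; under eq_integral do rewrite gee0_abs //; exact: iS.
move=> iT; have := integrable_ae measurableT iT; apply: ae_imp => x /(_ Logic.I) Sx.
apply: cvg_series_cvg_0; apply: nondecreasing_is_cvgn.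
  by apply: nondecreasing_series => k _ _.
exists (fine (S x)) => _ [m _ <-]; rewrite -lee_fin fineK // /series /= -sumEFin.
exact: nneseries_lim_ge.
Qed.

Section PatchConvergence.
Context {R : realType} {n : nat} (S : riemannian_manifold R 2) (N : riemannian_manifold R n).

Lemma row_cvg m (z : nat -> 'rV[R]_m) (z0 : 'rV[R]_m) :
  (forall a, z k 0 a @[k --> \oo] --> z0 0 a) -> z k @[k --> \oo] --> z0.
Proof.
move=> h; rewrite (row_sum_delta z0).
rewrite (_ : (fun k => z k) = fun k => \sum_j z k 0 j *: delta_mx 0 j); last first.
  by apply/funext => k; exact: row_sum_delta.
apply: cvg_big => [|j _]; first exact: add_continuous.
by apply: cvgZ; [exact: h|exact: cvg_cst].
Qed.

Lemma mulmx_cvg m k l (F : nat -> 'M[R]_(m, k)) (G : nat -> 'M[R]_(k, l)) (A : 'M[R]_(m, k)) (B : 'M[R]_(k, l)) :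
  (forall i j, F t i j @[t --> \oo] --> A i j) -> (forall i j, G t i j @[t --> \oo] --> B i j) ->
  forall i j, (F t *m G t) i j @[t --> \oo] --> (A *m B) i j.
Proof.
move=> hF hG i j; rewrite (_ : (fun t => (F t *m G t) i j) = (fun t => \sum_k F t i k * G t k j)).
  rewrite mxE; apply: cvg_big => [|a _]; first exact: add_continuous.
  by apply: cvgM; [exact: hF|exact: hG].
by apply/funext => t; rewrite mxE.
Qed.

Lemma pullback_patch (w : S -> N) y b : dom b (w y) ->
  let E := diff_map w y *m tmx (w y) b (chart (w y) (w y)) in
  pullback w y = E *m metric b (chart b (w y)) *m E^T.
Proof.
move=> bw E; rewrite /pullback /metric_at.
have o : overlap (w y) b (chart (w y) (w y)).
  by split; [apply: chart_img; exact: dom_self|rewrite chartK //; exact: dom_self].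
have e := metric_tmx o; rewrite chartK in e; last exact: dom_self.
by rewrite e (trmx_mul (diff_map w y)) !mulmxA.
Qed.

(** By [patch_frame] the coordinates of the maps and of their differentials are rational
    functions of the patch functions and of their derivatives. *)
Lemma diff_sqnorm_cvg (w : nat -> S -> N) (v : S -> N) y b : patch_set b (v y) ->
  patch_weight b (w k y) @[k --> \oo] --> patch_weight b (v y) ->
  (forall a, patch_coord b a (w k y) @[k --> \oo] --> patch_coord b a (v y)) ->
  (forall i, (diff_map (w k) y *m dfun (patch_weight b) (w k y)) i 0 @[k --> \oo] -->
     (diff_map v y *m dfun (patch_weight b) (v y)) i 0) ->
  (forall i a, (diff_map (w k) y *m dfun (patch_coord b a) (w k y)) i 0 @[k --> \oo] -->
     (diff_map v y *m dfun (patch_coord b a) (v y)) i 0) ->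
  2^-1 * diff_sqnorm (w k) y @[k --> \oo] --> 2^-1 * diff_sqnorm v y.
Proof.
move=> bv cW cC dW dC; have [bvy _] := bv.
have W0 : 0 < patch_weight b (v y) by rewrite patch_weightE //; exact: patch_bump_gt0.
have Wn : patch_weight b (v y) != 0 by rewrite gt_eqF.
have nW : \forall k \near \oo, 0 < patch_weight b (w k y) by exact: (cvgr_gt _ cW).
have domW q : 0 < patch_weight b q -> dom b q.
  by rewrite /patch_weight /patch_fun; case: asboolP => // _; rewrite ltxx.
have coordE q a : 0 < patch_weight b q -> patch_coord b a q / patch_weight b q = chart b q 0 a.
  move=> q0; have bq := domW q q0; rewrite (patch_coordE a bq) -(patch_weightE bq) mulrAC divff ?mul1r //.
  by rewrite gt_eqF.
have cz a : chart b (w k y) 0 a @[k --> \oo] --> chart b (v y) 0 a.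
  rewrite -(coordE _ _ W0); have n0 : \forall k \near \oo, patch_coord b a (w k y) / patch_weight b (w k y) = chart b (w k y) 0 a.
    by apply: filterS nW => k k0; exact: coordE.
  by apply: (cvg_trans (near_eq_cvg n0)); apply: cvgM => //; exact: cvgV.
pose E (q : S -> N) := diff_map q y *m tmx (q y) b (chart (q y) (q y)).
pose X (q : S -> N) i a := (patch_weight b (q y))^-1 * ((diff_map q y *m dfun (patch_coord b a) (q y)) i 0 -
  chart b (q y) 0 a * (diff_map q y *m dfun (patch_weight b) (q y)) i 0).
have EE q i a : 0 < patch_weight b (q y) -> X q i a = E q i a.
  move=> q0; have bq := domW _ q0; rewrite /X (patch_frame _ _ bq) -(patch_weightE bq).
  have lin (Y Z : 'cV[R]_2) c d : (c *: Y + d *: Z) i 0 = c * Y i 0 + d * Z i 0 by rewrite !mxE.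
  rewrite lin addrAC subrr add0r mulrA mulVf ?mul1r ?gt_eqF //; exact: mxE.
have EP q : dom b (q y) -> pullback q y = E q *m metric b (chart b (q y)) *m (E q)^T by exact: pullback_patch.
have cX i a : X (w k) i a @[k --> \oo] --> X v i a.
  apply: cvgM; first exact: cvgV.
  by apply: cvgB; [exact: dC|apply: cvgM; [exact: cz|exact: dW]].
clearbody X E.
have cE i a : E (w k) i a @[k --> \oo] --> E v i a.
  case: _ / (EE v i a W0); have n0 : \forall k \near \oo, X (w k) i a = E (w k) i a by apply: filterS nW => k k0; exact: EE.
  exact: (cvg_trans (near_eq_cvg n0) (cX i a)).
have cET i a : (E (w k))^T i a @[k --> \oo] --> (E v)^T i a.
  by rewrite mxE; under eq_fun do rewrite mxE; exact: cE.
have cg i j : metric b (chart b (w k y)) i j @[k --> \oo] --> metric b (chart b (v y)) i j.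
  have h := smooth_on_continuous (metric_smooth i j) (chart_img bvy).
  exact: (cvg_comp _ _ (row_cvg cz) h).
have cP i j : pullback (w k) y i j @[k --> \oo] --> pullback v y i j.
  rewrite (EP _ bvy).
  have n0 : \forall k \near \oo, (E (w k) *m metric b (chart b (w k y)) *m (E (w k))^T) i j = pullback (w k) y i j.
    by apply: filterS nW => k k0; rewrite (EP _ (domW _ k0)).
  by apply: (cvg_trans (near_eq_cvg n0)); apply: mulmx_cvg => //; exact: mulmx_cvg.
apply: cvgM; first exact: cvg_cst.
rewrite /diff_sqnorm /mxtrace; apply: cvg_big => [|i _]; first exact: add_continuous.
by apply: mulmx_cvg => // i' j'; exact: cvg_cst.
Qed.

End PatchConvergence.

Section InitialEnergy.
Context {R : realType} {n : nat} (S : riemannian_manifold R 2) (N : riemannian_manifold R n).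
Variable vol : {measure set (borel S) -> \bar R}.
Hypothesis volS : is_volume vol.
Hypothesis compactN : compact [set: N].
Local Notation bR := (g_sigma_algebraType (R.-ocitv.-measurable)).
Local Notation mu2 := (leb2 : {measure set (bR * bR) -> \bar R}).
Variables (x : S) (r : R).
Hypotheses (r_gt0 : 0 < r) (r_img : cube (chart x x) r `<=` img x).
Local Notation z0 := (chart x x).

Definition chart_box : set (borel S) := [set y | dom x y /\ forall i, `|chart x y 0 i - z0 0 i| < r].

Definition coord_box : set (bR * bR) := [set z | forall i, `|row2 z 0 i - z0 0 i| < r].

Lemma coord_box_img : coord_box `<=` img2 x.
Proof. by move=> z h; apply: r_img => i; exact: ltW. Qed.

Lemma coord_box_measurable : measurable coord_box.
Proof.
have c i : continuous (fun z : R * R => `|row2 z 0 i - z0 0 i|).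
  move=> z; apply: (@continuous_comp _ _ _ (fun z : R * R => row2 z 0 i - z0 0 i) Num.norm); last exact: norm_continuous.
  apply: cvgB; last exact: cvg_cst.
  exact: (@continuous_comp _ _ _ (@row2 R) (fun v : 'rV[R]_2 => v 0 i) z (@row2_continuous R z) (@coord_continuous R _ _ 0 i _)).
have m i : measurable [set z : bR * bR | `|row2 z 0 i - z0 0 i| < r].
  have := @continuous2_measurable R _ (c i) measurableT _ (@measurable_itv R `]-oo, r[).
  by rewrite setTI; congr measurable; apply/seteqP; split => z /=; rewrite in_itv.
rewrite (_ : coord_box = [set z | `|row2 z 0 e0 - z0 0 e0| < r] `&` [set z | `|row2 z 0 e1 - z0 0 e1| < r]).
  exact: measurableI.
by apply/seteqP; split=> [z h|z [h1 h2] i]; [split; exact: h|case: (ord2P i) => ->].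
Qed.

Lemma chart_boxE : chart_box = dom x `&` (coord2 \o chart x) @^-1` coord_box.
Proof. by apply/seteqP; split=> y [xy h]; split => // i; have := h i; rewrite /= coord2K. Qed.

Lemma chart_box_measurable : measurable chart_box.
Proof. rewrite chart_boxE; apply: chart_measurable; [exact: dom_measurable|exact: coord_box_measurable]. Qed.

Lemma box_measurable (h : bR * bR -> R) : measurable_fun coord_box h ->
  measurable_fun setT ((h \o (coord2 \o chart x)) \_ chart_box : borel S -> R).
Proof.
move=> mh; apply/(measurable_restrictT _ chart_box_measurable).
apply: (measurable_comp (F := coord_box) coord_box_measurable _ mh).
  by rewrite chart_boxE => _ [y [_ yb] <-].
by apply: (measurable_funS _ _ (chart_measurable (x := x))); [exact: dom_measurable|move=> y []].
Qed.

Lemma target_continuous (f : N -> R) : smooth_fun f -> continuous f.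
Proof.
move=> sf q; have qq := dom_self q.
have c : {for q, continuous ((f \o ichart q) \o chart q)}.
  apply: continuous_comp; first exact: chart_continuous.
  exact: (smooth_on_continuous (sf q) (chart_img qq)).
have nr : \forall p \near q, ((f \o ichart q) \o chart q) p = f p.
  have : \forall p \near q, dom q p by apply: open_nbhs_nbhs; split; [exact: dom_open|].
  by apply: filterS => p qp; rewrite /= chartK.
by rewrite /prop_for /continuous_at -(nbhs_singleton nr); exact: (cvg_trans (near_eq_cvg nr)).
Qed.

Lemma target_measurable (f : N -> R) (w : S -> N) : smooth_fun f ->
  (forall A : set N, open A -> measurable (w @^-1` A : set (borel S))) ->
  measurable_fun setT (f \o w : borel S -> R).
Proof.
move=> /target_continuous cf mw; apply: (measurability _ (RGenOpens.measurableE R)).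
move=> _ [_ [a [b ->]] <-]; rewrite setTI.
have oA : open (f @^-1` `]a, b[%classic) by move/continuousP : cf; apply; exact: interval_open.
exact: (mw _ oA).
Qed.

Lemma quad_col (G : 'M[R]_2) (w : 'cV[R]_2) : (w^T *m G *m w) 0 0 = quad G (fun i => w i 0).
Proof.
rewrite /quad mxE exchange_big; apply: eq_bigr => j _; rewrite mxE mulr_suml.
by apply: eq_bigr => i _; rewrite mxE.
Qed.

Lemma covector_chart y (w : 'cV[R]_2) : dom x y ->
  covector_sqnorm y w = quad (invmx (metric x (chart x y))) (fun i => (transition_jac x y *m w) i 0).
Proof.
move=> xy; have uJ := transition_jac_unit xy.
have ug : metric_at y \in unitmx by apply: metric_unitmx; exact: img_self.
rewrite (invmx_congruence uJ ug (metric_at_tmx xy)).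
set J := transition_jac x y; set h := invmx (metric_at y).
rewrite -quad_col /covector_sqnorm -/h; congr (fun_of_matrix _ 0 0); rewrite trmx_mul !mulmxA; congr (_ *m _).
have uJT : J^T \in unitmx by rewrite unitmx_tr.
by rewrite (mulmxKV uJ) trmx_inv (mulmxK uJT).
Qed.

(** The Cauchy-Schwarz inequality for a covector and a basis vector. *)
Lemma covector_coord (y : S) (w : 'cV[R]_2) i : (w i 0) ^+ 2 <= metric_at y i i * covector_sqnorm y w.
Proof.
rewrite /covector_sqnorm quad_col; have yy := img_self y; have d0 := det_metric_gt0 yy.
have dn : \det (metric_at y) != 0 by rewrite gt_eqF.
have [i00 i01 i10 i11] := inv2E dn; rewrite /quad !big_ord2 i00 i01 i10 i11.
rewrite (det_metricE yy) in d0 dn *; rewrite (metric_sym01 yy).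
move: d0 dn; rewrite -!/(metric_at y).
have alg (a b d D w0 w1 : R) : D = a * d - b ^+ 2 -> 0 < D ->
    w0 ^+ 2 <= a * (w0 * (d / D) * w0 + w0 * (- b / D) * w1 + (w1 * (- b / D) * w0 + w1 * (a / D) * w1)) /\
    w1 ^+ 2 <= d * (w0 * (d / D) * w0 + w0 * (- b / D) * w1 + (w1 * (- b / D) * w0 + w1 * (a / D) * w1)).
  move=> DE D0; have Dn : D != 0 by rewrite gt_eqF.
  split; rewrite -subr_ge0.
    rewrite (_ : _ - _ = (b * w0 - a * w1) ^+ 2 / D); first by rewrite divr_ge0 ?sqr_ge0 // ltW.
    by apply: (mulIf Dn); rewrite mulrBl DE in Dn *; field.
  rewrite (_ : _ - _ = (d * w0 - b * w1) ^+ 2 / D); first by rewrite divr_ge0 ?sqr_ge0 // ltW.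
  by apply: (mulIf Dn); rewrite mulrBl DE in Dn *; field.
by move=> d0 _; case: (ord2P i) => ->; have [h1 h2] := alg _ _ _ _ (w e0 0) (w e1 0) erefl d0.
Qed.


Definition sqdist_fun (f : N -> R) (w v : S -> N) y : R := (f (w y) - f (v y)) ^+ 2
  + covector_sqnorm y (diff_map w y *m dfun f (w y) - diff_map v y *m dfun f (v y)).

Lemma covector_ge0 (y : S) (w : 'cV[R]_2) : 0 <= covector_sqnorm y w.
Proof.
have h := covector_coord y w e0; have g0 := metric_diag_gt0 e0 (img_self y).
by rewrite -(pmulr_rge0 _ g0); apply: le_trans h; exact: sqr_ge0.
Qed.

Lemma sqdist_fun_ge0 f w v y : 0 <= sqdist_fun f w v y.
Proof. by rewrite addr_ge0 ?sqr_ge0 ?covector_ge0. Qed.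

Lemma sqdist_measurable (f : N -> R) (w v : S -> N) : smooth_fun f ->
  (forall A : set N, open A -> measurable (w @^-1` A : set (borel S))) ->
  (forall A : set N, open A -> measurable (v @^-1` A : set (borel S))) ->
  (exists D, weak_differential w D) -> (exists D, weak_differential v D) ->
  measurable_fun setT (sqdist_fun f w v \_ chart_box : borel S -> R).
Proof.
move=> sf mw mv /diff_map_weak ww /diff_map_weak wv.
pose d i (z : bR * bR) := pdiff w (diff_map w) f x i (ichart x (row2 (z : R * R))) - pdiff v (diff_map v) f x i (ichart x (row2 (z : R * R))).
pose h (z : bR * bR) := quad (invmx (metric x (row2 (z : R * R)))) (fun i => d i z).
have md i : measurable_fun coord_box (d i).
  by apply: measurable_funB; apply: weak_differential_measurable.
have mg i j : measurable_fun coord_box (fun z : bR * bR => invmx (metric x (row2 (z : R * R))) i j).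
  apply: (measurable_funS (img2_measurable x) coord_box_img); apply: open_continuous2_measurable; first exact: img2_open.
  move=> z xz; apply: (@continuous_comp _ _ _ (@row2 R) (fun z => invmx (metric x z) i j) z (@row2_continuous R z)).
  exact: (C1_continuous (@invmx_C1 R S x i j _ xz)).
have mh : measurable_fun coord_box h.
  rewrite /h /quad; under eq_fun do rewrite !big_ord2.
  by apply: measurable_funD; apply: measurable_funD; apply: measurable_funM => //; apply: measurable_funM.
have mF : measurable_fun setT (fun y : borel S => (f (w y) - f (v y)) ^+ 2).
  by apply: measurable_funX; apply: measurable_funB; exact: target_measurable.
rewrite (_ : _ \_ _ = fun y : borel S => ((fun y : borel S => (f (w y) - f (v y)) ^+ 2) \_ chart_box) y + ((h \o (coord2 \o chart x)) \_ chart_box) y).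
  apply: measurable_funD; last exact: box_measurable.
  by apply/(measurable_restrictT _ chart_box_measurable); apply: measurable_funS mF.
apply/funext => y; rewrite !patchE; case: ifPn => [/set_mem[xy _]|_]; last by rewrite addr0.
congr (_ + _); rewrite (covector_chart _ xy) /h /= coord2K; congr quad; apply/funext => i.
by rewrite mulmxBr /d /pdiff coord2K chartK // [LHS]mxE; congr (_ + _); exact: mxE.
Qed.

Lemma cvg_of_sqr (a : nat -> R) (l C : R) (e : nat -> R) : (forall k, (a k - l) ^+ 2 <= C * e k) ->
  e k @[k --> \oo] --> 0 -> a k @[k --> \oo] --> l.
Proof.
move=> h e0; have Ce : C * e k @[k --> \oo] --> 0.
  by rewrite -(mulr0 C); apply: cvgM => //; exact: cvg_cst.
apply/cvgrPdist_lt => d d0; have d20 : 0 < d ^+ 2 by rewrite exprn_gt0.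
move/cvgrPdist_lt : Ce => /(_ _ d20); apply: filterS => k; rewrite sub0r normrN => hk.
have : (a k - l) ^+ 2 < d ^+ 2 by apply: le_lt_trans (h k) _; exact: le_lt_trans (ler_norm _) hk.
by rewrite distrC -real_normK ?num_real // ltr_sqr ?nnegrE // ltW.
Qed.

Variables (T : \bar R) (u : R -> S -> N).
Local Notation E := (R^o * 'rV[R]_2)%type.
Hypothesis ucont : forall (t : R) (x : S), 0 < t -> (t%:E < T)%E ->
  {for (t, x), continuous (fun s : R * S => u s.1 s.2)}.
Hypothesis usmooth : forall (x : S) (y : N),
  smooth_on [set s : E | [/\ 0 < s.1, (s.1%:E < T)%E, img x s.2 & dom y (u s.1 (ichart x s.2))]]
          (fun s : E => chart y (u s.1 (ichart x s.2))).

(** In the chart the classical energy density is continuous. *)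
Lemma half_density_version (t : R) : 0 < t -> (t%:E < T)%E -> exists G : borel S -> R,
  [/\ measurable_fun setT G, forall y, 0 <= G y &
      {ae vol, forall y, chart_box y -> G y = 2^-1 * diff_sqnorm (u t) y}].
Proof.
move=> t0 tT; pose P := flow_pair u x : E -> E -> E -> R^o.
pose h z := energy_density x P (t, z) / dens x z.
have hc z : img x z -> {for z, continuous h}.
  move=> xz; have ec : {for z, continuous (fun z => energy_density x P (t, z))}.
    apply: C1_continuous; apply: (energy_density_C1 _ t0 tT xz) => X Y.
    exact: (flow_pair_C1 (@ucont) (@usmooth)).
  apply: (cvgM ec); exact: C1_continuous (densV_C1 xz).
have h0 z : img x z -> 0 <= h z.
  move=> xz; exact: divr_ge0 (energy_density_ge0 (@ucont) (@usmooth) t0 tT xz) (ltW (dens_gt0 xz)).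
exists (((h \o @row2 R) \o (coord2 \o chart x)) \_ chart_box); split.
- apply: box_measurable; apply: (measurable_funS (img2_measurable x) coord_box_img).
  apply: open_continuous2_measurable; first exact: img2_open.
  by move=> z xz; exact: (@continuous_comp _ _ _ (@row2 R) h z (@row2_continuous R z) (hc _ xz)).
- move=> y; rewrite patchE; case: ifPn => // /set_mem[xy _]; rewrite /= coord2K.
  by apply: h0; exact: chart_img.
- apply: ae_imp (ae_classical volS compactN (@ucont) (@usmooth) t0 tT r_gt0 r_img) => y cl [xy yb].
  rewrite patchE mem_set /= ?coord2K //; have xz : img x (chart x y) by exact: chart_img.
  rewrite /h -[in diff_sqnorm _ _](chartK xy) (diff_sqnorm_chart (@ucont) (@usmooth) t0 tT xz); last first.
    by rewrite chartK //; exact: cl.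
  rewrite (@energy_density_trace R S x P t _ (fun i j => flow_pair_sym (@ucont) (@usmooth) t0 tT i j xz)).
  by rewrite [dens _ _ * _]mulrC mulfK // gt_eqF // dens_gt0.
Qed.

Lemma near_all_in (I : eqType) (s : seq I) (F : set_system R) (P : I -> R -> Prop) : Filter F ->
  (forall i, \forall t \near F, P i t) -> \forall t \near F, forall i, i \in s -> P i t.
Proof.
move=> FF h; elim: s => [|j s IH]; first by apply: filterE.
by apply: filterS2 (h j) IH => t pj ps i; rewrite inE => /orP[/eqP -> //|]; exact: ps.
Qed.

Lemma flow_slice_measurable (t : R) : 0 < t -> (t%:E < T)%E -> forall A : set N, open A -> measurable (u t @^-1` A : set (borel S)).
Proof.
move=> t0 tT A oA; have [cu _] := flow_slice_C1 (@ucont) (@usmooth) t0 tT.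
by apply: open_borel; move/continuousP : cu; exact.
Qed.

Hypothesis u0 : L21_map vol (u 0).
Hypothesis u0_limit : forall f : N -> R, smooth_fun f -> L21_sqdist vol f (u t) (u 0) @[t --> 0^'+] --> 0%E.
Hypothesis T_gt0 : (0 < T)%E.

(** Along times that tend to 0 fast enough, the functions of a finite frame and their
    differentials converge almost everywhere, hence so do the energy densities, and Fatou's
    lemma applies. *)
Lemma initial_energy (A : set S) (c : \bar R) : A `<=` chart_box ->
  (\forall t \near 0^'+, (energy vol (u t) A <= c)%E) -> (energy vol (u 0) A <= c)%E.
Proof.
have colB (X Y : 'cV[R]_2) j : (X - Y) j 0 = X j 0 - Y j 0 by rewrite !mxE.
move=> Abox hc; have [s hs] := patch_cover compactN.
pose F (i : N * option 'I_n) : N -> R := if i.2 is Some a then patch_coord i.1 a else patch_weight i.1.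
have sF i : smooth_fun (F i).
  by rewrite /F; case: i.2 => [a|]; [exact: patch_coord_smooth|exact: patch_weight_smooth].
pose fam := [seq (b, a) | b <- s, a <- None :: [seq Some a | a <- enum 'I_n]].
have inW b : b \in s -> (b, None) \in fam by move=> bs; apply/allpairsP; exists (b, None); rewrite inE.
have inC b a : b \in s -> (b, Some a) \in fam.
  by move=> bs; apply/allpairsP; exists (b, Some a); split => //; rewrite inE /=; apply/mapP; exists a; rewrite ?mem_enum.
have [_ w0 _] := u0; have [m0 _ _] := u0.
have nearT : \forall t \near 0^'+, 0 < t /\ (t%:E < T)%E.
  near=> t; split; first by near: t; exact: nbhs_right_gt.
  near: t; have [b b0 bT] := lt_ereal_between T_gt0.
  near=> t; apply: lt_trans bT; rewrite lte_fin; near: t; exact: nbhs_right_lt.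
have pick k : exists t : R, [/\ 0 < t, (t%:E < T)%E, (energy vol (u t) A <= c)%E &
    forall i, i \in fam -> (L21_sqdist vol (F i) (u t) (u 0) <= (1 / (2 ^ (k + 1))%:R)%:E)%E].
  have e0 : (0 < (1 / (2 ^ (k + 1))%:R)%:E :> \bar R)%E by rewrite lte_fin divr_gt0 // ltr0n expn_gt0.
  have h1 : \forall t \near 0^'+, forall i, i \in fam -> (L21_sqdist vol (F i) (u t) (u 0) <= (1 / (2 ^ (k + 1))%:R)%:E)%E.
    apply: near_all_in => i; have := u0_limit (sF i).
    move=> /(_ [set z | (z < (1 / (2 ^ (k + 1))%:R)%:E)%E]) h.
    have hn : nbhs (0%E : \bar R) [set z | (z < (1 / (2 ^ (k + 1))%:R)%:E)%E] by exact: (open_ereal_lt' e0).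
    have h' : \forall t \near 0^'+, (L21_sqdist vol (F i) (u t) (u 0) < (1 / (2 ^ (k + 1))%:R)%:E)%E := h hn.
    by apply: filterS h' => t; exact: ltW.
  have : \forall t \near 0^'+, [/\ 0 < t, (t%:E < T)%E, (energy vol (u t) A <= c)%E &
    forall i, i \in fam -> (L21_sqdist vol (F i) (u t) (u 0) <= (1 / (2 ^ (k + 1))%:R)%:E)%E].
    by apply: filterS3 nearT hc h1 => t [t0 tT] ht hi; split.
  by move=> /filter_ex.
have [t_ ht] := choice pick; pose w k := u (t_ k).
have t0 k : 0 < t_ k by have [] := ht k.
have tT k : ((t_ k)%:E < T)%E by have [] := ht k.
have cvg0 i : {ae vol, forall y, i \in fam -> (sqdist_fun (F i) (w k) (u 0) \_ chart_box) y @[k --> \oo] --> 0}.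
  have [ii|ni] := boolP (i \in fam); last by apply: aeW.
  have p0 k y : 0 <= (sqdist_fun (F i) (w k) (u 0) \_ chart_box) y.
    by rewrite patchE; case: ifP => // _; exact: sqdist_fun_ge0.
  have := @ae_cvg0_geometric _ (borel S) R vol (fun k => sqdist_fun (F i) (w k) (u 0) \_ chart_box).
  move=> /(_ _ p0) h; have {}h : {ae vol, forall y, (sqdist_fun (F i) (w k) (u 0) \_ chart_box) y @[k --> \oo] --> 0}.
  { apply: h => k.
    apply: (sqdist_measurable (sF i) (flow_slice_measurable (t0 k) (tT k)) m0 _ w0).
    by exists (classical_diff (w k)); apply: classical_diff_weak; exact: (flow_slice_C1 (@ucont) (@usmooth) (t0 k) (tT k)).
    have [_ _ _ /(_ _ ii)] := ht k; apply: le_trans.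
    apply: ge0_le_integral_ae => [y|y|]; [by rewrite lee_fin; exact: p0|by rewrite lee_fin; exact: sqdist_fun_ge0|].
    apply: aeW => y; rewrite lee_fin patchE; case: ifP => // _; exact: sqdist_fun_ge0. }
  by apply: ae_imp h => y.
have conv : {ae vol, forall y, A y -> 2^-1 * diff_sqnorm (w k) y @[k --> \oo] --> 2^-1 * diff_sqnorm (u 0) y}.
{ apply: ae_imp (ae_seq fam cvg0) => y hy Ay; have [b bs yb] := hs (u 0 y).
  have sq i : i \in fam -> sqdist_fun (F i) (w k) (u 0) y @[k --> \oo] --> 0.
    move=> ii; have h := hy i ii ii.
    have e : (fun k => (sqdist_fun (F i) (w k) (u 0) \_ chart_box) y) = (fun k => sqdist_fun (F i) (w k) (u 0) y).
      by apply/funext => k; rewrite patchE mem_set //; exact: Abox.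
    by rewrite e in h.
  have cF i : i \in fam -> F i (w k y) @[k --> \oo] --> F i (u 0 y).
    move=> ii; apply: (cvg_of_sqr (C := 1) _ (sq i ii)) => k.
    by rewrite mul1r lerDl covector_ge0.
  have cD i j : i \in fam -> (diff_map (w k) y *m dfun (F i) (w k y)) j 0 @[k --> \oo] --> (diff_map (u 0) y *m dfun (F i) (u 0 y)) j 0.
    move=> ii; apply: (cvg_of_sqr (C := metric_at y j j) _ (sq i ii)) => k.
    apply: (@le_trans _ _ (metric_at y j j * covector_sqnorm y (diff_map (w k) y *m dfun (F i) (w k y) - diff_map (u 0) y *m dfun (F i) (u 0 y)))).
      apply: le_trans (covector_coord _ _ j); rewrite le_eqVlt; apply/orP; left; apply/eqP; congr (_ ^+ 2).
      exact: (esym (colB _ _ _)).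
    apply: ler_wpM2l; first by apply: ltW; apply: metric_diag_gt0; exact: img_self.
    by rewrite lerDr sqr_ge0.
  apply: (diff_sqnorm_cvg yb (cF _ (inW b bs)) _ (fun i => cD _ i (inW b bs))).
  - by move=> a; exact: (cF _ (inC b a bs)).
  - by move=> i a; exact: (cD _ i (inC b a bs)). }
have [G hG] := choice (fun k => half_density_version (t0 k) (tT k)).
have aeG : {ae vol, forall y, forall k, chart_box y -> G k y = 2^-1 * diff_sqnorm (w k) y}.
  by apply: ae_foralln => k; have [] := hG k.
have d0 (v : S -> N) y : 0 <= 2^-1 * diff_sqnorm v y by rewrite mulr_ge0 ?invr_ge0 // diff_sqnorm_ge0.
apply: (@lower_fatou _ (borel S) R vol A G).
- by move=> k y; have [] := hG k.
- by move=> y; exact: d0.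
- by move=> k; have [] := hG k.
- apply: ae_imp2 aeG conv => y hy cy Ay.
  by rewrite (_ : (fun k => G k y) = (fun k => 2^-1 * diff_sqnorm (w k) y)); [exact: cy|apply/funext => k; exact: hy _ (Abox _ Ay)].
- move=> k; have [_ _ + _] := ht k; apply: le_trans.
  rewrite [leLHS]integral_mkcond /energy [leRHS]integral_mkcond.
  apply: ge0_le_integral_ae => [y|y|].
  + by rewrite patchE; case: ifP => // _; rewrite lee_fin; have [] := hG k.
  + by rewrite patchE; case: ifP => // _; rewrite lee_fin.
  + by apply: ae_imp aeG => y hy; rewrite !patchE; case: ifPn => // /set_mem Ay; rewrite hy //; exact: Abox.
Unshelve. all: by end_near.
Qed.

End InitialEnergy.


(** * The bound on the outer energy scale *)

Section OuterScale.
Context {R : realType}.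

(** If l >= rho the interval of radii is empty for rho itself. *)
Lemma outer_scale_le (S : riemannian_manifold R 2) n (N : riemannian_manifold R n) (vol : {measure set (borel S) -> \bar R})
    (eps rho l : R) (p : S) (v : S -> N) : 0 <= l ->
  (l < rho -> (ereal_sup [set energy vol v (annulus p (r / 2)%R r) | r in `]l, rho[] < eps%:E)%E) ->
  0 < rho -> 0 < eps -> outer_scale vol eps rho p v <= l.
Proof.
move=> l0 h rho0 eps0; have lbl (A : set R) y : (forall z, A z -> 0 <= z) -> A y -> inf A <= y.
  by move=> A0 Ay; apply: ge_inf => //; exists 0 => z /A0.
have [rl|lr] := leP rho l.
  apply: le_trans rl; apply: lbl => [z [/andP[]]//|]; split; first by rewrite ltW //= lexx.
  by rewrite set_itvoo0 image_set0 ereal_sup0 ltNyr.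
apply: lbl => [z [/andP[]]//|]; split; first by rewrite l0 ltW.
exact: h.
Qed.

Lemma powR_root (X q l : R) : 0 <= X -> 0 < q -> X `^ (q / 2) <= l -> X <= l `^ (2 / q).
Proof.
move=> X0 q0 h; have qn : q != 0 by rewrite gt_eqF.
have e : X = (X `^ (q / 2)) `^ (2 / q).
  by rewrite -powRrM (_ : q / 2 * (2 / q) = 1) ?powRr1 //; field.
rewrite {1}e; apply: ge0_ler_powR => //; rewrite ?nnegrE ?powR_ge0 //; first by rewrite divr_ge0 ?ltW.
by apply: le_trans h; exact: powR_ge0.
Qed.

Variables (alpha beta kappa : R).
Hypotheses (alpha_gt0 : 0 < alpha) (alpha_beta : alpha < beta) (kappa_gt1 : 1 < kappa) (kappa_le : kappa ^+ 2 <= 2).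
Hypotheses (outer_room : 5 / 4 * kappa * beta <= 1 / 2) (inner_room : 1 / 4 <= alpha / kappa).
Variable M : R.
Hypothesis M_gt0 : 0 < M.
Hypothesis cutoff_bound : forall s, `|'D_1 (cutoff (alpha ^+ 2) (beta ^+ 2) : R^o -> R^o) s| <= M /\
  `|'D_1 ('D_1 (cutoff (alpha ^+ 2) (beta ^+ 2) : R^o -> R^o)) s| <= M.

(** The factor 4 turns the bound on the growth of the localized energy into eps / 4. *)
Definition scale_const : R := 4 * (hessian_const (beta ^+ 2) M * (1 + 8 * beta ^+ 2)).

Lemma scale_const_gt0 : 0 < scale_const.
Proof.
have b0 := sqr_ge0 beta; have Mb : 0 <= 8 * M * (beta ^+ 2 + 1).
  by rewrite !mulr_ge0 ?addr_ge0 // ltW.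
have h1 : 0 < hessian_const (beta ^+ 2) M by rewrite /hessian_const ltr_wpDl.
have h2 : 0 < 1 + 8 * beta ^+ 2 by rewrite ltr_pwDl // mulr_ge0.
by rewrite /scale_const; apply: mulr_gt0 => //; exact: mulr_gt0.
Qed.

Variable S : riemannian_manifold R 2.
Variable vol : {measure set (borel S) -> \bar R}.
Hypothesis volS : is_volume vol.

Lemma small_scale_exists (x : S) (r K : R) : 0 < r -> exists2 l0, 0 < l0 &
  forall l, 0 < l -> l <= l0 -> small_scale beta M x r K l.
Proof.
move=> r0; pose c1 := 48 * K ^+ 4 * M * Num.sqrt (K * beta ^+ 2).
pose c2 := 5 / 4 * Num.sqrt (coord_const x * beta ^+ 2).
have c10 : 0 <= c1.
  have K4 : 0 <= K ^+ 4 by exact: exprn_even_ge0.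
  by apply: mulr_ge0 (sqrtr_ge0 _); apply: mulr_ge0 (ltW M_gt0); exact: mulr_ge0.
have c20 : 0 <= c2 by rewrite mulr_ge0 ?sqrtr_ge0.
have d0 : 0 < c1 + c2 + 1 by rewrite ltr_wpDl ?addr_ge0.
have m0 : 0 < Num.min 1 (r / 2) by rewrite lt_min ltr01 divr_gt0.
exists (Num.min 1 (r / 2) / (c1 + c2 + 1)); first by rewrite divr_gt0.
move=> l l0; rewrite ler_pdivlMr // => h.
have h1 : l * (c1 + c2 + 1) <= 1 by apply: (le_trans h); rewrite ge_min lexx.
have h2 : l * (c1 + c2 + 1) <= r / 2 by apply: (le_trans h); rewrite ge_min lexx orbT.
have p1 := mulr_ge0 (ltW l0) c10; have p2 := mulr_ge0 (ltW l0) c20.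
by split; rewrite -/c1 -/c2 mulrC; lra.
Qed.

Definition scale_estimate (p : S) (R0 : R) : Prop :=
  forall (n : nat) (N : riemannian_manifold R n), compact [set: N] ->
  forall (T : \bar R) (u : R -> S -> N), (0 < T)%E -> harmonic_map_flow vol T u ->
  forall q sigma tau : R, 1 <= q -> 0 < sigma -> 0 <= tau -> (tau%:E < T)%E ->
  (ereal_sup [set stress_norm vol q (u t) | t in [set t : R | (tau <= t)%R /\ t%:E < T]] <= sigma%:E)%E ->
  forall (eps r rho t1 t2 : R), 0 < eps -> 0 < r -> r <= rho -> rho < R0 ->
  tau <= t1 -> t1 <= t2 -> (t2%:E < T)%E ->
  (ereal_sup [set energy vol (u t) (geodesic_ball p rho) | t in `[t1, t2]]
     <= energy vol (u t2) (geodesic_ball p r) + (eps / 2)%:E)%E ->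
  forall t : R, t1 <= t <= t2 ->
  outer_scale vol eps rho p (u t)
    <= Num.max (4 * r) ((scale_const * sigma * (t2 - t) / eps) `^ (q / 2)).

Lemma scale_estimate_near (x p : S) (s K l0 : R) : metric_box x (kappa ^+ 2) s K -> dom x p ->
  (forall i, `|chart x p 0 i - chart x x 0 i| <= s / 2) -> 0 < l0 ->
  (forall l, 0 < l -> l <= l0 -> small_scale beta M x s K l) -> scale_estimate p (l0 / 4).
Proof.
move=> box xp pr l00 small n N cN T u T0 [u0 u0lim ucont usmooth uflow] q sigma tau q1 sg0 tau0 tauT hS.
move=> eps r rho t1 t2 eps0 r0 rrho rho0 taut1 t12 t2T hE t /andP[t1t tt2].
have q0 : 0 < q by apply: lt_le_trans q1.
set l := Num.max _ _; have rho_gt0 : 0 < rho by apply: lt_le_trans rrho.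
have l4r : 4 * r <= l by rewrite le_max lexx.
have l_gt0 : 0 < l by apply: lt_le_trans l4r; rewrite mulr_gt0.
have rl4 : r <= l / 4 by rewrite ler_pdivlMr // mulrC.
apply: outer_scale_le => //; first exact: ltW.
move=> lrho; have ll0 : l <= l0 by lra.
have sl := small l l_gt0 ll0; have sl0 := small l0 l00 (lexx _).
have stress r' : t <= r' <= t2 -> (stress_norm vol q (u r') <= sigma%:E)%E.
  move=> /andP[tr rt]; apply: le_trans hS; apply: ereal_sup_ubound; exists r' => //; split.
    by apply: le_trans taut1 _; exact: le_trans t1t tr.
  by apply: le_lt_trans t2T; rewrite lee_fin.
have ballE r' : t1 <= r' <= t2 -> (energy vol (u r') (geodesic_ball p rho) <= energy vol (u t2) (geodesic_ball p r) + (eps / 2)%:E)%E.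
  by move=> h; apply: le_trans hE; apply: ereal_sup_ubound; exists r' => //=; rewrite in_itv.
have lpow : scale_const * sigma * (t2 - t) / eps <= l `^ (2 / q).
  apply: powR_root => //; last by rewrite le_max lexx orbT.
  by rewrite divr_ge0 ?(ltW eps0) // mulr_ge0 ?subr_ge0 // mulr_ge0 ?(ltW sg0) // ltW // scale_const_gt0.
have later r' s' : 0 < r' -> t <= r' -> r' <= t2 -> l < s' -> s' <= rho ->
    (energy vol (u r') (annulus p (s' / 2)%R s') <= (3 / 4 * eps)%:E)%E.
{ move=> r'0 tr' r't2 ls sr.
  apply: (annulus_small alpha_gt0 alpha_beta kappa_gt1 kappa_le outer_room inner_room cutoff_bound box xp pr l_gt0 sl volS cN
    ucont usmooth uflow r'0 r't2 t2T q1 sg0 eps0 _ _ _ rl4 ls sr).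
  - by move=> r'' /andP[h1 h2]; apply: stress; rewrite h2 (le_trans tr').
  - by apply: ballE; rewrite r't2 (le_trans t1t).
  - apply: le_trans lpow; rewrite -/scale_const ler_pM2r ?invr_gt0 // ler_wpM2l //; last by rewrite lerD2l lerN2.
    by rewrite mulr_ge0 ?(ltW sg0) // ltW // scale_const_gt0. }
apply: (@le_lt_trans _ _ (3 / 4 * eps)%:E); last by rewrite lte_fin; lra.
apply: ge_ereal_sup => e [s' /= + <-]; rewrite in_itv /= => /andP[ls sr].
(* At time 0 the map is only in L^2_1, and the bound is passed to the limit from
   later times. *)
have [t0|t0] := ltP 0 t; first by apply: later => //; exact: ltW.
have te : t = 0 by apply: le_anti; rewrite t0 (le_trans tau0) // (le_trans taut1).
have [t20|t20] := ltP 0 t2.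
{ rewrite te; apply: (initial_energy volS cN (box_r0 box) (box_img box) ucont usmooth u0 u0lim T0).
  - move=> y [ys _]; have yl0 : (dist p y < (l0 / 4)%:E)%E.
      by apply: lt_trans ys _; rewrite lte_fin; lra.
    have [xy qy] := near_in_ellipse alpha_gt0 alpha_beta kappa_gt1 inner_room box xp pr l00 sl0 yl0.
    split => // i; apply: (ellipse_in_box pr l00 sl0); apply: (le_trans qy).
    by rewrite ler_sqr ?nnegrE ?(ltW alpha_gt0) ?(ltW alpha_beta) // (le_trans (ltW alpha_gt0)) // ltW.
  - have n1 : \forall r' \near 0^'+, 0 < r' /\ r' < t2.
      by apply: filterS2 (nbhs_right_gt 0) (nbhs_right_lt t20) => r'; split.
    by apply: filterS n1 => r' [r'0 r't]; apply: later => //; rewrite ?te ltW. }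
(* If t = t2 = 0 the bump energy is finite and cancels. *)
have t2e : t2 = t by apply: le_anti; rewrite tt2 andbT te.
have h1 := annulus_bump_bound alpha_gt0 alpha_beta kappa_gt1 outer_room box xp pr l_gt0 sl vol (u t) ls (ltW sr).
have h2 := ball_bump_bound alpha_gt0 alpha_beta kappa_gt1 inner_room box xp pr l_gt0 sl vol (u t) rl4.
have h3 := ballE t; rewrite t1t tt2 t2e in h3; have {}h3 := h3 isT.
set B := bump_energy _ _ _ _ _ _ _ in h1 h2.
have ann0 : (0 <= energy vol (u t) (annulus p (s' / 2)%R s'))%E by apply: integral_ge0 => y _; exact: half_density_ge0.
have B0 : (0 <= B)%E by apply: le_trans h2; apply: integral_ge0 => y _; exact: half_density_ge0.
have Bfin : B \is a fin_num.
  rewrite ge0_fin_numE //; have [_ _] := u0; apply: le_lt_trans.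
  apply: (@le_trans _ _ (energy vol (u t) (geodesic_ball p rho))).
    by apply: le_trans h1; rewrite leeDr.
  by rewrite te; apply: ge0_le_integral_subset => // y; exact: half_density_ge0.
have : (energy vol (u t) (annulus p (s' / 2)%R s') + B <= B + (eps / 2)%:E)%E.
  by apply: (le_trans h1); apply: (le_trans h3); exact: leeD2r.
rewrite addeC leeD2lE // => h; apply: (le_trans h); rewrite lee_fin; lra.
Qed.

Lemma scale_estimate_local (x : S) : exists2 l0, 0 < l0 &
  \forall p \near x, forall R0, R0 <= l0 -> scale_estimate p R0.
Proof.
have k1 : 1 < kappa ^+ 2 by rewrite expr_gt1 // ltW // (lt_trans ltr01).
have [s [K box]] := metric_box_exists x k1; have s0 := box_r0 box.
have [l0 l00 small] := small_scale_exists x K s0.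
exists (l0 / 4); first by rewrite divr_gt0.
have h1 : \forall p \near x, dom x p by apply: open_nbhs_nbhs; split; [exact: dom_open|exact: dom_self].
have h2 : \forall p \near x, forall i, `|chart x p 0 i - chart x x 0 i| <= s / 2.
  have c := chart_continuous (dom_self x).
  have hb : nbhs (chart x x) (ball (chart x x) (s / 2)) by apply: nbhsx_ballx; rewrite divr_gt0.
  have hc : \forall p \near x, ball (chart x x) (s / 2) (chart x p) := c _ hb.
  by apply: filterS hc => p hp i; rewrite distrC; apply: ltW; exact: (hp.2 0 i).
apply: filterS2 h1 h2 => p xp pr R0 R0l.
have := scale_estimate_near box xp pr l00 small.
move=> h n N cN T u T0 hu q sigma tau q1 sg0 tau0 tauT hS eps r rho t1 t2 eps0 r0 rrho rhoR.
by apply: (h n N cN T u T0 hu q sigma tau q1 sg0 tau0 tauT hS) => //; apply: lt_le_trans R0l.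
Qed.

(** Every point has a neighbourhood with a common radius, and finitely many of these cover
    the surface. *)
Lemma scale_estimate_uniform : compact [set: S] -> exists2 R0, 0 < R0 & forall p, scale_estimate p R0.
Proof.
move=> /compact_near_coveringP cS.
have := cS R (0^'+) (fun R0 p => scale_estimate p R0) _ _.
have h : forall x, [set: S] x -> \forall p \near x & R0 \near 0^'+, scale_estimate p R0.
  move=> x _; have [l0 l00 hl] := scale_estimate_local x.
  exists ([set p | forall R0, R0 <= l0 -> scale_estimate p R0], [set R0 | R0 <= l0]).
    by split => //=; apply: nbhs_right_le.
  by move=> [p R0] [/= hp hR]; exact: hp.
move=> /(_ _ h) near0.
have : \forall R0 \near 0^'+, 0 < R0 /\ [set: S] `<=` (fun p => scale_estimate p R0).
  by apply: filterS2 (nbhs_right_gt 0) near0 => R0; split.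
by move=> /filter_ex[R0 [R00 hR]]; exists R0 => // p; exact: hR.
Qed.

End OuterScale.

Theorem theorem4p4 (R : realType) :
  exists2 C : R, 0 < C &
  forall (Sigma : riemannian_manifold R 2)
         (vol : {measure set (borel Sigma) -> \bar R}),
  compact [set: Sigma] -> is_volume vol ->
  exists2 R0 : R, 0 < R0 &
  forall (n : nat) (N : riemannian_manifold R n), compact [set: N] ->
  forall (T : \bar R) (u : R -> Sigma -> N),
  (0 < T)%E -> harmonic_map_flow vol T u ->
  forall q sigma tau : R,
  1 <= q -> 0 < sigma -> 0 <= tau -> (tau%:E < T)%E ->
  (ereal_sup [set stress_norm vol q (u t) | t in
     [set t : R | (tau <= t)%R /\ t%:E < T]] <= sigma%:E)%E ->
  forall (p : Sigma) (eps r rho t1 t2 : R),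
  0 < eps -> 0 < r -> r <= rho -> rho < R0 ->
  tau <= t1 -> t1 <= t2 -> (t2%:E < T)%E ->
  (ereal_sup [set energy vol (u t) (geodesic_ball p rho) | t in `[t1, t2]]
     <= energy vol (u t2) (geodesic_ball p r) + (eps / 2)%:E)%E ->
  forall t : R, t1 <= t <= t2 ->
  outer_scale vol eps rho p (u t)
    <= Num.max (4 * r) ((C * sigma * (t2 - t) / eps) `^ (q / 2)).

Proof.
(* The bump is 1 up to 3/10 of the scale and vanishes beyond 7/20 of it, and distances
   are known up to a factor 11/10: the first ellipse contains the ball of radius 1/4 of
   the scale, the second is contained in the ball of radius 1/2 of the scale. *)
pose al : R := 3 / 10; pose be : R := 7 / 20; pose ka : R := 11 / 10.
have [a0 ab k1 k2] : [/\ 0 < al, al < be, 1 < ka & ka ^+ 2 <= 2] by rewrite /al /be /ka; split; lra.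
have o1 : 5 / 4 * ka * be <= 1 / 2 by rewrite /al /be /ka; lra.
have o2 : 1 / 4 <= al / ka by rewrite /al /be /ka; lra.
have ab2 : al ^+ 2 < be ^+ 2 by rewrite /al /be; lra.
have [M M0 hM] := cutoff_derive_bound ab2.
exists (scale_const be M); first exact: scale_const_gt0.
move=> Sigma vol cS volS.
have [R0 R00 h] := scale_estimate_uniform a0 ab k1 k2 o1 o2 M0 hM volS cS.
exists R0 => // n N cN T u T0 hu q sigma tau q1 sg0 tau0 tauT hS p.
exact: (h p n N cN T u T0 hu q sigma tau q1 sg0 tau0 tauT hS).
Qed.
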